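(* Let the domain $D$, the boundary portions $\Gamma_D,\Gamma_N,\Gamma_d$, the probability space $(\Theta,\mathcal{B},\mathcal{P})$, the final time $t_F>0$, the random coefficients $\mu,\lambda,\alpha,c_0,\kappa$ (with their standing assumptions), the spaces $\boldsymbol{U},P$, the bilinear forms $a,b,c,d$, and the data $\boldsymbol{f}\in L^2((0,t_F);L^2(D)^d)$, $g\in L^2((0,t_F);L^2(D))$, $\phi_0\in L^2(D)$ be as in the context. Assume that: (i) $\mu\in L^\infty(D\times\Theta)$ and there is a constant $\underline\mu>0$ such that $\underline\mu\le\mu(x,\theta)$ for a.e. $(x,\theta)\in D\times\Theta$; (ii) the bulk modulus $K:=\frac{2\mu+d\lambda}{d}$ belongs to $L^\infty(D\times\Theta)$ and there is a constant $\overline K<+\infty$ such that $0<K(x,\theta)\le\overline K$ for a.e. $(x,\theta)\in D\times\Theta$. Let $(\boldsymbol{u},p)\in L^2((0,t_F);\boldsymbol{U}\times P)$ be a solution of the weak stochastic Biot problem, i.e. for all $\boldsymbol v\in\boldsymbol U$, all $q\in P$ and all $\psi\in C_c^\infty((0,t_F))$, $$\int_0^{t_F} a(\boldsymbol u(t),\boldsymbol v)\,\psi(t)\,dt+\int_0^{t_F} b(\boldsymbol v,p(t))\,\psi(t)\,dt=\int_0^{t_F}\mathbb{E}\big((\boldsymbol f(t),\boldsymbol v)_D\big)\psi(t)\,dt,$$ $$\int_0^{t_F}\big[b(\boldsymbol u(t),q)-c(p(t),q)\big]\,\psi'(t)\,dt+\int_0^{t_F} d(p(t),q)\,\psi(t)\,dt=\int_0^{t_F}\mathbb{E}\big((g(t),q)_D\big)\psi(t)\,dt,$$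 $$c(p(0),q)-b(\boldsymbol u(0),q)=\mathbb{E}\big((\phi_0,q)_D\big).$$ Then $$\int_0^{t_F}\big[a(\boldsymbol u(t),\boldsymbol u(t))+c(p(t),p(t))\big]\,dt\le\int_0^{t_F}\Big(\frac{C_{\rm K}}{2\underline\mu}\|\boldsymbol f(t)\|_{L^2(D)^d}^2+\frac{\overline K}{\underline\alpha}\|G(t)\|_{L^2(D)}^2\Big)dt,$$ where $G:(0,t_F)\to L^2(D)$ is defined by $G(t):=\int_0^t g(s)\,ds+\phi_0$, $C_{\rm K}$ is the constant of Korn's first inequality, and $\underline\alpha$ is the lower bound of $\alpha$.
   Context: **Domain and probability space.** $D\subset\mathbb{R}^d$, $d\in\{2,3\}$, is a bounded connected polyhedral domain (open, with Lipschitz boundary). $\Gamma_D\subset\partial D$ has positive $(d-1)$-dimensional Hausdorff measure, $\Gamma_N:=\partial D\setminus\Gamma_D$; $\Gamma_d\subset\partial D$, $\Gamma_n:=\partial D\setminus\Gamma_d$. $(\Theta,\mathcal B,\mathcal P)$ is a probability space with expectation $\mathbb E$. For a normed function space $V$ on $D$, $L^2_{\mathcal P}(\Theta;V)$ is the Bochner space of random fields $v$ with $\|v\|_{L^2_{\mathcal P}(\Theta;V)}:=\mathbb E(\|v\|_V^2)^{1/2}<\infty$. $(\cdot,\cdot)_D$ is the $L^2(D)$ (or $L^2(D)^d$) inner product, and $\nabla_s\boldsymbol v:=\frac12(\nabla\boldsymbol v+\nabla\boldsymbol v^{T})$. **Spaces.** $H^1_{0,\Gamma_D}(D)^d:=\{\boldsymbol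 v\in H^1(D)^d:\boldsymbol v|_{\Gamma_D}=0\}$, $H^1_{0,\Gamma_d}(D):=\{q\in H^1(D):q|_{\Gamma_d}=0\}$, $L^2_0(D):=\{q\in L^2(D):\int_D q=0\}$. $\boldsymbol U:=L^2_{\mathcal P}(\Theta;H^1_{0,\Gamma_D}(D)^d)$. $P:=L^2_{\mathcal P}(\Theta;H^1(D)\cap L^2_0(D))$ if $\Gamma_d=\Gamma_N=\emptyset$ and $c_0=0$, and $P:=L^2_{\mathcal P}(\Theta;H^1_{0,\Gamma_d}(D))$ otherwise. **Coefficients.** $\mu,\lambda,\alpha,c_0,\kappa$ are measurable real functions on $D\times\Theta$ with $\mu>0$, $\lambda>0$, $\kappa>0$, $c_0\ge 0$, such that the bilinear forms below are well defined (finite) on the indicated spaces. The reference porosity $\varphi$ is a strictly positive constant and the Biot–Willis coefficient satisfies $0<\underline\alpha:=\frac{3\varphi}{2+\varphi}<\alpha(x,\theta)\le1$. The storage coefficient $c_0$ is linked to the other coefficients by the physical relations $\alpha=1-K_{\rm d}/K_{\rm m}$ and $\alpha^2=c_0(K-K_{\rm d})$ (Gassmann equation), where $K_{\rm d},K_{\rm m}$ are the bulk moduli of the drained medium and of the solid matrix, which satisfy $K_{\rm d}\le K\le K_{\rm m}$, with $K=\frac{2\mu}{d}+\lambda$. These relations are used only through their consequence $\alpha/c_0\le K$, i.e. $c_0^{-1}\le K/\alpha$ a.e. in $D\times\Theta$, which may be taken as a standing assumption. **Bilinear forms.** For $\boldsymbol v,\boldsymbol w\in\boldsymbol U$ and $q,r\in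 P$: $a(\boldsymbol v,\boldsymbol w):=\mathbb E\big(\int_D(2\mu\,\nabla_s\boldsymbol v:\nabla_s\boldsymbol w+\lambda\,(\nabla\cdot\boldsymbol v)(\nabla\cdot\boldsymbol w))\,dx\big)$, $b(\boldsymbol v,q):=\mathbb E\big(-\int_D\alpha\,(\nabla\cdot\boldsymbol v)\,q\,dx\big)$, $c(q,r):=\mathbb E\big(\int_D c_0\,q\,r\,dx\big)$, $d(q,r):=\mathbb E\big(\int_D\kappa\,\nabla r\cdot\nabla q\,dx\big)$. **Data.** $\boldsymbol f,g,\phi_0$ are deterministic. If $\Gamma_N=\Gamma_d=\emptyset$ and $c_0=0$, they also satisfy $\int_D\phi_0=0$ and $\int_D g(\cdot,t)=0$ for all $t\in(0,t_F)$. **Initial condition.** The second equation implies that, for each $q\in P$, $t\mapsto c(p(t),q)-b(\boldsymbol u(t),q)$ belongs to $H^1((0,t_F))$; the expression $c(p(0),q)-b(\boldsymbol u(0),q)$ denotes the value at $t=0$ of its continuous representative. **Korn constant.** $C_{\rm K}>0$ is a constant such that $\|\boldsymbol v\|_{H^1(D)^d}^2\le C_{\rm K}\|\nabla_s\boldsymbol v\|_{L^2(D)^{d\times d}}^2$ for all $\boldsymbol v\in H^1_{0,\Gamma_D}(D)^d$. *)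

(* Defs.v *)
From HB Require Import structures.
From mathcomp Require Import all_boot all_order all_algebra.
From mathcomp Require Import all_classical all_reals all_analysis.

Set Implicit Arguments.
Unset Strict Implicit.
Unset Printing Implicit Defensive.
Import Order.TTheory GRing.Theory Num.Theory.
Import numFieldNormedType.Exports.

Local Open Scope classical_set_scope.
Local Open Scope ring_scope.

(** * Lebesgue measure on R^n *)

Section row_measurable.
Context {R : realType} (n : nat).

Let coord (i : 'I_n) (x : 'rV[R]_n) : R := x ord0 i.

Let row_set0 : g_sigma_preimage coord set0.
Proof. exact: sigma_algebra0. Qed.

Let row_setC A : g_sigma_preimage coord A -> g_sigma_preimage coord (~` A).
Proof. exact: sigma_algebraC. Qed.

Let row_bigcup (F : (set 'rV[R]_n)^nat) :
  (forall i, g_sigma_preimage coord (F i)) ->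
  g_sigma_preimage coord (\bigcup_i (F i)).
Proof. exact: sigma_algebra_bigcup. Qed.

(* The Borel sigma-algebra of R^n, generated by the coordinates. *)
HB.instance Definition _ := @isMeasurable.Build
  default_measure_display 'rV[R]_n
  (g_sigma_preimage coord) row_set0 row_setC row_bigcup.

End row_measurable.

Section row_measurable_theory.
Context {R : realType}.

Lemma measurable_row_coord n (i : 'I_n) :
  measurable_fun [set: 'rV[R]_n] (fun x => x ord0 i).
Proof.
move=> _ Y mY; rewrite setTI; apply: sub_sigma_algebra => /=.
rewrite -bigcup_seq/=; exists i => /=; first by rewrite mem_index_enum.
by exists Y => //; rewrite setTI.
Qed.

Lemma measurable_fun_rowP d (T : measurableType d) n (f : T -> 'rV[R]_n) :
  (forall i, measurable_fun [set: T] (fun t => f t ord0 i)) ->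
  measurable_fun [set: T] f.
Proof.
move=> mf _ A mA; rewrite setTI.
suff : g_sigma_preimage (fun i t => f t ord0 i) `<=` @measurable _ T.
  apply; rewrite (g_sigma_preimage_comp (fun i (x : 'rV[R]_n) => x ord0 i) f).
  by exists A => //; rewrite setTI.
apply: smallest_sub; first exact: sigma_algebra_measurable.
case: n => [|n] in f mf A mA *; first by rewrite big_ord0.
rewrite -bigcup_mkord_ord; apply: bigcup_sub => i Ii.
by move=> B [C mC <-]; exact: mf.
Qed.

Definition cons_row n (p : R * 'rV[R]_n) : 'rV[R]_n.+1 := row_mx p.1%:M p.2.

Lemma measurable_cons_row n : measurable_fun [set: R * 'rV[R]_n] (@cons_row n).
Proof.
apply: measurable_fun_rowP => i.
rewrite -(@splitK 1 n i).
case: (fintype.split _) => j /=.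
- rewrite (_ : (fun t => _) = fst); first exact: measurable_fst.
  apply/funext => t; rewrite /cons_row.
  by rewrite (row_mxEl t.1%:M t.2 ord0 j) mxE (ord1 j) eqxx mulr1n.
- rewrite (_ : (fun t => _) = (fun x : 'rV[R]_n => x ord0 j) \o snd).
    by apply: measurableT_comp; [exact: measurable_row_coord|
                                 exact: measurable_snd].
  by apply/funext => t; rewrite /cons_row (row_mxEr t.1%:M t.2 ord0 j).
Qed.

Definition uncons_row n (x : 'rV[R]_n.+1) : R * 'rV[R]_n :=
  (x ord0 ord0, \row_i x ord0 (lift ord0 i)).

Lemma measurable_uncons_row n : measurable_fun setT (@uncons_row n).
Proof.
apply/measurable_fun_pairP; split; first exact: measurable_row_coord.
apply: measurable_fun_rowP => i /=.
by under eq_fun do rewrite /= mxE; exact: measurable_row_coord.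
Qed.

Lemma cons_rowK n : cancel (@cons_row n) (@uncons_row n).
Proof.
case=> a y; rewrite /uncons_row /cons_row; congr (_, _) => /=.
  have -> : (ord0 : 'I_n.+1) = @lshift 1 n ord0 by exact/val_inj.
  by rewrite (row_mxEl a%:M y) mxE eqxx mulr1n.
by apply/rowP => i; rewrite mxE -rshift1 (row_mxEr a%:M y).
Qed.

End row_measurable_theory.

Section lebesgue_step.
Context {R : realType} (n : nat).
Variable m : {sigma_finite_measure set 'rV[R]_n -> \bar R}.
Local Open Scope ereal_scope.

Definition lebesgue_step : set 'rV[R]_n.+1 -> \bar R :=
  pushforward (@lebesgue_measure R \x m) (@cons_row R n).

Let lebesgue_step0 : lebesgue_step set0 = 0.
Proof. by rewrite /lebesgue_step /pushforward preimage_set0 measure0. Qed.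

Let lebesgue_step_ge0 A : 0 <= lebesgue_step A.
Proof. exact: (measure_ge0 (@lebesgue_measure R \x m)). Qed.

Let lebesgue_step_sigma_additive : semi_sigma_additive lebesgue_step.
Proof.
have mpre A : measurable A -> measurable (@cons_row R n @^-1` A).
  by move=> mA; rewrite -[X in measurable X]setTI; exact: measurable_cons_row.
move=> F mF tF mUF; rewrite /lebesgue_step /pushforward preimage_bigcup.
apply: (@measure_semi_sigma_additive _ _ _ (@lebesgue_measure R \x m)).
- by move=> k; exact: mpre.
- apply/trivIsetP => /= i j _ _ ij; rewrite -preimage_setI.
  by move/trivIsetP : tF => /(_ _ _ _ _ ij) ->//; rewrite preimage_set0.
- by rewrite -preimage_bigcup; exact: mpre.
Qed.

HB.instance Definition _ := isMeasure.Build _ _ _ lebesgue_step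
  lebesgue_step0 lebesgue_step_ge0 lebesgue_step_sigma_additive.

Let lebesgue_step_sigma_finite : sigma_finite setT lebesgue_step.
Proof.
have /sigma_finiteP[F [TF ndF Foo]] := sigma_finiteT (@lebesgue_measure R).
have /sigma_finiteP[G [TG ndG Goo]] := sigma_finiteT m.
exists (fun k => @uncons_row R n @^-1` (F k `*` G k)).
  rewrite -preimage_bigcup (_ : \bigcup_k _ = setT) ?preimage_setT//.
  rewrite -subTset => -[x y] _.
  have [i _ Fix] : (\bigcup_k F k) x by rewrite -TF.
  have [j _ Gjy] : (\bigcup_k G k) y by rewrite -TG.
  exists (maxn i j) => //; split => /=.
  - by move: x Fix; exact/subsetPset/ndF/leq_maxl.
  - by move: y Gjy; exact/subsetPset/ndG/leq_maxr.
move=> k; have [mF Fk] := Foo k; have [mG Gk] := Goo k; split.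
  rewrite -[X in measurable X]setTI.
  by apply: measurable_uncons_row => //; exact: measurableX.
rewrite /lebesgue_step /pushforward -comp_preimage.
rewrite (_ : _ \o _ = id); last by apply/funext => x /=; rewrite cons_rowK.
by rewrite preimage_id product_measure1E// lte_mul_pinfty// ge0_fin_numE.
Qed.

HB.instance Definition _ := Measure_isSigmaFinite.Build _ _ _ lebesgue_step
  lebesgue_step_sigma_finite.

End lebesgue_step.

Fixpoint lebesgue_row {R : realType} (n : nat) :
    {sigma_finite_measure set 'rV[R]_n -> \bar R} :=
  match n with
  | 0 => \d_(0 : 'rV[R]_0)
  | k.+1 => lebesgue_step (lebesgue_row k)
  end.

(** * Hausdorff measure *)

Definition frob_dot {R : realType} {m n : nat} (A B : 'M[R]_(m, n)) : R :=
  \sum_i \sum_j A i j * B i j.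

Definition eucl_dist {R : realType} {n : nat} (x y : 'rV[R]_n) : R :=
  Num.sqrt (frob_dot (x - y) (x - y)).

Section hausdorff.
Context {R : realType} {n : nat}.
Implicit Types (A G : set 'rV[R]_n) (F : (set 'rV[R]_n)^nat) (s : nat).
Local Open Scope ereal_scope.

(* [(diam A)^s], with the usual convention that the empty set contributes 0. *)
Definition diam_pow s A : \bar R :=
  ereal_sup ([set 0] `|` [set ((eucl_dist x y) ^+ s)%:E | x in A & y in A]).

Definition fine_cover (delta : R) A F : Prop :=
  A `<=` \bigcup_k F k /\
  forall k x y, F k x -> F k y -> (eucl_dist x y <= delta)%R.

Definition hausdorff_pre s (delta : R) A : \bar R :=
  ereal_inf [set \sum_(k <oo) diam_pow s (F k) | F in fine_cover delta A].

(* No normalising constant: only null sets and limits of integrals matter. *)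
Definition hausdorff s A : \bar R :=
  ereal_sup [set hausdorff_pre s delta A | delta in [set r : R | (0 < r)%R]].

(* The restriction of the Hausdorff measure to [G], as an outer measure, so
   that integrals over [G] make sense without measurability of [G]. *)
Definition hausdorff_on s G A : \bar R := hausdorff s (A `&` G).

Lemma diam_pow_ge0 s A : 0 <= diam_pow s A.
Proof. by apply: ereal_sup_ubound; left. Qed.

Lemma diam_pow_set0 s : diam_pow s set0 = 0.
Proof.
apply/eqP; rewrite eq_le diam_pow_ge0 andbT.
by apply: ge_ereal_sup => _ [->//|[x []]].
Qed.

Lemma hausdorff_pre_ge0 s delta A : 0 <= hausdorff_pre s delta A.
Proof.
apply: le_ereal_inf_tmp => _ [F _ <-].
by apply: nneseries_ge0 => k _ _; exact: diam_pow_ge0.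
Qed.

Lemma hausdorff_pre0 s delta : hausdorff_pre s delta set0 = 0.
Proof.
apply/eqP; rewrite eq_le hausdorff_pre_ge0 andbT.
apply: ereal_inf_lbound; exists (fun=> set0); first by split.
by rewrite eseries0// => k _ _; exact: diam_pow_set0.
Qed.

Lemma le_hausdorff_pre s delta :
  {homo hausdorff_pre s delta : A B / A `<=` B >-> A <= B}.
Proof.
move=> A B AB; apply/ereal_inf_le_tmp => x [F [BF Fd]] <-.
by exists F => //; split => //; exact: subset_trans AB BF.
Qed.

Lemma hausdorff_pre_sigma_subadditive s delta :
  sigma_subadditive (hausdorff_pre s delta).
Proof.
move=> A; have [[i ioo]|] := pselect
    (exists i, hausdorff_pre s delta (A i) = +oo).
  rewrite (eseries_pinfty _ _ ioo) ?leey// => k _.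
  by rewrite -ltNye (lt_le_trans _ (hausdorff_pre_ge0 _ _ _)).
rewrite -forallNE => Aoo.
suff add2e (e : {posnum R}) :
    hausdorff_pre s delta (\bigcup_n A n)
      <= \sum_(i <oo) hausdorff_pre s delta (A i) + e%:num%:E.
  by apply/lee_addgt0Pr => _/posnumP[].
rewrite (le_trans _ (epsilon_trick _ _ _))//; last first.
  by move=> k; exact: hausdorff_pre_ge0.
pose P k (B : (set 'rV[R]_n)^nat) := fine_cover delta (A k) B /\
  \sum_(j <oo) diam_pow s (B j)
    <= hausdorff_pre s delta (A k) + (e%:num / (2 ^ k.+1)%:R)%:E.
have [G PG] : {G : ((set 'rV[R]_n)^nat)^nat & forall k, P k (G k)}.
  apply: (@choice _ _ P) => k; rewrite /P /hausdorff_pre.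
  set S := (X in ereal_inf X); move infS : (ereal_inf S) => iS.
  case: iS infS => [r Sr|Soo|Soo].
  - have en1 : (0 < e%:num / (2 ^ k.+1)%:R)%R by [].
    have /(lb_ereal_inf_adherent en1) : ereal_inf S \is a fin_num by rewrite Sr.
    move=> [x [B cB muBx] xS].
    by exists B; split => //; rewrite muBx -Sr; exact/ltW.
  - by have := Aoo k; rewrite /hausdorff_pre Soo.
  - suff : lbound S 0 by move/le_ereal_inf_tmp; rewrite Soo.
    by move=> /= _ [B _ <-]; apply: nneseries_ge0 => *; exact: diam_pow_ge0.
have muG_ge0 x : 0 <= (diam_pow s \o uncurry G) x by exact: diam_pow_ge0.
apply: (@le_trans _ _ (\esum_(i in setT) (diam_pow s \o uncurry G) i)).
  apply: ereal_inf_lbound => /=.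
  have /card_esym/ppcard_eqP[f] := card_nat2.
  exists (uncurry G \o f).
    split => [t [i _ /(PG i).1.1 [j _ Gijt]]|k x y].
      by exists (f^-1%FUN (i, j)) => //=; rewrite invK ?inE.
    by rewrite /=; case: (f k) => i j /=; exact: (PG i).1.2.
  rewrite -(esum_pred_image (diam_pow s \o uncurry G) _ xpredT)
    ?[fun=> _]set_true//.
  by rewrite image_eq.
rewrite (_ : esum _ _ =
    \sum_(i <oo) \sum_(j <oo) diam_pow s (G i j)); last first.
  pose J : nat -> set (nat * nat) := fun i => [set (i, j) | j in setT].
  rewrite (_ : setT = \bigcup_k J k); last first.
    by rewrite predeqE => -[a b]; split => // _; exists a => //; exists b.
  rewrite esum_bigcupT /=; last 2 first.
    - apply/trivIsetP => i j _ _ ij.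
      rewrite predeqE => -[k m] /=; split => //= -[] [_] _ [<-{k} _].
      by move=> [m' _] [] /esym/eqP; rewrite (negbTE ij).
    - by move=> /= [k m]; exact: diam_pow_ge0.
  rewrite -(image_id [set: nat]) -fun_true esum_pred_image//; last first.
    by move=> k _; apply: esum_ge0 => i _; exact: diam_pow_ge0.
  apply: eq_eseriesr => /= j _.
  rewrite -(esum_pred_image (diam_pow s \o uncurry G) (pair j) predT)//=;
      last 2 first.
    - by move=> *; exact: diam_pow_ge0.
    - by move=> ? ? _ _; exact: (@can_inj _ _ _ snd).
  by congr esum; rewrite predeqE => -[a b]; split; move=> [i _ <-]; exists i.
apply: lee_lim.
- apply: is_cvg_nneseries => k *.
  by apply: nneseries_ge0 => m *; exact: (muG_ge0 (k, m)).
- apply: is_cvg_nneseries => k *.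
  by apply: adde_ge0 => //; exact: hausdorff_pre_ge0.
- by near=> k; apply: lee_sum => i _; exact: (PG i).2.
Unshelve. all: by end_near. Qed.

Section hausdorff_on.
Variables (s : nat) (G : set 'rV[R]_n).

Let hausdorff_on0 : hausdorff_on s G set0 = 0.
Proof.
rewrite /hausdorff_on set0I; apply/eqP; rewrite eq_le; apply/andP; split.
  by apply: ge_ereal_sup => _ [delta _ <-]; rewrite hausdorff_pre0.
by apply: ereal_sup_ubound; exists 1%R => //=; exact: hausdorff_pre0.
Qed.

Let hausdorff_on_ge0 A : 0 <= hausdorff_on s G A.
Proof.
apply: (le_trans (hausdorff_pre_ge0 s 1%R (A `&` G))).
by apply: ereal_sup_ubound; exists 1%R => //=; exact: ltr01.
Qed.

Let le_hausdorff_on : {homo hausdorff_on s G : A B / A `<=` B >-> A <= B}.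
Proof.
move=> A B AB; apply: ge_ereal_sup => _ [delta delta0 <-].
apply: (@le_trans _ _ (hausdorff_pre s delta (B `&` G))).
  by apply: le_hausdorff_pre; exact: setSI.
by apply: ereal_sup_ubound; exists delta.
Qed.

Let hausdorff_on_sigma_subadditive : sigma_subadditive (hausdorff_on s G).
Proof.
move=> F; apply: ge_ereal_sup => _ [delta delta0 <-].
rewrite setI_bigcupl.
apply: (le_trans (hausdorff_pre_sigma_subadditive _ _ _)).
apply: lee_nneseries => [k *|k _]; first exact: hausdorff_pre_ge0.
by apply: ereal_sup_ubound; exists delta.
Qed.

HB.instance Definition _ := isOuterMeasure.Build R 'rV[R]_n
  (hausdorff_on s G) hausdorff_on0 hausdorff_on_ge0 le_hausdorff_on
  hausdorff_on_sigma_subadditive.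

End hausdorff_on.
End hausdorff.

(** * Bounded polyhedral Lipschitz domains *)

Section domains.
Context {R : realType} {d : nat}.
Implicit Types D : set 'rV[R]_d.

Definition bd D : set 'rV[R]_d := closure D `\` interior D.

(* Near every boundary point, after a rigid motion (the rows of [Q] are the new
   axes), [D] is the strict epigraph of a Lipschitz function of the coordinates
   other than the [j]-th one. *)
Definition lipschitz_boundary D : Prop :=
  forall x, bd D x ->
  exists (Q : 'M[R]_d) (j : 'I_d) (r h L : R) (gamma : 'rV[R]_d.-1 -> R),
    [/\ Q *m Q^T = 1%:M, 0 < r, 0 < h,
        forall y z, `|gamma y - gamma z| <= L * `|y - z| &
        forall y : 'rV[R]_d, `|col' j y| < r -> `|y ord0 j| < h ->
          (D (x + y *m Q) <-> gamma (col' j y) < y ord0 j)].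

Definition polyhedron (K : set 'rV[R]_d) : Prop :=
  exists (m : nat) (A : 'M[R]_(m, d)) (b : 'cV[R]_m),
    K = [set x | forall i, (A *m x^T) i ord0 <= b i ord0].

Definition polyhedral D : Prop :=
  exists (k : nat) (K : 'I_k -> set 'rV[R]_d),
    (forall i, polyhedron (K i)) /\ closure D = \bigcup_i K i.

Definition polyhedral_domain D : Prop :=
  [/\ open D, bounded_set D, connected D, lipschitz_boundary D & polyhedral D].

End domains.

(** * Smooth functions, weak derivatives and Sobolev spaces *)

Section smooth.
Context {R : realType} {V : normedModType R}.

Fixpoint Ck (k : nat) (f : V -> R) : Prop :=
  continuous f /\
  match k with
  | 0 => True
  | k'.+1 => forall v, (forall x, derivable f x v) /\ Ck k' ('D_v f)
  end.

Definition smooth (f : V -> R) : Prop := forall k, Ck k f.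

Definition test_function (D : set V) (f : V -> R) : Prop :=
  [/\ smooth f, compact (closure [set x | f x != 0]) &
      closure [set x | f x != 0] `<=` D].

End smooth.

Section sobolev.
Context {R : realType} {d : nat}.
Variable D : set 'rV[R]_d.
Implicit Types (q : 'rV[R]_d -> R) (v g : 'rV[R]_d -> 'rV[R]_d).

Local Notation leb := (lebesgue_row d).

Definition L2 : set ('rV[R]_d -> R) :=
  [set q : 'rV[R]_d -> R | measurable_fun D q /\
    (\int[leb]_(x in D) ((q x) ^+ 2)%:E < +oo)%E].

Definition L2v : set ('rV[R]_d -> 'rV[R]_d) :=
  [set v : 'rV[R]_d -> 'rV[R]_d | forall i, L2 (fun x => v x ord0 i)].

Definition L2_0 : set ('rV[R]_d -> R) :=
  L2 `&` [set q : 'rV[R]_d -> R | \int[leb]_(x in D) q x = 0].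

Definition L2norm q : \bar R :=
  ((\int[leb]_(x in D) ((q x) ^+ 2)%:E) `^ 2^-1)%E.

Definition L2norm_mx m n (A : 'rV[R]_d -> 'M[R]_(m, n)) : \bar R :=
  ((\int[leb]_(x in D) (frob_dot (A x) (A x))%:E) `^ 2^-1)%E.

Definition is_weak_grad q g : Prop :=
  forall phi, test_function D phi -> forall i : 'I_d,
    \int[leb]_(x in D) (q x * 'D_(delta_mx ord0 i) phi x) =
    - \int[leb]_(x in D) (g x ord0 i * phi x).

Definition H1 : set ('rV[R]_d -> R) :=
  L2 `&` [set q : 'rV[R]_d -> R | exists g, L2v g /\ is_weak_grad q g].

(* A representative of the weak gradient; meaningful on [H1] only. *)
Definition weak_grad q : 'rV[R]_d -> 'rV[R]_d :=
  xget (fun=> 0) [set g | L2v g /\ is_weak_grad q g].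

Definition H1norm q : \bar R :=
  ((\int[leb]_(x in D)
     ((q x) ^+ 2 + frob_dot (weak_grad q x) (weak_grad q x))%:E) `^ 2^-1)%E.

Definition H1v : set ('rV[R]_d -> 'rV[R]_d) :=
  [set v : 'rV[R]_d -> 'rV[R]_d | forall i, H1 (fun x => v x ord0 i)].

(* [weak_jac v x i j] is the j-th partial derivative of the i-th component. *)
Definition weak_jac v (x : 'rV[R]_d) : 'M[R]_d :=
  \matrix_(i, j) weak_grad (fun y => v y ord0 i) x ord0 j.

Definition symgrad v (x : 'rV[R]_d) : 'M[R]_d :=
  2^-1 *: (weak_jac v x + (weak_jac v x)^T).

Definition divergence v (x : 'rV[R]_d) : R := \tr (weak_jac v x).

Definition H1normv v : \bar R :=
  ((\int[leb]_(x in D)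
     (frob_dot (v x) (v x) +
      frob_dot (weak_jac v x) (weak_jac v x))%:E) `^ 2^-1)%E.

(* [tau] is the trace of [q] on [Gam], i.e. the L2(Gam)-limit of the
   restrictions of smooth functions converging to [q] in H1(D). *)
Definition is_trace (Gam : set 'rV[R]_d) q (tau : 'rV[R]_d -> R) : Prop :=
  exists phi : nat -> 'rV[R]_d -> R,
    [/\ forall n, smooth (phi n),
        (fun n => H1norm (phi n - q)) @ \oo --> 0%E &
        (fun n => @integral _ (caratheodory_type (hausdorff_on d.-1 Gam)) R
                    (hausdorff_on d.-1 Gam) setT
                    (fun x => ((phi n x - tau x) ^+ 2)%:E)) @ \oo --> 0%E].

Definition H1_0 (Gam : set 'rV[R]_d) : set ('rV[R]_d -> R) :=
  H1 `&` [set q : 'rV[R]_d -> R | is_trace Gam q (fun=> 0)].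

Definition H1_0v (Gam : set 'rV[R]_d) : set ('rV[R]_d -> 'rV[R]_d) :=
  [set v : 'rV[R]_d -> 'rV[R]_d | forall i, H1_0 Gam (fun x => v x ord0 i)].

End sobolev.

Arguments L2norm_mx {R d} D {m n} A.

(** * Bochner spaces *)

(* [S] is a linear space of functions (its elements are not identified almost
   everywhere) and [N] its norm, which is only a seminorm on representatives. *)
Section bochner.
Context {R : realType} {disp : measure_display} {T : measurableType disp}.
Context {V : lmodType R}.
Variables (mu : {measure set T -> \bar R}) (A : set T).
Variables (S : set V) (N : V -> \bar R).

Definition simple_fun (s : seq (set T * V)) (t : T) : V :=
  \sum_(p <- s) (\1_(p.1) t : R) *: p.2.

Definition is_simple (s : seq (set T * V)) : Prop :=
  forall p, p \in s -> measurable p.1 /\ S p.2.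

Definition simple_integral (s : seq (set T * V)) : V :=
  \sum_(p <- s) fine (mu (A `&` p.1)) *: p.2.

Definition strongly_measurable (f : T -> V) : Prop :=
  (forall t, A t -> S (f t)) /\
  exists s : nat -> seq (set T * V),
    (forall n, is_simple (s n)) /\
    forall t, A t -> (fun n => N (simple_fun (s n) t - f t)) @ \oo --> 0%E.

Definition bochner_norm (f : T -> V) : \bar R :=
  ((\int[mu]_(t in A) (N (f t)) ^+ 2) `^ 2^-1)%E.

Definition bochnerL2 : set (T -> V) :=
  [set f : T -> V | strongly_measurable f /\ (bochner_norm f < +oo)%E].

Definition is_bochner_integral (f : T -> V) (I : V) : Prop :=
  S I /\ exists s : nat -> seq (set T * V),
    [/\ forall n, is_simple (s n),
        (fun n => \int[mu]_(t in A) N (simple_fun (s n) t - f t))%E @ \oo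
          --> 0%E &
        (fun n => N (simple_integral (s n) - I)) @ \oo --> 0%E].

Definition bochner_integral (f : T -> V) : V :=
  xget 0 [set I | is_bochner_integral f I].

End bochner.

(** * The stochastic Biot problem *)

Section biot.
Context {R : realType} {d : nat} {disp : measure_display}.
Context {Theta : measurableType disp}.
Variables (P : probability Theta R) (D : set 'rV[R]_d).
Local Notation X := 'rV[R]_d.
Implicit Types (coef mu lambda alpha kappa : X * Theta -> R).
Implicit Types (v w : Theta -> X -> 'rV[R]_d) (q r : Theta -> X -> R).

(* An iterated integral: the fields [v th], given for each [th] up to null sets
   of [D], need not be jointly measurable in [(x, th)]. *)
Definition ED (F : Theta -> X -> R) : R :=
  \int[P]_th \int[lebesgue_row d]_(x in D) F th x.

Definition ED_finite (F : Theta -> X -> R) : Prop :=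
  (\int[P]_th \int[lebesgue_row d]_(x in D) `|F th x|%:E < +oo)%E.

Definition a_density mu lambda v w (th : Theta) (x : X) : R :=
  2 * mu (x, th) * frob_dot (symgrad D (v th) x) (symgrad D (w th) x) +
  lambda (x, th) * (divergence D (v th) x * divergence D (w th) x).

Definition b_density alpha v q (th : Theta) (x : X) : R :=
  - (alpha (x, th) * divergence D (v th) x * q th x).

Definition c_density (c0 : X * Theta -> R) q r (th : Theta) (x : X) : R :=
  c0 (x, th) * q th x * r th x.

Definition d_density kappa q r (th : Theta) (x : X) : R :=
  kappa (x, th) * frob_dot (weak_grad D (r th) x) (weak_grad D (q th) x).

Definition a_form mu lambda v w : R := ED (a_density mu lambda v w).
Definition b_form alpha v q : R := ED (b_density alpha v q).
Definition c_form (c0 : X * Theta -> R) q r : R := ED (c_density c0 q r).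
Definition d_form kappa q r : R := ED (d_density kappa q r).

Definition bulk_modulus mu lambda (z : X * Theta) : R :=
  (2 * mu z + d%:R * lambda z) / d%:R.

Definition aeDT (Q : X * Theta -> Prop) : Prop :=
  {ae (lebesgue_row d \x P)%E, forall z, D z.1 -> Q z}.

Definition Linfty coef : Prop :=
  measurable_fun (D `*` [set: Theta]) coef /\
  exists M : R, aeDT (fun z => `|coef z| <= M).

Definition U_space (Gam_D : set X) : set (Theta -> X -> 'rV[R]_d) :=
  bochnerL2 P setT (H1_0v D Gam_D) (H1normv D).

(* The case in which the pressure is determined only up to a constant. *)
Definition pressure_up_to_constant (Gam_D Gam_d : set X)
    (c0 : X * Theta -> R) : Prop :=
  [/\ bd D `\` Gam_D = set0, Gam_d = set0 & aeDT (fun z => c0 z = 0)].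

Definition P_space (Gam_D Gam_d : set X) (c0 : X * Theta -> R) :
    set (Theta -> X -> R) :=
  bochnerL2 P setT
    (if `[< pressure_up_to_constant Gam_D Gam_d c0 >] then H1 D `&` L2_0 D
     else H1_0 D Gam_d) (H1norm D).

End biot.

(* The continuous representative on [0, T] of a function given a.e. on ]0, T[,
   if there is one. *)
Definition continuous_rep {R : realType} (T : R) (h : R -> R) : R -> R :=
  xget h [set w | {within `[0, T], continuous w} /\
    {ae (@lebesgue_measure R), forall t, t \in `]0, T[ -> h t = w t}].

(* Main.v *)
Require Import Defs.
From mathcomp Require Import all_boot all_order all_algebra.
From mathcomp Require Import all_classical all_reals all_analysis.
From mathcomp Require Import measurable_realfun ring lra zify.
(* Testing the momentum equation with u(t), and the mass equation, integrated
   once in time, with p(t), makes the coupling terms b(u(t), p(t)) cancel when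
   the two are added: for almost every t,
     a(u,u) + c(p,p) + int_0^t d(p(s), p(t)) ds = (f,u) + (G,p).
   The integral over t of the last term on the left is half the integral of
   d(p(s), p(t)) over the whole square, hence nonnegative; half of a + c is then
   absorbed by Young's inequality, using Korn's inequality for (f,u) and
   1 / c0 <= K / alpha for (G,p).

   Evaluating the equations along the solution requires the forms to be
   continuous, although kappa and c0 are only assumed to give finite integrals.
   The truncated weights min(kappa, k), min(c0, k) give seminorms that are
   pointwise bounded in k, hence uniformly bounded because P is complete. This
   needs the functions of H1 with zero trace to form a closed subspace of H1,
   where even linearity rests on Caratheodory's criterion: continuous functions
   are measurable for the Hausdorff outer measure. *)

Set Implicit Arguments.
Unset Strict Implicit.
Unset Printing Implicit Defensive.
Import Order.TTheory GRing.Theory Num.Theory.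
Import numFieldNormedType.Exports.
Local Open Scope classical_set_scope.
Local Open Scope ring_scope.

(** Functions are never identified almost everywhere: a space is a set [S] of representatives with a
    seminorm, and weak gradients and Bochner integrals are choices, determined only up to seminorm
    0. Two obstacles follow. First, the values of a random field are known up to null sets of [D]
    for each outcome separately, and the forms are iterated integrals; Fubini and pointwise algebra
    become available only once every observed quantity has a jointly measurable representative on
    [D] times [Theta]. Second, the null set of bad times in a tested equation depends on the test
    field, while the field to be inserted is the solution at that very time; the finitely many
    values of each simple approximation of the solution reduce this to countably many test fields,
    and continuity of the forms does the rest. The constant [C_K / (2 * mu_low)] is the inverse of
    the coefficient [2 * mu_low / C_K] in Korn's lower bound for [a]: with this weight in Young's
    inequality exactly one copy of [a] absorbs the displacement. In the same way [K_up / alpha_low]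
    lets one copy of [c] absorb the pressure. *)

Section real_integrable.
Context {R : realType} {disp : measure_display} {T : measurableType disp}.
Variables (mu : {measure set T -> \bar R}) (A : set T).
Hypothesis mA : measurable A.
Implicit Types f g : T -> R.

Definition rintegrable (f : T -> R) : Prop := mu.-integrable A (EFin \o f).

Lemma rintegrable_measurable f : rintegrable f -> measurable_fun A f.
Proof. by move=> /integrableP[/measurable_EFinP]. Qed.

Lemma rintegrableZl r f : rintegrable f -> rintegrable (fun x => r * f x).
Proof. exact: integrableZl. Qed.

Lemma rintegrableZr r f : rintegrable f -> rintegrable (fun x => f x * r).
Proof.
by move=> /(rintegrableZl r); congr rintegrable; apply/funext => x; rewrite mulrC.
Qed.

Lemma rintegrableD f g :
  rintegrable f -> rintegrable g -> rintegrable (fun x => f x + g x).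
Proof. exact: integrableD. Qed.

Lemma rintegrableB f g :
  rintegrable f -> rintegrable g -> rintegrable (fun x => f x - g x).
Proof. exact: integrableB. Qed.

Lemma rintegrable_le f g : measurable_fun A f ->
  (forall x, A x -> `|f x| <= g x) -> rintegrable g -> rintegrable f.
Proof.
move=> mf fg; apply: le_integrable => //; first exact/measurable_EFinP.
move=> x Ax /=; rewrite lee_fin; apply: le_trans (fg x Ax) _.
exact: ler_norm.
Qed.

Lemma rintegrable_norm f : rintegrable f -> rintegrable (fun x => `|f x|).
Proof. exact: integrable_norm. Qed.

Lemma rintegrable_sum (I : eqType) (r : seq I) (F : I -> T -> R) :
  (forall i, i \in r -> rintegrable (F i)) ->
  rintegrable (fun x => \sum_(i <- r) F i x).
Proof.
elim: r => [|i r IH] h.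
  rewrite (_ : (fun x => _) = cst 0); first exact: integrable0.
  by apply/funext => x; rewrite big_nil.
rewrite (_ : (fun x => _) = (fun x => F i x + \sum_(j <- r) F j x)).
  apply: rintegrableD; first by apply: h; rewrite mem_head.
  by apply: IH => j jr; apply: h; rewrite in_cons jr orbT.
by apply/funext => x; rewrite big_cons.
Qed.

Lemma rintegrable_ge0 f : measurable_fun A f -> (forall x, A x -> 0 <= f x) ->
  (\int[mu]_(x in A) (f x)%:E < +oo)%E -> rintegrable f.
Proof.
move=> mf f0 fo; apply/integrableP; split; first exact/measurable_EFinP.
by under eq_integral => x /set_mem Ax do rewrite gee0_abs ?lee_fin ?f0//.
Qed.

Lemma rintegrable_ltoo f : rintegrable f ->
  (\int[mu]_(x in A) (f x)%:E < +oo)%E.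
Proof. by move=> /(integrable_fin_num mA); rewrite fin_numE ltey => /andP[]. Qed.

Lemma EFin_Rintegral f : rintegrable f ->
  ((\int[mu]_(x in A) f x)%R%:E = \int[mu]_(x in A) (f x)%:E)%E.
Proof. by move=> fi; rewrite /Rintegral fineK//; exact: integrable_fin_num. Qed.

Lemma Rintegral_sum (I : eqType) (r : seq I) (F : I -> T -> R) :
  (forall i, i \in r -> rintegrable (F i)) ->
  \int[mu]_(x in A) (\sum_(i <- r) F i x) = \sum_(i <- r) \int[mu]_(x in A) F i x.
Proof.
elim: r => [|i r IH] h.
  rewrite big_nil (_ : (fun x => _) = cst 0) ?Rintegral_cst ?mul0r//.
  by apply/funext => x; rewrite big_nil.
rewrite (_ : (fun x => _) = (fun x => F i x + \sum_(j <- r) F j x)); last first.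
  by apply/funext => x; rewrite big_cons.
have hr : forall j, j \in r -> rintegrable (F j).
  by move=> j jr; apply: h; rewrite in_cons jr orbT.
rewrite RintegralD//; [|by apply: h; rewrite mem_head|exact: rintegrable_sum].
by rewrite big_cons IH.
Qed.

Lemma Rintegral_ae f g : measurable_fun A f -> measurable_fun A g ->
  {ae mu, forall x, A x -> f x = g x} ->
  \int[mu]_(x in A) f x = \int[mu]_(x in A) g x.
Proof.
move=> mf mg fg; congr fine; apply: ae_eq_integral => //.
- exact/measurable_EFinP.
- exact/measurable_EFinP.
- by apply: filterS fg => x fg Ax; rewrite fg.
Qed.

End real_integrable.

(** * Tonelli and Fubini theorems on rectangles *)

Section product_sets.
Context {R : realType} {d1 d2 : measure_display}.
Context {T1 : measurableType d1} {T2 : measurableType d2}.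
Variables (m1 : {sigma_finite_measure set T1 -> \bar R}).
Variables (m2 : {sigma_finite_measure set T2 -> \bar R}).
Variables (A : set T1) (B : set T2).
Hypotheses (mA : measurable A) (mB : measurable B).
Implicit Types f : T1 * T2 -> R.

Let mAB : measurable (A `*` B). Proof. exact: measurableX. Qed.

(** Extension by zero reduces a rectangle to the whole product space. *)
Let cut (h : T1 * T2 -> \bar R) := h \_ (A `*` B).

Let measurable_cut h : measurable_fun (A `*` B) h -> measurable_fun setT (cut h).
Proof. by move=> mh; apply/(measurable_restrict _ mAB measurableT); rewrite setTI. Qed.

Let fubini_G_cut h : fubini_G m1 (cut h) =
  (fun y => \int[m1]_(x in A) h (x, y))%E \_ B.
Proof.
apply/funext => y; rewrite /fubini_G patchE; case: ifPn => yB.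
  rewrite [RHS]integral_mkcond; apply: eq_integral => x _.
  rewrite /cut !patchE; congr (if _ then _ else _).
  by rewrite in_setX yB andbT.
by rewrite integral0_eq// => x _; rewrite /cut patchE in_setX (negbTE yB) andbF.
Qed.

Let fubini_F_cut h : fubini_F m2 (cut h) =
  (fun x => \int[m2]_(y in B) h (x, y))%E \_ A.
Proof.
apply/funext => x; rewrite /fubini_F patchE; case: ifPn => xA.
  rewrite [RHS]integral_mkcond; apply: eq_integral => y _.
  rewrite /cut !patchE; congr (if _ then _ else _).
  by rewrite in_setX xA.
by rewrite integral0_eq// => y _; rewrite /cut patchE in_setX (negbTE xA).
Qed.

Lemma tonelli_prod (h : T1 * T2 -> \bar R) : measurable_fun (A `*` B) h ->
  (forall z, (A `*` B) z -> (0 <= h z)%E) ->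
  [/\ measurable_fun B (fun y => \int[m1]_(x in A) h (x, y))%E,
   (\int[m1 \x m2]_(z in A `*` B) h z =
    \int[m2]_(y in B) \int[m1]_(x in A) h (x, y))%E,
   measurable_fun A (fun x => \int[m2]_(y in B) h (x, y))%E &
   (\int[m1 \x m2]_(z in A `*` B) h z =
    \int[m1]_(x in A) \int[m2]_(y in B) h (x, y))%E].
Proof.
move=> mh h0; have mc := measurable_cut mh.
have c0 z : (0 <= cut h z)%E by rewrite /cut patchE; case: ifPn => // /set_mem/h0.
have := measurable_fun_fubini_tonelli_G (m1 := m1) (cut h) mc c0.
rewrite fubini_G_cut => mG.
have := measurable_fun_fubini_tonelli_F (m2 := m2) (cut h) mc c0.
rewrite fubini_F_cut => mF.
split.
- by move/(measurable_restrict _ mB measurableT) : mG; rewrite setTI.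
- by rewrite integral_mkcond (fubini_tonelli2 _ mc c0) fubini_G_cut -integral_mkcond.
- by move/(measurable_restrict _ mA measurableT) : mF; rewrite setTI.
- by rewrite integral_mkcond (fubini_tonelli1 _ mc c0) fubini_F_cut -integral_mkcond.
Qed.

Lemma measurable_section2 d' (T' : measurableType d') (f : T1 * T2 -> T') y :
  measurable_fun (A `*` B) f -> B y -> measurable_fun A (fun x => f (x, y)).
Proof.
move=> mf By; apply: (@measurable_comp _ _ _ _ _ _ (A `*` B) f _ (fun x => (x, y))) => //.
  by move=> _ [x Ax <-].
by apply: measurable_funTS; exact: pair2_measurable.
Qed.

Lemma rintegrable_prod f : measurable_fun (A `*` B) f ->
  (\int[m2]_(y in B) \int[m1]_(x in A) `|f (x, y)|%:E < +oo)%E ->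
  rintegrable (m1 \x m2)%E (A `*` B) f.
Proof.
move=> mf fo; apply/integrableP; split; first exact/measurable_EFinP.
have [||_ -> _ _] := @tonelli_prod (fun z => `|f z|%:E) => //.
by apply/measurable_EFinP; exact: measurableT_comp.
Qed.

(** The inner integral is real valued, so an infinite one is read as 0. This happens only on a null
    set of [y], so passing through [fine] changes neither integrability nor the value. *)
Lemma fubini_prod f : rintegrable (m1 \x m2)%E (A `*` B) f ->
  [/\ {ae m2, forall y, B y -> rintegrable m1 A (fun x => f (x, y))},
    rintegrable m2 B (fun y => \int[m1]_(x in A) f (x, y)) &
    \int[(m1 \x m2)%E]_(z in A `*` B) f z =
    \int[m2]_(y in B) \int[m1]_(x in A) f (x, y)].
Proof.
move=> fi; have mf := rintegrable_measurable fi.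
have [||mN NE _ _] := @tonelli_prod (fun z => `|f z|%:E) => //.
  by apply/measurable_EFinP; exact: measurableT_comp.
have No : (\int[m2]_(y in B) \int[m1]_(x in A) `|f (x, y)|%:E < +oo)%E.
  by rewrite -NE; case/integrableP : fi.
have Ni : m2.-integrable B (fun y => \int[m1]_(x in A) `|f (x, y)|%:E)%E.
  apply/integrableP; split=> //; under eq_integral do rewrite gee0_abs ?integral_ge0//.
  exact: No.
have ic : (m1 \x m2)%E.-integrable setT (cut (EFin \o f)).
  exact/(integrable_mkcond _ mAB).
have mG := measurable_fubini_G ic; rewrite fubini_G_cut in mG.
move/(measurable_restrict _ mB measurableT) : mG; rewrite setTI => mG.
have Gi : m2.-integrable B (fun y => \int[m1]_(x in A) (f (x, y))%:E)%E.
  apply: (le_integrable mB mG _ Ni) => y By /=.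
  rewrite [leRHS]gee0_abs ?integral_ge0//; apply: le_abse_integral => //.
  by apply/measurable_EFinP; exact: (measurable_section2 mf By).
have fine_integrable : m2.-integrable B
    (EFin \o (fun y => \int[m1]_(x in A) f (x, y))).
  apply: (le_integrable mB _ _ Gi) => [|y By /=].
    by apply/measurable_EFinP; exact: measurableT_comp.
  by rewrite /Rintegral; case: (integral _ _ _) => [r| |] //=; rewrite leey.
split.
- apply: filterS (integrable_ae mB Ni) => y yfin By; apply/integrableP; split.
    by apply/measurable_EFinP; exact: (measurable_section2 mf By).
  by have := yfin By; rewrite fin_numE ltey => /andP[].
- exact: fine_integrable.
- rewrite /Rintegral integral_mkcond.
  rewrite -(integral21_prod_meas1 ic) fubini_G_cut -integral_mkcond; congr fine.
  apply: ae_eq_integral => //.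
    by apply/measurable_EFinP; exact: measurableT_comp.
  by apply: filterS (integrable_ae mB Gi) => y yfin By; rewrite fineK// yfin.
Qed.

Lemma fubini_prod1 f : rintegrable (m1 \x m2)%E (A `*` B) f ->
  \int[(m1 \x m2)%E]_(z in A `*` B) f z =
  \int[m1]_(x in A) \int[m2]_(y in B) f (x, y).
Proof.
move=> fi; have ic : (m1 \x m2)%E.-integrable setT (cut (EFin \o f)).
  exact/(integrable_mkcond _ mAB).
have Fi := integrable_fubini_F ic; rewrite fubini_F_cut in Fi.
move/(integrable_mkcond _ mA) : Fi => Fi.
rewrite /Rintegral integral_mkcond.
rewrite -(integral12_prod_meas1 ic) fubini_F_cut -integral_mkcond; congr fine.
have mF := measurable_int _ Fi; apply: ae_eq_integral => //.
  by apply/measurable_EFinP; exact: measurableT_comp.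
by apply: filterS (integrable_ae mA Fi) => x xfin Ax; rewrite fineK// xfin.
Qed.

End product_sets.
(** * Seminormed spaces and Bochner spaces *)

Section seminormed.
Context {R : realType} {V : lmodType R}.

(** [N] may be infinite or meaningless outside [S], hence the axioms restricted to [S]. Elements are
    functions, not classes, so [N v = 0] does not force [v = 0]. *)
Record seminormed (S : set V) (N : V -> \bar R) : Prop := Seminormed {
  seminormed0 : S 0;
  seminormed_lin : forall a v w, S v -> S w -> S (a *: v + w);
  seminormed_ge0 : forall v, (0 <= N v)%E;
  seminormed_fin : forall v, S v -> N v \is a fin_num;
  seminormedD : forall v w, S v -> S w -> (N (v + w)%R <= N v + N w)%E;
  seminormedZ : forall a v, S v -> N (a *: v)%R = (`|a|%:E * N v)%E }.

Definition nrm (N : V -> \bar R) (v : V) : R := fine (N v).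

Variables (S : set V) (N : V -> \bar R).
Hypothesis SN : seminormed S N.
Local Notation n := (nrm N).

Lemma nrmE v : S v -> N v = (n v)%:E.
Proof. by move=> Sv; rewrite /nrm fineK//; exact: (seminormed_fin SN). Qed.

Lemma nrm_ge0 v : 0 <= n v.
Proof. exact/fine_ge0/(seminormed_ge0 SN). Qed.

Lemma subspD v w : S v -> S w -> S (v + w).
Proof. by move=> Sv Sw; rewrite -[v]scale1r; exact: (seminormed_lin SN). Qed.

Lemma subspZ a v : S v -> S (a *: v).
Proof.
by move=> Sv; rewrite -[_ *: _]addr0; apply: (seminormed_lin SN) => //;
  exact: (seminormed0 SN).
Qed.

Lemma subspN v : S v -> S (- v).
Proof. by rewrite -scaleN1r; exact: subspZ. Qed.

Lemma subspB v w : S v -> S w -> S (v - w).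
Proof. by move=> Sv Sw; apply: subspD => //; exact: subspN. Qed.

Lemma nrmD v w : S v -> S w -> n (v + w) <= n v + n w.
Proof.
move=> Sv Sw; rewrite -lee_fin EFinD -!nrmE//; first exact: (seminormedD SN).
exact: subspD.
Qed.

Lemma nrmZ a v : S v -> n (a *: v) = `|a| * n v.
Proof. by move=> Sv; rewrite /nrm (seminormedZ SN)// (nrmE Sv). Qed.

Lemma nrm0 : n 0 = 0.
Proof.
by rewrite -(scale0r 0) nrmZ ?normr0 ?mul0r//; exact: (seminormed0 SN).
Qed.

Lemma nrmN v : S v -> n (- v) = n v.
Proof. by move=> Sv; rewrite -scaleN1r nrmZ// normrN1 mul1r. Qed.

Lemma nrmB v w : S v -> S w -> n (v - w) <= n v + n w.
Proof.
by move=> Sv Sw; rewrite -(nrmN Sw); apply: nrmD => //; exact: subspN.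
Qed.

Lemma nrm_distC v w : S v -> S w -> n (v - w) = n (w - v).
Proof. by move=> Sv Sw; rewrite -opprB nrmN//; exact: subspB. Qed.

Lemma nrm_triangle w v z : S v -> S w -> S z ->
  n (v - z) <= n (v - w) + n (w - z).
Proof.
move=> Sv Sw Sz; rewrite (_ : v - z = (v - w) + (w - z)); last first.
  by rewrite addrA subrK.
by apply: nrmD; exact: subspB.
Qed.

Lemma nrm_le_dist v w : S v -> S w -> `|n v - n w| <= n (v - w).
Proof.
move=> Sv Sw; have := nrm_triangle Sv Sw (seminormed0 SN).
have := nrm_triangle Sw Sv (seminormed0 SN).
rewrite !subr0 (nrm_distC Sw Sv) ler_norml => ? ?; apply/andP; split; lra.
Qed.

Lemma subsp_sum (I : eqType) (r : seq I) (F : I -> V) :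
  (forall i, i \in r -> S (F i)) -> S (\sum_(i <- r) F i).
Proof.
elim: r => [|i r IH] h; first by rewrite big_nil; exact: (seminormed0 SN).
rewrite big_cons; apply: subspD; first by apply: h; rewrite mem_head.
by apply: IH => j jr; apply: h; rewrite in_cons jr orbT.
Qed.

Lemma cvg_nrmP (F : set_system nat) {FF : Filter F} (f : nat -> V) (l : V) :
  (forall k, S (f k)) -> S l ->
  (fun k => N (f k - l)) @ F --> 0%E <-> (fun k => n (f k - l)) @ F --> 0.
Proof.
move=> Sf Sl; have -> : (fun k => N (f k - l)) = EFin \o (fun k => n (f k - l)).
  by apply/funext => k; rewrite /= nrmE//; exact: subspB.
split => [/fine_cvg//|h]; apply: cvg_EFin; last exact: h.
exact: nearW.
Qed.

Lemma nrm_cvg (f : nat -> V) (l : V) : (forall k, S (f k)) -> S l ->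
  (fun k => n (f k - l)) @ \oo --> 0 -> (fun k => n (f k)) @ \oo --> n l.
Proof.
move=> Sf Sl fl; apply/cvgrPdist_le => e e0.
move/cvgrPdist_le : fl => /(_ _ e0); apply: filterS => k; rewrite sub0r normrN.
rewrite (ger0_norm (nrm_ge0 _)); apply: le_trans.
by rewrite (nrm_distC (Sf k) Sl); exact: nrm_le_dist.
Qed.

(** Completeness along sequences with geometrically decaying steps. Any two rates in ]0, 1[ give the
    same notion ([seminorm_complete_rate]), but [bochner_complete] naturally turns the rate 1/2 for
    the values into 1/4 for the fields. *)
Definition seminorm_complete (r : R) : Prop := forall f : nat -> V,
  (forall k, S (f k)) -> (forall k, n (f k.+1 - f k) <= r ^+ k) ->
  exists l, S l /\ (fun k => n (f k - l)) @ \oo --> 0.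

Lemma seminorm_completeZ r (C : R) (f : nat -> V) : 0 <= r ->
  seminorm_complete r -> 0 <= C -> (forall k, S (f k)) ->
  (forall k, n (f k.+1 - f k) <= C * r ^+ k) ->
  exists l, S l /\ (fun k => n (f k - l)) @ \oo --> 0.
Proof.
(* Dividing by [C + 1] instead of [C] covers the case [C = 0]. *)
move=> r0 cS C0 Sf fr; have D0 : 0 < C + 1 by lra.
have Sg k : S ((C + 1)^-1 *: f k) by exact: subspZ.
have [k|l [Sl fl]] := cS _ Sg.
  rewrite -scalerBr nrmZ; last exact: subspB.
  rewrite gtr0_norm ?invr_gt0// mulrC ler_pdivrMr//.
  apply: le_trans (fr k) _.
  by rewrite mulrC ler_wpM2l ?exprn_ge0// lerDl.
exists ((C + 1) *: l); split; first exact: subspZ.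
rewrite -[X in _ --> X](mulr0 (C + 1)).
rewrite (_ : (fun k => _) = fun k => (C + 1) * n ((C + 1)^-1 *: f k - l)).
  exact: cvgMr.
apply/funext => k; rewrite -[X in X * _](gtr0_norm D0) -nrmZ; last exact: subspB.
by rewrite scalerBr scalerA divff ?scale1r// gt_eqF.
Qed.

Lemma geometric_dist (r C : R) (f : nat -> V) : 0 <= r -> r < 1 ->
  (forall k, S (f k)) -> (forall k, n (f k.+1 - f k) <= C * r ^+ k) ->
  forall k m, (k <= m)%N -> n (f k - f m) <= C * r ^+ k / (1 - r).
Proof.
move=> r0 r1 Sf fr k m km.
have C0 : 0 <= C by have := le_trans (nrm_ge0 _) (fr 0%N); rewrite expr0 mulr1.
rewrite -(subnKC km); move: (m - k)%N => j {m km}.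
have r1' : 0 < 1 - r by lra.
(* The induction needs the exact partial geometric sum; the factor [1 - r ^+ j] is dropped
   afterwards. *)
suff h : n (f k - f (k + j)%N) <= C * r ^+ k * (1 - r ^+ j) / (1 - r).
  apply: le_trans h _; rewrite ler_pM2r ?invr_gt0//.
  have rj : 0 <= r ^+ j by rewrite exprn_ge0.
  have : 0 <= C * r ^+ k by rewrite mulr_ge0// exprn_ge0.
  by move=> ?; nra.
elim: j => [|j IH]; first by rewrite addn0 subrr expr0 subrr mulr0 mul0r nrm0.
apply: le_trans (nrm_triangle (Sf k) (Sf (k + j)%N) (Sf _)) _.
have := fr (k + j)%N; rewrite nrm_distC// addnS => fj.
apply: le_trans (lerD IH fj) _.
rewrite le_eqVlt; apply/orP; left; apply/eqP.
by rewrite exprD exprS; field; lra.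
Qed.

End seminormed.

(** * Simple functions and strong measurability *)

Section simple_functions.
Context {R : realType} {disp : measure_display} {T : measurableType disp}.
Context {V : lmodType R}.
Implicit Types (S : set V) (N : V -> \bar R) (s : seq (set T * V)).

Lemma simple_fun_nil (t : T) : simple_fun (V := V) [::] t = 0.
Proof. by rewrite /simple_fun big_nil. Qed.

Lemma simple_fun_cons p s (t : T) :
  simple_fun (p :: s) t = (\1_(p.1) t : R) *: p.2 + simple_fun s t.
Proof. by rewrite /simple_fun big_cons. Qed.

Lemma simple_fun_cat s1 s2 (t : T) :
  simple_fun (s1 ++ s2) t = simple_fun s1 t + simple_fun s2 t.
Proof. by rewrite /simple_fun big_cat. Qed.

Definition scale_simple (a : R) s : seq (set T * V) :=
  [seq (p.1, a *: p.2) | p <- s].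

Lemma simple_fun_scale a s (t : T) :
  simple_fun (scale_simple a s) t = a *: simple_fun s t.
Proof.
rewrite /simple_fun big_map scaler_sumr; apply: eq_bigr => p _ /=.
by rewrite !scalerA mulrC.
Qed.

Definition restrict_simple (B : set T) s : seq (set T * V) :=
  [seq (B `&` p.1, p.2) | p <- s].

Lemma simple_fun_restrict B s (t : T) :
  simple_fun (restrict_simple B s) t = (\1_B t : R) *: simple_fun s t.
Proof.
rewrite /simple_fun big_map scaler_sumr; apply: eq_bigr => p _ /=.
by rewrite !scalerA indicI.
Qed.

Lemma simple_fun_cons_in (B : set T) (v : V) s t : B t ->
  simple_fun ((B, v) :: s) t = v + simple_fun s t.
Proof. by move=> Bt; rewrite simple_fun_cons/= indicE mem_set// scale1r. Qed.

Lemma simple_fun_cons_notin (B : set T) (v : V) s t : ~ B t ->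
  simple_fun ((B, v) :: s) t = simple_fun s t.
Proof. by move=> Bt; rewrite simple_fun_cons/= indicE memNset// scale0r add0r. Qed.

Lemma is_simple_cons S p s :
  is_simple S (p :: s) <-> [/\ measurable p.1, S p.2 & is_simple S s].
Proof.
split => [h|[mp Sp h] q].
  split; [by case: (h p (mem_head _ _))|by case: (h p (mem_head _ _))|].
  by move=> q qs; apply: h; rewrite in_cons qs orbT.
by rewrite in_cons => /orP[/eqP ->//|]; exact: h.
Qed.

Lemma is_simple_cat S s1 s2 :
  is_simple S s1 -> is_simple S s2 -> is_simple S (s1 ++ s2).
Proof. by move=> h1 h2 p; rewrite mem_cat => /orP[/h1|/h2]. Qed.

Lemma is_simple_restrict S B s : measurable B -> is_simple S s ->
  is_simple S (restrict_simple B s).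
Proof.
move=> mB h p /mapP[q qs ->]/=; have [mq Sq] := h q qs.
by split => //; exact: measurableI.
Qed.

Lemma is_simple_scale S N a s : seminormed S N -> is_simple S s ->
  is_simple S (scale_simple a s).
Proof.
move=> SN h p /mapP[q qs ->]/=; have [mq Sq] := h q qs.
by split => //; exact: (subspZ SN).
Qed.

Lemma simple_fun_in S N s t : seminormed S N -> is_simple S s ->
  S (simple_fun s t).
Proof.
move=> SN h; apply: (subsp_sum SN) => p ps; apply: (subspZ SN).
by have [] := h p ps.
Qed.

Lemma simple_integral_in S N (mu : {measure set T -> \bar R}) A s :
  seminormed S N -> is_simple S s -> S (simple_integral mu A s).
Proof.
move=> SN h; apply: (subsp_sum SN) => p ps; apply: (subspZ SN).
by have [] := h p ps.
Qed.

(** Induction on the list, whose sets may overlap: on the first set the value [v] is moved into the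
    test map as the translation [Psi t (v + _)], which is why [Psi] varies in the induction. *)
Lemma measurable_comp_simple S N A d' (T' : measurableType d')
    (Psi : T -> V -> T') s :
  seminormed S N -> measurable A -> is_simple S s ->
  (forall v, S v -> measurable_fun A (Psi ^~ v)) ->
  measurable_fun A (fun t => Psi t (simple_fun s t)).
Proof.
move=> SN mA; elim: s Psi => [|[B v] s IH] Psi.
  move=> _ /(_ _ (seminormed0 SN)).
  by apply: eq_measurable_fun => t _; rewrite simple_fun_nil.
move=> /is_simple_cons[/= mB Sv hs] mPsi.
have -> : (fun t => Psi t (simple_fun ((B, v) :: s) t)) =
    fun t => if t \in B then Psi t (v + simple_fun s t)
             else Psi t (simple_fun s t).
  apply/funext => t; case: ifPn => [/set_mem Bt|/negP tB].
    by rewrite simple_fun_cons_in.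
  by rewrite simple_fun_cons_notin// => /mem_set.
apply: measurable_fun_if => //.
- apply: (measurable_fun_bool true).
  rewrite (_ : _ @^-1` _ = B) ?setTI//; first exact: measurableI.
  by apply/seteqP; split=> t /=; [exact: set_mem|exact: mem_set].
- apply: (measurable_funS mA); first by move=> t [].
  apply: (IH (fun t w => Psi t (v + w))) => // w Sw; apply: mPsi.
  exact: (subspD SN).
- apply: (measurable_funS mA); first by move=> t [].
  exact: IH.
Qed.

(** All subset sums of the listed values: a finite list that contains the range even when the sets
    overlap. *)
Fixpoint simple_values s : seq V :=
  if s is p :: s' then
    simple_values s' ++ [seq p.2 + v | v <- simple_values s'] else [:: 0].

Lemma simple_fun_values s t : simple_fun s t \in simple_values s.
Proof.
elim: s => [|[B v] s IH]; first by rewrite simple_fun_nil mem_head.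
rewrite /= mem_cat; have [Bt|Bt] := pselect (B t).
  by rewrite simple_fun_cons_in// map_f ?orbT.
by rewrite simple_fun_cons_notin// IH.
Qed.

Lemma simple_values_in S N s v : seminormed S N -> is_simple S s ->
  v \in simple_values s -> S v.
Proof.
move=> SN; elim: s v => [|p s IH] v /=.
  by move=> _; rewrite inE => /eqP ->; exact: (seminormed0 SN).
move=> /is_simple_cons[mp Sp hs]; rewrite mem_cat => /orP[|]; first exact: IH.
by move=> /mapP[w ws ->]; apply: (subspD SN) => //; exact: IH.
Qed.

End simple_functions.

Section strong_measurability.
Context {R : realType} {disp : measure_display} {T : measurableType disp}.
Context {V : lmodType R}.
Variables (A : set T) (S : set V) (N : V -> \bar R).
Hypotheses (mA : measurable A) (SN : seminormed S N).
Local Notation n := (nrm N).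
Local Notation smeas := (strongly_measurable A S N).

Lemma strongly_measurableP (f : T -> V) : smeas f <->
  (forall t, A t -> S (f t)) /\
  exists s : nat -> seq (set T * V), (forall k, is_simple S (s k)) /\
    forall t, A t -> (fun k => n (simple_fun (s k) t - f t)) @ \oo --> 0.
Proof.
split=> -[Sf [s [hs sf]]]; split=> //; exists s; split=> // t At;
  (apply/(cvg_nrmP SN); [|exact: Sf|exact: sf]) => k;
  exact: (simple_fun_in t SN (hs k)).
Qed.

(** Since [f] is a pointwise limit of simple functions, measurability for constant second arguments
    together with sequential continuity is enough. *)
Lemma measurable_smeas (f : T -> V) (Psi : T -> V -> R) :
  smeas f -> (forall v, S v -> measurable_fun A (Psi ^~ v)) ->
  (forall t (g : nat -> V), A t -> (forall k, S (g k)) ->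
    (fun k => n (g k - f t)) @ \oo --> 0 ->
    (fun k => Psi t (g k)) @ \oo --> Psi t (f t)) ->
  measurable_fun A (fun t => Psi t (f t)).
Proof.
move=> /strongly_measurableP[Sf [s [hs sf]]] mPsi cPsi.
apply: (@measurable_fun_cvg _ _ _ A (fun k t => Psi t (simple_fun (s k) t))).
  by move=> k; exact: (measurable_comp_simple SN mA (hs k)).
by move=> t At; apply: cPsi => // [k|]; [exact: (simple_fun_in t SN)|exact: sf].
Qed.

Lemma measurable_nrm_dist (f : T -> V) (e : V) : smeas f -> S e ->
  measurable_fun A (fun t => n (f t - e)).
Proof.
move=> hf Se; have [Sf _] := hf.
apply: (measurable_smeas (Psi := fun _ v => n (v - e))) => //.
move=> t g At Sg gf; apply: (nrm_cvg SN) => [k||].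
- exact: (subspB SN).
- by apply: (subspB SN) => //; exact: Sf.
- apply: cvg_trans gf; apply: near_eq_cvg; apply: nearW => k.
  by congr (n _); rewrite opprB addrA subrK.
Qed.

Lemma measurable_nrm (f : T -> V) : smeas f -> measurable_fun A (n \o f).
Proof.
move=> hf; have := measurable_nrm_dist hf (seminormed0 SN).
by apply: eq_measurable_fun => t _; rewrite subr0.
Qed.

Lemma smeas_cst (v : V) : S v -> smeas (cst v).
Proof.
move=> Sv; apply/strongly_measurableP; split=> //.
exists (fun=> [:: (setT, v)]); split=> [k p|t At].
  by rewrite inE => /eqP ->; split=> //=; exact: measurableT.
under eq_fun do rewrite simple_fun_cons_in// simple_fun_nil addr0 subrr (nrm0 SN).
exact: cvg_cst.
Qed.

Lemma smeas_lin a (f g : T -> V) : smeas f -> smeas g -> smeas (a *: f + g).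
Proof.
move=> /strongly_measurableP[Sf [s [hs sf]]].
move=> /strongly_measurableP[Sg [s' [hs' sg]]].
apply/strongly_measurableP; split=> [t At|].
  by apply: (seminormed_lin SN); [exact: Sf|exact: Sg].
exists (fun k => scale_simple a (s k) ++ s' k); split=> [k|t At].
  apply: is_simple_cat; [move=> q; exact: (is_simple_scale SN (hs k))|exact: hs'].
apply: (@squeeze_cvgr _ _ _ _ (cst 0)
  (fun k => `|a| * n (simple_fun (s k) t - f t) + n (simple_fun (s' k) t - g t))).
- apply: nearW => k; rewrite (nrm_ge0 SN)/= simple_fun_cat simple_fun_scale.
  have Sk := simple_fun_in t SN (hs k).
  have Sk' := simple_fun_in t SN (hs' k).
  have St := Sf t At; have St' := Sg t At.
  rewrite (_ : _ - _ = a *: (simple_fun (s k) t - f t) +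
    (simple_fun (s' k) t - g t)); last by rewrite scalerBr opprD addrACA.
  rewrite -(nrmZ SN); last exact: (subspB SN).
  by apply: (nrmD SN); [apply: (subspZ SN)|]; exact: (subspB SN).
- exact: cvg_cst.
- rewrite -[X in _ --> X]addr0 -[X in X + _](mulr0 `|a|).
  by apply: cvgD; [apply: cvgMr; exact: sf|exact: sg].
Qed.

End strong_measurability.
Section strong_measurability_limits.
Context {R : realType} {disp : measure_display} {T : measurableType disp}.
Context {V : lmodType R}.
Variables (A : set T) (S : set V) (N : V -> \bar R).
Hypotheses (mA : measurable A) (SN : seminormed S N).
Local Notation n := (nrm N).
Local Notation smeas := (strongly_measurable A S N).

(* Values of the approximation at rank [k]: the best among [e 0], ..., [e k]. *)
Fixpoint best_approx (e : nat -> V) (f : T -> V) k : seq (set T * V) :=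
  if k is k'.+1 then
    let B := A `&` [set t | n (f t - e k) < n (f t - simple_fun (best_approx e f k') t)] in
    (B, e k) :: restrict_simple (~` B) (best_approx e f k')
  else [:: (setT, e 0%N)].

(** A form of Pettis' theorem: the best approximation among the first members of a countable family
    is selected measurably, by comparing distances, and tends to [f t] because the family comes
    arbitrarily close to it. *)
Lemma smeas_separable (e : nat -> V) (f : T -> V) :
  (forall j, S (e j)) -> (forall t, A t -> S (f t)) ->
  (forall v, S v -> measurable_fun A (fun t => n (f t - v))) ->
  (forall t, A t -> forall r, 0 < r -> exists j, n (f t - e j) < r) ->
  smeas f.
Proof.
move=> Se Sf mf ef.
have best_simple k : is_simple S (best_approx e f k).
  elim: k => [|k IH] /=.
    by move=> p; rewrite inE => /eqP -> /=; split => //; exact: measurableT.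
  set B := A `&` _.
  have mB : measurable B.
    have m2 := measurable_comp_simple SN mA IH mf.
    have := measurable_fun_ltr (mf _ (Se k.+1)) m2.
    move=> /(_ mA [set true] I).
    by congr measurable; apply/seteqP; split => t [].
  apply/is_simple_cons; split => //=; apply: is_simple_restrict => //.
  exact: measurableC.
have bestS k t : simple_fun (best_approx e f k.+1) t =
    if (n (f t - e k.+1) < n (f t - simple_fun (best_approx e f k) t)) &&
       `[< A t >] then e k.+1 else simple_fun (best_approx e f k) t.
  rewrite [best_approx e f k.+1]/=; set B := A `&` _.
  case: ifPn => [/andP[lt /asboolP At]|ht].
    rewrite simple_fun_cons_in//= simple_fun_restrict indicE memNset ?scale0r ?addr0//.
    by move=> []; split.
  have nB : ~ B t by move=> [At ltt]; move: ht; rewrite ltt/= => /asboolP.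
  by rewrite simple_fun_cons_notin// simple_fun_restrict indicE mem_set ?scale1r.
have best_le j k t : A t -> (j <= k)%N ->
    n (f t - simple_fun (best_approx e f k) t) <= n (f t - e j).
  move=> At; elim: k => [|k IH].
    by rewrite leqn0 => /eqP -> /=; rewrite simple_fun_cons_in// simple_fun_nil addr0.
  rewrite bestS leq_eqVlt ltnS => /orP[/eqP ->|/IH jk].
    by case: ifPn => //; rewrite asboolT// andbT -leNgt.
  by case: ifPn => // /andP[/ltW/le_trans + _]; apply.
apply/(strongly_measurableP _ SN); split => //; exists (best_approx e f).
split => // t At; apply/cvgrPdist_lt => r r0.
have [j ej] := ef t At r r0.
exists j => // k /= jk; rewrite sub0r normrN ger0_norm ?(nrm_ge0 SN)//.
rewrite (nrm_distC SN); last exact: Sf.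
  exact: (le_lt_trans (best_le _ _ _ At jk)).
exact: (simple_fun_in t SN (best_simple k)).
Qed.

(** A limit of limits of simple functions has no evident diagonal sequence that works at every
    point. Instead, the values of all the approximations form a countable family coming arbitrarily
    close to each [f t], and [smeas_separable] applies. *)
Lemma smeas_lim (g : nat -> T -> V) (f : T -> V) :
  (forall k, smeas (g k)) -> (forall t, A t -> S (f t)) ->
  (forall t, A t -> (fun k => n (g k t - f t)) @ \oo --> 0) -> smeas f.
Proof.
move=> hg Sf gf.
have Sg k t : A t -> S (g k t) by move=> At; have [+ _] := hg k; apply.
have /choice[s hs] : forall k, exists s : nat -> seq (set T * V),
    (forall j, is_simple S (s j)) /\
    forall t, A t -> (fun j => n (simple_fun (s j) t - g k t)) @ \oo --> 0.
  by move=> k; have /(strongly_measurableP _ SN)[_ ?] := hg k.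
(* An enumeration of the values by codes of triples; codes of nothing and indices beyond the list
   give the harmless value 0. *)
pose e i := if @unpickle (nat * nat * nat)%type i is Some (k, j, l)
  then nth 0 (simple_values (s k j)) l else 0.
apply: (@smeas_separable e) => //.
- move=> i; rewrite /e; case: unpickle => [[[k j] l]|]; last exact: (seminormed0 SN).
  have [lt|ge] := ltnP l (size (simple_values (s k j))).
    by apply: (simple_values_in SN ((hs k).1 j)); exact: mem_nth.
  by rewrite nth_default//; exact: (seminormed0 SN).
- move=> v Sv; apply: (@measurable_fun_cvg _ _ _ A (fun k t => n (g k t - v))).
    by move=> k; exact: (measurable_nrm_dist mA SN).
  move=> t At; apply: (nrm_cvg SN); [|exact: (subspB SN (Sf _ At))|].
    by move=> k; apply: (subspB SN) => //; exact: Sg.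
  apply: cvg_trans (gf t At); apply: near_eq_cvg; apply: nearW => k.
  by congr (n _); rewrite opprB addrA subrK.
- move=> t At r r0.
  have r2 : 0 < r / 2 by rewrite divr_gt0.
  have /cvgrPdist_lt/(_ _ r2)[k _ /(_ k (leqnn _))/=] := gf t At.
  rewrite sub0r normrN (ger0_norm (nrm_ge0 SN _)) => gk.
  have /cvgrPdist_lt/(_ _ r2)[j _ /(_ j (leqnn _))/=] := (hs k).2 t At.
  rewrite sub0r normrN (ger0_norm (nrm_ge0 SN _)) => sj.
  have v_in := simple_fun_values (s k j) t.
  exists (pickle (k, j, index (simple_fun (s k j) t) (simple_values (s k j)))).
  rewrite /e pickleK nth_index//.
  have Ss := simple_fun_in t SN ((hs k).1 j).
  apply: le_lt_trans (nrm_triangle SN (Sf t At) (Sg k t At) Ss) _.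
  rewrite (nrm_distC SN (Sf t At) (Sg k t At)) (nrm_distC SN (Sg k t At) Ss).
  lra.
Qed.

End strong_measurability_limits.

(** * Seminorms from the weighted Young inequality, and Bochner norms *)

Section young_seminorms.
Context {R : realType}.

(* The weighted Young inequality is equivalent to the triangle inequality for
   square roots, and, unlike it, is preserved by integration. *)
Lemma sqr_young (a b z : R) : 0 <= a -> 0 <= b ->
  (forall e, 0 < e -> z <= (1 + e) * a ^+ 2 + (1 + e^-1) * b ^+ 2) ->
  z <= (a + b) ^+ 2.
Proof.
rewrite le_eqVlt => /orP[/eqP <-|a0].
  (* For [a = 0] one wants [e] to tend to infinity: if [z] exceeded [b ^+ 2], the [e] below would
     make [e^-1 * b ^+ 2] at most half of the gap. *)
  move=> b0 h; rewrite add0r leNgt; apply/negP => bz.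
  have b1 : 0 <= b ^+ 2 by rewrite sqr_ge0.
  have e0 : 0 < 2 * (b ^+ 2 + 1) / (z - b ^+ 2).
    by rewrite divr_gt0 ?subr_gt0//; lra.
  have := h _ e0; rewrite expr0n mulr0 add0r invf_div mulrDl mul1r.
  have : (z - b ^+ 2) / (2 * (b ^+ 2 + 1)) * b ^+ 2 <= (z - b ^+ 2) / 2.
    rewrite -subr_ge0.
    rewrite [leRHS](_ : _ = (z - b ^+ 2) / 2 / (b ^+ 2 + 1)); last by field; lra.
    by rewrite divr_ge0//; lra.
  by move=> ? ?; lra.
rewrite le_eqVlt => /orP[/eqP <-|b0] h.
  rewrite addr0 leNgt; apply/negP => az.
  have a1 : 0 < a ^+ 2 by rewrite exprn_gt0.
  (* For [b = 0], this [e] makes [e * a ^+ 2] equal to half of the gap. *)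
  have e0 : 0 < (z - a ^+ 2) / (2 * a ^+ 2).
    by rewrite divr_gt0 ?mulr_gt0// subr_gt0.
  have := h _ e0; rewrite expr0n mulr0 addr0 mulrDl mul1r.
  rewrite [_ / _ * _](_ : _ = (z - a ^+ 2) / 2); last by field; lra.
  by move=> ?; lra.
(* The minimiser [e = b / a] turns the right-hand side into exactly [(a + b) ^+ 2]. *)
apply: le_trans (h _ (divr_gt0 b0 a0)) _.
rewrite le_eqVlt; apply/orP; left; apply/eqP; field; apply/andP; split; lra.
Qed.

Lemma sqrt_young (x y z : R) : 0 <= x -> 0 <= y ->
  (forall e, 0 < e -> z <= (1 + e) * x + (1 + e^-1) * y) ->
  Num.sqrt z <= Num.sqrt x + Num.sqrt y.
Proof.
move=> x0 y0 h.
have s0 : 0 <= Num.sqrt x + Num.sqrt y by rewrite addr_ge0// sqrtr_ge0.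
rewrite -(ger0_norm s0) -sqrtr_sqr ler_sqrt ?sqr_ge0//.
by apply: sqr_young; rewrite ?sqrtr_ge0// => e e0; rewrite !sqr_sqrtr//; exact: h.
Qed.

Lemma young_sqrD (x y e : R) : 0 < e ->
  (x + y) ^+ 2 <= (1 + e) * x ^+ 2 + (1 + e^-1) * y ^+ 2.
Proof.
move=> e0; rewrite -subr_ge0.
rewrite [leRHS](_ : _ = e * (x - y / e) ^+ 2); last by field; lra.
by rewrite mulr_ge0 ?sqr_ge0// ltW.
Qed.

(** Homogeneity of degree two and the weighted Young inequality both pass through integrals; this is
    how Minkowski's inequality is obtained for the Bochner and Sobolev norms. *)
Lemma seminormed_sqrt (V : lmodType R) (S : set V) (Q : V -> \bar R) :
  S 0 -> (forall a v w, S v -> S w -> S (a *: v + w)) ->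
  (forall v, 0 <= Q v)%E -> (forall v, S v -> Q v < +oo)%E ->
  (forall a v, S v -> Q (a *: v)%R = ((a ^+ 2)%:E * Q v)%E) ->
  (forall e v w, 0 < e -> S v -> S w ->
    (Q (v + w)%R <= (1 + e)%:E * Q v + (1 + e^-1)%:E * Q w)%E) ->
  seminormed S (fun v => (Q v `^ 2^-1)%E).
Proof.
move=> S0 Slin Q0 Qfin QZ QY.
have Qf v : S v -> Q v = (fine (Q v))%:E.
  by move=> Sv; rewrite fineK// ge0_fin_numE// Qfin.
have QE v : S v -> (Q v `^ 2^-1)%E = (Num.sqrt (fine (Q v)))%:E.
  by move=> Sv; rewrite {1}Qf// poweR_EFin powR12_sqrt// fine_ge0.
split => //.
- by move=> v; exact: poweR_ge0.
- by move=> v Sv; rewrite QE.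
- move=> v w Sv Sw.
  have Svw : S (v + w) by rewrite -[v]scale1r; exact: Slin.
  rewrite !QE// -EFinD lee_fin; apply: sqrt_young; rewrite ?fine_ge0// => e e0.
  by rewrite -lee_fin EFinD !EFinM -!Qf//; exact: QY.
- move=> a v Sv; have SZv : S (a *: v) by rewrite -[_ *: _]addr0; exact: Slin.
  rewrite !QE// QZ// (Qf _ Sv) -EFinM/= sqrtrM ?sqr_ge0//.
  by rewrite sqrtr_sqr EFinM.
Qed.

Lemma sqr_fine_poweR (x : \bar R) : (0 <= x)%E -> (x < +oo)%E ->
  (fine (x `^ 2^-1)%E) ^+ 2 = fine x.
Proof.
move=> x0 xoo; rewrite -[x]fineK ?ge0_fin_numE//.
by rewrite poweR_EFin/= powR12_sqrt ?fine_ge0// sqr_sqrtr// fine_ge0.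
Qed.

End young_seminorms.

Section bochner_seminorm.
Context {R : realType} {disp : measure_display} {T : measurableType disp}.
Context {V : lmodType R}.
Variables (mu : {measure set T -> \bar R}) (A : set T).
Variables (S : set V) (N : V -> \bar R).
Hypotheses (mA : measurable A) (SN : seminormed S N).
Local Notation n := (nrm N).
Local Notation smeas := (strongly_measurable A S N).

(** Written with the real seminorm [nrm N], so that the integrand is real valued; its square root
    agrees with [bochner_norm] on [S]-valued maps. *)
Definition bochner_sq (f : T -> V) : \bar R :=
  (\int[mu]_(t in A) ((n (f t)) ^+ 2)%:E)%E.

Lemma bochner_sq_ge0 f : (0 <= bochner_sq f)%E.
Proof. by apply: integral_ge0 => t _; rewrite lee_fin sqr_ge0. Qed.

Lemma bochner_normE f : (forall t, A t -> S (f t)) ->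
  bochner_norm mu A N f = (bochner_sq f `^ 2^-1)%E.
Proof.
move=> Sf; congr (_ `^ _)%E; apply: eq_integral => t /set_mem At.
by rewrite (nrmE SN)//; exact: Sf.
Qed.

Lemma measurable_nrm_sq f : smeas f ->
  measurable_fun A (fun t => ((n (f t)) ^+ 2)%:E).
Proof.
move=> hf; apply/measurable_EFinP.
exact: (measurable_funX 2 (measurable_nrm mA SN hf)).
Qed.

Lemma bochnerL2P f : bochnerL2 mu A S N f <-> smeas f /\ (bochner_sq f < +oo)%E.
Proof.
split=> -[hf Nf]; split=> //; have [Sf _] := hf.
  by move: Nf; rewrite bochner_normE//; apply: lty_poweRy; rewrite invr_neq0.
by rewrite bochner_normE//; exact: poweR_lty.
Qed.

Lemma bochner_sq_young e f g : 0 < e -> smeas f -> smeas g ->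
  (bochner_sq (f + g)%R <=
   (1 + e)%:E * bochner_sq f + (1 + e^-1)%:E * bochner_sq g)%E.
Proof.
move=> e0 hf hg; have [Sf _] := hf; have [Sg _] := hg.
have e1 : 0 <= 1 + e by lra.
have e2 : 0 <= 1 + e^-1 by rewrite addr_ge0// invr_ge0 ltW.
rewrite /bochner_sq -!ge0_integralZl_EFin//; first last.
- exact: measurable_nrm_sq.
- by move=> t _; rewrite lee_fin sqr_ge0.
- exact: measurable_nrm_sq.
- by move=> t _; rewrite lee_fin sqr_ge0.
have hfg : smeas (f + g) by rewrite -[f]scale1r; exact: smeas_lin.
rewrite -ge0_integralD//; first last.
- by apply: measurable_funeM; exact: measurable_nrm_sq.
- by move=> t _; rewrite -EFinM lee_fin mulr_ge0// sqr_ge0.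
- by apply: measurable_funeM; exact: measurable_nrm_sq.
- by move=> t _; rewrite -EFinM lee_fin mulr_ge0// sqr_ge0.
apply: ge0_le_integral => //.
- by move=> t _; rewrite lee_fin sqr_ge0.
- exact: measurable_nrm_sq.
- by apply: emeasurable_funD; apply: measurable_funeM; exact: measurable_nrm_sq.
move=> t At; rewrite -!EFinM -EFinD lee_fin.
apply: le_trans (young_sqrD _ _ e0); rewrite ler_sqr ?nnegrE ?(nrm_ge0 SN)//.
  by apply: (nrmD SN); [exact: Sf|exact: Sg].
by rewrite addr_ge0// (nrm_ge0 SN).
Qed.

Lemma bochner_sqZ a f : smeas f ->
  bochner_sq (a *: f) = ((a ^+ 2)%:E * bochner_sq f)%E.
Proof.
move=> hf; have [Sf _] := hf.
rewrite /bochner_sq -ge0_integralZl_EFin ?sqr_ge0//; first last.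
- exact: measurable_nrm_sq.
- by move=> t _; rewrite lee_fin sqr_ge0.
apply: eq_integral => t /set_mem At; rewrite -EFinM.
by rewrite (nrmZ SN _ (Sf t At)) exprMn real_normK// num_real.
Qed.

Lemma bochner_sq_lin a f g : bochnerL2 mu A S N f -> bochnerL2 mu A S N g ->
  (bochner_sq (a *: f + g)%R < +oo)%E.
Proof.
move=> /bochnerL2P[hf fo] /bochnerL2P[hg go].
have haf : smeas (a *: f) by rewrite -[_ *: _]addr0; apply: smeas_lin => //;
  exact: (smeas_cst A SN (seminormed0 SN)).
apply: le_lt_trans (bochner_sq_young ltr01 haf hg) _.
rewrite bochner_sqZ// lte_add_pinfty// !lte_mul_pinfty ?bochner_sq_ge0 ?lee_fin ?sqr_ge0 ?addr_ge0//.
Qed.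

Lemma seminormed_bochner :
  seminormed (bochnerL2 mu A S N) (bochner_norm mu A N).
Proof.
(* The two functionals are known to agree only for [S]-valued maps, so the axioms are proved for
   this one and then transferred. *)
have h : seminormed (bochnerL2 mu A S N) (fun f => (bochner_sq f `^ 2^-1)%E).
  apply: seminormed_sqrt.
  - apply/bochnerL2P; split; first exact: (smeas_cst A SN (seminormed0 SN)).
    rewrite /bochner_sq (eq_integral (cst 0%E)) ?integral0// => t _.
    by rewrite (nrm0 SN) expr0n.
  - move=> a f g hf hg; apply/bochnerL2P; split; last exact: bochner_sq_lin.
    by apply: smeas_lin => //; [case: hf|case: hg].
  - exact: bochner_sq_ge0.
  - by move=> f /bochnerL2P[].
  - by move=> a f [hf _]; exact: bochner_sqZ.
  - by move=> e f g e0 [hf _] [hg _]; exact: bochner_sq_young.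
have E f : bochnerL2 mu A S N f -> bochner_norm mu A N f = (bochner_sq f `^ 2^-1)%E.
  by move=> [[Sf _] _]; exact: bochner_normE.
have Slin := seminormed_lin h; split => //.
- exact: (seminormed0 h).
- by move=> f; exact: poweR_ge0.
- by move=> f hf; rewrite E//; exact: (seminormed_fin h).
- by move=> f g hf hg; rewrite !E//; [exact: (seminormedD h)|exact: (subspD h)].
- by move=> a f hf; rewrite !E//; [exact: (seminormedZ h)|exact: (subspZ h)].
Qed.

Lemma nrm_bochner_sq f : bochnerL2 mu A S N f ->
  bochner_sq f = (nrm (bochner_norm mu A N) f ^+ 2)%:E.
Proof.
move=> /[dup] hf /bochnerL2P[[Sf _] fo].
rewrite /nrm bochner_normE// sqr_fine_poweR ?bochner_sq_ge0//.
by rewrite fineK// ge0_fin_numE ?bochner_sq_ge0.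
Qed.

End bochner_seminorm.

(** * Completeness of Bochner spaces *)

Lemma nneseries_geometric (R : realType) (r : R) : 0 <= r -> r < 1 ->
  (\sum_(0 <= k <oo) (r ^+ k)%:E <= ((1 - r)^-1)%:E)%E.
Proof.
move=> r0 r1; have r1' : 0 < 1 - r by lra.
apply: lime_le.
  by apply: is_cvg_nneseries => k _ _; rewrite lee_fin exprn_ge0.
apply: nearW => m; rewrite sumEFin lee_fin.
suff -> : \sum_(0 <= k < m) r ^+ k = (1 - r ^+ m) / (1 - r).
  rewrite -[leRHS]mul1r ler_pM2r ?invr_gt0// lerBlDr lerDl exprn_ge0//.
elim: m => [|m IH]; first by rewrite big_nil expr0 subrr mul0r.
by rewrite big_nat_recr//= IH exprS; field; lra.
Qed.

Section bochner_complete.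
Context {R : realType} {disp : measure_display} {T : measurableType disp}.
Context {V : lmodType R}.
Variables (mu : {measure set T -> \bar R}) (A : set T).
Variables (S : set V) (N : V -> \bar R).
Hypotheses (mA : measurable A) (SN : seminormed S N).
Local Notation n := (nrm N).
Local Notation smeas := (strongly_measurable A S N).
Local Notation bL2 := (bochnerL2 mu A S N).
Local Notation bN := (bochner_norm mu A N).
Local Notation bsq := (bochner_sq mu A N).

Lemma smeas_restrict B f : measurable B -> smeas f ->
  smeas (fun t => (\1_B t : R) *: f t).
Proof.
move=> mB /(strongly_measurableP _ SN)[Sf [s [hs sf]]].
apply/(strongly_measurableP _ SN); split=> [t At|].
  by apply: (subspZ SN); exact: Sf.
exists (fun k => restrict_simple B (s k)); split=> [k|t At].
  exact: is_simple_restrict.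
have [Bt|Bt] := pselect (B t); last first.
  under eq_fun do rewrite simple_fun_restrict indicE memNset// !scale0r subrr (nrm0 SN).
  exact: cvg_cst.
under eq_fun do rewrite simple_fun_restrict indicE mem_set// !scale1r.
exact: sf.
Qed.

(** The Riesz-Fischer argument. The increments [h k] have squared norms at most [16^-k]; the weights
    [4 ^+ k] keep the sum [W] integrable, and where [W] is finite [h k] is at most [2^-k] times the
    square root of [W], so that completeness of the values applies at rate 1/2. *)
Lemma bochner_complete :
  seminorm_complete S N 2^-1 -> seminorm_complete bL2 bN 4^-1.
Proof.
move=> cS F bF Fr.
have bSN := seminormed_bochner mu mA SN.
have SF k t : A t -> S (F k t) by have [[+ _] _] := bF k; apply.
have hF k : smeas (F k) by have [] := bF k.
have bD k : bL2 (F k.+1 - F k) by exact: (subspB bSN).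
pose h k t := n (F k.+1 t - F k t).
have mh k : measurable_fun A (fun t => ((h k t) ^+ 2)%:E).
  by apply: (@measurable_nrm_sq _ _ _ _ _ _ _ mA SN (F k.+1 - F k)); case: (bD k).
pose w k t : \bar R := ((4 ^+ k)%:E * ((h k t) ^+ 2)%:E)%E.
have mw k : measurable_fun A (w k) by exact: measurable_funeM.
have w0 k t : A t -> (0 <= w k t)%E.
  by move=> _; rewrite /w -EFinM lee_fin mulr_ge0 ?sqr_ge0 ?exprn_ge0.
pose W t := (\sum_(0 <= k <oo) w k t)%E.
have W0 t : A t -> (0 <= W t)%E by move=> At; apply: nneseries_ge0 => k _ _; exact: w0.
have mW : measurable_fun A W by apply: ge0_emeasurable_sum => // k t At _; exact: w0.
have IW : (\int[mu]_(t in A) W t <= 2%:E)%E.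
  rewrite integral_nneseries//.
  have le4 : (\sum_(0 <= k <oo) (4^-1 ^+ k : R)%:E <= 2%:E)%E.
    apply: le_trans (nneseries_geometric _ _) _; [lra|lra|].
    by rewrite lee_fin -[leRHS]invrK lef_pV2 ?posrE//; lra.
  apply: le_trans le4; apply: lee_nneseries => k _.
    by move=> _; apply: integral_ge0 => t; exact: w0.
  rewrite ge0_integralZl_EFin ?exprn_ge0//; last first.
    by move=> t _; rewrite lee_fin sqr_ge0.
  rewrite -[X in (_ * X)%E]/(bsq (F k.+1 - F k)).
  rewrite (nrm_bochner_sq SN (bD k)) -EFinM lee_fin.
  have Fk := Fr k.
  rewrite -ler_sqr ?nnegrE ?exprn_ge0 ?invr_ge0 ?(nrm_ge0 bSN)// in Fk.
  move: Fk => /(ler_wpM2l (exprn_ge0 k (ler0n R 4))) /le_trans; apply.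
  rewrite expr2 mulrA -exprMn divff ?expr1n ?mul1r// gt_eqF//; lra.
pose G := A `&` [set t | (W t < +oo)%E].
have mG : measurable G by exact: emeasurable_fun_infty_o.
have GA : G `<=` A by move=> t [].
have AG : mu (A `\` G) = 0.
  apply/negligibleP; first exact: measurableD.
  have iW : mu.-integrable A W.
    apply/integrableP; split=> //; apply: le_lt_trans (ltry 2).
    by under eq_integral => t /set_mem At do rewrite gee0_abs ?W0//.
  apply: negligibleS (integrable_ae mA iW) => t [At nGt] /= Wt.
  apply: nGt; split => //=; rewrite ltey; apply/eqP => Woo.
  by have := Wt At; rewrite Woo.
have hW k t : G t -> h k t <= Num.sqrt (fine (W t)) * 2^-1 ^+ k.
  move=> [At Wt]; have Wf : W t = (fine (W t))%:E.
    by rewrite fineK// ge0_fin_numE//; exact: W0.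
  have : (w k t <= W t)%E.
    apply: le_trans (nneseries_lim_ge k.+1 (fun i _ _ => w0 i t At)).
    rewrite big_nat_recr//= leeDr// sume_ge0// => i _; exact: w0.
  have : 0 <= fine (W t) by rewrite fine_ge0// W0.
  move: Wf; generalize (fine (W t)) => c -> c0; rewrite /w -EFinM lee_fin => wk.
  rewrite -ler_sqr ?nnegrE ?mulr_ge0 ?sqrtr_ge0 ?exprn_ge0 ?(nrm_ge0 SN)//.
  rewrite exprMn sqr_sqrtr// -exprM mulnC exprM (_ : 2^-1 ^+ 2 = 4^-1 :> R); last by field.
  by rewrite exprVn ler_pdivlMr ?exprn_gt0// mulrC.
(* Off the set [G], which has full measure in [A], the limit is set to 0. This keeps [L] in [S] and
   makes it the limit, everywhere on [A], of the restrictions of [F k] to [G]. *)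
have /choice[L hL] : forall t, exists l, S l /\
    (G t -> (fun k => n (F k t - l)) @ \oo --> 0) /\ (~ G t -> l = 0).
  move=> t; have [Gt|nGt] := pselect (G t); last first.
    by exists 0; split; [exact: (seminormed0 SN)|split].
  have [||l [Sl fl]] := seminorm_completeZ SN (f := F ^~ t) _ cS (sqrtr_ge0 _) _ (fun k => hW k t Gt).
    by rewrite invr_ge0.
  - by move=> k; apply: SF; exact: GA.
  by exists l; split => //; split => // /(_ Gt).
have SL t : S (L t) by have [] := hL t.
have mL : smeas L.
  apply: (smeas_lim mA SN (g := fun k t => (\1_G t : R) *: F k t)) => //.
    by move=> k; exact: smeas_restrict.
  move=> t At; have [_ [h1 h2]] := hL t; have [Gt|nGt] := pselect (G t).
    by under eq_fun do rewrite indicE mem_set// scale1r; exact: h1.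
  under eq_fun do rewrite indicE memNset// scale0r (h2 nGt) subr0 (nrm0 SN).
  exact: cvg_cst.
(* The factor 4 is the square of the geometric sum [(1 - 2^-1)^-1]. *)
have dist k t : G t -> n (F k t - L t) ^+ 2 <= 4 * 4^-1 ^+ k * fine (W t).
  move=> Gt; have At := GA _ Gt.
  have d m : (k <= m)%N ->
      n (F k t - F m t) <= Num.sqrt (fine (W t)) * 2^-1 ^+ k / (1 - 2^-1).
    apply: (geometric_dist SN (f := F ^~ t)); [lra|lra|by move=> j; exact: SF|].
    by move=> j; exact: hW.
  have le : n (F k t - L t) <= Num.sqrt (fine (W t)) * 2^-1 ^+ k * 2.
    have [_ [/(_ Gt) h1 _]] := hL t.
    apply/ler_addgt0Pr => e e0; move/cvgrPdist_lt : h1 => /(_ _ e0)[m _ hm].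
    have := hm (maxn k m) (leq_maxr _ _); rewrite /= sub0r normrN.
    rewrite ger0_norm ?(nrm_ge0 SN)// => lte.
    have := d (maxn k m) (leq_maxl _ _).
    have := nrm_triangle SN (SF k t At) (SF (maxn k m) t At) (SL t).
    rewrite (_ : (1 - 2^-1)^-1 = 2 :> R); last by field.
    by lra.
  rewrite -ler_sqr ?nnegrE ?(nrm_ge0 SN) ?mulr_ge0 ?sqrtr_ge0 ?exprn_ge0// in le.
  apply: le_trans le _; rewrite !exprMn sqr_sqrtr ?fine_ge0 ?W0//.
  rewrite -exprM mulnC exprM (_ : 2^-1 ^+ 2 = 4^-1 :> R); last by field.
  by rewrite le_eqVlt; apply/orP; left; apply/eqP; ring.
have hFL k : smeas (F k - L).
  rewrite (_ : F k - L = (-1) *: L + F k); first exact: smeas_lin.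
  by rewrite scaleN1r addrC.
(* Here 8 is that 4 times the bound 2 on the integral of [W]; its square root is below the 3 used at
   the end. *)
have sqFL k : (bsq (F k - L)%R <= (8 * 4^-1 ^+ k)%:E)%E.
  rewrite /bochner_sq (ge0_negligible_integral _ mA _ _ AG); last 3 first.
  - exact: measurableD.
  - exact: (measurable_nrm_sq mA SN (hFL k)).
  - by move=> t _; rewrite lee_fin sqr_ge0.
  rewrite setDD setIidr//.
  apply: (@le_trans _ _ (\int[mu]_(t in G) ((4 * 4^-1 ^+ k)%:E * W t))%E).
    apply: ge0_le_integral => //.
    - by move=> t _; rewrite lee_fin sqr_ge0.
    - by apply: (measurable_funS mA GA); exact: (measurable_nrm_sq mA SN (hFL k)).
    - by apply: measurable_funeM; exact: (measurable_funS mA GA).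
    move=> t Gt; have [At Wt] := Gt.
    rewrite -[W t]fineK; first by rewrite -EFinM lee_fin; exact: dist.
    by rewrite ge0_fin_numE//; exact: W0.
  have c0 : 0 <= 4 * 4^-1 ^+ k :> R by rewrite mulr_ge0// exprn_ge0.
  rewrite ge0_integralZl_EFin//; last 2 first.
  - by move=> t /GA; exact: W0.
  - exact: (measurable_funS mA GA).
  rewrite (_ : 8 * 4^-1 ^+ k = 4 * 4^-1 ^+ k * 2); last by ring.
  rewrite [leRHS]EFinM; apply: lee_wpmul2l; rewrite ?lee_fin//.
  apply: le_trans IW; exact: ge0_subset_integral.
have bFL k : bL2 (F k - L).
  by apply/(bochnerL2P _ _ SN); split=> //; exact: le_lt_trans (sqFL k) (ltry _).
exists L; split.
  rewrite (_ : L = F 0%N - (F 0%N - L)); first exact: (subspB bSN).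
  by rewrite opprB addrC subrK.
have sq k : nrm bN (F k - L) <= 3 * 2^-1 ^+ k.
  rewrite -ler_sqr ?nnegrE ?(nrm_ge0 bSN) ?mulr_ge0 ?exprn_ge0//.
  rewrite -lee_fin -(nrm_bochner_sq SN (bFL k)); apply: le_trans (sqFL k) _.
  rewrite lee_fin exprMn -exprM mulnC exprM (_ : 2^-1 ^+ 2 = 4^-1 :> R); last by field.
  by rewrite ler_pM2r ?exprn_gt0 ?invr_gt0//; lra.
apply: (@squeeze_cvgr _ _ _ _ (cst 0) (fun k => 3 * 2^-1 ^+ k)).
- by apply: nearW => k; rewrite (nrm_ge0 bSN) sq.
- exact: cvg_cst.
- rewrite -[X in _ --> X](mulr0 3); apply: cvgMr; apply: cvg_expr.
  by rewrite gtr0_norm; lra.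
Qed.

End bochner_complete.

(** * The uniform boundedness principle for seminorms *)

Section uniform_boundedness.
Context {R : realType} {V : lmodType R}.
Variables (S : set V) (N : V -> \bar R).
Hypotheses (SN : seminormed S N) (cS : seminorm_complete S N 4^-1).
Local Notation n := (nrm N).
Variables (p : nat -> V -> R) (C : nat -> R).
Hypotheses (p_ge0 : forall k v, 0 <= p k v).
Hypothesis (pD : forall k v w, S v -> S w -> p k (v + w) <= p k v + p k w).
Hypothesis (pZ : forall k a v, S v -> p k (a *: v) = `|a| * p k v).
Hypothesis (pC : forall k v, S v -> p k v <= C k * n v).
Hypothesis (p_bounded : forall v, S v -> exists B, forall k, p k v <= B).

(* Sokal's proof: of two points [x + y] and [x - y], one has [p]-value at least
   [p y]; following near-maximisers [y] of size [4^-j] yields a limit at which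
   all the [p k] cannot be bounded. *)
Lemma uniform_boundedness :
  exists2 M, 0 <= M & forall k v, S v -> p k v <= M * n v.
Proof.
have S0 := seminormed0 SN.
pose E k := [set p k v | v in [set v | S v /\ n v <= 1]].
have pC1 k v : S v -> n v <= 1 -> p k v <= `|C k|.
  move=> Sv nv; apply: le_trans (pC k Sv) _; have := nrm_ge0 SN v.
  by have := ler_norm (C k); have := normr_ge0 (C k); nra.
have Esup k : has_sup (E k).
  split; first by exists (p k 0); exists 0 => //; split=> //; rewrite (nrm0 SN).
  by exists `|C k| => _ [v [Sv nv] <-]; exact: pC1.
pose P k := sup (E k).
have P0 k : 0 <= P k.
  apply: le_trans (p_ge0 k 0) _; apply: ub_le_sup; first by case: (Esup k).
  by exists 0 => //; split=> //; rewrite (nrm0 SN).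
have pP k v : S v -> p k v <= P k * n v.
  move=> Sv; have := nrm_ge0 SN v; rewrite le_eqVlt => /orP[/eqP nv|nv].
    by have := pC k Sv; rewrite -nv !mulr0.
  have -> : p k v = p k ((n v)^-1 *: v) * n v.
    by rewrite pZ// gtr0_norm ?invr_gt0// mulrAC mulVf ?mul1r// gt_eqF.
  rewrite ler_pM2r//; apply: ub_le_sup; first by case: (Esup k).
  exists ((n v)^-1 *: v) => //; split; first exact: (subspZ SN).
  by rewrite (nrmZ SN)// gtr0_norm ?invr_gt0// mulVf// gt_eqF.
have [[M PM]|noM] := pselect (exists M, forall k, P k <= M).
  exists M => [|k v Sv]; first exact: le_trans (P0 0%N) (PM 0%N).
  by apply: le_trans (pP k v Sv) _; rewrite ler_wpM2r// (nrm_ge0 SN).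
(* The threshold is [3 * 4 ^+ j * (j + 1)]: after multiplication by [4^-j / 3] it still leaves
   [j + 1]. *)
have /choice[kk hkk] : forall j, exists k, 3 * 4 ^+ j * j%:R + 3 * 4 ^+ j < P k.
  move=> j; apply: contrapT => h; apply: noM.
  exists (3 * 4 ^+ j * j%:R + 3 * 4 ^+ j) => k.
  by rewrite leNgt; apply/negP => ?; apply: h; exists k.
have Pgt0 j : 0 < P (kk j).
  by apply: le_lt_trans (hkk j); rewrite addr_ge0// !mulr_ge0// ?exprn_ge0.
have /choice[v hv] : forall j, exists v,
    [/\ S v, n v <= 1 & P (kk j) * (2 / 3) < p (kk j) v].
  move=> j; have e0 : 0 < P (kk j) / 3 by rewrite divr_gt0.
  have [_ [v [Sv nv] <-] pv] := sup_adherent e0 (Esup (kk j)).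
  by exists v; split=> //; apply: le_lt_trans pv; rewrite /P; lra.
have Sv j : S (v j) by case: (hv j).
pose y j := 4^-1 ^+ j *: v j.
have Sy j : S (y j) by exact: (subspZ SN).
(* Since [2 y = (x + y) - (x - y)], at least one of the two signs gives a value not smaller than
   that of [y]. *)
pose step x j := if p (kk j) (y j) <= p (kk j) (x + y j) then x + y j else x - y j.
pose x := fix x j := if j is j'.+1 then step (x j') j' else 0.
have Sx j : S (x j).
  elim: j => //= j IH; rewrite /step; case: ifP => _; first exact: (subspD SN).
  exact: (subspB SN).
have q0 j : 0 <= 4^-1 ^+ j :> R by rewrite exprn_ge0 ?invr_ge0.
have ny j : n (y j) <= 4^-1 ^+ j.
  rewrite (nrmZ SN)// ger0_norm//; case: (hv j) => _ nv _.
  by rewrite -[leRHS]mulr1 ler_wpM2l.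
have xx j : n (x j.+1 - x j) <= 4^-1 ^+ j.
  rewrite /= /step; case: ifP => _; first by rewrite addrC addKr.
  by rewrite addrC addKr (nrmN SN).
have px j : 4^-1 ^+ j * (P (kk j) * (2 / 3)) <= p (kk j) (x j.+1).
  apply: (@le_trans _ _ (p (kk j) (y j))).
    by rewrite pZ// ger0_norm// ler_wpM2l//; case: (hv j) => _ _ /ltW.
  rewrite [x j.+1]/= /step; case: ifPn => //; rewrite -ltNge => lt.
  have : p (kk j) (2 *: y j) <= p (kk j) (x j + y j) + p (kk j) (x j - y j).
    have -> : 2 *: y j = (x j + y j) + (-1) *: (x j - y j).
      by rewrite scaleN1r opprB addrC addrA subrK -[2]/(1 + 1) scalerDl scale1r.
    apply: le_trans (pD _ _ _) _.
    - exact: (subspD SN).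
    - by apply: (subspZ SN); exact: (subspB SN).
    by rewrite pZ ?normrN1 ?mul1r//; exact: (subspB SN).
  by rewrite pZ// ger0_norm//; lra.
have [l [Sl xl]] := cS Sx xx.
have q4 : 0 <= 4^-1 :> R by rewrite invr_ge0.
have dist j : n (x j - l) <= 4^-1 ^+ j * (4 / 3).
  apply/ler_addgt0Pr => e e0; move/cvgrPdist_lt : xl => /(_ _ e0)[m _ hm].
  have := hm (maxn j m) (leq_maxr _ _); rewrite /= sub0r normrN.
  rewrite ger0_norm ?(nrm_ge0 SN)// => lte.
  have := geometric_dist SN (f := x) (C := 1) q4 _ Sx _ (leq_maxl j m).
  rewrite mul1r (_ : (1 - 4^-1)^-1 = 4 / 3 :> R); last by field.
  move=> h; have {h} := h ltac:(lra) ltac:(by move=> k; rewrite mul1r).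
  have := nrm_triangle SN (Sx j) (Sx (maxn j m)) Sl.
  by lra.
have [B hB] := p_bounded Sl.
(* At the limit, the gain [P * 4^-j * 2 / 3] loses at most [P * 4^-j / 3], because the remaining
   steps add up to at most [4^-(j+1) * 4 / 3]; the third that is left is at least [j + 1]. *)
have big j : j%:R + 1 <= B.
  apply: le_trans (hB (kk j)).
  have h1 : p (kk j) (x j.+1) <= p (kk j) l + p (kk j) (x j.+1 - l).
    by rewrite -{1}(subrKC l (x j.+1)); apply: pD => //; exact: (subspB SN).
  have h2 := pP (kk j) _ (subspB SN (Sx j.+1) Sl).
  have h3 : P (kk j) * n (x j.+1 - l) <= P (kk j) * (4^-1 ^+ j / 3).
    rewrite ler_wpM2l//; apply: le_trans (dist _) _.
    by rewrite exprS le_eqVlt; apply/orP; left; apply/eqP; field.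
  have h4 : j%:R + 1 <= P (kk j) * (4^-1 ^+ j / 3).
    have := ltW (hkk j); rewrite -(@ler_pM2r _ (4^-1 ^+ j / 3)); last first.
      by rewrite divr_gt0// exprn_gt0// invr_gt0.
    apply: le_trans; rewrite le_eqVlt; apply/orP; left; apply/eqP.
    rewrite exprVn; field; rewrite expf_neq0//.
  have := px j; lra.
have := truncnS_gt B; have := big (Num.truncn B).
by rewrite -natr1; lra.
Qed.

End uniform_boundedness.

(** * Bochner integrals and bounded forms *)

Section bochner_integral.
Context {R : realType} {disp : measure_display} {T : measurableType disp}.
Context {V : lmodType R}.
Variables (mu : {measure set T -> \bar R}) (A : set T).
Variables (S : set V) (N : V -> \bar R).
Hypotheses (mA : measurable A) (SN : seminormed S N).
Local Notation n := (nrm N).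
Local Notation smeas := (strongly_measurable A S N).

Lemma measurable_nrm_simple_dist f s : smeas f -> is_simple S s ->
  measurable_fun A (fun t => n (simple_fun s t - f t)).
Proof.
move=> hf hs; have [Sf _] := hf.
apply: (measurable_comp_simple (Psi := fun t v => n (v - f t)) SN mA hs) => v Sv.
have := measurable_nrm_dist mA SN hf Sv; apply: eq_measurable_fun => t /set_mem At.
by rewrite (nrm_distC SN)//; exact: Sf.
Qed.

(** Pointwise approximations need not be dominated. Cutting each one off where its norm exceeds
    [2 * n (f t)] makes the errors bounded by [3 * n (f t)], and dominated convergence applies. *)
Lemma simple_L1_approx f : smeas f -> (\int[mu]_(t in A) (n (f t))%:E < +oo)%E ->
  exists s : nat -> seq (set T * V), (forall k, is_simple S (s k)) /\
    ((fun k => \int[mu]_(t in A) (n (simple_fun (s k) t - f t))%:E) @ \oo --> 0)%E.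
Proof.
move=> hf fo; have /(strongly_measurableP _ SN)[Sf [s [hs sf]]] := hf.
pose B k := A `&` [set t | n (simple_fun (s k) t) <= 2 * n (f t)].
have mn k : measurable_fun A (fun t => n (simple_fun (s k) t)).
  apply: (measurable_comp_simple (Psi := fun _ v => n v) SN mA (hs k)) => v _.
  exact: measurable_cst.
have mf := measurable_nrm mA SN hf.
have mB k : measurable (B k).
  have m2 : measurable_fun A (fun t => 2 * n (f t)) by exact: measurable_funM.
  have := measurable_fun_ler (mn k) m2.
  move=> /(_ mA [set true] I).
  by congr measurable; apply/seteqP; split => t [].
pose s' k := restrict_simple (B k) (s k).
have hs' k : is_simple S (s' k) by exact: is_simple_restrict.
have Ss k t : S (simple_fun (s k) t) by exact: (simple_fun_in t SN (hs k)).
have Ss' k t : S (simple_fun (s' k) t) by exact: (simple_fun_in t SN (hs' k)).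
have s'2 k t : A t -> n (simple_fun (s' k) t) <= 2 * n (f t).
  move=> At; rewrite simple_fun_restrict (nrmZ SN)// indicE.
  have [Bt|nBt] := pselect (B k t).
    by rewrite mem_set// normr1 mul1r; case: Bt.
  by rewrite memNset// normr0 mul0r mulr_ge0// (nrm_ge0 SN).
exists s'; split => //.
have -> : 0%E = (\int[mu]_(t in A) (cst 0 t)%:E)%E :> \bar R.
  by rewrite integral0.
apply: (@dominated_cvg _ _ _ _ _ mA _ _ (fun t => (3 * n (f t))%:E)) => //.
- by move=> k; apply/measurable_EFinP; exact: measurable_nrm_simple_dist.
- move=> t At; apply: cvg_EFin; first exact: nearW.
  (* Where [n (f t) = 0] the cut-off forces norm 0. Elsewhere the approximations are eventually
     within [n (f t)] of [f t], hence the cut-off becomes inactive. *)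
  have := nrm_ge0 SN (f t); rewrite le_eqVlt => /orP[/eqP nf0|nf0].
    apply: (@squeeze_cvgr _ _ _ _ (cst 0) (cst 0)); last 2 first.
    - exact: cvg_cst.
    - exact: cvg_cst.
    apply: nearW => k /=; rewrite (nrm_ge0 SN)/=.
    have := s'2 k t At; rewrite -nf0 mulr0 => s0.
    apply: le_trans (nrmB SN (Ss' k t) (Sf t At)) _.
    by rewrite -nf0 addr0.
  apply: cvg_trans (sf t At); apply: near_eq_cvg.
  have /cvgrPdist_lt/(_ _ nf0) := sf t At; apply: filterS => k.
  rewrite sub0r normrN ger0_norm ?(nrm_ge0 SN)// => lt.
  rewrite /= simple_fun_restrict indicE mem_set ?scale1r//; split=> //=.
  have := nrm_triangle SN (Ss k t) (Sf t At) (seminormed0 SN).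
  by rewrite !subr0; lra.
- apply/integrableP; split.
    by apply/measurable_EFinP; exact: measurable_funM.
  rewrite (eq_integral (fun t => (3%:E * (n (f t))%:E)%E)); last first.
    move=> t _; rewrite gee0_abs ?lee_fin ?mulr_ge0 ?(nrm_ge0 SN)//.
  rewrite ge0_integralZl_EFin//; first by rewrite lte_mul_pinfty.
  - by move=> t _; rewrite lee_fin (nrm_ge0 SN).
  - exact/measurable_EFinP.
- move=> k t At; rewrite gee0_abs ?lee_fin ?(nrm_ge0 SN)//.
  apply: le_trans (nrmB SN (Ss' k t) (Sf t At)) _.
  by have := s'2 k t At; lra.
Qed.

Lemma simple_integral_nil (B : set T) : simple_integral (V := V) mu B [::] = 0.
Proof. by rewrite /simple_integral big_nil. Qed.

Lemma simple_integral_cons (B : set T) p (s : seq (set T * V)) :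
  simple_integral mu B (p :: s) =
  fine (mu (B `&` p.1)) *: p.2 + simple_integral mu B s.
Proof. by rewrite /simple_integral big_cons. Qed.

Lemma simple_integral_cat (B : set T) (s1 s2 : seq (set T * V)) :
  simple_integral mu B (s1 ++ s2) =
  simple_integral mu B s1 + simple_integral mu B s2.
Proof. by rewrite /simple_integral big_cat. Qed.

Lemma simple_integral_scale (B : set T) a (s : seq (set T * V)) :
  simple_integral mu B (scale_simple a s) = a *: simple_integral mu B s.
Proof.
rewrite /simple_integral big_map scaler_sumr; apply: eq_bigr => p _ /=.
by rewrite !scalerA mulrC.
Qed.

Lemma measure_splitI (B C : set T) : measurable B -> measurable C ->
  (mu B < +oo)%E ->
  [/\ (mu (B `&` C) < +oo)%E, (mu (B `\` C) < +oo)%E &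
   fine (mu B) = fine (mu (B `&` C)) + fine (mu (B `\` C))].
Proof.
move=> mB mC Bo.
have BC : (mu (B `&` C) < +oo)%E.
  by apply: le_lt_trans Bo; apply: le_measure; rewrite ?inE//; exact: measurableI.
have BD : (mu (B `\` C) < +oo)%E.
  by apply: le_lt_trans Bo; apply: le_measure; rewrite ?inE//; exact: measurableD.
split => //; rewrite -fineD ?ge0_fin_numE//.
rewrite addeC -measureDI//.
Qed.

Lemma nrm_simple_integral_le (s : seq (set T * V)) : is_simple S s ->
  (mu A < +oo)%E ->
  ((n (simple_integral mu A s))%:E <= \int[mu]_(t in A) (n (simple_fun s t))%:E)%E.
Proof.
move=> + Ao.
(* Generalised for the induction, since the sets may overlap: [w] is the sum of the values already
   met, and [B] is the region where exactly those values occur. The next set splits [B] in two. *)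
suff gen B w : measurable B -> (mu B < +oo)%E -> S w -> is_simple S s ->
    ((n (fine (mu B) *: w + simple_integral mu B s))%:E <=
     \int[mu]_(t in B) (n (w + simple_fun s t))%:E)%E.
  move=> hs; have := gen A 0 mA Ao (seminormed0 SN) hs.
  by rewrite scaler0 add0r; under eq_integral do rewrite add0r.
elim: s B w => [|[C v] s IH] B w mB Bo Sw.
  move=> _; rewrite simple_integral_nil addr0 (nrmZ SN)// ger0_norm ?fine_ge0//.
  under eq_integral do rewrite simple_fun_nil addr0.
  by rewrite integral_cst// muleC EFinM fineK// ge0_fin_numE.
move=> /is_simple_cons[/= mC Sv hs]; have [BC BD Bsum] := measure_splitI mB mC Bo.
have mBC : measurable (B `&` C) by exact: measurableI.
have mBD : measurable (B `\` C) by exact: measurableD.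
have split_s : simple_integral mu B s =
    simple_integral mu (B `&` C) s + simple_integral mu (B `\` C) s.
  rewrite /simple_integral -big_split/= !big_seq; apply: eq_bigr => q qs.
  have [mq _] := hs q qs.
  have [BqBC BqBD ->] := measure_splitI (measurableI _ _ mB mq) mC
    (le_lt_trans (le_measure mu (mem_set (measurableI _ _ mB mq)) (mem_set mB) (@subIsetl _ _ _)) Bo).
  by rewrite scalerDl setIAC setIDAC setIDA.
have -> : fine (mu B) *: w + simple_integral mu B ((C, v) :: s) =
    (fine (mu (B `&` C)) *: (w + v) + simple_integral mu (B `&` C) s) +
    (fine (mu (B `\` C)) *: w + simple_integral mu (B `\` C) s).
  rewrite simple_integral_cons/= split_s Bsum scalerDl scalerDr.
  by rewrite [RHS]addrACA -!addrA; congr (_ + _); rewrite addrCA.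
have mn (D : set T) x : measurable D -> S x ->
    measurable_fun D (fun t => n (x + simple_fun s t)).
  move=> mD Sx.
  apply: (measurable_comp_simple (Psi := fun _ y => n (x + y)) SN mD hs) => y _.
  exact: measurable_cst.
have Swv : S (w + v) by exact: (subspD SN).
have SI D x : S x -> S (fine (mu D) *: x + simple_integral mu D s).
  by move=> Sx; apply: (seminormed_lin SN) => //; exact: (simple_integral_in mu D SN hs).
apply: (@le_trans _ _ ((n (fine (mu (B `&` C)) *: (w + v) + simple_integral mu (B `&` C) s))%:E +
    (n (fine (mu (B `\` C)) *: w + simple_integral mu (B `\` C) s))%:E)%E).
  by rewrite -EFinD lee_fin; apply: (nrmD SN); exact: SI.
apply: le_trans (leeD (IH _ _ mBC BC Swv hs) (IH _ _ mBD BD Sw hs)) _.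
rewrite [leRHS](_ : _ = \int[mu]_(t in (B `&` C) `|` (B `\` C))
    (n (w + simple_fun ((C, v) :: s) t))%:E)%E; last by rewrite setUIDK.
rewrite ge0_integral_setU//; last 3 first.
- rewrite setUIDK; apply/measurable_EFinP.
  apply: (measurable_comp_simple (Psi := fun _ y => n (w + y)) SN mB) => [|y _].
    exact/is_simple_cons.
  exact: measurable_cst.
- by move=> t _; rewrite lee_fin (nrm_ge0 SN).
- by rewrite disj_set2E setIDA setIC setIA setICl !set0I eqxx || apply/disj_setPS => t [[_ Ct] []].
apply: leeD; rewrite le_eqVlt; apply/orP; left; apply/eqP;
  apply: eq_integral => t /set_mem[_ Ct].
  by rewrite simple_fun_cons_in// addrA.
by rewrite simple_fun_cons_notin.
Qed.

End bochner_integral.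
Lemma cvge0_small (R : realType) (x : nat -> \bar R) (e : R) :
  x @ \oo --> 0%E -> 0 < e -> \forall k \near \oo, (x k <= e%:E)%E.
Proof.
move=> /fine_cvgP[xfin /cvgrPdist_le x0] e0.
near=> k; have xk : x k \is a fin_num by near: k.
rewrite -(fineK xk) lee_fin.
have : `|0 - (fine \o x) k| <= e by near: k; exact: x0.
by rewrite sub0r normrN => /(le_trans (ler_norm _)).
Unshelve. all: by end_near. Qed.

Section bochner_integral_linear.
Context {R : realType} {disp : measure_display} {T : measurableType disp}.
Context {V : lmodType R}.
Variables (mu : {measure set T -> \bar R}) (A : set T).
Variables (S : set V) (N : V -> \bar R).
Hypotheses (mA : measurable A) (SN : seminormed S N).
Hypothesis (Aoo : (mu A < +oo)%E).
Local Notation n := (nrm N).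
Local Notation smeas := (strongly_measurable A S N).

Definition linear_on (l : V -> R) : Prop :=
  forall a v w, S v -> S w -> l (a *: v + w) = a * l v + l w.

Lemma linear_on0 l : linear_on l -> l 0 = 0.
Proof.
move=> /(_ (-1) 0 0 (seminormed0 SN) (seminormed0 SN)).
by rewrite scaler0 addr0 mulN1r addNr.
Qed.

Lemma linear_onD l v w : linear_on l -> S v -> S w -> l (v + w) = l v + l w.
Proof. by move=> h Sv Sw; rewrite -{1}[v]scale1r h// mul1r. Qed.

Lemma linear_onZ l a v : linear_on l -> S v -> l (a *: v) = a * l v.
Proof.
move=> h Sv; rewrite -[a *: v]addr0 h ?(linear_on0 h) ?addr0//.
exact: (seminormed0 SN).
Qed.

Lemma linear_onB l v w : linear_on l -> S v -> S w -> l (v - w) = l v - l w.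
Proof. by move=> h Sv Sw; rewrite addrC -scaleN1r h// mulN1r addrC. Qed.

Lemma linear_on_simple l s : linear_on l -> is_simple S s ->
  mu.-integrable A (EFin \o (fun t => l (simple_fun s t))) /\
  \int[mu]_(t in A) l (simple_fun s t) = l (simple_integral mu A s).
Proof.
move=> hl; elim: s => [|[C v] s IH].
  move=> _; rewrite simple_integral_nil (linear_on0 hl).
  have E : (fun t : T => l (simple_fun [::] t)) = cst 0.
    by apply/funext => t; rewrite simple_fun_nil (linear_on0 hl).
  by rewrite E Rintegral_cst// mul0r; split=> //; exact: integrable0.
move=> /is_simple_cons[/= mC Sv hs]; have [si sI] := IH hs.
have Ss t : S (simple_fun s t) by exact: (simple_fun_in t SN hs).
have E : (fun t => l (simple_fun ((C, v) :: s) t)) =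
    (fun t => \1_C t * l v + l (simple_fun s t)).
  by apply/funext => t; rewrite simple_fun_cons hl.
have iC : rintegrable mu A (\1_C : T -> R).
  apply: measurable_bounded_integrable => //; exists 1; split=> //.
  by move=> M M1 t _ /=; rewrite indicE; case: (t \in C); rewrite ?normr0 ?normr1; lra.
have iCv := rintegrableZr mA (l v) iC.
rewrite E; split; first exact: (rintegrableD mA).
rewrite RintegralD// sI simple_integral_cons/= hl//; last first.
  exact: (simple_integral_in mu A SN hs).
by congr (_ + _); rewrite RintegralZr//; congr (_ * _);
  rewrite /Rintegral integral_indic// setIC.
Qed.

Lemma L1_bochnerL2 f : smeas f -> (bochner_sq mu A N f < +oo)%E ->
  rintegrable mu A (n \o f).
Proof.
move=> hf fo; have mf := measurable_nrm mA SN hf.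
have i2 : rintegrable mu A (fun t => n (f t) ^+ 2).
  apply: rintegrable_ge0 => //; first exact: measurable_funX.
  by move=> t _; exact: sqr_ge0.
have i1 : rintegrable mu A (cst 1).
  apply: measurable_bounded_integrable => //; exists 1; split=> //.
  by move=> M M1 t _ /=; rewrite normr1; lra.
apply: (rintegrable_le mA mf _ (rintegrableD mA i1 i2)) => t At /=.
by rewrite ger0_norm ?(nrm_ge0 SN)//; nra.
Qed.

Lemma simple_L1_small f e : smeas f -> rintegrable mu A (n \o f) -> 0 < e ->
  exists2 s, is_simple S s &
    (\int[mu]_(t in A) (n (simple_fun s t - f t))%:E <= e%:E)%E.
Proof.
move=> hf fi e0; have fo := rintegrable_ltoo mA fi.
have [s [hs /cvge0_small/(_ e0)[k _ /(_ k (leqnn k)) le]]] := simple_L1_approx mA SN hf fo.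
by exists (s k).
Qed.

Lemma simple_integral_dist s1 s2 f : smeas f -> is_simple S s1 -> is_simple S s2 ->
  ((n (simple_integral mu A s1 - simple_integral mu A s2))%:E <=
   \int[mu]_(t in A) (n (simple_fun s1 t - f t))%:E +
   \int[mu]_(t in A) (n (simple_fun s2 t - f t))%:E)%E.
Proof.
move=> hf h1 h2; have [Sf _] := hf.
have hs : is_simple S (s1 ++ scale_simple (-1) s2).
  by apply: is_simple_cat => // p; exact: (is_simple_scale SN h2).
rewrite -[X in (n X)%:E](_ : simple_integral mu A (s1 ++ scale_simple (-1) s2) = _);
  last by rewrite simple_integral_cat simple_integral_scale scaleN1r.
apply: le_trans (nrm_simple_integral_le mA SN hs Aoo) _.
rewrite -ge0_integralD//; last 4 first.
- by move=> t _; rewrite lee_fin (nrm_ge0 SN).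
- apply/measurable_EFinP; exact: (measurable_nrm_simple_dist mA SN hf h1).
- by move=> t _; rewrite lee_fin (nrm_ge0 SN).
- apply/measurable_EFinP; exact: (measurable_nrm_simple_dist mA SN hf h2).
apply: ge0_le_integral => //.
- by move=> t _; rewrite lee_fin (nrm_ge0 SN).
- apply/measurable_EFinP.
  apply: (measurable_comp_simple (Psi := fun _ y => n y) SN mA hs) => y _.
  exact: measurable_cst.
- apply: emeasurable_funD; apply/measurable_EFinP;
    [exact: (measurable_nrm_simple_dist mA SN hf h1)|exact: (measurable_nrm_simple_dist mA SN hf h2)].
move=> t At; rewrite -EFinD lee_fin simple_fun_cat simple_fun_scale scaleN1r.
have S1 := simple_fun_in t SN h1; have S2 := simple_fun_in t SN h2.
rewrite (nrm_distC SN S2 (Sf t At)).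
exact: (nrm_triangle SN S1 (Sf t At) S2).
Qed.

(** Simple approximations within [r ^+ k / 2] in L1 have integrals with steps at most [r ^+ k], as
    [seminorm_complete] requires. Existence makes the choice by [xget] a genuine integral. *)
Lemma bochner_integral_exists r f : 0 < r -> r < 1 -> seminorm_complete S N r ->
  smeas f -> rintegrable mu A (n \o f) ->
  is_bochner_integral mu A S N f (bochner_integral mu A S N f).
Proof.
move=> r0 r1 cS hf fi; have [Sf _] := hf.
have q0 k : 0 < r ^+ k / 2 by rewrite divr_gt0// exprn_gt0.
have /choice[s hs] : forall k, exists s, is_simple S s /\
    (\int[mu]_(t in A) (n (simple_fun s t - f t))%:E <= (r ^+ k / 2)%:E)%E.
  by move=> k; have [s] := simple_L1_small hf fi (q0 k); exists s.
have Ss k : S (simple_integral mu A (s k)).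
  exact: (simple_integral_in mu A SN (hs k).1).
have [k|I [SI sI]] := cS _ Ss.
  have := simple_integral_dist hf (hs k.+1).1 (hs k).1.
  move=> /le_trans /(_ (leeD (hs k.+1).2 (hs k).2)).
  rewrite -EFinD lee_fin => /le_trans; apply.
  by rewrite exprS; have : 0 <= r ^+ k by [rewrite exprn_ge0// ltW]; nra.
apply: (@xgetPex _ 0 [set I | is_bochner_integral mu A S N f I]); exists I; split => //.
exists s; split => [k||]; first by case: (hs k).
- apply: (@squeeze_cvge _ _ _ _ (cst 0%E) _ (fun k => (r ^+ k / 2)%:E)).
  + apply: nearW => k; rewrite integral_ge0/=; last first.
      by move=> t _; exact: (seminormed_ge0 SN).
    apply: le_trans (hs k).2; rewrite le_eqVlt; apply/orP; left; apply/eqP.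
    apply: eq_integral => t /set_mem At; rewrite (nrmE SN)//.
    by apply: (subspB SN); [exact: (simple_fun_in t SN (hs k).1)|exact: Sf].
  + exact: cvg_cst.
  + apply: cvg_EFin; first exact: nearW.
    rewrite -[X in _ --> X](mul0r 2^-1); apply: cvgMl; apply: cvg_expr.
    by rewrite gtr0_norm.
- exact/(cvg_nrmP SN).
Qed.

(** Any integral [I] is allowed: integrals differ by seminorm 0, which a bounded functional does not
    see. The identity is exact on simple functions, and boundedness controls the error on either
    side. *)
Lemma bochner_integral_linear f I (l : V -> R) C : smeas f ->
  rintegrable mu A (n \o f) -> is_bochner_integral mu A S N f I ->
  linear_on l -> (forall v, S v -> `|l v| <= C * n v) ->
  rintegrable mu A (l \o f) /\ \int[mu]_(t in A) l (f t) = l I.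
Proof.
move=> hf fi [SI [s [hs sf sI]]] hl lC; have [Sf _] := hf.
have C0 : 0 <= `|C| by [].
have lC' v : S v -> `|l v| <= `|C| * n v.
  move=> Sv; apply: le_trans (lC v Sv) _.
  by rewrite ler_wpM2r ?(nrm_ge0 SN)// ler_norm.
have mlf : measurable_fun A (fun t => l (f t)).
  apply: (measurable_smeas (Psi := fun _ v => l v) mA SN hf) => [v _|t g At Sg gf].
    exact: measurable_cst.
  apply/cvgrPdist_le => e e0.
  have e1 : 0 < e / (`|C| + 1) by rewrite divr_gt0//; lra.
  move/cvgrPdist_le : gf => /(_ _ e1); apply: filterS => k.
  rewrite sub0r normrN ger0_norm ?(nrm_ge0 SN)// => gk.
  have St := Sf t At.
  rewrite distrC -linear_onB//; apply: le_trans (lC' _ (subspB SN (Sg k) St)) _.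
  move: gk; rewrite ler_pdivlMr; last lra.
  by have := nrm_ge0 SN (g k - f t); nra.
have lfi : rintegrable mu A (l \o f).
  apply: (rintegrable_le mA mlf _ (rintegrableZl mA `|C| fi)) => t At /=.
  by apply: lC'; exact: Sf.
split => //; apply/eqP; rewrite -subr_eq0 -normr_le0; apply/ler_addgt0Pr => e e0.
(* Two errors of size [|C| * d] then add up to at most [e]; the [+ 1] covers [C = 0]. *)
rewrite add0r; pose d := e / (2 * (`|C| + 1)).
have d0 : 0 < d by rewrite divr_gt0// mulr_gt0//; lra.
have [k [sfk sIk]] : exists k,
    (\int[mu]_(t in A) N (simple_fun (s k) t - f t) <= d%:E)%E /\
    (N (simple_integral mu A (s k) - I)%R <= d%:E)%E.
  have := filterI (cvge0_small sf d0) (cvge0_small sI d0).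
  by move=> [k _ /(_ k (leqnn k))]; exists k.
have [si sE] := linear_on_simple hl (hs k).
have Ss t : S (simple_fun (s k) t) by exact: (simple_fun_in t SN (hs k)).
have SSI : S (simple_integral mu A (s k)) by exact: (simple_integral_in mu A SN (hs k)).
have di := rintegrableB mA lfi si.
have md := measurable_nrm_simple_dist mA SN hf (hs k).
have -> : \int[mu]_(t in A) l (f t) - l I =
    \int[mu]_(t in A) (l (f t) - l (simple_fun (s k) t)) +
    (l (simple_integral mu A (s k)) - l I).
  by rewrite RintegralB// sE addrA subrK.
apply: le_trans (ler_normD _ _) _.
have h1 : `|\int[mu]_(t in A) (l (f t) - l (simple_fun (s k) t))| <= `|C| * d.
  apply: le_trans (le_normr_Rintegral mA di) _.
  rewrite -lee_fin EFin_Rintegral//; last exact: rintegrable_norm.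
  apply: (@le_trans _ _ (\int[mu]_(t in A) (`|C|%:E * (n (simple_fun (s k) t - f t))%:E))%E).
    apply: ge0_le_integral => //.
    - by apply/measurable_EFinP; exact: measurableT_comp (rintegrable_measurable di).
    - by apply: measurable_funeM; exact/measurable_EFinP.
    move=> t At; rewrite -EFinM lee_fin -linear_onB//; last exact: Sf.
    rewrite (nrm_distC SN (Ss t) (Sf t At)); apply: lC'.
    by apply: (subspB SN) => //; exact: Sf.
  rewrite ge0_integralZl_EFin//; last 2 first.
  - by move=> t _; rewrite lee_fin (nrm_ge0 SN).
  - exact/measurable_EFinP.
  rewrite EFinM; apply: lee_wpmul2l; first by rewrite lee_fin.
  apply: le_trans sfk; rewrite le_eqVlt; apply/orP; left; apply/eqP.
  apply: eq_integral => t /set_mem At; rewrite (nrmE SN)//.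
  by apply: (subspB SN) => //; exact: Sf.
have h2 : `|l (simple_integral mu A (s k)) - l I| <= `|C| * d.
  rewrite -linear_onB//; apply: le_trans (lC' _ (subspB SN SSI SI)) _.
  rewrite ler_wpM2l// -lee_fin -(nrmE SN)//; exact: (subspB SN).
apply: le_trans (lerD h1 h2) _.
rewrite /d [leRHS](_ : _ = 2 * (`|C| + 1) * (e / (2 * (`|C| + 1)))); last first.
  by field; rewrite gt_eqF//; lra.
by rewrite -/d; nra.
Qed.

End bochner_integral_linear.
Section bounded_linear.
Context {R : realType} {V : lmodType R}.
Variables (S : set V) (N : V -> \bar R).
Hypotheses (SN : seminormed S N).
Local Notation n := (nrm N).

Lemma linear_on_cvg (l : V -> R) C (g : nat -> V) (v : V) :
  linear_on S l -> (forall w, S w -> `|l w| <= C * n w) ->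
  (forall k, S (g k)) -> S v -> (fun k => n (g k - v)) @ \oo --> 0 ->
  (fun k => l (g k)) @ \oo --> l v.
Proof.
move=> hl lC Sg Sv gv; apply/cvgrPdist_le => e e0.
have e1 : 0 < e / (`|C| + 1) by rewrite divr_gt0// ltr_wpDl.
move/cvgrPdist_le : gv => /(_ _ e1); apply: filterS => k.
rewrite sub0r normrN ger0_norm ?(nrm_ge0 SN)// => gk.
rewrite distrC -(linear_onB hl)//; apply: le_trans (lC _ (subspB SN (Sg k) Sv)) _.
move: gk; rewrite ler_pdivlMr ?ltr_wpDl//.
have := nrm_ge0 SN (g k - v); have := ler_norm C; have := normr_ge0 C.
by nra.
Qed.

End bounded_linear.

Section bilinear.
Context {R : realType} {V1 V2 : lmodType R}.
Variables (S1 : set V1) (N1 : V1 -> \bar R) (S2 : set V2) (N2 : V2 -> \bar R).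
Local Notation n1 := (nrm N1).
Local Notation n2 := (nrm N2).

Record bounded_bilinear (beta : V1 -> V2 -> R) (C : R) : Prop := BoundedBilinear {
  bilinear_l : forall w, S2 w -> linear_on S1 (beta ^~ w);
  bilinear_r : forall v, S1 v -> linear_on S2 (beta v);
  bilinear_bound : forall v w, S1 v -> S2 w -> `|beta v w| <= C * n1 v * n2 w }.

Context {disp : measure_display} {T : measurableType disp}.
Variables (A : set T).
Hypotheses (mA : measurable A) (SN1 : seminormed S1 N1) (SN2 : seminormed S2 N2).

Lemma bilinear_cvg_l beta C (g : nat -> V1) v w : bounded_bilinear beta C ->
  (forall k, S1 (g k)) -> S1 v -> S2 w -> (fun k => n1 (g k - v)) @ \oo --> 0 ->
  (fun k => beta (g k) w) @ \oo --> beta v w.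
Proof.
move=> hb Sg Sv Sw; apply: (linear_on_cvg SN1 (l := beta ^~ w) (C := C * n2 w)) => //.
  exact: (bilinear_l hb).
by move=> y Sy; rewrite mulrAC; exact: (bilinear_bound hb).
Qed.

Lemma bilinear_cvg_r beta C (g : nat -> V2) v w : bounded_bilinear beta C ->
  (forall k, S2 (g k)) -> S1 v -> S2 w -> (fun k => n2 (g k - w)) @ \oo --> 0 ->
  (fun k => beta v (g k)) @ \oo --> beta v w.
Proof.
move=> hb Sg Sv Sw; apply: (linear_on_cvg SN2 (l := beta v) (C := C * n1 v)) => //.
  exact: (bilinear_r hb).
by move=> y Sy; exact: (bilinear_bound hb).
Qed.

Lemma measurable_bilinear beta C f g : bounded_bilinear beta C ->
  strongly_measurable A S1 N1 f -> strongly_measurable A S2 N2 g ->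
  measurable_fun A (fun t => beta (f t) (g t)).
Proof.
move=> hb hf hg; have [Sf _] := hf; have [Sg _] := hg.
apply: (measurable_smeas (Psi := fun t v => beta v (g t)) mA SN1 hf); last first.
  by move=> t h At Sh hft; apply: (bilinear_cvg_l hb); [|exact: Sf|exact: Sg|].
move=> v Sv; apply: (measurable_smeas (Psi := fun t w => beta v w) mA SN2 hg).
  by move=> w Sw; exact: measurable_cst.
by move=> t h At Sh hft; apply: (bilinear_cvg_r hb); [| |exact: Sg|].
Qed.

Lemma rintegrable_bilinear (mu : {measure set T -> \bar R}) beta C f g :
  bounded_bilinear beta C ->
  bochnerL2 mu A S1 N1 f -> bochnerL2 mu A S2 N2 g ->
  rintegrable mu A (fun t => beta (f t) (g t)).
Proof.
move=> hb /(bochnerL2P _ _ SN1)[hf fo] /(bochnerL2P _ _ SN2)[hg go].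
have [Sf _] := hf; have [Sg _] := hg.
have i1 : rintegrable mu A (fun t => n1 (f t) ^+ 2).
  apply: rintegrable_ge0 => //; last by move=> t _; exact: sqr_ge0.
  exact/measurable_EFinP/(measurable_nrm_sq mA SN1).
have i2 : rintegrable mu A (fun t => n2 (g t) ^+ 2).
  apply: rintegrable_ge0 => //; last by move=> t _; exact: sqr_ge0.
  exact/measurable_EFinP/(measurable_nrm_sq mA SN2).
have mb := measurable_bilinear hb hf hg.
apply: (rintegrable_le mA mb _ (rintegrableZl mA `|C| (rintegrableD mA i1 i2))) => t At /=.
apply: le_trans (bilinear_bound hb (Sf t At) (Sg t At)) _.
have := nrm_ge0 SN1 (f t); have := nrm_ge0 SN2 (g t).
rewrite -mulrA => a0 b0; apply: (@le_trans _ _ (`|C| * (n1 (f t) * n2 (g t)))).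
  by rewrite ler_wpM2r ?mulr_ge0// ler_norm.
by rewrite ler_wpM2l//; nra.
Qed.

End bilinear.

Lemma smeas_comp (R : realType) d d' (T : measurableType d) (T' : measurableType d')
    (V : lmodType R) (S : set V) (N : V -> \bar R) (A : set T) (phi : T' -> T) f :
  measurable_fun setT phi -> strongly_measurable A S N f ->
  strongly_measurable (phi @^-1` A) S N (f \o phi).
Proof.
move=> mphi [Sf [s [hs sf]]]; split=> [t At|]; first exact: Sf.
exists (fun k => [seq (phi @^-1` p.1, p.2) | p <- s k]); split.
  move=> k p /mapP[q qs ->]/=; have [mq Sq] := hs k q qs; split => //.
  by rewrite -[X in measurable X]setTI; exact: mphi.
move=> t At; rewrite (_ : (fun k => _) =
  (fun k => N (simple_fun (s k) (phi t) - f (phi t)))); first exact: sf.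
by apply/funext => k; rewrite /simple_fun big_map.
Qed.

Lemma smeas_subset (R : realType) d (T : measurableType d) (V : lmodType R)
    (S : set V) (N : V -> \bar R) (A B : set T) f :
  B `<=` A -> strongly_measurable A S N f -> strongly_measurable B S N f.
Proof.
move=> BA [Sf [s [hs sf]]]; split=> [t /BA|]; first exact: Sf.
by exists s; split=> // t /BA; exact: sf.
Qed.

(** * Positivity of the memory term *)

Section volterra.
Context {R : realType} {disp : measure_display} {T : measurableType disp}.
Variables (mu : {sigma_finite_measure set T -> \bar R}) (A : set T).
Hypotheses (mA : measurable A) (Aoo : (mu A < +oo)%E).
Context {V : lmodType R}.
Variables (S : set V) (N : V -> \bar R) (SN : seminormed S N).
Variables (beta : V -> V -> R) (C r : R) (p : T -> V).
Hypotheses (hb : bounded_bilinear S N S N beta C) (r0 : 0 < r) (r1 : r < 1).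
Hypothesis cS : seminorm_complete S N r.
Hypothesis beta_sym : forall v w, S v -> S w -> beta v w = beta w v.
Hypothesis beta_ge0 : forall v, S v -> 0 <= beta v v.
Hypothesis hp : bochnerL2 mu A S N p.
Variable lt : T -> T -> bool.
Hypothesis mlt : measurable_fun (A `*` A) (fun z => lt z.1 z.2).
Hypothesis lt_total : forall t, A t -> {ae mu, forall s, A s -> lt t s = ~~ lt s t}.
Local Notation n := (nrm N).

Let Sp t : A t -> S (p t). Proof. by move: hp => [[+ _] _]; apply. Qed.

Let n_int : rintegrable mu A (n \o p).
Proof.
by move/(bochnerL2P _ _ SN) : hp => [hq qo]; exact: (L1_bochnerL2 mA SN Aoo hq qo).
Qed.

Let mAA : measurable (A `*` A). Proof. exact: measurableX. Qed.

Let measurable_kernel : measurable_fun (A `*` A) (fun z => beta (p z.1) (p z.2)).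
Proof.
have [hp1 _] := hp.
apply: (measurable_bilinear mAA SN SN hb).
- apply: (@smeas_subset _ _ _ _ _ _ (fst @^-1` A) _ (p \o fst)); first by move=> z [].
  by apply: smeas_comp => //; exact: measurable_fst.
- apply: (@smeas_subset _ _ _ _ _ _ (snd @^-1` A) _ (p \o snd)); first by move=> z [].
  by apply: smeas_comp => //; exact: measurable_snd.
Qed.

Let dominate (z : T * T) : R := `|C| * n (p z.1) * n (p z.2).

Let beta_dominate z : (A `*` A) z -> `|beta (p z.1) (p z.2)| <= dominate z.
Proof.
move=> [A1 A2]; apply: le_trans (bilinear_bound hb (Sp A1) (Sp A2)) _.
by rewrite /dominate -!mulrA ler_wpM2r ?ler_norm// mulr_ge0 ?(nrm_ge0 SN).
Qed.

Let dominate_int : rintegrable (mu \x mu)%E (A `*` A) dominate.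
Proof.
have mn := rintegrable_measurable n_int.
have mn1 : measurable_fun (A `*` A) (fun z => n (p z.1)).
  apply: (@measurable_comp _ _ _ _ _ _ A (n \o p)) => //; first by move=> _ [z [? ?] <-].
  by apply: measurable_funTS; exact: measurable_fst.
have mn2 : measurable_fun (A `*` A) (fun z => n (p z.2)).
  apply: (@measurable_comp _ _ _ _ _ _ A (n \o p)) => //; first by move=> _ [z [? ?] <-].
  by apply: measurable_funTS; exact: measurable_snd.
apply: rintegrable_prod => //.
  by apply: measurable_funM => //; exact: measurable_funM.
pose L := \int[mu]_(s in A) n (p s).
rewrite (eq_integral (fun t => (`|C| * L * n (p t))%:E)); last first.
  move=> t _; rewrite (eq_integral (fun s => (`|C| * n (p t) * n (p s))%:E)); last first.
    move=> s _; rewrite /dominate/= ger0_norm; first by rewrite mulrAC.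
    by rewrite !mulr_ge0 ?(nrm_ge0 SN).
  rewrite -EFin_Rintegral//; last exact: rintegrableZl.
  by rewrite RintegralZl//; congr EFin; rewrite /L mulrAC.
by apply: rintegrable_ltoo => //; exact: rintegrableZl.
Qed.

Let F (s t : T) : R := if lt s t then beta (p s) (p t) else 0.

Let measurable_F : measurable_fun (A `*` A) (fun z => F z.1 z.2).
Proof.
apply: measurable_fun_if => //.
by apply: (measurable_funS mAA) => // z [].
Qed.

Let norm_F s t : `|F s t| <= `|beta (p s) (p t)|.
Proof. by rewrite /F; case: ifP => // _; rewrite normr0. Qed.

Let F_int : rintegrable (mu \x mu)%E (A `*` A) (fun z => F z.1 z.2).
Proof.
apply: (rintegrable_le mAA measurable_F _ dominate_int) => z Az.
exact: le_trans (norm_F _ _) (beta_dominate Az).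
Qed.

Let F'_int : rintegrable (mu \x mu)%E (A `*` A) (fun z => F z.2 z.1).
Proof.
apply: (rintegrable_le mAA _ _ dominate_int) => [|z [A1 A2]].
  apply: (@measurable_comp _ _ _ _ _ _ (A `*` A) (fun z => F z.1 z.2) _
    (fun z : T * T => (z.2, z.1))) => //.
    by move=> _ [z [? ?] <-].
  by apply: measurable_funTS; exact: measurable_swap.
apply: le_trans (norm_F _ _) _; rewrite beta_sym; [|exact: Sp|exact: Sp].
exact: beta_dominate.
Qed.

(** By symmetry of [beta] the triangle carries half of the integral over the square, and the latter
    is [beta I I] with [I] the Bochner integral of [p]. The order is an abstract Boolean relation,
    total up to a null set of [s] for each [t], so that the diagonal can be discarded. *)
Lemma volterra_ge0 :
  rintegrable mu A (fun t => \int[mu]_(s in A) (if lt s t then beta (p s) (p t) else 0)) /\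
  0 <= \int[mu]_(t in A) \int[mu]_(s in A) (if lt s t then beta (p s) (p t) else 0).
Proof.
have [_ Fi FE] := fubini_prod mA mA F_int.
have [_ F'i F'E] := fubini_prod mA mA F'_int.
have FE1 := fubini_prod1 mA mA F_int.
split => //.
have [hp1 hpo] := (bochnerL2P _ _ SN _).1 hp.
have HI := bochner_integral_exists mA SN Aoo r0 r1 cS hp1 n_int.
have [SI _] := HI.
set I := bochner_integral _ _ _ _ _ in SI HI.
have k_int t : A t -> rintegrable mu A (fun s => beta (p s) (p t)) /\
    \int[mu]_(s in A) beta (p s) (p t) = beta I (p t).
  move=> At; apply: (bochner_integral_linear (l := beta ^~ (p t)) (C := C * n (p t)) mA SN Aoo hp1 n_int HI).
    by apply: (bilinear_l hb); exact: Sp.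
  by move=> v Sv; rewrite mulrAC; apply: (bilinear_bound hb) => //; exact: Sp.
have double : 2 * \int[mu]_(t in A) \int[mu]_(s in A) F s t = beta I I.
  have [_ <-] : rintegrable mu A (beta I \o p) /\
      \int[mu]_(t in A) beta I (p t) = beta I I.
    apply: (bochner_integral_linear (C := C * n I) mA SN Aoo hp1 n_int HI).
      exact: (bilinear_r hb).
    by move=> v Sv; exact: (bilinear_bound hb).
  have -> : 2 = 1 + 1 :> R by [].
  (* One of the two copies is integrated in the other order, which exchanges [s] and [t]: the two
     integrands then live on opposite sides of the diagonal. *)
  rewrite mulrDl mul1r -[X in X + _]FE FE1 -RintegralD//.
  apply: eq_Rintegral => t /set_mem At; have [ki <-] := k_int t At.
  have mk := rintegrable_measurable ki.
  have m1 := measurable_section2 mA mA (rintegrable_measurable F_int) At.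
  have m2 := measurable_section2 mA mA (rintegrable_measurable F'_int) At.
  have i1 : rintegrable mu A (fun s => F s t).
    apply: (rintegrable_le mA m1 _ (rintegrable_norm ki)) => s As.
    exact: norm_F.
  have i2 : rintegrable mu A (fun s => F t s).
    apply: (rintegrable_le mA m2 _ (rintegrable_norm ki)) => s As.
    by rewrite beta_sym; [exact: norm_F|exact: Sp|exact: Sp].
  rewrite -RintegralD//; apply: Rintegral_ae => //.
    by apply: measurable_funD.
  apply: filterS (lt_total At) => s tot As; rewrite /F (tot As).
  by case: (lt s t) => /=; rewrite ?addr0 ?add0r// beta_sym//; exact: Sp.
by rewrite -(pmulr_rge0 _ (ltr0Sn R 1)) double; exact: beta_ge0.
Qed.

End volterra.
(** The sets over which [h] integrates to 0 form a Dynkin class, so a generating pi-system decides.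
    Both versions of the fundamental lemma, in space and in time, end with this argument. *)
Lemma pi_system_ae0 (R : realType) d (T : measurableType d)
    (mu : {measure set T -> \bar R}) (D : set T) (h : T -> R) (G : set (set T)) :
  measurable D -> rintegrable mu D h ->
  @measurable d T = <<s G >> -> setI_closed G ->
  \int[mu]_(x in D) h x = 0 ->
  (forall E, G E -> \int[mu]_(x in D `&` E) h x = 0) ->
  {ae mu, forall x, D x -> h x = 0}.
Proof.
move=> mD hi mG GI D0 G0.
have hiE E : measurable E -> E `<=` D -> mu.-integrable E (EFin \o h).
  by move=> mE ED; exact: (integrableS mD mE ED hi).
have all0 E : measurable E -> \int[mu]_(x in D `&` E) h x = 0.
  rewrite mG; apply: (dynkin_induction (P := fun E => \int[mu]_(x in D `&` E) h x = 0) mG GI) => //.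
  - by rewrite setIT.
  - move=> S mS S0; have := @Rintegral_setU _ _ _ mu (D `&` S) (D `\` S) h.
    rewrite setUIDK D0 S0 add0r => /(_ _ _ _ _)/esym; rewrite -setDE; apply.
    + exact: measurableI.
    + exact: measurableD.
    + exact: hi.
    + by apply/disj_setPS => x [[_ ?] []].
  - move=> F mF tF F0; rewrite setI_bigcupr.
    have mDF k : measurable (D `&` F k) by exact: measurableI.
    rewrite /Rintegral integral_bigcup//.
    + rewrite eseries0// => k _ _; have := F0 k; rewrite /Rintegral.
      move=> /eqP; rewrite fine_eq0; first by move/eqP.
      by apply: integrable_fin_num => //; exact: hiE.
    + apply/trivIsetP => i j _ _ ij; rewrite setIACA setIid.
      by move/trivIsetP : tF => /(_ i j I I ij) ->; rewrite setI0.
    + by apply: hiE; [exact: bigcup_measurable|apply: bigcup_sub].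
suff : ae_eq mu D (EFin \o h) (cst 0%E).
  by apply: filterS => x + Dx => /(_ Dx)[].
apply: integral_ae_eq => // E ED mE.
rewrite integral0; have := all0 E mE; rewrite (setIidr ED) /Rintegral => /eqP.
rewrite fine_eq0; first by move/eqP.
by apply: integrable_fin_num => //; exact: hiE.
Qed.

(** * Lebesgue measure and topology of R^n *)

Section row_measure.
Context {R : realType} {d : nat}.
Local Notation X := 'rV[R]_d.

Definition obox (a b : X) : set X :=
  [set x | forall i, a ord0 i < x ord0 i < b ord0 i].

(** Orthants form a pi-system generating the Borel sets, and they cut a box in a box
    ([obox_orthant]), which suits [pi_system_ae0]. *)
Definition orthant (c : X) : set X := [set x | forall i, c ord0 i < x ord0 i].

Lemma measurable_coord_set (i : 'I_d) (Y : set R) : measurable Y ->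
  measurable [set x : X | Y (x ord0 i)].
Proof.
move=> mY; rewrite -[X in measurable X]setTI.
exact: (measurable_row_coord i measurableT mY).
Qed.

Lemma measurable_forall_coord (P : 'I_d -> set R) :
  (forall i, measurable (P i)) -> measurable [set x : X | forall i, P i (x ord0 i)].
Proof.
move=> mP; rewrite (_ : [set x | _] =
  \bigcap_(i in [set: 'I_d]) [set x : X | P i (x ord0 i)]).
  apply: fin_bigcap_measurable => [|i _]; first exact: finite_finset.
  exact: measurable_coord_set.
by apply/seteqP; split => x /= h i => [_|]; [exact: h|exact: (h i I)].
Qed.

Lemma measurable_obox a b : measurable (obox a b).
Proof.
apply: (measurable_forall_coord (P := fun i => `]a ord0 i, b ord0 i[%classic)).
by move=> i; exact: measurable_itv.
Qed.

Lemma measurable_orthant c : measurable (orthant c).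
Proof.
rewrite (_ : orthant c = [set x : X | forall i, `]c ord0 i, +oo[%classic (x ord0 i)]).
  by apply: (measurable_forall_coord (P := fun i => `]c ord0 i, +oo[%classic)) => i;
    exact: measurable_itv.
by apply/seteqP; split => x /= h i; have := h i; rewrite in_itv/= andbT.
Qed.

Lemma orthantI : setI_closed (range orthant).
Proof.
move=> _ _ [a _ <-] [b _ <-].
exists (\row_i Num.max (a ord0 i) (b ord0 i)) => //.
apply/seteqP; split => x /=.
  by move=> h; split => i; have := h i; rewrite mxE gt_max => /andP[].
by move=> [ha hb] i; rewrite mxE gt_max ha hb.
Qed.

End row_measure.

Section orthants_generate.
Context {R : realType} {d : nat}.
Local Notation X := 'rV[R]_d.

Lemma measurable_coord_orthant (i : 'I_d) :
  measurable_fun [set: g_sigma_algebraType (range (@orthant R d))]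
    (fun x : X => x ord0 i).
Proof.
apply: (measurability (@RGenOInfty.G R)); first exact: RGenOInfty.measurableE.
move=> _ [_ [c ->] <-]; rewrite setTI.
(* A half-space is the union of orthants whose other bounds recede to minus infinity. *)
rewrite (_ : _ @^-1` _ = \bigcup_(M : nat)
    orthant (\row_j (if j == i then c else - M%:R))).
  apply: bigcup_measurable => M _; apply: sub_sigma_algebra.
  by exists (\row_j (if j == i then c else - M%:R)).
apply/seteqP; split => x /=.
  rewrite in_itv/= andbT => cx; pose M := \sum_j `|x ord0 j|.
  exists (Num.truncn M).+1 => // j; rewrite mxE; case: eqP => [->//|_].
  rewrite ltrNl; apply: (@le_lt_trans _ _ `|x ord0 j|).
    by rewrite -normrN ler_norm.
  apply: le_lt_trans (truncnS_gt M); rewrite /M (bigD1 j)//= lerDl.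
  by apply: sumr_ge0.
by move=> [M _ /(_ i)]; rewrite mxE eqxx in_itv/= andbT.
Qed.

Lemma row_measurableE : @measurable _ X = <<s range (@orthant R d) >>.
Proof.
apply/seteqP; split; last first.
  apply: smallest_sub; first exact: sigma_algebra_measurable.
  by move=> _ [c _ <-]; exact: measurable_orthant.
apply: smallest_sub; first exact: smallest_sigma_algebra.
suff h (i : 'I_d) : preimage_set_system setT (fun x : X => x ord0 i) (@measurable _ R)
    `<=` <<s range (@orthant R d) >>.
  case: d h => [|d'] h; first by rewrite big_ord0.
  by rewrite -bigcup_mkord_ord; apply: bigcup_sub => i _; exact: h.
by move=> _ [Y mY <-]; exact: (measurable_coord_orthant i measurableT mY).
Qed.

End orthants_generate.

Section row_topology.
Context {R : realType} {d : nat}.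
Local Notation X := 'rV[R]_d.

Definition cbox (a b : X) : set X :=
  [set x | forall i, a ord0 i <= x ord0 i <= b ord0 i].

(** Boxes with rational corners, kept only if the closed box stays in [U]: bump functions of such a
    box are test functions of [U]. *)
Lemma open_box_cover (U : set X) : open U ->
  exists (P : set nat) (a b : nat -> X),
    (forall k, P k -> cbox (a k) (b k) `<=` U) /\
    U = \bigcup_(k in P) obox (a k) (b k).
Proof.
move=> oU.
pose q k : 'rV[rat]_d * 'rV[rat]_d := odflt (0, 0) (unpickle k).
pose a k : X := map_mx ratr (q k).1.
pose b k : X := map_mx ratr (q k).2.
exists [set k | cbox (a k) (b k) `<=` U], a, b; split=> //.
apply/seteqP; split => x; last first.
  by move=> [k kU xk]; apply: kU => i; have /andP[/ltW -> /ltW ->] := xk i.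
move=> Ux; have /nbhs_ballP[e /= e0 eU] := open_nbhs_nbhs (conj oU Ux).
have /choice[f hf] i : exists pq : rat * rat,
    x ord0 i - e < ratr pq.1 < x ord0 i /\ x ord0 i < ratr pq.2 < x ord0 i + e.
  have h1 : x ord0 i - e < x ord0 i by rewrite gtrBl.
  have h2 : x ord0 i < x ord0 i + e by rewrite ltrDl.
  have [p1 p1P] := rat_in_itvoo h1; have [p2 p2P] := rat_in_itvoo h2.
  by exists (p1, p2); move: p1P p2P; rewrite !in_itv.
pose pq : 'rV[rat]_d * 'rV[rat]_d := (\row_i (f i).1, \row_i (f i).2).
have qE : q (pickle pq) = pq by rewrite /q pickleK.
exists (pickle pq) => /=; rewrite /a /b qE/=.
  move=> y hy; apply: eU; split=> // i j; rewrite ord1.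
  have := hy j; rewrite !mxE => /andP[y1 y2].
  have [/andP[h1 h2] /andP[h3 h4]] := hf j.
  by rewrite /ball/= ltr_norml; apply/andP; split; lra.
by move=> i; rewrite !mxE; have [/andP[_ ->] /andP[->]] := hf i.
Qed.

Lemma open_row_measurable (U : set X) : open U -> measurable U.
Proof.
move=> /open_box_cover[P [a [b [_ ->]]]].
by apply: bigcup_measurable => k _; exact: measurable_obox.
Qed.

Lemma continuous_row_measurable (f : X -> R) : continuous f ->
  measurable_fun setT f.
Proof.
move=> cf; apply: (measurability (@RGenOInfty.G R)).
  exact: RGenOInfty.measurableE.
move=> _ [_ [c ->] <-]; rewrite setTI; apply: open_row_measurable.
by apply: open_comp => // x _; exact: cf.
Qed.

End row_topology.

Definition cube {R : realType} (d : nat) (M : R) : set 'rV[R]_d :=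
  [set x | forall i, `|x ord0 i| <= M].
Arguments cube {R} d M.

Lemma measurable_cube (R : realType) d (M : R) : measurable (cube d M).
Proof.
rewrite (_ : cube d M = [set x : 'rV[R]_d | forall i, `[- M, M]%classic (x ord0 i)]).
  by apply: (measurable_forall_coord (P := fun i => `[- M, M]%classic)) => i;
    exact: measurable_itv.
by apply/seteqP; split => x /= h i; have := h i; rewrite in_itv/= ler_norml.
Qed.

Lemma cons_row0 (R : realType) n (p : R * 'rV[R]_n) :
  cons_row p ord0 ord0 = p.1.
Proof. by have := congr1 fst (cons_rowK p). Qed.

Lemma cons_rowS (R : realType) n (p : R * 'rV[R]_n) (i : 'I_n) :
  cons_row p ord0 (lift ord0 i) = p.2 ord0 i.
Proof. by have := congr1 (fun q : R * 'rV[R]_n => q.2 ord0 i) (cons_rowK p); rewrite mxE. Qed.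

Lemma lebesgue_row_cube (R : realType) d (M : R) :
  (lebesgue_row d (cube d M) < +oo)%E.
Proof.
elim: d => [|d IH]; first by rewrite /= diracE ltry.
rewrite /= /lebesgue_step /pushforward.
rewrite (_ : _ @^-1` _ = `[- M, M]%classic `*` cube d M).
  rewrite product_measure1E//; last exact: measurable_cube.
  rewrite lte_mul_pinfty//.
  have itvoo : (@lebesgue_measure R `[(- M)%R, M]%classic < +oo)%E.
    by rewrite lebesgue_measure_itv/=; case: ifPn => // _; rewrite -EFinB ltry.
  by rewrite ge0_fin_numE.
apply/seteqP; split => p /=.
  move=> h; split; first by have := h ord0; rewrite cons_row0 in_itv/= ler_norml.
  by move=> i; have := h (lift ord0 i); rewrite cons_rowS.
move=> [h1 h2] i; case: (unliftP ord0 i) => [j ->|->].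
  by rewrite cons_rowS; exact: h2.
by rewrite cons_row0 ler_norml; move: h1; rewrite /= in_itv.
Qed.

Lemma bounded_set_cube (R : realType) d (D : set 'rV[R]_d) :
  bounded_set D -> exists M, D `<=` cube d M.
Proof.
move=> [M [_ DM]]; exists (M + 1) => x Dx i.
have M1 : M < M + 1 by rewrite ltrDl.
apply: le_trans (DM _ M1 x Dx).
have /mapP[j Hj ->] : `|x ord0 i| \in [seq `|x k.1 k.2| | k : 'I_1 * 'I_d].
  by apply/mapP; exists (ord0, i) => //=; rewrite mem_enum.
by rewrite [leRHS]/Num.norm /= mx_normrE; apply/bigmax_geP; right => /=; exists j.
Qed.

Lemma bounded_set_lty (R : realType) d (D : set 'rV[R]_d) :
  measurable D -> bounded_set D -> (lebesgue_row d D < +oo)%E.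
Proof.
move=> mD /bounded_set_cube[M DM]; apply: le_lt_trans (lebesgue_row_cube d M).
by apply: le_measure; rewrite ?inE//; exact: measurable_cube.
Qed.
(** * Smooth functions and the fundamental lemma *)

Section smooth_algebra.
Context {R : realType} {V : normedModType R}.
Implicit Types f g : V -> R.

Lemma Ck_continuous k f : Ck k f -> continuous f.
Proof. by case: k => [|k] []. Qed.

Lemma Ck_pred k f : Ck k.+1 f -> Ck k f.
Proof.
elim: k f => [|k IH] f /= [cf hf]; split => // v.
by have [df hv] := hf v; split => //; exact: IH.
Qed.

Lemma Ck_cst k (c : R) : Ck k (cst c : V -> R).
Proof.
elim: k c => [|k IH] c; split; try exact: cst_continuous; first by [].
move=> v; split=> [x|]; first exact: derivable_cst.
rewrite (_ : 'D_v (cst c) = cst 0); first exact: IH.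
by apply/funext => x; rewrite derive_cst.
Qed.

Lemma Ck_add k f g : Ck k f -> Ck k g -> Ck k (f + g).
Proof.
elim: k f g => [|k IH] f g [cf hf] [cg hg]; split; try by [].
- by move=> x; apply: continuousD; [exact: cf|exact: cg].
- by move=> x; apply: continuousD; [exact: cf|exact: cg].
move=> v; have [df hfv] := hf v; have [dg hgv] := hg v.
split=> [x|]; first exact: derivableD.
rewrite (_ : 'D_v (f + g) = 'D_v f + 'D_v g); first exact: IH.
by apply/funext => x; rewrite deriveD.
Qed.

Lemma Ck_mul k f g : Ck k f -> Ck k g -> Ck k (f * g).
Proof.
elim: k f g => [|k IH] f g /[dup] Cf [cf hf] /[dup] Cg [cg hg]; split; try by [].
- by move=> x; apply: continuousM; [exact: cf|exact: cg].
- by move=> x; apply: continuousM; [exact: cf|exact: cg].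
move=> v; have [df hfv] := hf v; have [dg hgv] := hg v.
split=> [x|]; first exact: derivableM.
rewrite (_ : 'D_v (f * g) = f * 'D_v g + g * 'D_v f).
  by apply: Ck_add; apply: IH => //; exact: Ck_pred.
by apply/funext => x; rewrite deriveM.
Qed.

Lemma Ck_lin k a f g : Ck k f -> Ck k g -> Ck k (a *: f + g).
Proof.
move=> Cf Cg; rewrite (_ : a *: f = cst a * f)//.
by apply: Ck_add => //; apply: Ck_mul => //; exact: Ck_cst.
Qed.

Lemma smooth_lin a f g : smooth f -> smooth g -> smooth (a *: f + g).
Proof. by move=> sf sg k; apply: Ck_lin. Qed.

Lemma smooth_mul f g : smooth f -> smooth g -> smooth (f * g).
Proof. by move=> sf sg k; apply: Ck_mul. Qed.

Lemma smooth_cst c : smooth (cst c : V -> R).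
Proof. by move=> k; exact: Ck_cst. Qed.

Lemma smooth_prod (I : Type) (r : seq I) (F : I -> V -> R) :
  (forall i, smooth (F i)) -> smooth (fun x => \prod_(i <- r) F i x).
Proof.
move=> sF; elim: r => [|i r IH].
  by rewrite (_ : (fun x => _) = cst 1);
    [exact: smooth_cst|apply/funext => x; rewrite big_nil].
rewrite (_ : (fun x => _) = F i * (fun x => \prod_(j <- r) F j x)).
  exact: smooth_mul.
by apply/funext => x; rewrite big_cons.
Qed.

Lemma is_derive_line f x v df :
  is_derive (0 : R) 1 (fun h => f (h *: v + x)) df -> is_derive x v f df.
Proof.
move=> [ex val].
have E : (fun h : R => h^-1 *: (((fun h => f (h *: v + x)) \o shift 0) (h *: 1) -
    f (0 *: v + x))) = (fun h : R => h^-1 *: ((f \o shift x) (h *: v) - f x)).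
  by apply/funext => h /=; rewrite scale0r add0r addr0 [_ *: 1]mulr1.
by split; [rewrite /derivable -E|rewrite /derive -E].
Qed.

End smooth_algebra.

Section flat_function.
Context {R : realType}.
Implicit Types p : {poly R}.

(* Every derivative of exp(-1/x) is of the form p(1/x) exp(-1/x). *)
Definition flat p (x : R) : R := if 0 < x then p.[x^-1] * expR (- x^-1) else 0.

Lemma horner_expR_bounded p n : exists2 C, 0 <= C &
  forall y, 0 <= y -> `|p.[y]| * y ^+ n * expR (- y) <= C.
Proof.
have base m : exists2 C : R, 0 <= C & forall y, 0 <= y -> y ^+ m * expR (- y) <= C.
  (* The bound comes from raising [y / m <= exp (y / m)] to the power [m]; for [m = 0] it is 1. *)
  exists (m%:R ^+ m) => [|y y0]; first by rewrite exprn_ge0.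
  case: m => [|m].
    by rewrite !expr0 mul1r -expR0 ler_expR oppr_le0.
  have m0 : 0 < m.+1%:R :> R by rewrite ltr0n.
  rewrite expRN ler_pdivrMr ?expR_gt0//.
  have -> : expR y = expR (y / m.+1%:R) ^+ m.+1.
    by rewrite -expRM_natl mulrC divfK// gt_eqF.
  rewrite -exprMn ler_pXn2r ?nnegrE ?mulr_ge0 ?expR_ge0//.
  rewrite mulrC -ler_pdivrMr//; apply: le_trans (expR_ge1Dx _).
  by rewrite lerDr.
elim/poly_ind: p n => [|p c IH] n.
  by exists 0 => // y _; rewrite horner0 normr0 !mul0r.
have [C1 C10 h1] := IH n.+1; have [C2 C20 h2] := base n.
exists (C1 + `|c| * C2) => [|y y0]; first by rewrite addr_ge0// mulr_ge0.
rewrite !hornerE; apply: (@le_trans _ _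
  (`|p.[y]| * y ^+ n.+1 * expR (- y) + `|c| * (y ^+ n * expR (- y)))).
  rewrite exprS !mulrA -!mulrDl ler_wpM2r ?expR_ge0// ler_wpM2r ?exprn_ge0//.
  by apply: le_trans (ler_normD _ _) _; rewrite normrM (ger0_norm y0).
by apply: lerD; [exact: h1|rewrite ler_wpM2l// h2].
Qed.

(** This quadratic bound forces the derivative at 0 to exist and to vanish. *)
Lemma flat_le_sqr p : exists2 C, 0 <= C & forall x, `|flat p x| <= C * x ^+ 2.
Proof.
have [C C0 h] := horner_expR_bounded p 2; exists C => // x; rewrite /flat.
case: ifPn => [x0|_]; last by rewrite normr0 mulr_ge0// sqr_ge0.
have := h x^-1; rewrite invr_ge0 => /(_ (ltW x0)).
rewrite normrM [`|expR _|]ger0_norm ?expR_ge0// mulrAC exprVn.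
by rewrite ler_pdivrMr ?exprn_gt0.
Qed.

(** With [y = 1 / x], the derivative of [p(y) exp(-y)] in [y] is [(p' - p)(y) exp(-y)], and
    [dy/dx = - y^2]. The result is again of the form [flat], which gives smoothness by iteration. *)
Lemma is_derive_flat p (x : R) :
  is_derive x (1 : R) (flat p) (flat ('X^2 * (p - p^`())) x).
Proof.
have [x0|x0|->] := ltgtP x 0.
- rewrite [X in is_derive _ _ _ X]/flat ltNge (ltW x0)/=.
  apply: (near_eq_is_derive _ (is_derive_cst (0 : R) x (1 : R))).
  near=> y; rewrite /flat; case: ifPn => // y0.
  suff : y < 0 by rewrite ltNge (ltW y0).
  by near: y; exact: lt_nbhsl.
- rewrite [X in is_derive _ _ _ X]/flat x0.
  have xn0 : x != 0 by rewrite gt_eqF.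
  have dV : is_derive x (1 : R) (fun y : R => y^-1) (- x ^- 2 *: 1).
    exact: is_deriveV.
  have d1 := is_derive1_comp (is_derive_poly p x^-1) dV.
  have dN : is_derive x (1 : R) (fun y : R => - y^-1) (- (- x ^- 2 *: 1)).
    exact: (is_deriveN dV).
  have d2 := @is_derive1_comp _ expR (fun y => - y^-1) _ _ _
    (is_derive_expR (- x^-1)) dN.
  have := is_deriveM d1 d2.
  set D := (X in is_derive _ _ _ X -> _) => hD.
  have -> : ('X^2 * (p - p^`())).[x^-1] * expR (- x^-1) = D.
    by rewrite /D !hornerE /GRing.scale/=; field.
  apply: (near_eq_is_derive _ hD).
  near=> y; rewrite /flat; case: ifPn => // /negP y0; exfalso; apply: y0.
  by near: y; exact: lt_nbhsr.
- rewrite [X in is_derive _ _ _ X]/flat ltxx.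
  have [C C0 hC] := flat_le_sqr p.
  have cv : h^-1 *: ((flat p \o shift 0) (h *: 1) - flat p 0) @[h --> 0^'] --> (0 : R).
    apply/cvgrPdist_le => e e0.
    have d0 : 0 < e / (C + 1) by rewrite divr_gt0// ltr_wpDl.
    near=> h; rewrite sub0r normrN /= addr0 {2}/flat ltxx subr0.
    have h0 : h != 0 by near: h; exact: nbhs_dnbhs_neq.
    rewrite (_ : h%:A = h); last exact: mulr1.
    rewrite normrZ normfV ler_pdivrMl ?normr_gt0//.
    apply: le_trans (hC h) _; rewrite -real_normK ?num_real// expr2 mulrCA.
    rewrite ler_wpM2l//.
    have : `|h| <= e / (C + 1).
      near: h; apply: dnbhs0_le; exact: d0.
    rewrite ler_pdivlMr ?ltr_wpDl// => he.
    by apply: le_trans he; rewrite mulrC ler_wpM2l// lerDl.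
  split; first by apply/cvg_ex; exists 0.
  exact: cvg_lim.
Unshelve. all: by end_near. Qed.

End flat_function.
Section bump_functions.
Context {R : realType}.

Lemma continuous_flat (p : {poly R}) : continuous (flat p).
Proof.
move=> x; apply: differentiable_continuous; apply/derivable1_diffP.
exact: (@ex_derive _ _ _ _ _ _ _ (is_derive_flat p x)).
Qed.

Lemma Ck_flat_affine (V : normedModType R) k (p : {poly R}) (l : V -> R) c :
  (forall a v w, l (a *: v + w) = a * l v + l w) -> continuous l ->
  Ck k (fun x => flat p (l x + c)).
Proof.
move=> hl cl.
have cont q : continuous (fun x => flat q (l x + c)).
  move=> x; apply: (@continuous_comp _ _ _ (fun x => l x + c) (flat q)).
    by apply: continuousD; [exact: cl|exact: cst_continuous].
  exact: continuous_flat.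
elim: k p => [|k IH] p; split; try by [].
move=> v; have dx x : is_derive x v (fun x => flat p (l x + c))
    (flat ('X^2 * (p - p^`())) (l x + c) * l v).
  apply: is_derive_line.
  have d1 : is_derive (0 : R) (1 : R) (fun h : R => h * l v + (l x + c)) (l v).
    have := is_deriveD (is_deriveM (is_derive_id (0 : R) (1 : R))
      (is_derive_cst (l v : R) (0 : R) (1 : R))) (is_derive_cst (l x + c : R) (0 : R) (1 : R)).
    by rewrite scaler0 add0r addr0 /GRing.scale/= mulr1.
  have d2 : is_derive (0 * l v + (l x + c)) (1 : R) (flat p)
      (flat ('X^2 * (p - p^`())) (l x + c)).
    by rewrite mul0r add0r; exact: is_derive_flat.
  have := @is_derive1_comp _ (flat p) (fun h : R => h * l v + (l x + c)) 0 _ _ d2 d1.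
  rewrite (_ : _ \o _ = (fun h : R => flat p (l (h *: v + x) + c)))//.
  by apply/funext => h /=; rewrite hl addrA.
split=> [x|]; first exact: (@ex_derive _ _ _ _ _ _ _ (dx x)).
rewrite (_ : 'D_v _ = (fun x => flat ('X^2 * (p - p^`())) (l x + c)) * cst (l v)).
  by apply: Ck_mul; [exact: IH|exact: Ck_cst].
by apply/funext => x; rewrite (@derive_val _ _ _ _ _ _ _ (dx x)).
Qed.

(** The height stays at most 1 and [k] only steepens the sides: as [k] grows, the bumps tend to the
    indicator of the open interval. *)
Definition bump (k a b x : R) : R := flat 1 (k * (x - a)) * flat 1 (k * (b - x)).

Lemma flat1E (x : R) : flat 1 x = if 0 < x then expR (- x^-1) else 0.
Proof. by rewrite /flat hornerE mul1r. Qed.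

Lemma flat1_ge0 (x : R) : 0 <= flat 1 x.
Proof. by rewrite flat1E; case: ifP => // _; exact: expR_ge0. Qed.

Lemma flat1_le1 (x : R) : flat 1 x <= 1.
Proof.
rewrite flat1E; case: ifP => // x0.
by rewrite -expR0 ler_expR oppr_le0 invr_ge0 ltW.
Qed.

Lemma bump_ge0 k a b x : 0 <= bump k a b x.
Proof. by rewrite mulr_ge0 ?flat1_ge0. Qed.

Lemma bump_le1 k a b x : bump k a b x <= 1.
Proof. by rewrite mulr_ile1 ?flat1_ge0 ?flat1_le1. Qed.

Lemma bump_neq0 k a b x : 0 < k -> bump k a b x != 0 -> a < x < b.
Proof.
move=> k0; rewrite /bump mulf_eq0 negb_or !flat1E => /andP[].
by case: ifPn; rewrite ?eqxx// pmulr_rgt0// subr_gt0 => -> _;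
  case: ifPn; rewrite ?eqxx// pmulr_rgt0// subr_gt0.
Qed.

Lemma bump_cvg a b x : (fun n => bump n.+1%:R a b x) @ \oo --> (\1_(`]a, b[) x : R).
Proof.
have cv y : 0 < y -> (fun n => flat 1 (n.+1%:R * y)) @ \oo --> (1 : R).
  move=> y0; rewrite (_ : (fun n => _) = (fun n => expR (- y^-1 * n.+1%:R^-1))).
    rewrite -[X in _ --> X]expR0; apply: continuous_cvg; first exact: continuous_expR.
    by rewrite -(mulr0 (- y^-1)); apply: cvgMr; exact: cvg_harmonic.
  by apply/funext => n; rewrite flat1E pmulr_rgt0// y0 invfM mulNr mulrC.
rewrite indicE; have [|xab] := boolP (x \in _).
  rewrite inE/= in_itv/= => /andP[ax xb]; rewrite -[X in _ --> X](mulr1 1).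
  by apply: cvgM; apply: cv; rewrite subr_gt0.
rewrite (_ : (fun n => _) = cst 0); first exact: cvg_cst.
apply/funext => n; apply/eqP; apply: contraT => /(bump_neq0 (ltr0Sn _ _)) h.
by move: xab; rewrite notin_setE/= in_itv/= h.
Qed.

Lemma smooth_bump (V : normedModType R) k a b (l : V -> R) :
  (forall a v w, l (a *: v + w) = a * l v + l w) -> continuous l ->
  smooth (fun x => bump k a b (l x)).
Proof.
move=> hl cl j; rewrite (_ : (fun x => _) =
  (fun x => flat 1 (k * l x + - (k * a))) * (fun x => flat 1 (- k * l x + k * b))).
  apply: Ck_mul; apply: Ck_flat_affine.
  - by move=> c v w; rewrite hl; ring.
  - by move=> x; apply: (@continuousM _ _ (cst k) l); [exact: cst_continuous|exact: cl].
  - by move=> c v w; rewrite hl; ring.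
  - by move=> x; apply: (@continuousM _ _ (cst (- k)) l); [exact: cst_continuous|exact: cl].
by apply/funext => x; rewrite /bump; congr (flat _ _ * flat _ _); ring.
Qed.

Section rows.
Context {d : nat}.
Local Notation X := 'rV[R]_d.

Definition row_bump (k : R) (a b x : X) : R :=
  \prod_i bump k (a ord0 i) (b ord0 i) (x ord0 i).

Lemma smooth_row_bump k a b : smooth (row_bump k a b).
Proof.
apply: smooth_prod => i; apply: smooth_bump => [c v w|].
  by rewrite !mxE.
exact: coord_continuous.
Qed.

Lemma row_bump_ge0 k a b x : 0 <= row_bump k a b x.
Proof. by apply: prodr_ge0 => i _; exact: bump_ge0. Qed.

Lemma row_bump_le1 k a b x : row_bump k a b x <= 1.
Proof.
by apply: prodr_ile1 => i _; rewrite bump_ge0 bump_le1.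
Qed.

Lemma row_bump_neq0 k a b x : 0 < k -> row_bump k a b x != 0 -> obox a b x.
Proof.
by move=> k0 /prodf_neq0 h i; apply: (bump_neq0 k0); exact: h.
Qed.

Lemma row_bump_cvg a b x :
  (fun n => row_bump n.+1%:R a b x) @ \oo --> (\1_(obox a b) x : R).
Proof.
rewrite (_ : \1_(obox a b) x = \prod_i (\1_(`]a ord0 i, b ord0 i[) (x ord0 i) : R)).
  rewrite /row_bump; elim: (index_enum _) => [|i r IH].
    by under eq_fun do rewrite big_nil; rewrite big_nil; exact: cvg_cst.
  under eq_fun do rewrite big_cons; rewrite big_cons.
  by apply: cvgM => //; exact: bump_cvg.
rewrite indicE; have [|xab] := boolP (x \in _).
  rewrite inE => h; rewrite big1// => i _; rewrite indicE mem_set//=.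
  by rewrite in_itv; exact: h.
apply/esym/eqP/prodf_eq0; apply: contrapT => h.
move: xab; rewrite notin_setE; apply => i; apply: contrapT => hi; apply: h.
by exists i => //; rewrite indicE memNset//= in_itv.
Qed.

Lemma compact_cbox (a b : X) : compact (cbox a b).
Proof.
have := @rV_compact R d (fun i => `[a ord0 i, b ord0 i]%classic).
by apply => i; exact: segment_compact.
Qed.

Lemma test_row_bump (D : set X) k a b : 0 < k -> cbox a b `<=` D ->
  test_function D (row_bump k a b).
Proof.
move=> k0 abD; have cb : closed (cbox a b).
  by apply: compact_closed; [exact: norm_hausdorff|exact: compact_cbox].
have sub : closure [set x | row_bump k a b x != 0] `<=` cbox a b.
  rewrite (closure_id (cbox a b)).1//; apply: closure_subset => x /= xn0 i.
  by have /andP[/ltW -> /ltW ->] := row_bump_neq0 k0 xn0 i.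
split; first exact: smooth_row_bump.
- exact: (subclosed_compact (@closed_closure _ _) (@compact_cbox a b) sub).
- exact: subset_trans sub abD.
Qed.

End rows.

End bump_functions.
Lemma Rintegral_indicr (R : realType) d (T : measurableType d)
    (mu : {measure set T -> \bar R}) (A E : set T) (f : T -> R) :
  \int[mu]_(x in A) (f x * \1_E x) = \int[mu]_(x in A `&` E) f x.
Proof.
rewrite Rintegral_mkcondr; apply: eq_Rintegral => x _.
by rewrite patchE indicE; case: (x \in E); rewrite ?mulr1 ?mulr0.
Qed.

(** Turns a statement against test functions into one over a set, by dominated convergence along
    bumps that tend to the indicator of [E]. *)
Lemma Rintegral_bumps_cvg (R : realType) d (T : measurableType d)
    (mu : {measure set T -> \bar R}) (A E : set T) (f : T -> R) (g : nat -> T -> R) :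
  measurable A -> rintegrable mu A f ->
  (forall n, measurable_fun A (g n)) -> (forall n x, 0 <= g n x <= 1) ->
  (forall x, (fun n => g n x) @ \oo --> (\1_E x : R)) ->
  (forall n, \int[mu]_(x in A) (f x * g n x) = 0) ->
  \int[mu]_(x in A `&` E) f x = 0.
Proof.
move=> mA fi mg g01 gE fg0; have mf := rintegrable_measurable fi.
rewrite -Rintegral_indicr /Rintegral.
have fgi n : rintegrable mu A (fun x => f x * g n x).
  apply: (rintegrable_le mA _ _ (rintegrable_norm fi)) => [|x Ax].
    exact: measurable_funM.
  have /andP[g0 g1] := g01 n x.
  by rewrite normrM ler_piMr// ger0_norm.
have := @dominated_cvg _ _ _ mu A mA (fun n x => (f x * g n x)%:E)
  (fun x => (f x * \1_E x)%:E) (fun x => `|f x|%:E).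
have -> : (fun n => \int[mu]_(x in A) (f x * g n x)%:E)%E = cst 0%E.
  by apply/funext => n; rewrite -EFin_Rintegral// fg0.
move=> h; have {h} h0 : cst 0%E x @[x --> \oo] -->
    (\int[mu]_(x in A) (f x * \1_E x)%:E)%E.
  apply: h => //.
  - by move=> n; apply/measurable_EFinP; exact: measurable_funM.
  - move=> x Ax; apply: cvg_EFin; first exact: nearW.
    by apply: cvgMr; exact: gE.
  - exact: rintegrable_norm.
  - move=> n x Ax; rewrite lee_fin; have /andP[g0 g1] := g01 n x.
    by rewrite normrM ler_piMr// ger0_norm.
have := cvg_unique _ (cvg_cst 0%E) h0.
by move=> <-.
Qed.

Lemma obox_orthant (R : realType) d (a b c : 'rV[R]_d) :
  obox a b `&` orthant c = obox (\row_i Num.max (a ord0 i) (c ord0 i)) b.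
Proof.
apply/seteqP; split => x /=.
  move=> [h1 h2] i; have /andP[xa xb] := h1 i.
  by rewrite mxE gt_max xa xb h2.
move=> h; split => i; have := h i; rewrite mxE gt_max => /andP[/andP[? ?] ?] //.
by apply/andP.
Qed.

Lemma subset_cbox (R : realType) d (a a' b : 'rV[R]_d) :
  (forall i, a ord0 i <= a' ord0 i) -> cbox a' b `<=` cbox a b.
Proof.
move=> aa x h i; have /andP[h1 ->] := h i.
by rewrite (le_trans (aa i) h1).
Qed.

Lemma obox_sub_cbox (R : realType) d (a b : 'rV[R]_d) : obox a b `<=` cbox a b.
Proof. by move=> x h i; have /andP[/ltW -> /ltW ->] := h i. Qed.

(** Integrals over boxes whose closure lies in [D] vanish, by bumps. A box cut by an orthant is
    again such a box, so [pi_system_ae0] applies on each box of a countable cover. *)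
Lemma fundamental_lemma (R : realType) d (D : set 'rV[R]_d) (h : 'rV[R]_d -> R) :
  open D -> rintegrable (lebesgue_row d) D h ->
  (forall phi, test_function D phi ->
    \int[lebesgue_row d]_(x in D) (h x * phi x) = 0) ->
  {ae lebesgue_row d, forall x, D x -> h x = 0}.
Proof.
move=> oD hi h0; have mD := open_row_measurable oD.
have box0 a b : cbox a b `<=` D -> \int[lebesgue_row d]_(x in obox a b) h x = 0.
  move=> abD; rewrite -(setIidr (subset_trans (@obox_sub_cbox _ _ a b) abD)).
  apply: (Rintegral_bumps_cvg (g := fun n => row_bump n.+1%:R a b)) => //.
  - move=> n; apply: measurable_funTS; apply: continuous_row_measurable.
    exact: (Ck_continuous (smooth_row_bump n.+1%:R a b 0)).
  - by move=> n x; rewrite row_bump_ge0 row_bump_le1.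
  - by move=> x; exact: row_bump_cvg.
  - by move=> n; apply: h0; exact: test_row_bump.
have [P [a [b [abD ->]]]] := open_box_cover oD.
have aek k : {ae lebesgue_row d, forall x, P k -> obox (a k) (b k) x -> h x = 0}.
  have [Pk|nPk] := pselect (P k); last by apply: aeW.
  have kD := subset_trans (@obox_sub_cbox _ _ (a k) (b k)) (abD k Pk).
  have : {ae lebesgue_row d, forall x, obox (a k) (b k) x -> h x = 0}.
    apply: (pi_system_ae0 (G := range (@orthant R d))).
    - exact: measurable_obox.
    - exact: (integrableS mD (measurable_obox _ _) kD hi).
    - exact: row_measurableE.
    - exact: orthantI.
    - by apply: box0; exact: abD.
    - move=> _ [c _ <-]; rewrite obox_orthant; apply: box0.
      apply: subset_trans (abD k Pk); apply: subset_cbox => i.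
      by rewrite mxE le_max lexx.
  by apply: filterS => x + _.
have := ae_foralln aek; apply: filterS => x hx [k Pk abx].
exact: (hx k Pk abx).
Qed.
(** * Weak derivatives in time *)

Section interval.
Context {R : realType} (T : R).
Local Notation mu := (@lebesgue_measure R).
Local Notation A := (`]0%R, T[%classic).
Implicit Types (h w psi : R -> R).

Lemma measurable_time_itv : measurable (A : set (measurableTypeR R)).
Proof. exact: measurable_itv. Qed.

Lemma time_itv_lty : (mu A < +oo)%E.
Proof. by rewrite lebesgue_measure_itv/=; case: ifPn => // _; rewrite -EFinB ltry. Qed.

Let mA := measurable_time_itv.

Lemma test_bump k a b : 0 < k -> 0 < a -> b < T -> test_function A (bump k a b).
Proof.
move=> k0 a0 bT; have cb : closed (`[a, b]%classic : set R) by exact: itv_closed.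
have sub : closure [set x | bump k a b x != 0] `<=` `[a, b]%classic.
  rewrite (closure_id `[a, b]%classic).1//; apply: closure_subset => x /= xn0.
  by rewrite in_itv/=; have /andP[/ltW -> /ltW ->] := bump_neq0 k0 xn0.
split.
- by apply: (@smooth_bump _ _ k a b id) => // x.
- exact: (subclosed_compact (@closed_closure _ _) (@segment_compact _ a b) sub).
- apply: (subset_trans sub) => x /=; rewrite !in_itv/= => /andP[ax xb].
  by rewrite (lt_le_trans a0 ax) (le_lt_trans xb bT).
Qed.

Lemma continuous_measurable_time (f : R -> R) (B : set (measurableTypeR R)) :
  continuous f -> measurable_fun B f.
Proof. by move=> cf; apply: measurable_funTS; exact: continuous_measurable_fun. Qed.

Lemma smooth_derive1 psi : smooth psi -> continuous (derive1 psi).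
Proof.
move=> /(_ 1%N)[_ /(_ 1)[_ [c _]]].
by rewrite (_ : derive1 psi = 'D_1 psi)//; apply/funext => x; rewrite derive1E.
Qed.

Lemma fundamental_lemma_itv h : rintegrable mu A h ->
  (forall psi, test_function A psi -> \int[mu]_(t in A) (h t * psi t) = 0) ->
  {ae mu, forall t, A t -> h t = 0}.
Proof.
move=> hi h0.
have itv0 a b : 0 < a -> b < T -> \int[mu]_(x in `]a, b[) h x = 0.
  move=> a0 bT; rewrite -[X in Rintegral _ X](_ : A `&` `]a, b[ = _); last first.
    apply: setIidr => x /=; rewrite !in_itv/= => /andP[ax xb].
    by rewrite (lt_trans a0 ax) (lt_trans xb bT).
  apply: (@Rintegral_bumps_cvg R _ (measurableTypeR R) mu A `]a, b[%classic h
    (fun n => bump n.+1%:R a b)) => //.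
  - move=> n; apply: continuous_measurable_time.
    have [sb _ _] := test_bump (ltr0Sn R n) a0 bT.
    exact: (Ck_continuous (sb 0%N)).
  - by move=> n x; rewrite bump_ge0 bump_le1.
  - by move=> x; exact: bump_cvg.
  - by move=> n; apply: h0; exact: test_bump.
(* Exhaustion by intervals trimmed by [1 / (k + 1)] at both ends, inside which bumps are test
   functions. *)
have aek k : {ae mu, forall x, `]k.+1%:R^-1, (T - k.+1%:R^-1)[%classic x -> h x = 0}.
  have k0 : 0 < k.+1%:R^-1 :> R by rewrite invr_gt0.
  have kT : T - k.+1%:R^-1 < T by rewrite gtrBl.
  apply: (@pi_system_ae0 R _ (measurableTypeR R) mu
    `]k.+1%:R^-1, (T - k.+1%:R^-1)[%classic h (@RGenOInfty.G R)).
  - exact: measurable_itv.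
  - apply: (integrableS mA _ _ hi); first exact: measurable_itv.
    move=> x /=; rewrite !in_itv/= => /andP[ax xb].
    by rewrite (lt_trans k0 ax) (lt_trans xb kT).
  - exact: RGenOInfty.measurableE.
  - move=> _ _ [a ->] [b ->]; exists (Num.max a b).
    by apply/seteqP; split => x /=; rewrite !in_itv/= !andbT gt_max => /andP.
  - exact: itv0.
  - move=> _ [c ->].
    rewrite (_ : _ `&` _ = `](Num.max k.+1%:R^-1 c), (T - k.+1%:R^-1)[%classic).
      by apply: itv0 => //; rewrite lt_max k0.
    apply/seteqP; split => x /=; rewrite !in_itv/= !andbT gt_max.
      by move=> [/andP[-> ->] ->].
    by move=> /andP[/andP[-> ->] ->].
have := ae_foralln aek; apply: filterS => x hx /=; rewrite in_itv/= => /andP[x0 xT].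
have m0 : 0 < Num.min x (T - x) by rewrite lt_min x0 subr_gt0.
have [k /ltW kx] : exists k, k.+1%:R^-1 < Num.min x (T - x).
  exists (Num.truncn (Num.min x (T - x))^-1).
  by rewrite invf_plt ?posrE// truncnS_gt.
have k1 : k.+2%:R^-1 < k.+1%:R^-1 :> R by rewrite ltf_pV2 ?posrE// ltr_nat.
apply: (hx k.+1); rewrite /= in_itv/=; move: kx; rewrite le_min => /andP[k2 k3].
rewrite (lt_le_trans k1 k2)/=.
by have := lt_le_trans k1 k3; rewrite !ltrBrDr addrC.
Qed.

(* Subtracting a multiple of one fixed bump makes a test function mean-free, so
   that its primitive is again a test function. *)
Lemma test_primitive (eta : R -> R) a b : smooth eta -> 0 < a -> b < T ->
  (forall t, eta t != 0 -> a <= t <= b) -> \int[mu]_(t in A) eta t = 0 ->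
  exists psi, test_function A psi /\ forall t, derive1 psi t = eta t.
Proof.
move=> seta a0 bT eab I0; have ceta : continuous eta := Ck_continuous (seta 0%N).
pose psi x := \int[mu]_(t in `]-oo, x]) eta t.
have mT : measurable ([set: R] : set (measurableTypeR R)) by exact: measurableT.
have meta := @continuous_measurable_time eta setT ceta.
have ei : rintegrable (mu : {measure set (measurableTypeR R) -> \bar R}) setT eta.
  have iab : mu.-integrable `[a, b] (EFin \o eta).
    apply: continuous_compact_integrable; first exact: segment_compact.
    by apply: continuous_subspaceT.
  have mab : measurable (`[a, b]%classic : set (measurableTypeR R)).
    exact: measurable_itv.
  have := (@integrable_mkcond _ (measurableTypeR R) R mu _ (EFin \o eta) mab).1 iab; apply: eq_integrable => //.
  move=> t _; rewrite patchE; case: ifPn => // tab; apply/esym/eqP.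
  rewrite /= eqe; apply: contraNT tab => /eab h.
  by rewrite inE/= in_itv.
have dpsi x : is_derive x (1 : R) psi (eta x).
  have x1 : x < x + 1 by rewrite ltrDl.
  have iu : mu.-integrable `]-oo, (x + 1)] (EFin \o eta).
    by apply: (integrableS mT _ _ ei) => //; exact: measurable_itv.
  have [|d1 d2] := continuous_FTC1 x1 iu _ (ceta x); first by rewrite ltNyr.
  by split; [exact: d1|rewrite -derive1E; exact: d2].
have dfpsi x : differentiable psi x.
  by apply/derivable1_diffP; exact: (@ex_derive _ _ _ _ _ _ _ (dpsi x)).
have Dpsi v : 'D_v psi = cst v * eta.
  apply/funext => x; rewrite deriveE// -[v in LHS]mulr1 -[v * 1]/(v *: 1) linearZ/=.
  rewrite -deriveE// (@derive_val _ _ _ _ _ _ _ (dpsi x)); exact.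
have psi_l x : x < a -> psi x = 0.
  move=> xa; rewrite /psi /Rintegral integral0_eq// => t /=; rewrite in_itv/= => tx.
  congr EFin; apply/eqP; apply: contraT => /eab/andP[at_ _].
  by have := lt_le_trans xa at_; rewrite ltNge tx.
(* Beyond [b] the primitive equals the whole integral of [eta], which is 0: this is where the mean
   enters. *)
have psi_r x : b < x -> psi x = 0.
  move=> bx; rewrite -I0 /psi Rintegral_mkcond [RHS]Rintegral_mkcond.
  congr Rintegral; apply/funext => t; rewrite !patchE.
  have [->|/eab/andP[at_ tb]] := eqVneq (eta t) 0; first by do 2 case: ifP.
  rewrite !mem_set//= in_itv/=; last exact: le_trans tb (ltW bx).
  by rewrite (lt_le_trans a0 at_) (le_lt_trans tb bT).
have sub : closure [set x | psi x != 0] `<=` `[a, b]%classic.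
  have cb : closed (`[a, b]%classic : set R) by exact: itv_closed.
  rewrite (closure_id `[a, b]%classic).1//; apply: closure_subset => x /= xn0.
  rewrite in_itv/=; apply/andP; split; rewrite leNgt; apply: contraNN xn0.
    by move=> /psi_l ->.
  by move=> /psi_r ->.
exists psi; split; last by move=> t; rewrite derive1E (@derive_val _ _ _ _ _ _ _ (dpsi t)).
split.
- have cpsi : continuous psi by move=> x; exact: differentiable_continuous.
  case=> [|k]; split => // v; split=> [x|]; first exact: diff_derivable.
  by rewrite Dpsi; apply: Ck_mul; [exact: Ck_cst|exact: seta].
- exact: (subclosed_compact (@closed_closure _ _) (@segment_compact _ a b) sub).
- apply: (subset_trans sub) => x /=; rewrite !in_itv/= => /andP[ax xb].
  by rewrite (lt_le_trans a0 ax) (le_lt_trans xb bT).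
Qed.

Lemma test_function_itv_bounds psi : 0 < T -> test_function A psi ->
  exists a b, [/\ 0 < a, a < b, b < T & forall t, psi t != 0 -> a <= t <= b].
Proof.
move=> T0 [_ cp sA].
have sub t : psi t != 0 -> 0 < t < T.
  by move=> tn0; have := sA _ (@subset_closure _ [set x | psi x != 0] t tn0); rewrite /= in_itv.
have [ne|nne] := pselect (exists t, psi t != 0); last first.
  exists (T / 3), (T / 2); split; [lra|lra|lra|].
  by move=> t tn0; exfalso; apply: nne; exists t.
have ne' : closure [set x | psi x != 0] !=set0.
  by have [t tn0] := ne; exists t; exact: subset_closure.
have cid : {within closure [set x | psi x != 0], continuous (@idfun R)}.
  by apply: continuous_subspaceT => x.
have [m mC mP] := compact_EVT_min ne' cp cid.
have [M MC MP] := compact_EVT_max ne' cp cid.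
have m0 : 0 < m < T by have := sA _ (set_mem mC); rewrite /= in_itv.
have M0 : 0 < M < T by have := sA _ (set_mem MC); rewrite /= in_itv.
(* The midpoint of [M] and [T] instead of [M] makes [a < b] strict although only [m <= M] is
   known. *)
exists m, ((M + T) / 2); split; [lra| |lra|].
  have : m <= M by exact: mP.
  lra.
move=> t tn0; have tC : t \in closure [set x | psi x != 0].
  by apply/mem_set; exact: subset_closure.
by have := mP t tC; have := MP t tC; rewrite /idfun => ? ?; apply/andP; split; lra.
Qed.

Lemma test_bounded psi : 0 < T -> test_function A psi ->
  exists C, forall t, `|psi t| <= C.
Proof.
move=> T0 /[dup] /(test_function_itv_bounds T0)[a [b [a0 ab bT pab]]] [spsi _ _].
have cpsi : {within `[a, b], continuous (fun t => `|psi t|)}.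
  apply: continuous_subspaceT => t; apply: continuous_comp; last exact: norm_continuous.
  exact: (Ck_continuous (spsi 0%N)).
have [M _ MP] := EVT_max (ltW ab) cpsi.
exists `|psi M| => t; have [->|/pab tab] := eqVneq (psi t) 0; first by rewrite normr0.
by apply: MP; rewrite in_itv.
Qed.

(** Every test function minus a suitable multiple of one fixed bump [rho] is the derivative of a
    test function. Hence [h] acts on test functions as the constant [C], its weighted mean against
    [rho]. *)
Lemma du_bois_reymond h : 0 < T -> rintegrable mu A h ->
  (forall psi, test_function A psi -> \int[mu]_(t in A) (h t * derive1 psi t) = 0) ->
  exists C, {ae mu, forall t, A t -> h t = C}.
Proof.
move=> T0 hi h0.
have t3 : 0 < T / 3 by lra.
have t23 : 2 * T / 3 < T by lra.
have int_mul (f psi : R -> R) : rintegrable mu A f -> test_function A psi ->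
    rintegrable mu A (fun t => f t * psi t).
  move=> fi tpsi; have [spsi _ _] := tpsi; have [C hC] := test_bounded T0 tpsi.
  have mpsi := @continuous_measurable_time psi A (Ck_continuous (spsi 0%N)).
  have mf := rintegrable_measurable fi.
  apply: (rintegrable_le mA _ _ (rintegrableZl mA C (rintegrable_norm fi))) => [|t _].
    exact: measurable_funM.
  by rewrite normrM mulrC ler_wpM2r.
have int1 : rintegrable mu A (cst 1).
  by apply: measurable_bounded_integrable => //; [exact: time_itv_lty|];
    exists 1; split=> // M M1 t _ /=; rewrite normr1 ltW.
have int_test psi : test_function A psi -> rintegrable mu A psi.
  move=> tpsi; have := int_mul _ _ int1 tpsi.
  by congr rintegrable; apply/funext => t; rewrite mul1r.
(* Some bump has nonzero integral, because the bumps tend to the indicator of an interval of length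
   [T / 3]. *)
have [n I0] : exists n, \int[mu]_(t in A) bump n.+1%:R (T / 3) (2 * T / 3) t != 0.
  apply: contrapT => nI.
  have : \int[mu]_(x in A `&` `](T / 3), (2 * T / 3)[) (cst 1 x : R) = 0.
    apply: (@Rintegral_bumps_cvg R _ (measurableTypeR R) mu A
      `](T / 3), (2 * T / 3)[%classic (cst 1)
      (fun n => bump n.+1%:R (T / 3) (2 * T / 3)) mA int1).
    - move=> k; apply: continuous_measurable_time.
      have [sb _ _] := test_bump (ltr0Sn R k) t3 t23.
      exact: (Ck_continuous (sb 0%N)).
    - by move=> k x; rewrite bump_ge0 bump_le1.
    - by move=> x; exact: bump_cvg.
    - move=> k; apply/eqP; apply: contraT => kn0; exfalso; apply: nI; exists k.
      by move: kn0; under eq_Rintegral do rewrite mul1r.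
  rewrite setIidr; last first.
    move=> x /=; rewrite !in_itv/= => /andP[ax xb].
    by rewrite (lt_trans t3 ax) (lt_trans xb t23).
  rewrite Rintegral_cst; last exact: measurable_itv.
  rewrite mul1r => E0.
  have : fine (mu (`](T / 3)%R, (2 * T / 3)%R[%classic)) = 0 := E0.
  rewrite lebesgue_measure_itv/= lte_fin.
  have -> : T / 3 < 2 * T / 3 by lra.
  by rewrite -EFinB/= => ?; lra.
pose rho := bump n.+1%:R (T / 3) (2 * T / 3).
have trho : test_function A rho := test_bump (ltr0Sn R n) t3 t23.
rewrite -/rho in I0; set I := \int[mu]_(t in A) rho t in I0.
pose C := (\int[mu]_(t in A) (h t * rho t)) / I.
exists C; have hCi : rintegrable mu A (fun t => h t - C).
  by apply: rintegrableB => //; have := rintegrableZl mA C int1;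
    congr rintegrable; apply/funext => t /=; rewrite mulr1.
have : {ae mu, forall t, A t -> h t - C = 0}.
  apply: fundamental_lemma_itv hCi _ => psi tpsi.
  have [a [b [a0 ab bT pab]]] := test_function_itv_bounds T0 tpsi.
  have [a' [b' [a0' ab' bT' pab']]] := test_function_itv_bounds T0 trho.
  pose c := (\int[mu]_(t in A) psi t) / I.
  pose eta := (- c) *: rho + psi.
  have etaE t : eta t = psi t - c * rho t.
    by rewrite -[eta t]/(- c * rho t + psi t) addrC mulNr.
  have seta : smooth eta by case: tpsi => ? _ _; case: trho => ? _ _; exact: smooth_lin.
  have ipsi := int_test _ tpsi; have irho := int_test _ trho.
  have I_eta : \int[mu]_(t in A) eta t = 0.
    under eq_Rintegral do rewrite etaE.
    rewrite RintegralB//; last exact: rintegrableZl.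
    by rewrite RintegralZl// -/I /c divfK// subrr.
  have m0 : 0 < Num.min a a' by rewrite lt_min a0 a0'.
  have mT : Num.max b b' < T by rewrite gt_max bT bT'.
  have eab t : eta t != 0 -> Num.min a a' <= t <= Num.max b b'.
    move=> eta0; have : (psi t != 0) || (rho t != 0).
      rewrite -negb_and; apply: contraNN eta0 => /andP[/eqP p0 /eqP r0].
      by rewrite etaE p0 r0 mulr0 subrr.
    by move=> /orP[/pab|/pab'] /andP[h1 h2]; rewrite ge_min le_max h1 h2 ?orbT.
  have [phi [tphi dphi]] := test_primitive seta m0 mT eab I_eta.
  have := h0 _ tphi; under eq_Rintegral do rewrite dphi etaE mulrBr.
  have i1 := int_mul _ _ hi tpsi; have i2 := int_mul _ _ hi trho.
  rewrite RintegralB//; last first.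
    have := rintegrableZl mA c i2; congr rintegrable.
    by apply/funext => t; rewrite mulrCA.
  have -> : \int[mu]_(t in A) (h t * (c * rho t)) = C * \int[mu]_(t in A) psi t.
    under eq_Rintegral do rewrite mulrCA.
    by rewrite RintegralZl// /c /C; ring.
  move=> hpsi; under eq_Rintegral do rewrite mulrBl.
  rewrite RintegralB//; last exact: rintegrableZl.
  by rewrite RintegralZl.
apply: filterS; first exact: (ae_filter_ringOfSetsType mu).
by move=> t ht At; apply/eqP; rewrite -subr_eq0 ht.
Qed.

Lemma measurable_time_lt :
  measurable_fun ((A : set (measurableTypeR R)) `*` (A : set (measurableTypeR R)))
    (fun z => z.1 < z.2).
Proof.
apply: measurable_fun_ltr; apply: measurable_funTS.
  exact: measurable_fst.
exact: measurable_snd.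
Qed.

(** The fundamental theorem on [[s, T]]; [psi T = 0] because the support lies in the open
    interval. *)
Lemma Rintegral_test_derive psi s : test_function A psi -> A s ->
  \int[mu]_(t in A) (if s < t then derive1 psi t else 0) = - psi s.
Proof.
move=> [spsi _ sA] As; have [s0 sT] : 0 < s /\ s < T by move: As; rewrite /= in_itv/= => /andP.
have T0 := lt_trans s0 sT.
have cpsi : continuous psi := Ck_continuous (spsi 0%N).
have cpsi' := smooth_derive1 spsi.
have dpsi x : derivable psi x 1 by have [_ /(_ 1)[]] := spsi 1%N.
have psiT : psi T = 0.
  apply/eqP; apply: contraT => pT.
  by have := sA _ (@subset_closure _ [set x | psi x != 0] T pT); rewrite /= in_itv/= ltxx andbF.
have E : \int[mu]_(t in A) (if s < t then derive1 psi t else 0) =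
    \int[mu]_(t in `]s, T[) derive1 psi t.
  rewrite Rintegral_mkcond [RHS]Rintegral_mkcond; congr Rintegral.
  apply/funext => t; rewrite !patchE; case: (ltP s t) => st.
    congr (if _ then _ else _); apply/idP/idP; rewrite !inE/= !in_itv/= => /andP[? ->].
      by rewrite st.
    by rewrite (lt_trans s0 st).
  rewrite [X in if X then derive1 _ _ else _]memNset; first by case: ifP.
  by rewrite /= in_itv/= ltNge st.
have ftc := continuous_FTC2 sT (continuous_subspaceT cpsi') (F := psi).
have LR : derivable_oo_LRcontinuous psi s T.
  split; first by move=> x _; exact: dpsi.
    exact: cvg_at_right_filter (cpsi s).
  exact: cvg_at_left_filter (cpsi T).
rewrite E /Rintegral -(@integral_itv_bndoo _ s T _ true false); last first.
  by apply/measurable_EFinP; exact: (@continuous_measurable_time _ `]s, T[%classic cpsi').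
by rewrite (ftc LR (fun _ _ => erefl)) -EFinB/= psiT sub0r.
Qed.

Lemma rintegrable_test_mul (f psi : R -> R) : 0 < T -> rintegrable mu A f ->
  test_function A psi -> rintegrable mu A (fun t => f t * psi t).
Proof.
move=> T0 fi tpsi; have [spsi _ _] := tpsi; have [C hC] := test_bounded T0 tpsi.
have mpsi := @continuous_measurable_time psi A (Ck_continuous (spsi 0%N)).
have mf := rintegrable_measurable fi.
apply: (rintegrable_le mA _ _ (rintegrableZl mA C (rintegrable_norm fi))) => [|t _].
  exact: measurable_funM.
by rewrite normrM mulrC ler_wpM2r.
Qed.

Lemma test_derive1 psi : test_function A psi -> test_function A (derive1 psi).
Proof.
move=> [spsi cp sA].
have cpsi : continuous psi := Ck_continuous (spsi 0%N).
have sub : closure [set x | derive1 psi x != 0] `<=` closure [set x | psi x != 0].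
  rewrite [X in _ `<=` X](closure_id (closure [set x | psi x != 0])).1; last exact: closed_closure.
  apply: closure_subset => x /= dx; apply: contrapT => ncl.
  move/eqP : dx; apply; rewrite derive1E.
  have op : open (~` closure [set x | psi x != 0]) by exact/closed_openC/closed_closure.
  have z : \near x, psi x = cst 0 x.
    have := open_nbhs_nbhs (conj op (ncl : (~` closure [set x | psi x != 0]) x)).
    by apply: filterS => y ny; apply/eqP; apply: contraT => ?; exfalso; apply: ny;
      exact: subset_closure.
  by rewrite (near_eq_derive (1 : R) z) derive_cst.
split.
- move=> k; rewrite (_ : derive1 psi = 'D_1 psi); last by apply/funext => x; rewrite derive1E.
  by have [_ /(_ 1)[]] := spsi k.+1.
- exact: (subclosed_compact (@closed_closure _ _) cp sub).
- exact: subset_trans sub sA.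
Qed.

Let leb2 := ((mu : {sigma_finite_measure set (measurableTypeR R) -> \bar R}) \x
  (mu : {sigma_finite_measure set (measurableTypeR R) -> \bar R}))%E.

(** The explicit primitive [W] of [gam] has weak derivative [gam], by Fubini on the triangle
    [s < t]. Then [w - W] has weak derivative 0 and is constant by [du_bois_reymond]. *)
Lemma weak_derivative_ae w gam : 0 < T -> rintegrable mu A w -> rintegrable mu A gam ->
  (forall psi, test_function A psi ->
    \int[mu]_(t in A) (w t * derive1 psi t) = - \int[mu]_(t in A) (gam t * psi t)) ->
  exists C, {ae mu, forall t, A t ->
    w t = C + \int[mu]_(s in A) (if s < t then gam s else 0)}.
Proof.
move=> T0 wi gi wg.
pose F0 (z : measurableTypeR R * measurableTypeR R) : R := if z.1 < z.2 then gam z.1 else 0.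
have mAA : measurable ((A : set (measurableTypeR R)) `*` (A : set (measurableTypeR R))).
  exact: measurableX.
have mgam1 : measurable_fun ((A : set (measurableTypeR R)) `*` (A : set (measurableTypeR R)))
    (fun z => gam z.1).
  apply: (@measurable_comp _ _ _ _ _ _ (A : set (measurableTypeR R)) gam) => //.
  - by move=> _ [z [? ?] <-].
  - exact: (rintegrable_measurable gi).
  - by apply: measurable_funTS; exact: measurable_fst.
have mF0 : measurable_fun ((A : set (measurableTypeR R)) `*` (A : set (measurableTypeR R))) F0.
  apply: measurable_fun_if => //.
    exact: measurable_time_lt.
  by apply: (measurable_funS mAA) => // z [].
have int1 c : rintegrable mu A (cst c : R -> R).
  apply: measurable_bounded_integrable => //; first exact: time_itv_lty.
  by exists `|c|; split=> // M M1 t _ /=; exact: ltW.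
have dom c : rintegrable leb2 ((A : set (measurableTypeR R)) `*` (A : set (measurableTypeR R)))
    (fun z => c * `|gam z.1|).
  apply: rintegrable_prod => //.
    by apply: measurable_funM => //; exact: measurableT_comp.
  rewrite (eq_integral (cst (\int[mu]_(s in A) `|c * `|gam s| |)%:E)); last first.
    move=> t _; rewrite EFin_Rintegral//.
    by apply: rintegrable_norm => //; apply: rintegrableZl => //; exact: rintegrable_norm.
  by apply: rintegrable_ltoo => //; exact: int1.
have F0i : rintegrable leb2 ((A : set (measurableTypeR R)) `*` (A : set (measurableTypeR R))) F0.
  apply: (rintegrable_le mAA mF0 _ (dom 1)) => z _.
  by rewrite /F0 mul1r; case: ifP => //; rewrite normr0.
pose W t := \int[mu]_(s in A) (if s < t then gam s else 0).
have [_ Wi _] := fubini_prod mA mA F0i.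
rewrite -[X in rintegrable _ _ X]/W in Wi.
suff [C hC] : exists C, {ae mu, forall t, A t -> w t - W t = C}.
  exists C; apply: filterS hC; first exact: (ae_filter_ringOfSetsType mu).
  by move=> t ht At; rewrite -(ht At) -addrA addNr addr0.
apply: du_bois_reymond => //; first exact: rintegrableB.
move=> psi tpsi; have tpsi' := test_derive1 tpsi.
have [C hC] := test_bounded T0 tpsi'.
have i1 := rintegrable_test_mul T0 wi tpsi'.
have i2 := rintegrable_test_mul T0 Wi tpsi'.
under eq_Rintegral do rewrite mulrBl.
rewrite RintegralB// wg//.
pose F1 z := F0 z * derive1 psi z.2.
have [spsi' _ _] := tpsi'.
have F1i : rintegrable leb2 ((A : set (measurableTypeR R)) `*` (A : set (measurableTypeR R))) F1.
  apply: (rintegrable_le mAA _ _ (dom C)) => [|z _].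
    apply: measurable_funM => //.
    apply: (@measurable_comp _ _ _ _ _ _ (A : set (measurableTypeR R)) (derive1 psi)) => //.
    - by move=> _ [z [? ?] <-].
    - exact: continuous_measurable_time (Ck_continuous (spsi' 0%N)).
    - by apply: measurable_funTS; exact: measurable_snd.
  have C0 : 0 <= C := le_trans (normr_ge0 _) (hC 0).
  rewrite normrM mulrC; apply: ler_pM => //.
  by rewrite /F0; case: ifP => //; rewrite normr0.
have [_ _ E1] := fubini_prod mA mA F1i; have E2 := fubini_prod1 mA mA F1i.
have -> : \int[mu]_(t in A) (W t * derive1 psi t) =
    \int[leb2]_(z in (A : set (measurableTypeR R)) `*` (A : set (measurableTypeR R))) F1 z.
  rewrite E1; apply: eq_Rintegral => t /set_mem At.
  rewrite /F1 /F0/= RintegralZr//.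
  apply: (rintegrable_le mA _ _ (rintegrable_norm gi)) => [|s _].
    exact: (measurable_section2 mA mA mF0 At).
  by case: ifP => // _; rewrite normr0.
rewrite E2 -[X in X - _](_ : \int[mu]_(s in A) (gam s * - psi s) = _).
  apply/eqP; rewrite subr_eq0; apply/eqP; apply: eq_Rintegral => s /set_mem As.
  rewrite -(Rintegral_test_derive tpsi As) /F1 /F0/= -RintegralZl//; last first.
    have ms : measurable_fun (A : set (measurableTypeR R)) (fun t : measurableTypeR R => s < t).
      by apply: measurable_fun_ltr => //; exact: measurable_cst.
    apply: (rintegrable_le mA _ _ (int1 C)) => [|t _].
      apply: measurable_fun_if => //.
      by apply: measurable_funTS; exact: (@continuous_measurable_time _ setT (Ck_continuous (spsi' 0%N))).
    case: ifP => // _; rewrite normr0; exact: le_trans (normr_ge0 _) (hC 0).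
  by apply: eq_Rintegral => t _; case: ifP; rewrite ?mul0r ?mulr0.
under eq_Rintegral do rewrite mulrN -mulN1r.
rewrite RintegralZl ?mulN1r//; exact: rintegrable_test_mul.
Qed.

Lemma ae_time_exists (P : R -> Prop) r : 0 < r -> r <= T ->
  {ae mu, forall t, A t -> P t} -> exists t, 0 < t < r /\ P t.
Proof.
move=> r0 rT PA; apply: contrapT => nP.
have : mu.-negligible (`]0%R, r[%classic : set (measurableTypeR R)).
  apply: (negligibleS _ PA) => t /=; rewrite in_itv/= => tr At; apply: nP.
  exists t; split => //; apply: At; rewrite in_itv/=.
  by move/andP : tr => [-> /lt_le_trans -> ].
move/negligibleP => /(_ (measurable_itv _)).
have : mu (`]0%R, r[%classic) = r%:E.
  by rewrite lebesgue_measure_itv/= lte_fin r0 -EFinB subr0.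
move=> E E0; have [re0] : r%:E = 0%E := etrans (esym E) E0.
by move: r0; rewrite re0 ltxx.
Qed.

(** Whichever representative [xget] picks, it agrees almost everywhere with the explicit primitive.
    Points of agreement accumulate at 0, and both functions are right-continuous there. *)
Lemma continuous_rep_initial w gam C : 0 < T -> rintegrable mu A gam ->
  {ae mu, forall t, A t -> w t = C + \int[mu]_(s in A) (if s < t then gam s else 0)} ->
  continuous_rep T w 0 = C.
Proof.
move=> T0 gi wC.
pose gam0 : R -> R := gam \_ A.
have g0T : rintegrable (mu : {measure set (measurableTypeR R) -> \bar R}) setT gam0.
  have := (@integrable_mkcond _ (measurableTypeR R) R mu _ (EFin \o gam) mA).1 gi.
  rewrite /rintegrable; congr (_.-integrable _ _); apply/funext => t /=.
  by rewrite /gam0 !patchE; case: ifP.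
have g0i (i : interval R) : mu.-integrable [set` i] (EFin \o gam0).
  have mi : measurable ([set` i] : set (measurableTypeR R)) by exact: measurable_itv.
  exact: (integrableS (measurableT : measurable (setT : set (measurableTypeR R))) mi _ g0T).
pose W t := C + parameterized_integral mu 0 t gam0.
have W0 : W 0 = C.
  by rewrite /W /parameterized_integral set_itv1 Rintegral_set1 addr0.
have cW : {within `[0, T], continuous W}.
  have c1 := parameterized_integral_continuous (ltW T0) (g0i `[0, T]).
  by move=> t; apply: cvgD; [exact: cvg_cst|exact: c1].
have WE t : A t -> W t = C + \int[mu]_(s in A) (if s < t then gam s else 0).
  move=> At; congr (_ + _); rewrite /parameterized_integral.
  rewrite -(Rintegral_itv_bndo_bndc (g0i `[0, t[)).
  rewrite Rintegral_mkcond [RHS]Rintegral_mkcond; congr Rintegral.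
  apply/funext => s; rewrite /gam0 !patchE.
  move: At; rewrite /= in_itv/= => /andP[t0 tT].
  have [sA|sA] := boolP (s \in A); last by case: ifP.
  move: sA; rewrite inE/= in_itv/= => /andP[s0 sT].
  have [st|ts] := ltP s t; first by rewrite mem_set//= in_itv/= (ltW s0) st.
  by rewrite memNset//= in_itv/= (ltW s0) ltNge ts.
(* Without a continuous representative [continuous_rep] would return [w] itself, whose value at 0 is
   arbitrary. *)
have ex : exists w', {within `[0, T], continuous w'} /\
    {ae mu, forall t, t \in `]0, T[ -> w t = w' t}.
  exists W; split=> //; apply: filterS wC; first exact: (ae_filter_ringOfSetsType mu).
  by move=> t h At; rewrite WE// h.
have := xgetPex w ex; rewrite -/(continuous_rep T w).
set w' := continuous_rep T w => -[cw' ww'].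
have ae0 : {ae mu, forall t, A t -> w' t - W t = 0}.
  apply: filterS2 wC ww'; first exact: (ae_filter_ringOfSetsType mu).
  by move=> t h1 h2 At; rewrite WE// -h1// h2// subrr.
rewrite -W0; apply/eqP; rewrite -subr_eq0; apply: contraT => dn0.
have cd : {within `[0, T], continuous (fun t => w' t - W t)}.
  by move=> t; apply: cvgB; [exact: cw'|exact: cW].
have [_ d0 _] := (continuous_within_itvP _ T0).1 cd.
have e0 : 0 < `|w' 0 - W 0| by rewrite normr_gt0.
move/cvgrPdist_lt : d0 => /(_ _ e0)[r /= r0 hr].
have m0 : 0 < Num.min r T by rewrite lt_min r0 T0.
have mT : Num.min r T <= T by rewrite ge_min lexx orbT.
have [t [/andP[t0 tm] wt]] := ae_time_exists m0 mT ae0.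
have tr : t < r by move: tm; rewrite lt_min => /andP[].
have := hr t; rewrite /= sub0r normrN gtr0_norm// => /(_ tr t0).
by rewrite wt subr0 ltxx.
Qed.

End interval.

(** * Change of rate, and the scalar case *)

Section rate_change.
Context {R : realType} {V : lmodType R}.
Variables (S : set V) (N : V -> \bar R).
Hypothesis SN : seminormed S N.
Local Notation n := (nrm N).

(** Keeping only the indices [m * k], with [r' ^+ m <= r], turns the rate [r'] into [r]; the omitted
    terms are controlled by the geometric tail. *)
Lemma seminorm_complete_rate r r' : 0 < r -> 0 <= r' -> r' < 1 ->
  seminorm_complete S N r -> seminorm_complete S N r'.
Proof.
move=> r0 r'0 r'1 cS f Sf fr.
have dist k m : (k <= m)%N -> n (f k - f m) <= r' ^+ k / (1 - r').
  move=> km; have := geometric_dist SN (f := f) (C := 1) r'0 r'1 Sf _ km.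
  by rewrite mul1r; apply => j; rewrite mul1r.
have cv : (fun m => r' ^+ m) @ \oo --> (0 : R) by apply: cvg_expr; rewrite ger0_norm.
have [m r'm m0] : exists2 m, r' ^+ m <= r & (0 < m)%N.
  move/cvgrPdist_le : cv => /(_ _ r0)[m _ hm].
  exists m.+1 => //; have := hm m.+1 (leqnSn _); rewrite /= sub0r normrN.
  by rewrite ger0_norm// exprn_ge0.
have C0 : 0 <= (1 - r')^-1 by rewrite invr_ge0; lra.
have [||k|l [Sl fl]] := @seminorm_completeZ _ _ S N SN r (1 - r')^-1 (fun k => f (m * k)%N) (ltW r0) cS.
- by [].
- by [].
- rewrite (nrm_distC SN)//.
  apply: le_trans (dist (m * k)%N (m * k.+1)%N _) _; first by rewrite leq_mul2l leqnSn orbT.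
  rewrite mulrC ler_wpM2l// exprM lerXn2r// nnegrE ?exprn_ge0//.
  exact: ltW.
exists l; split => //.
apply: (@squeeze_cvgr _ _ _ _ (cst 0) (fun k => r' ^+ k / (1 - r') + n (f (m * k)%N - l))).
- apply: nearW => k; rewrite (nrm_ge0 SN)/=.
  apply: le_trans (nrm_triangle SN (Sf k) (Sf (m * k)%N) Sl) _.
  by rewrite lerD2r dist// leq_pmull.
- exact: cvg_cst.
- rewrite -[X in _ --> X]addr0; apply: cvgD => //.
  by rewrite -(mul0r (1 - r')^-1); apply: cvgMl.
Qed.

End rate_change.

Section real_seminorm.
Context {R : realType}.

(** The scalars as a complete seminormed space: square-integrable functions become a Bochner space
    and inherit its completeness. *)
Definition abs_norm (x : R^o) : \bar R := (`|x|)%:E.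

Lemma seminormed_abs : seminormed setT abs_norm.
Proof.
split=> //.
- by move=> v; rewrite lee_fin.
- by move=> v w _ _; rewrite -EFinD lee_fin ler_normD.
- by move=> a v _; rewrite -EFinM /abs_norm normrM.
Qed.

Lemma abs_complete : seminorm_complete setT abs_norm 2^-1.
Proof.
move=> f _ fr.
have dist k m : (k <= m)%N -> `|f k - f m| <= 2 * 2^-1 ^+ k.
  move=> km; have := geometric_dist seminormed_abs (f := f) (C := 1) (r := 2^-1) _ _ _ _ km.
  rewrite /nrm/= mul1r (_ : (1 - 2^-1)^-1 = 2 :> R); last by field.
  rewrite mulrC; apply; [lra|lra|by []|by move=> j; rewrite mul1r; exact: fr].
have cv : (fun m => 2 * 2^-1 ^+ m) @ \oo --> (0 : R).
  rewrite -(mulr0 2); apply: cvgMr; apply: cvg_expr.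
  by rewrite gtr0_norm; lra.
have : cvgn f.
  apply/cauchy_cvgP/cauchy_exP => e e0.
  move/cvgrPdist_lt : cv => /(_ _ e0)[m _ hm].
  exists (f m), m => // k /= mk.
  apply: le_lt_trans (dist m k mk) _; have := hm m (leqnn m).
  by rewrite /= sub0r normrN ger0_norm// mulr_ge0// exprn_ge0.
move=> /cvg_ex[/= l fl]; exists l; split => //.
rewrite /nrm/=; apply/cvgrPdist_le => e e0; move/cvgrPdist_le : fl => /(_ _ e0).
by apply: filterS => k; rewrite sub0r normrN normr_id distrC.
Qed.

Context {disp : measure_display} {T : measurableType disp}.
Variables (mu : {measure set T -> \bar R}) (A : set T).
Hypothesis mA : measurable A.

Lemma smeas_real (f : T -> R) :
  strongly_measurable A setT abs_norm (f : T -> R^o) <-> measurable_fun A f.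
Proof.
split=> [hf|mf].
  apply: (measurable_smeas (Psi := fun _ v => v : R) mA seminormed_abs hf) => [v _|t g At _ gf].
    exact: measurable_cst.
  apply/cvgrPdist_le => e e0; move/cvgrPdist_le : gf => /(_ _ e0).
  by apply: filterS => k; rewrite /nrm/= sub0r normrN normr_id distrC.
apply: (smeas_separable mA seminormed_abs (e := fun k => ratr (odflt 0 (unpickle k)) : R)) => //.
  move=> v _; rewrite /nrm/=; apply: measurableT_comp => //.
  by apply: measurable_funB => //; exact: measurable_cst.
move=> t At r r0; have h : f t - r < f t by rewrite gtrBl.
have [q] := rat_in_itvoo h; rewrite in_itv/= => /andP[q1 q2].
exists (pickle q); rewrite pickleK/= /nrm/=.
by rewrite gtr0_norm ?subr_gt0// ltrBlDl -ltrBlDr.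
Qed.

End real_seminorm.

(** * Square-integrable functions *)

Section square_integrable.
Context {R : realType} {disp : measure_display} {T : measurableType disp}.
Variables (mu : {measure set T -> \bar R}) (A : set T).
Hypothesis mA : measurable A.
Implicit Types q r : T -> R.

Definition sqint q : Prop :=
  measurable_fun A q /\ (\int[mu]_(x in A) ((q x) ^+ 2)%:E < +oo)%E.

Definition sqi q : R := \int[mu]_(x in A) (q x) ^+ 2.

Lemma sqint_rintegrable q : sqint q -> rintegrable mu A (fun x => q x ^+ 2).
Proof.
move=> [mq qoo]; apply: rintegrable_ge0 => //; first exact: measurable_funX.
by move=> x _; exact: sqr_ge0.
Qed.

Lemma sqi_ge0 q : 0 <= sqi q.
Proof. by apply: Rintegral_ge0 => x _; exact: sqr_ge0. Qed.

Lemma sqiE q : sqint q -> (\int[mu]_(x in A) ((q x) ^+ 2)%:E)%E = (sqi q)%:E.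
Proof. by move=> /sqint_rintegrable h; rewrite EFin_Rintegral. Qed.

Lemma sqint_mul q r : sqint q -> sqint r -> rintegrable mu A (fun x => q x * r x).
Proof.
move=> hq hr; have [mq _] := hq; have [mr _] := hr.
apply: (rintegrable_le (g := fun x => q x ^+ 2 + r x ^+ 2) mA).
- exact: measurable_funM.
- by move=> x _; rewrite ler_norml; have := sqr_ge0 (q x); have := sqr_ge0 (r x); nra.
- by apply: rintegrableD => //; exact: sqint_rintegrable.
Qed.

Lemma sqint_ge q : measurable_fun A q -> rintegrable mu A (fun x => q x ^+ 2) -> sqint q.
Proof. by move=> mq qi; split => //; exact: rintegrable_ltoo. Qed.

Lemma sqint_lin a q r : sqint q -> sqint r -> sqint (fun x => a * q x + r x).
Proof.
move=> hq hr; have [mq _] := hq; have [mr _] := hr.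
have m : measurable_fun A (fun x => a * q x + r x).
  by apply: measurable_funD => //; exact: measurable_funM.
apply: sqint_ge => //.
apply: (rintegrable_le (g := fun x => 2 * a ^+ 2 * q x ^+ 2 + 2 * r x ^+ 2) mA).
- exact: measurable_funX.
- move=> x _; rewrite ger0_norm ?sqr_ge0//.
  by have := sqr_ge0 (a * q x - r x); nra.
- by apply: rintegrableD => //; apply: rintegrableZl => //; exact: sqint_rintegrable.
Qed.

Lemma sqint0 : sqint (fun=> 0).
Proof.
split; first exact: measurable_cst.
by rewrite expr0n/= integral0.
Qed.

Lemma sqintZ a q : sqint q -> sqint (fun x => a * q x).
Proof.
move=> hq; have := sqint_lin a hq sqint0.
by congr sqint; apply/funext => x; rewrite addr0.
Qed.

Lemma sqintD q r : sqint q -> sqint r -> sqint (fun x => q x + r x).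
Proof.
move=> hq hr; have := sqint_lin 1 hq hr.
by congr sqint; apply/funext => x; rewrite mul1r.
Qed.

Lemma sqintB q r : sqint q -> sqint r -> sqint (fun x => q x - r x).
Proof.
move=> hq hr; have := sqint_lin (-1) hr hq.
by congr sqint; apply/funext => x; rewrite mulN1r addrC.
Qed.

Lemma sqi_ae q r : measurable_fun A q -> measurable_fun A r ->
  {ae mu, forall x, A x -> q x = r x} -> sqi q = sqi r.
Proof.
move=> mq mr qr; apply: Rintegral_ae => //; try exact: measurable_funX.
by apply: filterS qr => x /[apply] ->.
Qed.

Lemma sqi_mul q r a b : sqint q -> sqint r -> 0 <= a -> 0 <= b ->
  sqi q <= a ^+ 2 -> sqi r <= b ^+ 2 ->
  \int[mu]_(x in A) `|q x * r x| <= a * b.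
Proof.
move=> hq hr a0 b0 qa rb.
have [mq _] := hq; have [mr _] := hr.
apply/ler_addgt0Pr => e e0.
(* Slightly larger bounds are positive, so that one can divide by them; the shift is small enough
   for [a' * b' <= a * b + e]. *)
set a' := a + e / (a + b + e + 1); set b' := b + e / (a + b + e + 1).
pose t := e / (a + b + e + 1).
have ab1 : 0 < a + b + e + 1 by lra.
have t0 : 0 < t by rewrite divr_gt0.
have tE : t * (a + b + e + 1) = e by rewrite divfK ?gt_eqF.
have t1 : t <= 1 by rewrite ler_pdivrMr//; lra.
have a'0 : 0 < a' by rewrite /a' -/t; lra.
have b'0 : 0 < b' by rewrite /b' -/t; lra.
have a'a : a ^+ 2 <= a' ^+ 2 by rewrite lerXn2r ?nnegrE// ?ltW// /a' -/t; lra.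
have b'b : b ^+ 2 <= b' ^+ 2 by rewrite lerXn2r ?nnegrE// ?ltW// /b' -/t; lra.
have ab : a' * b' <= a * b + e.
  rewrite /a' /b' -/t mulrDl !mulrDr -subr_ge0.
  have : 0 <= t * (1 - t) by rewrite mulr_ge0//; lra.
  have : 0 <= t * e by rewrite mulr_ge0// ltW.
  by move=> ? ?; move: tE; nra.
apply: le_trans ab.
have h x : `|q x * r x| <= b' / (2 * a') * q x ^+ 2 + a' / (2 * b') * r x ^+ 2.
  rewrite normrM -(real_normK (num_real (q x))) -(real_normK (num_real (r x))).
  rewrite -subr_ge0 [X in 0 <= X](_ : _ =
    (b' * `|q x| - a' * `|r x|) ^+ 2 / (2 * a' * b')); last first.
    by field; rewrite ?gt_eqF.
  by rewrite divr_ge0 ?sqr_ge0// ltW// !mulr_gt0.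
have iq := sqint_rintegrable hq; have ir := sqint_rintegrable hr.
have iq' := rintegrableZl mA (b' / (2 * a')) iq.
have ir' := rintegrableZl mA (a' / (2 * b')) ir.
apply: (@le_trans _ _ (\int[mu]_(x in A) (b' / (2 * a') * q x ^+ 2 + a' / (2 * b') * r x ^+ 2))).
  apply: le_Rintegral => //.
  - by apply: rintegrable_norm => //; exact: sqint_mul.
  - exact: rintegrableD.
rewrite RintegralD// !RintegralZl//.
apply: (@le_trans _ _ (b' / (2 * a') * a' ^+ 2 + a' / (2 * b') * b' ^+ 2)).
  have c1 : 0 <= b' / (2 * a') by rewrite divr_ge0 ?mulr_ge0// ltW.
  have c2 : 0 <= a' / (2 * b') by rewrite divr_ge0 ?mulr_ge0// ltW.
  by apply: lerD; [apply: ler_wpM2l => //; exact: le_trans qa a'a|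
                   apply: ler_wpM2l => //; exact: le_trans rb b'b].
by rewrite le_eqVlt; apply/orP; left; apply/eqP; field; rewrite ?gt_eqF.
Qed.

Lemma sqint_rintegrable1 q : (mu A < +oo)%E -> sqint q -> rintegrable mu A q.
Proof.
move=> Aoo hq; have [mq _] := hq.
apply: (rintegrable_le (g := fun x => 1 + q x ^+ 2) mA) => //.
- by move=> x _; rewrite ler_norml; have := sqr_ge0 (q x - 1); have := sqr_ge0 (q x + 1); nra.
- apply: rintegrableD => //; last exact: sqint_rintegrable.
  by apply/integrableP; split; [exact: measurable_cst|];
    rewrite /= normr1 integral_cst// mul1e.
Qed.

Lemma sqint_bounded q C : (mu A < +oo)%E -> measurable_fun A q ->
  (forall x, A x -> `|q x| <= C) -> sqint q.
Proof.
move=> Aoo mq qC; apply: sqint_ge => //.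
apply: (rintegrable_le (g := fun=> C ^+ 2) mA).
- exact: measurable_funX.
- move=> x Ax; rewrite normrX lerXn2r ?nnegrE ?normr_ge0 ?qC//.
  exact: le_trans (qC x Ax).
- apply/integrableP; split; [exact: measurable_cst|].
  by rewrite /= integral_cst// lte_mul_pinfty// lee_fin.
Qed.

Lemma sqi_complete (r : R) (f : nat -> T -> R) : 0 <= r -> r < 1 ->
  (forall k, sqint (f k)) -> (forall k, sqi (fun x => f k.+1 x - f k x) <= (r ^+ k) ^+ 2) ->
  exists l, sqint l /\ (fun k => sqi (fun x => f k x - l x)) @ \oo --> 0.
Proof.
move=> r0 r1 hf fr.
have SA := @seminormed_abs R.
have sb : forall q : T -> R, bochnerL2 mu A setT (@abs_norm R) q <-> sqint q.
  move=> q; rewrite bochnerL2P// /sqint (smeas_real mA).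
  by under [X in bochner_sq _ _ _ X]eq_fun do []; rewrite /bochner_sq;
    under eq_integral => x _ do rewrite /nrm/= real_normK ?num_real//.
have nb (q : T -> R) : sqint q -> nrm (bochner_norm mu A (@abs_norm R)) (q : T -> R^o) ^+ 2 = sqi q.
  move=> hq; have /sb/(nrm_bochner_sq SA) := hq.
  rewrite /bochner_sq => h; apply: EFin_inj; rewrite -h -sqiE//.
  by apply: eq_integral => x _; rewrite /nrm/= real_normK ?num_real.
have SB := @seminormed_bochner _ _ _ _ mu A _ _ mA SA.
have cB := bochner_complete (mu := mu) mA SA (@abs_complete R).
have r4 : 0 < 4^-1 :> R by lra.
have cr := seminorm_complete_rate SB r4 r0 r1 cB.
have [||l [/sb hl fl]] := cr (f : nat -> (T -> R^o)).
- by move=> k; apply/sb.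
- move=> k; rewrite -(@ler_pXn2r _ 2) ?nnegrE ?exprn_ge0 ?(nrm_ge0 SB)//.
  by rewrite nb; [exact: fr|exact: sqintB].
exists l; split => //.
rewrite (_ : (fun k => _) = (fun k => nrm (bochner_norm mu A (@abs_norm R)) ((f k - l) : T -> R^o) ^+ 2)); last first.
  by apply/funext => k; rewrite nb//; exact: sqintB.
by rewrite -(mulr0 0) ; under eq_fun do rewrite expr2; exact: cvgM.
Qed.

End square_integrable.

(** * Seminorms built from finitely many square-integrable observables *)

Section energy.
Context {R : realType} {disp : measure_display} {T : measurableType disp}.
Variables (mu : {measure set T -> \bar R}) (A : set T).
Hypothesis mA : measurable A.
Context {V : lmodType R}.
Variable S : set V.
Hypothesis S0 : S 0.
Hypothesis Slin : forall a v w, S v -> S w -> S (a *: v + w).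
Variables (I : finType) (O : I -> V -> T -> R).
Hypothesis OL2 : forall i v, S v -> sqint mu A (O i v).
Hypothesis Olin : forall i a v w, S v -> S w ->
  {ae mu, forall x, A x -> O i (a *: v + w) x = a * O i v x + O i w x}.

(** Common shape of the scalar and vector L2 and H1 norms: [O i v] is a value or a partial
    derivative. It is linear only almost everywhere, since [weak_grad] picks a representative. *)
Definition energy (v : V) : \bar R := (\int[mu]_(x in A) (\sum_i (O i v x) ^+ 2)%:E)%E.
Local Notation N := (fun v => energy v `^ 2^-1)%E.

Lemma energyE v : S v -> energy v = (\sum_i sqi mu A (O i v))%:E.
Proof.
move=> Sv.
have h i : i \in index_enum I -> rintegrable mu A (fun x => O i v x ^+ 2).
  by move=> _; apply: sqint_rintegrable => //; exact: OL2.
by rewrite -(Rintegral_sum mA h) EFin_Rintegral//; exact: rintegrable_sum.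
Qed.

Lemma obs0 i : {ae mu, forall x, A x -> O i 0 x = 0}.
Proof.
have := Olin i 1 S0 S0; apply: filterS => x /[apply].
by rewrite scale1r addr0 mul1r => h; lra.
Qed.

Lemma obsZ i a v : S v -> {ae mu, forall x, A x -> O i (a *: v) x = a * O i v x}.
Proof.
move=> Sv; have := Olin i a Sv S0; have := obs0 i.
by apply: filterS2 => x h0 h Ax; have := h Ax; rewrite addr0 h0// addr0.
Qed.

Lemma obsD i v w : S v -> S w ->
  {ae mu, forall x, A x -> O i (v + w) x = O i v x + O i w x}.
Proof.
move=> Sv Sw; have := Olin i 1 Sv Sw.
by apply: filterS => x /[apply]; rewrite scale1r mul1r.
Qed.

Lemma obsB i v w : S v -> S w ->
  {ae mu, forall x, A x -> O i (v - w) x = O i v x - O i w x}.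
Proof.
move=> Sv Sw; have := Olin i (-1) Sw Sv.
apply: filterS => x /[apply].
by rewrite scaleN1r mulN1r (addrC (- w)) (addrC (- O i w x)).
Qed.

Let SZ a v : S v -> S (a *: v).
Proof. by move=> Sv; rewrite -[_ *: _]addr0; exact: Slin. Qed.

Let SD v w : S v -> S w -> S (v + w).
Proof. by move=> Sv Sw; rewrite -[v]scale1r; exact: Slin. Qed.

Let SB v w : S v -> S w -> S (v - w).
Proof. by move=> Sv Sw; rewrite addrC -scaleN1r; exact: Slin. Qed.

Let sqi_obs i (v : V) (q : T -> R) : S v -> sqint mu A q ->
  {ae mu, forall x, A x -> O i v x = q x} -> sqi mu A (O i v) = sqi mu A q.
Proof. by move=> /OL2-/(_ i)[mo _] [mq _]; exact: sqi_ae. Qed.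

Lemma seminormed_energy : seminormed S N.
Proof.
apply: seminormed_sqrt => //.
- by move=> v; apply: integral_ge0 => x _; rewrite lee_fin sumr_ge0// => i _; exact: sqr_ge0.
- by move=> v Sv; rewrite energyE// ltry.
- move=> a v Sv; rewrite !energyE//; last exact: SZ.
  rewrite -EFinM mulr_sumr; congr EFin; apply: eq_bigr => i _.
  rewrite (sqi_obs (SZ a Sv) (sqintZ mA a (OL2 i Sv)) (obsZ i a Sv)).
  rewrite /sqi -RintegralZl//; last by apply: sqint_rintegrable => //; exact: OL2.
  by apply: eq_Rintegral => x _; rewrite exprMn.
- move=> e v w e0 Sv Sw; rewrite !energyE//; last exact: SD.
  rewrite -!EFinM -EFinD lee_fin !mulr_sumr -big_split/=.
  apply: ler_sum => i _.
  have hv := OL2 i Sv; have hw := OL2 i Sw.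
  rewrite (sqi_obs (SD Sv Sw) (sqintD mA hv hw) (obsD i Sv Sw)).
  rewrite /sqi -!RintegralZl//; [|by exact: sqint_rintegrable..].
  have iv := rintegrableZl mA (1 + e) (sqint_rintegrable hv).
  have iw := rintegrableZl mA (1 + e^-1) (sqint_rintegrable hw).
  rewrite -RintegralD//; apply: le_Rintegral => //.
  + by apply: sqint_rintegrable => //; exact: sqintD.
  + exact: rintegrableD.
  + by move=> x _; exact: young_sqrD.
Qed.

Lemma nrm_energy v : S v -> nrm N v ^+ 2 = \sum_i sqi mu A (O i v).
Proof.
move=> Sv; rewrite /nrm sqr_fine_poweR ?energyE ?ltry// lee_fin.
by apply: sumr_ge0 => i _; exact: sqi_ge0.
Qed.

Lemma sqi_obs_le i v : S v -> sqi mu A (O i v) <= nrm N v ^+ 2.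
Proof.
move=> Sv; rewrite nrm_energy// (bigD1 i)//= lerDl.
by apply: sumr_ge0 => j _; exact: sqi_ge0.
Qed.

Lemma sqi_obsB i v w : S v -> S w ->
  sqi mu A (O i (v - w)) = sqi mu A (fun x => O i v x - O i w x).
Proof.
move=> Sv Sw; have hv := OL2 i Sv; have hw := OL2 i Sw.
exact: (sqi_obs (SB Sv Sw) (sqintB mA hv hw) (obsB i Sv Sw)).
Qed.

(** Each observable of a fast Cauchy sequence converges in L2. What remains is that the limits are
    the observables of one element; for H1 this is the closedness of weak differentiation. *)
Lemma energy_complete r : 0 <= r -> r < 1 ->
  (forall (f : nat -> V) (g : I -> T -> R), (forall k, S (f k)) ->
    (forall i, sqint mu A (g i)) ->
    (forall i, (fun k => sqi mu A (fun x => O i (f k) x - g i x)) @ \oo --> 0) ->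
    exists l, S l /\ forall i, {ae mu, forall x, A x -> O i l x = g i x}) ->
  seminorm_complete S N r.
Proof.
move=> r0 r1 closed f Sf fr.
have SN := seminormed_energy.
have hg i : exists g, sqint mu A g /\
    (fun k => sqi mu A (fun x => O i (f k) x - g x)) @ \oo --> 0.
  apply: (sqi_complete mA r0 r1 (f := fun k => O i (f k))) => [k|k]; first exact: OL2.
  rewrite -sqi_obsB//; apply: le_trans (sqi_obs_le i (SB (Sf _) (Sf _))) _.
  by rewrite lerXn2r ?nnegrE ?exprn_ge0 ?(nrm_ge0 SN)//; exact: fr.
have [g hg'] := choice hg.
have [l [Sl hl]] := closed f g Sf (fun i => (hg' i).1) (fun i => (hg' i).2).
exists l; split => //.
have h : (fun k => nrm N (f k - l) ^+ 2) @ \oo --> 0.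
  rewrite (_ : (fun k => _) = fun k => \sum_i sqi mu A (fun x => O i (f k) x - g i x)); last first.
    apply/funext => k; rewrite nrm_energy; last exact: SB.
    apply: eq_bigr => i _; rewrite sqi_obsB//.
    have [mf _] := OL2 i (Sf k); have [mg _] := (hg' i).1; have [ml _] := OL2 i Sl.
    apply: sqi_ae => //; [exact: measurable_funB..|].
    by apply: filterS (hl i) => x /[apply] ->.
  rewrite [X in _ --> X](_ : 0 = \sum_(i : I) (0 : R)); last by rewrite big1.
  by apply: cvg_big => [|i _]; [exact: add_continuous|exact: (hg' i).2].
apply/cvgrPdist_le => e e0; move/cvgrPdist_le : h => /(_ _ (exprn_gt0 2 e0)).
apply: filterS => k; rewrite !sub0r !normrN ger0_norm ?sqr_ge0// => hk.
by rewrite ger0_norm ?(nrm_ge0 SN)// -(@ler_pXn2r _ 2) ?nnegrE ?(nrm_ge0 SN)// ltW.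
Qed.

End energy.

Lemma Rintegral_eq0 (R : realType) d (T : measurableType d)
    (mu : {measure set T -> \bar R}) (A : set T) (f : T -> R) :
  (forall x, A x -> f x = 0) -> \int[mu]_(x in A) f x = 0.
Proof.
move=> f0; rewrite /Rintegral integral0_eq// => x Ax.
by rewrite f0.
Qed.

(** * Sobolev spaces *)

Section integration_by_parts.
Context {R : realType}.

Lemma continuous_cons_row_l n (y : 'rV[R]_n) :
  continuous ((fun t => cons_row (t, y)) : R -> 'rV[R]_n.+1).
Proof.
move=> t; apply/cvg_ballP => e e0.
have : nbhs t (ball t e) by exact: nbhsx_ballx.
apply: filterS => t' ht; split => // i j; rewrite (ord1 i).
by case: (unliftP ord0 j) => [k ->|->]; rewrite ?cons_rowS ?cons_row0//=; exact: ballxx.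
Qed.

Lemma continuous_cons_row_r n (t : R) :
  continuous ((fun y => cons_row (t, y)) : 'rV[R]_n -> 'rV[R]_n.+1).
Proof.
move=> y U /nbhs_ballP[e /= e0 eU].
have : nbhs y (ball y e) by exact: nbhsx_ballx.
apply: filterS => y' [_ hy]; apply: eU; split => // i j; rewrite (ord1 i).
by case: (unliftP ord0 j) => [k ->|->]; rewrite ?cons_rowS ?cons_row0//=; exact: ballxx.
Qed.

Lemma continuous_bounded_on d (D : set 'rV[R]_d) (f : 'rV[R]_d -> R) :
  bounded_set D -> continuous f -> exists2 C, 0 <= C & forall x, D x -> `|f x| <= C.
Proof.
move=> /bounded_set_cube[M DM] cf.
have cK : compact (cbox (const_mx (- M) : 'rV[R]_d) (const_mx M)) := @compact_cbox _ _ _ _.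
have := continuous_compact (continuous_subspaceT cf) cK.
move=> /compact_bounded[B [_ hB]]; exists (`|B| + 1); first by rewrite addr_ge0.
move=> x Dx; apply: hB; first by rewrite ltr_pwDr// ler_norm.
by exists x => // i; rewrite !mxE -ler_norml; exact: DM.
Qed.

Lemma open_not_cube d M (x : 'rV[R]_d) : ~ cube d M x -> \forall y \near x, ~ cube d M y.
Proof.
move=> /existsNP[i /negP]; rewrite -ltNge => h.
have e0 : 0 < `|x ord0 i| - M by rewrite subr_gt0.
have : nbhs x (ball x (`|x ord0 i| - M)) by exact: nbhsx_ballx.
apply: filterS => y [_ /(_ ord0 i) hy] /(_ i) yM.
move: hy; rewrite /ball/= => hy; have := ler_normD (x ord0 i - y ord0 i) (y ord0 i).
by rewrite subrK; lra.
Qed.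

Lemma derive_out_cube d M (F : 'rV[R]_d -> R) v :
  (forall x, F x != 0 -> cube d M x) -> forall x, 'D_v F x != 0 -> cube d M x.
Proof.
move=> FM x; apply: contra_neqP => /open_not_cube xM.
have FN : {near x, F =1 cst 0}.
  by apply: filterS xM => y yM; apply/eqP; apply: contraT => /FM /yM.
by rewrite (near_eq_derive _ FN) ?derive_cst.
Qed.

Lemma rintegrable_cube d M (h : 'rV[R]_d -> R) : continuous h ->
  (forall x, h x != 0 -> cube d M x) -> rintegrable (lebesgue_row d) setT h.
Proof.
move=> ch hM.
have bc : bounded_set (cube d M : set 'rV[R]_d).
  exists `|M|; split; first by rewrite num_real.
  move=> N MN x xM /=; rewrite [leLHS]/Num.norm/= mx_normrE.
  apply/bigmax_leP; split; first by rewrite (le_trans _ (ltW MN)).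
  move=> [i j] _ /=; rewrite (ord1 i); apply: le_trans (xM j) _.
  by apply: le_trans (ler_norm M) _; exact: ltW.
have [C C0 hC] := continuous_bounded_on bc ch.
have mc := @measurable_cube R d M.
apply: (rintegrable_le (g := fun x => C * \1_(cube d M) x) measurableT).
- exact: continuous_row_measurable.
- move=> x _; have [->|/hM xM] := eqVneq (h x) 0; first by rewrite normr0 mulr_ge0.
  by rewrite indicE mem_set// mulr1 hC.
- apply: rintegrableZl => //; apply/integrableP; split.
    by apply/measurable_EFinP; exact: measurable_indic.
  under eq_integral => x _ do rewrite /= ger0_norm//.
  by rewrite integral_indic// setIT; exact: lebesgue_row_cube.
Qed.

Lemma Rintegral_line (M : R) (F f : R -> R) : (forall t : R, is_derive t (1 : R) F (f t)) -> continuous f ->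
  (forall t, F t != 0 -> `|t| <= M) -> (forall t, f t != 0 -> `|t| <= M) ->
  \int[@lebesgue_measure R]_t f t = 0.
Proof.
move=> dF cf FM fM.
pose L : R := `|M| + 1.
have ML : M < L by rewrite /L ltr_pwDr// ler_norm.
have L0 : - L < L by rewrite /L; have := normr_ge0 M; lra.
have E : \int[@lebesgue_measure R]_t f t = \int[@lebesgue_measure R]_(t in `[- L, L]) f t.
  rewrite [RHS]Rintegral_mkcond; congr Rintegral; apply/funext => t; rewrite patchE.
  case: ifPn => //; rewrite notin_setE/= in_itv/= -ler_norml => tL.
  by apply/eqP; apply: contraT => /fM h; exfalso; apply: tL; exact: le_trans h (ltW ML).
have cF : continuous F.
  move=> t; have [dt _] := dF t.
  by apply: differentiable_continuous; apply/derivable1_diffP.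
have ftc := continuous_FTC2 L0 (continuous_subspaceT cf) (F := F).
have LR : derivable_oo_LRcontinuous F (- L) L.
  split; first by move=> x _; have [] := dF x.
    exact: cvg_at_right_filter (cF _).
  exact: cvg_at_left_filter (cF _).
rewrite E /Rintegral (ftc LR); last by move=> x _; rewrite derive1E; have [_ ->] := dF x.
have z t : M < `|t| -> F t = 0.
  by move=> Mt; apply/eqP; apply: contraT => /FM; rewrite leNgt Mt.
have ML' : M < `|L| := lt_le_trans ML (ler_norm _).
have z1 : F L = 0 by exact: z.
have z2 : F (- L) = 0 by apply: z; rewrite normrN.
by rewrite z1 z2 subee.
Qed.

Lemma derive_cons_row_l n (F : 'rV[R]_n.+1 -> R) t y :
  derivable F (cons_row (t, y)) (delta_mx ord0 ord0) ->
  is_derive t (1 : R) (fun s => F (cons_row (s, y))) ('D_(delta_mx ord0 ord0) F (cons_row (t, y))).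
Proof.
have E : (fun h : R => h^-1 *: (F (cons_row ((h *: (1 : R) + t)%R, y)) - F (cons_row (t, y)))) =
  (fun h => h^-1 *: (F (h *: delta_mx ord0 ord0 + cons_row (t, y)) - F (cons_row (t, y)))).
  apply/funext => h; congr (_ *: (F _ - _)); apply/rowP => i.
  rewrite [RHS]mxE [X in _ = X + _]mxE [delta_mx _ _ _ _]mxE.
  case: (unliftP ord0 i) => [k ->|->].
    by rewrite !cons_rowS/= ?andbF mulr0 add0r.
  by rewrite !cons_row0/= [_ *: _]mulr1 mulr1.
by move=> dF; split; [rewrite /derivable /= E|rewrite /derive /= E].
Qed.

Lemma derive_cons_row_r n (F : 'rV[R]_n.+1 -> R) t y j :
  derivable F (cons_row (t, y)) (delta_mx ord0 (lift ord0 j)) ->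
  is_derive y (delta_mx ord0 j) (fun z => F (cons_row (t, z)))
    ('D_(delta_mx ord0 (lift ord0 j)) F (cons_row (t, y))).
Proof.
have E : (fun h : R => h^-1 *: (F (cons_row (t, (h *: delta_mx ord0 j + y)%R)) - F (cons_row (t, y)))) =
  (fun h => h^-1 *: (F (h *: delta_mx ord0 (lift ord0 j) + cons_row (t, y)) - F (cons_row (t, y)))).
  apply/funext => h; congr (_ *: (F _ - _)); apply/rowP => i.
  rewrite [RHS]mxE [X in _ = X + _]mxE [delta_mx _ _ _ _]mxE.
  case: (unliftP ord0 i) => [k ->|->].
    by rewrite !cons_rowS/= !mxE (inj_eq (@lift_inj _ _)).
  by rewrite !cons_row0/= ?andbF mulr0 add0r.
by move=> dF; split; [rewrite /derivable /= E|rewrite /derive /= E].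
Qed.

(** Fubini with the first coordinate split off: the first partial derivative integrates to 0 on each
    line by the fundamental theorem, and the others on each slice by induction on the dimension. *)
Lemma Rintegral_partial d (F : 'rV[R]_d -> R) (i : 'I_d) M :
  (forall x, derivable F x (delta_mx ord0 i)) -> continuous ('D_(delta_mx ord0 i) F) ->
  (forall x, F x != 0 -> cube d M x) ->
  \int[lebesgue_row d]_x 'D_(delta_mx ord0 i) F x = 0.
Proof.
elim: d => [|n IH] in F i *; first by case: i.
move=> dF cF FM; set h := 'D_ _ F in cF *.
have hM : forall x, h x != 0 -> cube n.+1 M x := derive_out_cube FM.
have ih := rintegrable_cube cF hM.
pose leb1 := @lebesgue_measure R : {sigma_finite_measure set (measurableTypeR R) -> \bar R}.
have mc : measurable_fun setT (h \o @cons_row R n : measurableTypeR R * 'rV[R]_n -> R).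
  exact: measurableT_comp (continuous_row_measurable cF) (@measurable_cons_row R n).
have ihc : rintegrable (leb1 \x lebesgue_row n)%E (setT `*` setT) (h \o @cons_row R n).
  rewrite setXTT; apply/integrableP; split; first exact/measurable_EFinP.
  have /integrableP[_] := ih; apply: le_lt_trans.
  rewrite /= /lebesgue_step ge0_integral_pushforward//=.
    exact: measurable_cons_row.
  by apply/measurable_EFinP; apply: measurableT_comp => //; exact: continuous_row_measurable.
have -> : \int[lebesgue_row n.+1]_x h x =
    \int[(leb1 \x lebesgue_row n)%E]_(z in setT `*` setT) h (cons_row z).
  rewrite setXTT /Rintegral /= /lebesgue_step integral_pushforward//=.
  - exact: measurable_cons_row.
  - by apply/measurable_EFinP; exact: continuous_row_measurable.
  - by move: ihc; rewrite setXTT.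
have zc z : h (cons_row z) != 0 -> `|z.1| <= M /\ cube n M z.2.
  move=> /hM hz; split; first by have := hz ord0; rewrite cons_row0.
  by move=> k; have := hz (lift ord0 k); rewrite cons_rowS.
have zF z : F (cons_row z) != 0 -> `|z.1| <= M /\ cube n M z.2.
  move=> /FM hz; split; first by have := hz ord0; rewrite cons_row0.
  by move=> k; have := hz (lift ord0 k); rewrite cons_rowS.
case: (unliftP ord0 i) => [j|] iE.
- rewrite fubini_prod1//; apply: Rintegral_eq0 => t _.
  have hE y := derive_cons_row_r (F := F) (t := t) (y := y) (j := j).
  rewrite iE in dF; rewrite /h iE in cF *.
  have {}hE y := hE y (dF _).
  transitivity (\int[lebesgue_row n]_y 'D_(delta_mx ord0 j) (fun y => F (cons_row (t, y))) y).
    by apply: eq_Rintegral => y _; have [_ ->] := hE y.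
  apply: (IH (fun y => F (cons_row (t, y))) j) => [y||y].
  - by have [] := hE y.
  - rewrite (_ : 'D_ _ _ = (fun y => 'D_(delta_mx ord0 (lift ord0 j)) F (cons_row (t, y)))); last first.
      by apply/funext => y; have [_ ->] := hE y.
    move=> y; apply: (@continuous_comp _ _ _ (fun z : 'rV[R]_n => cons_row (t, z)) ('D_(delta_mx ord0 (lift ord0 j)) F)).
      exact: continuous_cons_row_r.
    exact: cF.
  - by move=> /zF[].
- have [_ _ ->] := fubini_prod (measurableT : measurable (setT : set (measurableTypeR R))) measurableT ihc.
  apply: Rintegral_eq0 => y _.
  rewrite iE in dF; rewrite /h iE in cF zc *.
  apply: (@Rintegral_line M (fun s => F (cons_row (s, y)))) => [t||t|t].
  - exact: derive_cons_row_l.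
  - move=> t; apply: (@continuous_comp _ _ _ (fun s : R => cons_row (s, y)) ('D_(delta_mx ord0 ord0) F)).
      exact: continuous_cons_row_l.
    exact: cF.
  - by move=> /zF[].
  - by move=> /zc[].
Qed.

End integration_by_parts.

Lemma Rintegral_lin (R : realType) d (T : measurableType d)
    (mu : {measure set T -> \bar R}) (A : set T) a (f g h : T -> R) :
  measurable A -> rintegrable mu A f -> rintegrable mu A g ->
  (forall x, A x -> h x = a * f x + g x) ->
  \int[mu]_(x in A) h x = a * \int[mu]_(x in A) f x + \int[mu]_(x in A) g x.
Proof.
move=> mA fi gi hE; rewrite -RintegralZl// -RintegralD//; last exact: rintegrableZl.
by apply: eq_Rintegral => x /set_mem /hE.
Qed.

Section sobolev_spaces.
Context {R : realType} {d : nat}.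
Variable D : set 'rV[R]_d.
Hypotheses (oD : open D) (bD : bounded_set D).
Local Notation leb := (lebesgue_row d).
Local Notation X := 'rV[R]_d.
Local Notation e_ i := (delta_mx ord0 i : X).

Let mD : measurable D := open_row_measurable oD.
Let Doo : (leb D < +oo)%E := bounded_set_lty mD bD.

Lemma sqint_continuous (q : X -> R) : continuous q -> sqint leb D q.
Proof.
move=> cq; have [C _ hC] := continuous_bounded_on bD cq.
apply: (sqint_bounded (C := C) mD Doo) => //.
exact: measurable_funTS (continuous_row_measurable cq).
Qed.

Lemma smooth_derive_continuous (q : X -> R) v : smooth q -> continuous ('D_v q).
Proof. by move=> /(_ 1%N)[_ /(_ v)[_ []]]. Qed.

Lemma smooth_derivable (q : X -> R) v x : smooth q -> derivable q x v.
Proof. by move=> /(_ 1%N)[_ /(_ v)[]]. Qed.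

Lemma smooth_continuous (q : X -> R) : smooth q -> continuous q.
Proof. by move=> /(_ 0%N)[]. Qed.

(** Integration by parts is the vanishing integral of a partial derivative of [q * phi]. There is no
    boundary term, because the support of [phi] lies in [D] and the derivative is 0 outside [D]. *)
Lemma is_weak_grad_smooth (q : X -> R) : smooth q ->
  is_weak_grad D q (fun x => \row_i 'D_(e_ i) q x).
Proof.
move=> sq phi [sphi cphi phiD] i.
set K := closure _ in cphi phiD.
have [M KM] : exists M, K `<=` cube d M by apply: bounded_set_cube; exact: compact_bounded.
pose F := q * phi.
have sF : smooth F by exact: smooth_mul.
have FM x : F x != 0 -> cube d M x.
  move=> Fx; apply/KM/subset_closure => /=; apply: contra_neq Fx => phi0.
  by rewrite /F /GRing.mul/= phi0 mulr0.
have := Rintegral_partial (fun x => @smooth_derivable F (e_ i) x sF)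
  (@smooth_derive_continuous F (e_ i) sF) FM.
have dF x : 'D_(e_ i) F x = q x * 'D_(e_ i) phi x + 'D_(e_ i) q x * phi x.
  by rewrite deriveM; [rewrite [phi x *: _]mulrC|exact: smooth_derivable..].
have out x : ~ D x -> 'D_(e_ i) F x = 0.
  move=> nDx; have : \forall y \near x, ~ K y.
    have : open (~` K) by apply: closed_openC; exact: closed_closure.
    by move=> oK; apply: open_nbhs_nbhs; split => //= /phiD.
  move=> xK; have FN : {near x, F =1 cst 0}.
    apply: filterS xK => y yK; rewrite /F /GRing.mul/=.
    have [->|phiy] := eqVneq (phi y) 0; first by rewrite mulr0.
    by exfalso; apply: yK; exact: subset_closure.
  by rewrite (near_eq_derive _ FN) ?derive_cst.
have -> : \int[leb]_x 'D_(e_ i) F x = \int[leb]_(x in D) 'D_(e_ i) F x.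
  rewrite [RHS]Rintegral_mkcond; congr Rintegral; apply/funext => x; rewrite patchE.
  by case: ifPn => //; rewrite notin_setE => /out.
under eq_Rintegral do rewrite dF.
have i1 : rintegrable leb D (fun x => q x * 'D_(e_ i) phi x).
  by apply: sqint_mul => //; apply: sqint_continuous;
    [exact: smooth_continuous|exact: smooth_derive_continuous].
have i2 : rintegrable leb D (fun x => 'D_(e_ i) q x * phi x).
  by apply: sqint_mul => //; apply: sqint_continuous;
    [exact: smooth_derive_continuous|exact: smooth_continuous].
rewrite RintegralD// => /eqP; rewrite addr_eq0 => /eqP ->.
by congr (- _); apply: eq_Rintegral => x _; rewrite mxE.
Qed.

Lemma H1_smooth (q : X -> R) : smooth q -> H1 D q.
Proof.
move=> sq; split; first exact/sqint_continuous/smooth_continuous.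
exists (fun x => \row_i 'D_(e_ i) q x); split; last exact: is_weak_grad_smooth.
move=> i; under eq_fun do rewrite mxE.
exact/sqint_continuous/smooth_derive_continuous.
Qed.

Lemma test_sqint (phi : X -> R) : test_function D phi -> sqint leb D phi.
Proof. by move=> [s _ _]; exact/sqint_continuous/smooth_continuous. Qed.

Lemma test_derive_sqint (phi : X -> R) v : test_function D phi -> sqint leb D ('D_v phi).
Proof. by move=> [s _ _]; exact/sqint_continuous/smooth_derive_continuous. Qed.

Lemma weak_grad_unique (q : X -> R) g h : L2v D g -> L2v D h ->
  is_weak_grad D q g -> is_weak_grad D q h ->
  forall i, {ae leb, forall x, D x -> g x ord0 i = h x ord0 i}.
Proof.
move=> gL hL qg qh i.
have gi := sqint_rintegrable1 mD Doo (gL i); have hi := sqint_rintegrable1 mD Doo (hL i).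
have := fundamental_lemma oD (rintegrableB mD gi hi).
have h0 phi : test_function D phi ->
    \int[leb]_(x in D) ((g x ord0 i - h x ord0 i) * phi x) = 0.
  move=> tphi; have tL := test_sqint tphi.
  under eq_Rintegral do rewrite mulrBl.
  rewrite RintegralB//; [|exact: (sqint_mul mD (gL i) tL)|exact: (sqint_mul mD (hL i) tL)].
  by apply/eqP; rewrite subr_eq0 -eqr_opp -qg// -qh.
by move=> /(_ h0); apply: filterS => x /[apply] /eqP; rewrite subr_eq0 => /eqP.
Qed.

Lemma weak_gradP q : H1 D q -> L2v D (weak_grad D q) /\ is_weak_grad D q (weak_grad D q).
Proof. by move=> [_ ex]; rewrite /weak_grad; case: xgetP => [_ -> //|/(_ _)]; case: ex => g hg /(_ g). Qed.

Lemma row_lin_entry a (g h : X -> X) x i :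
  (a *: g + h) x ord0 i = a * g x ord0 i + h x ord0 i.
Proof. by rewrite [LHS](_ : _ = (a *: g x + h x) ord0 i)// !mxE. Qed.

Lemma is_weak_grad_lin a q r g h : L2 D q -> L2 D r -> L2v D g -> L2v D h ->
  is_weak_grad D q g -> is_weak_grad D r h ->
  is_weak_grad D (a *: q + r) (a *: g + h).
Proof.
move=> qL rL gL hL qg rh phi tphi i.
have tL := test_sqint tphi; have dL := test_derive_sqint (e_ i) tphi.
have i1 := sqint_mul mD qL dL; have i2 := sqint_mul mD rL dL.
have i3 := sqint_mul mD (gL i) tL; have i4 := sqint_mul mD (hL i) tL.
rewrite (Rintegral_lin (a := a) mD i1 i2); last by move=> x _; rewrite mulrA -mulrDl.
rewrite [X in _ = - X](Rintegral_lin (a := a) mD i3 i4); last by move=> x _; rewrite mulrA -mulrDl row_lin_entry.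
by rewrite qg// rh// opprD mulrN.
Qed.

Lemma H1_lin a q r : H1 D q -> H1 D r -> H1 D (a *: q + r).
Proof.
move=> /[dup] /weak_gradP[g1 g2] [qL _] /[dup] /weak_gradP[h1 h2] [rL _].
split; first exact: sqint_lin.
exists (a *: weak_grad D q + weak_grad D r); split; last exact: is_weak_grad_lin.
move=> i; have := sqint_lin mD a (g1 i) (h1 i).
by congr sqint; apply/funext => x; rewrite row_lin_entry.
Qed.

Lemma H1_0fun : H1 D 0.
Proof. exact/H1_smooth/smooth_cst. Qed.

Lemma weak_grad_lin a q r i : H1 D q -> H1 D r ->
  {ae leb, forall x, D x ->
    weak_grad D (a *: q + r) x ord0 i = a * weak_grad D q x ord0 i + weak_grad D r x ord0 i}.
Proof.
move=> qH rH; have [l1 l2] := weak_gradP (H1_lin a qH rH).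
have [g1 g2] := weak_gradP qH; have [h1 h2] := weak_gradP rH.
have [qL _] := qH; have [rL _] := rH.
have L : L2v D (a *: weak_grad D q + weak_grad D r).
  move=> j; have := sqint_lin mD a (g1 j) (h1 j).
  by congr sqint; apply/funext => x; rewrite row_lin_entry.
have := weak_grad_unique l1 L l2 (is_weak_grad_lin a qL rL g1 h1 g2 h2) i.
by apply: filterS => x /[apply] ->; rewrite row_lin_entry.
Qed.

(** Index 0 is the value, index [i + 1] the partial derivative number [i]. *)
Definition H1obs (k : 'I_d.+1) (q : X -> R) (x : X) : R :=
  if unlift ord0 k is Some i then weak_grad D q x ord0 i else q x.

Lemma H1obs_sqint k q : H1 D q -> sqint leb D (H1obs k q).
Proof.
move=> /[dup] /weak_gradP[gL _] [qL _]; rewrite /H1obs.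
by case: unliftP => [i _|_]; [exact: gL|exact: qL].
Qed.

Lemma H1obs_lin k a q r : H1 D q -> H1 D r ->
  {ae leb, forall x, D x -> H1obs k (a *: q + r) x = a * H1obs k q x + H1obs k r x}.
Proof.
move=> qH rH; rewrite /H1obs; case: unliftP => [i _|_]; first exact: weak_grad_lin.
exact: aeW.
Qed.

Lemma frob_dot_row (g h : X) : frob_dot g h = \sum_i g ord0 i * h ord0 i.
Proof. by rewrite /frob_dot big_ord1. Qed.

Lemma H1normE q : H1norm D q = (energy leb D H1obs q `^ 2^-1)%E.
Proof.
congr (_ `^ _)%E; apply: eq_integral => x _; congr EFin.
rewrite big_ord_recl /H1obs unlift_none frob_dot_row; congr (_ + _).
by apply: eq_bigr => i _; rewrite liftK expr2.
Qed.

Lemma L2_closed (f : nat -> X -> R) (q r : X -> R) : (forall k, L2 D (f k)) ->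
  L2 D q -> L2 D r -> (fun k => sqi leb D (fun x => f k x - q x)) @ \oo --> 0 ->
  (fun k => \int[leb]_(x in D) (f k x * r x)) @ \oo --> \int[leb]_(x in D) (q x * r x).
Proof.
move=> fL qL rL fq; apply/cvgrPdist_le => e e0.
pose s := Num.sqrt (sqi leb D r) + 1.
have s0 : 0 < s by rewrite ltr_wpDl// sqrtr_ge0.
have rs : sqi leb D r <= s ^+ 2.
  rewrite -[leLHS]sqr_sqrtr ?sqi_ge0// lerXn2r ?nnegrE ?sqrtr_ge0//; last by rewrite /s lerDl.
  exact: ltW.
have es : 0 < (e / s) ^+ 2 by rewrite exprn_gt0// divr_gt0.
move/cvgrPdist_le : fq => /(_ _ es); apply: filterS => k.
rewrite sub0r normrN ger0_norm ?sqi_ge0// => hk.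
have fqL := sqintB mD (fL k) qL.
have i1 := sqint_mul mD (fL k) rL; have i2 := sqint_mul mD qL rL.
rewrite distrC -RintegralB//.
have -> : \int[leb]_(x in D) (f k x * r x - q x * r x) =
    \int[leb]_(x in D) ((f k x - q x) * r x).
  by apply: eq_Rintegral => x _; rewrite mulrBl.
apply: le_trans (le_normr_Rintegral _ _) _ => //; first exact: sqint_mul.
apply: le_trans (sqi_mul mD fqL rL _ (ltW s0) hk rs) _; first by rewrite divr_ge0// ltW.
by rewrite divfK// gt_eqF.
Qed.

(** Both sides of the defining identity are pairings with fixed square-integrable functions, so they
    pass to the limit. *)
Lemma is_weak_grad_closed (f : nat -> X -> R) q g : (forall k, H1 D (f k)) ->
  L2 D q -> L2v D g -> (fun k => sqi leb D (fun x => f k x - q x)) @ \oo --> 0 ->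
  (forall i, (fun k => sqi leb D (fun x => weak_grad D (f k) x ord0 i - g x ord0 i)) @ \oo --> 0) ->
  is_weak_grad D q g.
Proof.
move=> fH qL gL fq fg phi tphi i.
have tL := test_sqint tphi; have dL := test_derive_sqint (e_ i) tphi.
have h1 := L2_closed (fun k => (fH k).1) qL dL fq.
have h2 := L2_closed (fun k => (weak_gradP (fH k)).1 i) (gL i) tL (fg i).
apply: (cvg_unique _ h1); first exact: norm_hausdorff.
rewrite [X in X @ _](_ : _ =
    fun k => - \int[leb]_(x in D) (weak_grad D (f k) x ord0 i * phi x)).
  by apply: cvgN; exact: h2.
by apply/funext => k; rewrite (weak_gradP (fH k)).2.
Qed.

Section subspace.
Variable S : set (X -> R).
Hypotheses (S0 : S 0) (Slin : forall a q r, S q -> S r -> S (a *: q + r)).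
Hypothesis SH : S `<=` H1 D.

Lemma seminormed_H1 : seminormed S (H1norm D).
Proof.
rewrite (_ : H1norm D = fun q => (energy leb D H1obs q `^ 2^-1)%E); last exact/funext/H1normE.
apply: seminormed_energy => //.
- by move=> k q /SH; exact: H1obs_sqint.
- by move=> k a q r /SH qH /SH rH; exact: H1obs_lin.
Qed.

Lemma sqi_H1obs k q : S q -> sqi leb D (H1obs k q) <= nrm (H1norm D) q ^+ 2.
Proof.
rewrite (_ : H1norm D = fun q => (energy leb D H1obs q `^ 2^-1)%E); last exact/funext/H1normE.
apply: (sqi_obs_le mD) => {k q}.
by move=> k q /SH; exact: H1obs_sqint.
Qed.

End subspace.

Lemma H1_complete r : 0 <= r -> r < 1 -> seminorm_complete (H1 D) (H1norm D) r.
Proof.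
move=> r0 r1.
rewrite (_ : H1norm D = fun q => (energy leb D H1obs q `^ 2^-1)%E); last exact/funext/H1normE.
apply: energy_complete => //.
- exact: H1_0fun.
- exact: H1_lin.
- by move=> k q; exact: H1obs_sqint.
- by move=> k a q q'; exact: H1obs_lin.
move=> f g Sf gL fg.
pose q := g ord0; pose G x : X := \row_i g (lift ord0 i) x.
have fq : (fun k => sqi leb D (fun x => f k x - q x)) @ \oo --> 0.
  by have := fg ord0; rewrite /H1obs unlift_none.
have GL : L2v D G by move=> i; have := gL (lift ord0 i); congr sqint; apply/funext => x; rewrite mxE.
have fG i : (fun k => sqi leb D (fun x => weak_grad D (f k) x ord0 i - G x ord0 i)) @ \oo --> 0.
  rewrite [X in X @ _](_ : _ = fun k =>
      sqi leb D (fun x => weak_grad D (f k) x ord0 i - g (lift ord0 i) x)).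
    by have := fg (lift ord0 i); rewrite /H1obs liftK.
  by apply/funext => k; congr sqi; apply/funext => x; rewrite mxE.
have qG := is_weak_grad_closed Sf (gL ord0) GL fq fG.
have qH : H1 D q by split; [exact: gL|exists G].
have [g1 g2] := weak_gradP qH.
exists q; split => // k.
rewrite /H1obs; case: unliftP => [i ->|->]; last exact: aeW.
by apply: filterS (weak_grad_unique g1 GL g2 qG i) => x /[apply] ->; rewrite mxE.
Qed.

Lemma H1_sub_complete (S : set (X -> R)) r : 0 <= r -> r < 1 -> S `<=` H1 D ->
  (forall f q, (forall k, S (f k)) -> H1 D q ->
    (fun k => nrm (H1norm D) (f k - q)) @ \oo --> 0 -> S q) ->
  seminorm_complete S (H1norm D) r.
Proof.
move=> r0 r1 SH closed f Sf fr.
have [q [qH fq]] := H1_complete r0 r1 (fun k => SH _ (Sf k)) fr.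
by exists q; split => //; exact: (closed f).
Qed.

End sobolev_spaces.

Section lebesgue_spaces.
Context {R : realType} {d : nat}.
Variable D : set 'rV[R]_d.
Hypothesis mD : measurable D.
Local Notation leb := (lebesgue_row d).
Local Notation X := 'rV[R]_d.

Let L2obs (i : 'I_1) (q : X -> R) := q.

Let L2normE : L2norm D = fun q => (energy leb D L2obs q `^ 2^-1)%E.
Proof.
apply/funext => q; congr (_ `^ _)%E; apply: eq_integral => x _.
by rewrite big_ord1.
Qed.

Lemma seminormed_L2 : seminormed (L2 D) (L2norm D).
Proof.
rewrite L2normE; apply: (seminormed_energy mD) => //.
- exact: sqint0.
- by move=> a v w; exact: sqint_lin.
- by move=> i a v w _ _; exact: aeW.
Qed.

Lemma nrm_L2 q : L2 D q -> nrm (L2norm D) q ^+ 2 = sqi leb D q.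
Proof. by move=> qL; rewrite L2normE (@nrm_energy _ _ _ _ _ mD _ (L2 D)) ?big_ord1. Qed.

Lemma L2_complete r : 0 <= r -> r < 1 -> seminorm_complete (L2 D) (L2norm D) r.
Proof.
move=> r0 r1; rewrite L2normE; apply: energy_complete => //.
- exact: sqint0.
- by move=> a v w; exact: sqint_lin.
- by move=> i a v w _ _; exact: aeW.
move=> f g _ gL fg; exists (g ord0); split; first exact: gL.
by move=> i; rewrite (ord1 i); exact: aeW.
Qed.

Let L2vobs (i : 'I_d) (v : X -> X) x := v x ord0 i.

Let L2vnormE : L2norm_mx D = fun v : X -> X => (energy leb D L2vobs v `^ 2^-1)%E.
Proof.
apply/funext => v; congr (_ `^ _)%E; apply: eq_integral => x _.
by rewrite frob_dot_row; congr EFin; apply: eq_bigr => i _; rewrite expr2.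
Qed.

Lemma seminormed_L2v : seminormed (L2v D) (L2norm_mx D).
Proof.
rewrite L2vnormE; apply: (seminormed_energy mD) => //.
- by move=> i; have := sqint0 leb D; congr sqint; apply/funext => x; rewrite mxE.
- move=> a v w vL wL i; have := sqint_lin mD a (vL i) (wL i).
  by congr sqint; apply/funext => x; rewrite row_lin_entry.
- by move=> i v vL; exact: vL.
- by move=> i a v w _ _; apply: aeW => x _; exact: row_lin_entry.
Qed.

Lemma nrm_L2v v : L2v D v -> nrm (L2norm_mx D) v ^+ 2 = \sum_i sqi leb D (fun x => v x ord0 i).
Proof. by move=> vL; rewrite L2vnormE (@nrm_energy _ _ _ _ _ mD _ (L2v D))// => i w wL; exact: wL. Qed.

End lebesgue_spaces.

Section vector_fields.
Context {R : realType} {d : nat}.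
Variable D : set 'rV[R]_d.
Hypotheses (oD : open D) (bD : bounded_set D).
Local Notation leb := (lebesgue_row d).
Local Notation X := 'rV[R]_d.
Variable S : set (X -> R).
Hypotheses (S0 : S 0) (Slin : forall a q r, S q -> S r -> S (a *: q + r)).
Hypothesis SH : S `<=` H1 D.

Definition fields : set (X -> X) := [set v : X -> X | forall i, S (fun x => v x ord0 i)].

Lemma field0 : fields 0.
Proof. by move=> i; rewrite (_ : (fun x => _) = 0)//; apply/funext => x; rewrite mxE. Qed.

Lemma field_entry a (v w : X -> X) i : (fun x => (a *: v + w) x ord0 i) =
  a *: (fun x => v x ord0 i) + (fun x => w x ord0 i) :> (X -> R).
Proof. by apply/funext => x; rewrite row_lin_entry. Qed.

Lemma field_lin a v w : fields v -> fields w -> fields (a *: v + w).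
Proof. by move=> vS wS i; rewrite field_entry; exact: Slin. Qed.

(** The first index is the component; the second is read as in [H1obs]. *)
Definition H1vobs (p : 'I_d * 'I_d.+1) (v : X -> X) : X -> R :=
  H1obs D p.2 (fun x => v x ord0 p.1).

Lemma H1vobs_sqint p v : fields v -> sqint leb D (H1vobs p v).
Proof. by move=> vS; apply: H1obs_sqint => //; exact/SH/vS. Qed.

Lemma H1vobs_lin p a v w : fields v -> fields w ->
  {ae leb, forall x, D x -> H1vobs p (a *: v + w) x = a * H1vobs p v x + H1vobs p w x}.
Proof.
move=> vS wS; rewrite /H1vobs field_entry.
by apply: H1obs_lin => //; [exact/SH/vS|exact/SH/wS].
Qed.

Lemma H1normvE : H1normv D = fun v => (energy leb D H1vobs v `^ 2^-1)%E.
Proof.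
apply/funext => v; congr (_ `^ _)%E; apply: eq_integral => x _; congr EFin.
rewrite -(pair_bigA _ (fun i k => H1vobs (i, k) v x ^+ 2))/= frob_dot_row /frob_dot.
rewrite -big_split/=; apply: eq_bigr => i _.
rewrite big_ord_recl /H1vobs /H1obs/= unlift_none -expr2; congr (_ + _).
by apply: eq_bigr => j _; rewrite liftK mxE expr2.
Qed.

Lemma seminormed_H1v : seminormed fields (H1normv D).
Proof.
rewrite H1normvE; apply: seminormed_energy.
- exact: open_row_measurable.
- exact: field0.
- exact: field_lin.
- exact: H1vobs_sqint.
- exact: H1vobs_lin.
Qed.

Lemma nrm_H1v v : fields v -> nrm (H1normv D) v ^+ 2 = \sum_p sqi leb D (H1vobs p v).
Proof.
by move=> vS; rewrite H1normvE (@nrm_energy _ _ _ _ _ (open_row_measurable oD) _ fields)// => p w; exact: H1vobs_sqint.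
Qed.

Lemma sqi_H1vobs p v : fields v -> sqi leb D (H1vobs p v) <= nrm (H1normv D) v ^+ 2.
Proof.
move=> vS; rewrite H1normvE; apply: (@sqi_obs_le _ _ _ _ _ (open_row_measurable oD) _ fields) => //.
exact: H1vobs_sqint.
Qed.

End vector_fields.

(** * Hausdorff measure and zero traces *)

Section hausdorff_metric.
Context {R : realType} {d : nat} (s : nat).
Local Notation X := 'rV[R]_d.
Implicit Types (A B G Y : set X) (h : X -> R).
Local Open Scope ereal_scope.

Lemma hausdorff_pre_anti (delta delta' : R) A : (delta <= delta')%R ->
  hausdorff_pre s delta' A <= hausdorff_pre s delta A.
Proof.
move=> dd'; apply/ereal_inf_le_tmp => x [F [AF Fd]] <-; exists F => //; split => //.
by move=> k a b Fa Fb; exact: le_trans (Fd k a b Fa Fb) dd'.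
Qed.

Variable h : X -> R.
Hypothesis h_lip : forall x y, (`|h x - h y| <= eucl_dist x y)%R.

(** A covering set of diameter at most [delta < e] cannot meet both [A] and [B], so a cover of the
    union splits into disjoint parts covering each. *)
Lemma hausdorff_pre_separated (delta c e : R) A B : (delta < e)%R ->
  (forall x, A x -> (h x <= c)%R) -> (forall x, B x -> (c + e <= h x)%R) ->
  hausdorff_pre s delta A + hausdorff_pre s delta B <= hausdorff_pre s delta (A `|` B).
Proof.
move=> de Ac Bc; apply: le_ereal_inf_tmp => _ [F [ABF Fd] <-].
pose FA k := if `[< exists x, F k x /\ A x >] then F k else set0.
pose FB k := if `[< exists x, F k x /\ B x >] then F k else set0.
apply: (@le_trans _ _ (\sum_(k <oo) diam_pow s (FA k) + \sum_(k <oo) diam_pow s (FB k))).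
  apply: leeD; apply: ereal_inf_lbound.
    exists FA => //; split.
      move=> x Ax; have [k _ Fkx] := ABF x (or_introl Ax); exists k => //.
      by rewrite /FA asboolT//; exists x.
    by move=> k x y; rewrite /FA; case: ifP => // _; exact: Fd.
  exists FB => //; split.
    move=> x Bx; have [k _ Fkx] := ABF x (or_intror Bx); exists k => //.
    by rewrite /FB asboolT//; exists x.
  by move=> k x y; rewrite /FB; case: ifP => // _; exact: Fd.
rewrite -nneseriesD; [|by move=> *; exact: diam_pow_ge0..].
apply: lee_nneseries => [k _ _|k _]; first by rewrite adde_ge0// diam_pow_ge0.
rewrite /FA /FB; case: ifPn => [/asboolP[x [Fx Ax]]|_]; last first.
  rewrite diam_pow_set0 add0e; case: ifP => // _.
  by rewrite diam_pow_set0 diam_pow_ge0.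
case: ifPn => [/asboolP[y [Fy By]]|_]; last by rewrite diam_pow_set0 adde0.
exfalso; have h1 := Fd _ _ _ Fy Fx; have := le_trans (h_lip y x) h1.
by have h2 := Ac _ Ax; have h3 := Bc _ By; have := ler_norm (h y - h x); lra.
Qed.

(** The pre-measures grow as the mesh shrinks, so two meshes may be replaced by a smaller common
    one, below [e]. Finiteness of the right-hand side lets the two suprema be taken one after the
    other, by subtraction. *)
Lemma hausdorff_on_separated G (c e : R) A B : (0 < e)%R ->
  (forall x, A x -> (h x <= c)%R) -> (forall x, B x -> (c + e <= h x)%R) ->
  hausdorff_on s G A + hausdorff_on s G B <= hausdorff_on s G (A `|` B).
Proof.
move=> e0 Ac Bc.
have H_pre delta C : (0 < delta)%R -> hausdorff_pre s delta (C `&` G) <= hausdorff_on s G C.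
  by move=> d0; apply: ereal_sup_ubound; exists delta.
have pre_bd d1 d2 : (0 < d1)%R -> (0 < d2)%R ->
    hausdorff_pre s d1 (A `&` G) + hausdorff_pre s d2 (B `&` G) <=
    hausdorff_on s G (A `|` B).
  move=> d10 d20; pose dl : R := Num.min (Num.min d1 d2) (e / 2)%R.
  have e2 : (0 < e / 2)%R by rewrite divr_gt0.
  have dl0 : (0 < dl)%R by rewrite !lt_min d10 d20.
  apply: (@le_trans _ _ (hausdorff_pre s dl (A `&` G) + hausdorff_pre s dl (B `&` G))).
    by apply: leeD; apply: hausdorff_pre_anti; rewrite !ge_min lexx ?orbT.
  apply: le_trans (H_pre dl _ dl0); rewrite setIUl.
  apply: (@hausdorff_pre_separated _ c e) => [|x [/Ac]//|x [/Bc]//].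
  by rewrite (@le_lt_trans _ _ (e / 2)%R) ?ge_min ?lexx ?orbT//; lra.
have Hge0 C : 0 <= hausdorff_on s G C by exact: (outer_measure_ge0 (hausdorff_on s G)).
have [->|fin] := eqVneq (hausdorff_on s G (A `|` B)) +oo; first exact: leey.
have fin' : hausdorff_on s G (A `|` B) \is a fin_num by rewrite ge0_fin_numE// ltey.
rewrite -leeBrDr//; last first.
  by rewrite ge0_fin_numE//; apply: le_lt_trans (le_outer_measure (hausdorff_on s G) _ _ (@subsetUr _ A B)) _; rewrite ltey.
apply: ge_ereal_sup => _ [d1 /= d10 <-].
have pf : hausdorff_pre s d1 (A `&` G) \is a fin_num.
  rewrite ge0_fin_numE ?hausdorff_pre_ge0//; apply: le_lt_trans (H_pre d1 A d10) _.
  by apply: le_lt_trans (le_outer_measure (hausdorff_on s G) _ _ (@subsetUl _ A B)) _; rewrite ltey.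
rewrite leeBrDr; last first.
  by rewrite ge0_fin_numE//; apply: le_lt_trans (le_outer_measure (hausdorff_on s G) _ _ (@subsetUr _ A B)) _; rewrite ltey.
rewrite addeC -leeBrDr//; apply: ge_ereal_sup => _ [d2 /= d20 <-].
by rewrite leeBrDr// addeC; exact: pre_bd.
Qed.

(* The slices of [Y] between the levels c + 1/(k+2) and c + 1/(k+1) with k of a
   fixed parity are at positive distance from each other, so their measures are
   summable and the part of [Y] above the level c is the limit of the parts
   above c + 1/n, to which [hausdorff_on_separated] applies. *)
Lemma level_set_caratheodory G (c : R) :
  caratheodory_measurable (hausdorff_on s G) [set x | (c < h x)%R].
Proof.
apply: le_caratheodory_measurable => Y; pose m := hausdorff_on s G.
change (m (Y `&` [set x | (c < h x)%R]) + m (Y `&` ~` [set x | (c < h x)%R]) <= m Y).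
have m0 A : 0 <= m A by exact: (outer_measure_ge0 (hausdorff_on s G)).
have mono A B : A `<=` B -> m A <= m B by exact: (le_outer_measure (hausdorff_on s G)).
have [->|Yfin] := eqVneq (m Y) +oo; first exact: leey.
have Yoo : m Y < +oo by rewrite ltey.
pose t k : R := (c + k.+1%:R^-1)%R.
pose R_ k := Y `&` [set x | (t k.+1 < h x <= t k)%R].
have inv_lt (a b : nat) : (0 < a)%N -> (a < b)%N -> (b%:R^-1 < a%:R^-1 :> R)%R.
  by move=> a0 ab; rewrite ltf_pV2 ?posrE ?ltr_nat ?ltr0n// (leq_ltn_trans _ ab).
have inv_le (a b : nat) : (0 < a)%N -> (a <= b)%N -> (b%:R^-1 <= a%:R^-1 :> R)%R.
  by move=> a0 ab; rewrite lef_pV2 ?posrE ?ler_nat ?ltr0n// (leq_trans a0).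
(* The offset [o] selects the parity. Skipping every other slice leaves a gap between the new slice
   and the previous ones, to which separation applies. *)
have even_sum o n : \sum_(0 <= k < n) m (R_ (2 * k + o)%N) <=
    m [set x | exists2 k, (k < n)%N & R_ (2 * k + o)%N x].
  elim: n => [|n IH]; first by rewrite big_geq.
  rewrite big_nat_recr//=.
  apply: le_trans (leeD2r _ IH) _; rewrite addeC.
  set W := [set x | _].
  have [e e0 he] : exists2 e, (0 < e)%R & forall x, W x -> (t (2 * n + o)%N + e <= h x)%R.
    case: (posnP n) => [n0|n0]; first by exists 1%R => // x [k]; rewrite n0.
    (* The gap is the height of the skipped slice, of index [2 * n + o - 1]. *)
    exists ((2 * n + o)%:R^-1 - (2 * n + o).+1%:R^-1)%R.
      by rewrite subr_gt0 inv_lt//; lia.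
    move=> x [k kn [_ /= /andP[h1 _]]]; rewrite /t.
    have h2 : ((2 * n + o)%:R^-1 <= (2 * k + o).+2%:R^-1 :> R)%R by apply: inv_le => //; lia.
    apply: le_trans (ltW h1); rewrite /t -addrA lerD2l.
    by rewrite [leLHS]addrC subrK.
  apply: le_trans (@hausdorff_on_separated G (t (2 * n + o)%N) e _ _ e0 _ he) _.
    by move=> x [_ /= /andP[]].
  apply: mono => x [Rx|[k kn Rx]]; first by exists n.
  by exists k => //; exact: ltnW.
have sumY o n : \sum_(0 <= k < n) m (R_ (2 * k + o)%N) <= m Y.
  by apply: le_trans (even_sum o n) _; apply: mono => x [k _ []].
have sum2 n : \sum_(0 <= k < 2 * n) m (R_ k) =
    \sum_(0 <= k < n) m (R_ (2 * k + 0)%N) + \sum_(0 <= k < n) m (R_ (2 * k + 1)%N).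
  elim: n => [|n IH]; first by rewrite muln0 !big_geq// adde0.
  rewrite mulnS add2n !big_nat_recr//= IH addn0 addn1 -!addeA; congr (_ + _).
  by rewrite addeCA addeA.
have sumoo : \sum_(0 <= k <oo) m (R_ k) < +oo.
  apply: (@le_lt_trans _ _ (m Y + m Y)); last by rewrite lte_add_pinfty.
  apply: lime_le; first by apply: is_cvg_nneseries.
  apply: nearW => n; apply: (@le_trans _ _ (\sum_(0 <= k < 2 * n) m (R_ k))).
    rewrite [leRHS](big_cat_nat (n := n))//= ?leeDl ?sume_ge0//; lia.
  by rewrite sum2 leeD.
have tail := nneseries_tail_cvg sumoo (fun k _ => m0 (R_ k)).
apply/lee_addgt0Pr => e e0.
have [n /= hn] : exists n, \sum_(n <= k <oo) m (R_ k) <= e%:E.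
  by have [N _ hN] := cvge0_small tail e0; exists N; exact: hN N (leqnn N).
pose Q := Y `&` [set x | (t n < h x)%R].
(* A point above [c] is above the level [t n] or in a slice of index at least [n], found from the
   least [j] with [t j < h x]. *)
have Qsub : Y `&` [set x | (c < h x)%R] `<=` Q `|` \bigcup_(k in ~` `I_n) R_ k.
  move=> x [Yx /= cx]; have [tn|tn] := ltP (t n) (h x); [by left|right].
  have ex : exists j, (t j < h x)%R.
    have hc0 : (0 < h x - c)%R by rewrite subr_gt0.
    exists (Num.truncn (h x - c)^-1); rewrite /t -ltrBrDl.
    rewrite invf_plt ?posrE// ?invr_gt0//; exact: truncnS_gt.
  case: (ex_minnP ex) => j tj jmin.
  have nj : (n < j)%N.
    rewrite ltnNge; apply/negP => jn; move: tn; rewrite leNgt => /negP; apply.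
    by apply: le_lt_trans tj; rewrite /t lerD2l inv_le.
  case: j => // j in tj jmin nj *; exists j; first by move=> /=; apply/negP; rewrite -leqNgt.
  by split => //=; rewrite tj/= leNgt; apply/negP => /jmin; rewrite ltnn.
apply: (@le_trans _ _ ((m Q + \sum_(n <= k <oo) m (R_ k)) + m (Y `&` ~` [set x | (c < h x)%R]))).
  apply: leeD => //; apply: le_trans (mono _ _ Qsub) _.
  apply: le_trans (outer_measureU2 (hausdorff_on s G) _ _) _; apply: leeD => //.
  exact: (outer_measure_sigma_subadditive_tail (hausdorff_on s G)).
rewrite addeAC; apply: leeD => //.
rewrite addeC; apply: le_trans (@hausdorff_on_separated G c (n.+1%:R^-1) _ _ _ _ _) _.
- by rewrite invr_gt0.
- by move=> x [_ /negP]; rewrite -leNgt.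
- by move=> x [_ /ltW].
- by apply: mono => x [[]|[]].
Qed.

End hausdorff_metric.

Section hausdorff_continuous.
Context {R : realType} {d : nat} (s : nat) (G : set 'rV[R]_d).
Local Notation X := 'rV[R]_d.

Lemma coord_le_eucl_dist (i : 'I_d) (x y : X) : `|x ord0 i - y ord0 i| <= eucl_dist x y.
Proof.
rewrite /eucl_dist frob_dot_row -sqrtr_sqr ler_wsqrtr//.
rewrite (bigD1 i)//= !mxE -expr2 lerDl; apply: sumr_ge0 => j _.
by rewrite -expr2 sqr_ge0.
Qed.

(** Caratheodory sets form a sigma-algebra. It contains the coordinate half-spaces, since
    coordinates are 1-Lipschitz, hence the orthants, which generate the Borel sets. *)
Lemma borel_caratheodory (A : set X) : measurable A ->
  caratheodory_measurable (hausdorff_on s G) A.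
Proof.
rewrite row_measurableE; apply: smallest_sub.
  have := sigma_algebra_measurable (caratheodory_type (hausdorff_on s G)); exact.
move=> _ [c _ <-].
pose H i : set (caratheodory_type (hausdorff_on s G)) := [set x : X | c ord0 i < x ord0 i].
have mH i : measurable (H i).
  exact: (@level_set_caratheodory R d s (fun x : X => x ord0 i) (coord_le_eucl_dist i)).
have -> : orthant c = \bigcap_(i in [set: 'I_d]) H i.
  by apply/seteqP; split => x h i; [move=> _; exact: h|exact: h].
by apply: (fin_bigcap_measurable (F := H)); [exact: finite_finset|move=> i _; exact: mH].
Qed.

Lemma continuous_caratheodory (f : X -> R) : continuous f ->
  measurable_fun [set: caratheodory_type (hausdorff_on s G)] f.
Proof.
move=> cf _ Y mY; rewrite setTI; apply: borel_caratheodory.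
by have := continuous_row_measurable cf measurableT mY; rewrite setTI.
Qed.

End hausdorff_continuous.

Lemma integral_sq_lin (R : realType) d (T : measurableType d)
    (mu : {measure set T -> \bar R}) a (q r : T -> R) :
  measurable_fun setT q -> measurable_fun setT r ->
  (\int[mu]_x ((a * q x + r x) ^+ 2)%:E <=
   (2 * a ^+ 2)%:E * \int[mu]_x ((q x) ^+ 2)%:E + 2%:E * \int[mu]_x ((r x) ^+ 2)%:E)%E.
Proof.
move=> mq mr.
have mc (f : T -> R) : measurable_fun setT f -> measurable_fun setT (fun x => ((f x) ^+ 2)%:E).
  by move=> mf; apply/measurable_EFinP; exact: measurable_funX.
have a0 : 0 <= 2 * a ^+ 2 by rewrite mulr_ge0// sqr_ge0.
have sq0 (f : T -> R) x : (0 <= ((f x) ^+ 2)%:E)%E by rewrite lee_fin sqr_ge0.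
rewrite -!ge0_integralZl_EFin//; [|by apply: mc..].
rewrite -ge0_integralD//; first last.
- by apply: measurable_funeM; exact: mc.
- by move=> x _; rewrite mule_ge0.
- by apply: measurable_funeM; exact: mc.
- by move=> x _; rewrite mule_ge0.
apply: ge0_le_integral => //.
- by move=> x _; exact: (sq0 (fun y => a * q y + r y)).
- by apply: (mc (fun y => a * q y + r y)); apply: measurable_funD => //; exact: measurable_funM.
- by apply: emeasurable_funD; apply: measurable_funeM; exact: mc.
- move=> x _; rewrite -!EFinM -EFinD lee_fin.
  by have := sqr_ge0 (a * q x - r x); nra.
Qed.

(** * Closed subspaces: zero trace and zero mean *)

Section trace_zero.
Context {R : realType} {d : nat}.
Variable D : set 'rV[R]_d.
Hypotheses (oD : open D) (bD : bounded_set D).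
Variable Gam : set 'rV[R]_d.
Local Notation leb := (lebesgue_row d).
Local Notation X := 'rV[R]_d.
Local Notation n := (nrm (H1norm D)).

Let gam : {outer_measure set X -> \bar R} := hausdorff_on d.-1 Gam.
Let gam_mu : {measure set (caratheodory_type gam) -> \bar R} := gam.

Definition trace_sq (q : X -> R) : \bar R :=
  (\int[gam_mu]_x ((q x) ^+ 2)%:E)%E.

Lemma trace_sq_ge0 q : (0 <= trace_sq q)%E.
Proof. by rewrite /trace_sq; apply: integral_ge0 => x _; rewrite lee_fin sqr_ge0. Qed.

(** Additivity of the integral requires measurable integrands for the Hausdorff outer measure, which
    continuity of the approximants provides. *)
Lemma trace_sq_lin a (q r : X -> R) : continuous q -> continuous r ->
  (trace_sq (a *: q + r)%R <= (2 * a ^+ 2)%:E * trace_sq q + 2%:E * trace_sq r)%E.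
Proof.
move=> cq cr; apply: (@integral_sq_lin R _ (caratheodory_type gam) gam_mu a q r);
  exact: continuous_caratheodory.
Qed.

Let SN := seminormed_H1 oD bD (H1_0fun oD bD) (H1_lin oD bD) (@subset_refl _ _).

(** One smooth approximant per tolerance replaces the approximating sequence, so that linearity and
    closedness become choices of tolerances. *)
Lemma H1_0P q : H1_0 D Gam q <-> H1 D q /\ forall e, 0 < e ->
  exists phi, [/\ smooth phi, n (phi - q) <= e & (trace_sq phi <= e%:E)%E].
Proof.
have tE (phi : X -> R) : trace_sq phi = (@integral _ (caratheodory_type (hausdorff_on d.-1 Gam)) R
    (hausdorff_on d.-1 Gam) setT (fun x => ((phi x - 0) ^+ 2)%:E))%E.
  by apply: eq_integral => x _; rewrite subr0.
split=> [[qH [phi [sphi h1 h2]]]|[qH hq]]; split => //.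
  move=> e e0.
  have [N _ hN] := cvge0_small h1 e0; have [M _ hM] := cvge0_small h2 e0.
  exists (phi (maxn N M)); split; first exact: sphi.
    have := hN _ (leq_maxl N M); rewrite (nrmE SN) ?lee_fin//.
    by apply: (subspB SN) => //; exact: H1_smooth.
  by rewrite tE; exact: hM _ (leq_maxr N M).
have /choice[phi hphi] (k : nat) : exists phi,
    [/\ smooth phi, n (phi - q) <= 2^-1 ^+ k & (trace_sq phi <= (2^-1 ^+ k)%:E)%E].
  by apply: hq; rewrite exprn_gt0.
have cv : (fun m => 2^-1 ^+ m) @ \oo --> (0 : R).
  by apply: cvg_expr; rewrite gtr0_norm; lra.
exists phi; split.
- by move=> k; have [] := hphi k.
- apply/(cvg_nrmP SN) => [k|//|].
    by have [s _ _] := hphi k; exact: H1_smooth.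
  apply: (@squeeze_cvgr _ _ _ _ (cst 0) (fun k => 2^-1 ^+ k)) => //; last exact: cvg_cst.
  by apply: nearW => k; rewrite (nrm_ge0 SN)/=; have [] := hphi k.
- apply: (@squeeze_cvge _ _ _ _ (cst 0%E) _ (fun k => (2^-1 ^+ k)%:E)); last 2 first.
  + exact: cvg_cst.
  + by apply/fine_cvgP; split => //; exact: nearW.
  apply: nearW => k; rewrite -tE trace_sq_ge0/=.
  by have [] := hphi k.
Qed.

Lemma H1_0_sub : H1_0 D Gam `<=` H1 D.
Proof. by move=> q []. Qed.

Lemma H1_0_0 : H1_0 D Gam 0.
Proof.
apply/H1_0P; split; first exact: H1_0fun.
move=> e e0; exists 0; split; first exact: smooth_cst.
  by rewrite subr0 (nrm0 SN) ltW.
rewrite /trace_sq integral0_eq ?lee_fin ?ltW// => x _.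
by rewrite [X in X ^+ 2](_ : _ = 0)// expr0n.
Qed.

Lemma H1_0_lin a q r : H1_0 D Gam q -> H1_0 D Gam r -> H1_0 D Gam (a *: q + r).
Proof.
move=> /H1_0P[qH hq] /H1_0P[rH hr]; apply/H1_0P; split; first exact: H1_lin.
(* [c] is the sum of the two amplifications: [|a| + 1] for the H1 distance and [2 * a ^+ 2 + 2] for
   the trace. *)
move=> e e0; pose c := 2 * a ^+ 2 + `|a| + 3.
have a2 := sqr_ge0 a; have an := normr_ge0 a.
have c0 : 0 < c by rewrite /c; lra.
have ec : 0 < e / c by rewrite divr_gt0.
have ecE : 2 * (a ^+ 2 * (e / c)) + `|a| * (e / c) + 3 * (e / c) = e.
  by rewrite -{4}(divfK (lt0r_neq0 c0) e) /c; ring.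
have a2e : 0 <= a ^+ 2 * (e / c) by rewrite mulr_ge0// ltW.
have ae : 0 <= `|a| * (e / c) by rewrite mulr_ge0// ltW.
have [phi [sphi p1 p2]] := hq _ ec; have [psi [spsi q1 q2]] := hr _ ec.
have pH := H1_smooth oD bD sphi; have sH := H1_smooth oD bD spsi.
exists (a *: phi + psi); split; first exact: smooth_lin.
  have -> : a *: phi + psi - (a *: q + r) = a *: (phi - q) + (psi - r).
    by rewrite scalerBr opprD addrACA.
  have Hd := subspB SN pH qH; have Hd' := subspB SN sH rH.
  apply: le_trans (nrmD SN (subspZ SN a Hd) Hd') _; rewrite (nrmZ SN a Hd).
  apply: le_trans (lerD (ler_wpM2l an p1) q1) _.
  by clear p1 p2 q1 q2; lra.
apply: le_trans (trace_sq_lin a (smooth_continuous sphi) (smooth_continuous spsi)) _.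
apply: (@le_trans _ _ ((2 * a ^+ 2)%:E * (e / c)%:E + 2%:E * (e / c)%:E)%E).
  apply: leeD; first by apply: lee_wpmul2l p2; rewrite lee_fin mulr_ge0.
  by apply: lee_wpmul2l q2; rewrite lee_fin.
rewrite -!EFinM -EFinD lee_fin.
by rewrite -mulrA; clear p1 p2 q1 q2; lra.
Qed.

Lemma H1_0_closed (f : nat -> X -> R) q : (forall k, H1_0 D Gam (f k)) -> H1 D q ->
  (fun k => n (f k - q)) @ \oo --> 0 -> H1_0 D Gam q.
Proof.
move=> fH qH fq; apply/H1_0P; split => // e e0.
have e2 : 0 < e / 2 by rewrite divr_gt0.
move/cvgrPdist_le : fq => /(_ _ e2)[N _ /(_ _ (leqnn N))]; rewrite /= sub0r normrN.
rewrite (ger0_norm (nrm_ge0 SN _)) => hN.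
have /H1_0P[fNH /(_ _ e2)[phi [sphi p1 p2]]] := fH N.
exists phi; split => //; last by apply: le_trans p2 _; rewrite lee_fin; clear hN p1; lra.
apply: le_trans (nrm_triangle SN (H1_smooth oD bD sphi) fNH qH) _.
by apply: le_trans (lerD p1 hN) _; clear hN p1; lra.
Qed.

End trace_zero.

Section mean_zero.
Context {R : realType} {d : nat}.
Variable D : set 'rV[R]_d.
Hypotheses (oD : open D) (bD : bounded_set D).
Local Notation leb := (lebesgue_row d).
Local Notation X := 'rV[R]_d.
Local Notation n := (nrm (H1norm D)).

Let mD : measurable D := open_row_measurable oD.
Let Doo : (leb D < +oo)%E := bounded_set_lty mD bD.
Let SN := seminormed_H1 oD bD (H1_0fun oD bD) (H1_lin oD bD) (@subset_refl _ _).

Lemma mean_zero0 : (H1 D `&` L2_0 D) 0.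
Proof.
have H0 := H1_0fun oD bD; split => //; split; first exact: H0.1.
by rewrite /= Rintegral_eq0.
Qed.

Lemma mean_zero_lin a q r : (H1 D `&` L2_0 D) q -> (H1 D `&` L2_0 D) r ->
  (H1 D `&` L2_0 D) (a *: q + r).
Proof.
move=> [qH [qL /= q0]] [rH [rL /= r0]]; have H := H1_lin oD bD a qH rH.
split => //; split; first exact: H.1.
rewrite /= (Rintegral_lin (a := a) (f := q) (g := r) mD) ?q0 ?r0 ?mulr0 ?addr0//.
- exact: (sqint_rintegrable1 mD Doo qL).
- exact: (sqint_rintegrable1 mD Doo rL).
Qed.

(** The mean is the pairing with the constant 1, which is square integrable because [D] is
    bounded. *)
Lemma mean_zero_closed (f : nat -> X -> R) q : (forall k, (H1 D `&` L2_0 D) (f k)) ->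
  H1 D q -> (fun k => n (f k - q)) @ \oo --> 0 -> (H1 D `&` L2_0 D) q.
Proof.
move=> fH qH fq; split => //; split; first exact: qH.1.
have L1 : L2 D (fun=> 1 : R).
  by apply: (sqint_bounded (C := 1) mD Doo) => // x _; rewrite normr1.
have h : (fun k => sqi leb D (fun x => f k x - q x)) @ \oo --> 0.
  apply: (@squeeze_cvgr _ _ _ _ (cst 0) (fun k => n (f k - q) ^+ 2)).
  - apply: nearW => k; rewrite sqi_ge0/=.
    have S := subspB SN (fH k).1 qH.
    have := sqi_H1obs oD (@subset_refl _ (H1 D)) ord0 S.
    by rewrite /H1obs unlift_none.
  - exact: cvg_cst.
  - by rewrite -(mulr0 0); under eq_fun do rewrite expr2; exact: cvgM.
have := L2_closed oD (fun k => (fH k).1.1) qH.1 L1 h.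
under eq_fun => k do under eq_Rintegral do rewrite mulr1.
under [in X in _ --> X]eq_Rintegral do rewrite mulr1.
move=> h1; apply: (cvg_unique _ h1); first exact: norm_hausdorff.
rewrite (_ : (fun k => _) = fun=> 0); first exact: cvg_cst.
by apply/funext => k; have [_ [_]] := fH k.
Qed.

End mean_zero.

(** * Forms on random fields *)

Section ae_convergence.
Context {R : realType} {disp : measure_display} {T : measurableType disp}.
Variables (mu : {measure set T -> \bar R}) (A : set T).
Hypothesis mA : measurable A.

(** The sum of the squares is integrable, so the series converges at almost every point and its
    terms tend to 0. *)
Lemma sqi_summable_cvg (u : nat -> T -> R) (C r : R) : 0 <= C -> 0 <= r -> r < 1 ->
  (forall k, sqint mu A (u k)) -> (forall k, sqi mu A (u k) <= C * r ^+ k) ->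
  {ae mu, forall x, A x -> (fun k => u k x) @ \oo --> 0}.
Proof.
move=> C0 r0 r1 hu ur.
pose w k x : \bar R := ((u k x) ^+ 2)%:E.
have mw k : measurable_fun A (w k).
  by apply/measurable_EFinP; apply: measurable_funX; exact: (hu k).1.
have w0 k x : (0 <= w k x)%E by rewrite lee_fin sqr_ge0.
pose W x := (\sum_(0 <= k <oo) w k x)%E.
have W0 x : (0 <= W x)%E by apply: nneseries_ge0 => k _ _; exact: w0.
have mW : measurable_fun A W by apply: ge0_emeasurable_sum.
have iW : mu.-integrable A W.
  apply/integrableP; split => //.
  under eq_integral => x _ do rewrite gee0_abs//.
  rewrite integral_nneseries//.
  apply: (@le_lt_trans _ _ (\sum_(0 <= k <oo) (C * r ^+ k)%:E)%E).
    by apply: lee_nneseries => k _; [move=> _; exact: integral_ge0|rewrite (sqiE mA (hu k)) lee_fin].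
  under eq_eseriesr do rewrite EFinM.
  rewrite nneseriesZl; last by move=> k _; rewrite lee_fin exprn_ge0.
  apply: le_lt_trans (lee_wpmul2l _ (nneseries_geometric r0 r1)) _; first by rewrite lee_fin.
  by rewrite -EFinM ltry.
apply: filterS (integrable_ae mA iW) => x /[apply] Wx.
have Woo : (W x < +oo)%E by rewrite -ge0_fin_numE.
have tail := nneseries_tail_cvg Woo (fun k _ => w0 k x).
apply/cvgrPdist_le => e e0.
have := cvge0_small tail (exprn_gt0 2 e0); apply: filterS => k hk.
rewrite sub0r normrN -[leRHS]ger0_norm ?(ltW e0)// -ler_sqr ?nnegrE// !real_normK ?num_real//.
rewrite -lee_fin; apply: le_trans hk.
apply: le_trans (nneseries_lim_ge k.+1 (fun i _ _ => w0 i x)).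
by rewrite big_nat1.
Qed.

End ae_convergence.

(** * Jointly measurable representatives of observed random fields *)

Section joint_representation.
Context {R : realType} {d1 d2 : measure_display}.
Context {X : measurableType d1} {Th : measurableType d2}.
Variables (m : {measure set X -> \bar R}) (D : set X).
Hypothesis mD : measurable D.
Context {V : lmodType R}.
Variables (S : set V) (N : V -> \bar R).
Hypothesis SN : seminormed S N.
Local Notation n := (nrm N).

(** Abstracts values, components, partial derivatives and divergences. The null set in [obs_linear]
    depends on [a], [v] and [w], because gradients are chosen representatives. *)
Record observable (o : V -> X -> R) (C : R) : Prop := Observable {
  obs_const : 0 <= C;
  obs_sqint : forall v, S v -> sqint m D (o v);
  obs_linear : forall a v w, S v -> S w ->
    {ae m, forall x, D x -> o (a *: v + w) x = a * o v x + o w x};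
  obs_bound : forall v, S v -> sqi m D (o v) <= C * n v ^+ 2 }.

Variables (o : V -> X -> R) (C : R).
Hypothesis oC : observable o C.

Lemma obs_sub v w : S v -> S w ->
  {ae m, forall x, D x -> o (v - w) x = o v x - o w x}.
Proof.
move=> Sv Sw; have := obs_linear oC (-1) Sw Sv.
apply: filterS => x /[apply].
by rewrite scaleN1r mulN1r (addrC (- w)) (addrC (- o w x)).
Qed.

Let mDT : measurable (D `*` [set: Th]). Proof. exact: measurableX. Qed.

(** [o] applied to each listed value: jointly measurable by construction, and for each outcome equal
    to [o] of the simple function only for almost every point, by linearity. *)
Let H (s : seq (set Th * V)) (z : X * Th) : R := \sum_(p <- s) (\1_(p.1) z.2 : R) * o p.2 z.1.

Let mH s : is_simple S s -> measurable_fun (D `*` [set: Th]) (H s).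
Proof.
elim: s => [|p s IH] hs.
  rewrite (_ : H _ = cst 0); first exact: measurable_cst.
  by apply/funext => z; rewrite /H big_nil.
have [mp Sp {}/IH ms] := (is_simple_cons S p s).1 hs.
rewrite (_ : H _ = fun z => (\1_(p.1) z.2 : R) * o p.2 z.1 + H s z); last first.
  by apply/funext => z; rewrite /H big_cons.
apply: measurable_funD => //; apply: measurable_funM.
  apply: measurable_funTS; apply: measurableT_comp => //.
have mo := (obs_sqint oC Sp).1.
have := @measurable_comp _ _ _ _ _ _ D (o p.2) (D `*` [set: Th]) fst mD.
apply => //; first by move=> _ [[x t] [Dx _] <-].
exact: measurable_funTS.
Qed.

Let HE s t : is_simple S s -> {ae m, forall x, D x -> H s (x, t) = o (simple_fun s t) x}.
Proof.
elim: s => [|p s IH] hs.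
  have := obs_sub (seminormed0 SN) (seminormed0 SN).
  by apply: filterS => x /[apply]; rewrite subr0 simple_fun_nil /H big_nil subrr => ->.
have [mp Sp /[dup] Ss /IH] := (is_simple_cons S p s).1 hs.
have := obs_linear oC (\1_(p.1) t : R) Sp (simple_fun_in t SN Ss).
apply: filterS2 => x h1 h2 Dx.
by rewrite simple_fun_cons h1// -h2// /H big_cons.
Qed.

(* At [t], use the first simple approximation within 4^-j of [f t]: this index
   depends measurably on [t], and the rate makes the observables converge almost
   everywhere in [x] for every [t], not only for almost every one. *)
Lemma joint_representation (f : Th -> V) : strongly_measurable setT S N f ->
  exists F : X * Th -> R, measurable_fun (D `*` [set: Th]) F /\
    forall t, {ae m, forall x, D x -> F (x, t) = o (f t) x}.
Proof.
move=> hf; have /(strongly_measurableP _ SN)[Sf [s [hs sf]]] := hf.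
pose A j k := [set t | n (simple_fun (s k) t - f t) < 4^-1 ^+ j].
have mA j k : measurable (A j k).
  have h := measurable_nrm_simple_dist measurableT SN hf (hs k).
  have mlt : measurable_fun [set: Th] (fun t => n (simple_fun (s k) t - f t) < 4^-1 ^+ j).
    by apply: measurable_fun_ltr => //; exact: measurable_cst.
  by have := mlt measurableT [set true] I; rewrite setTI; congr measurable;
    apply/seteqP; split => t.
have exA j t : exists k, `[< A j k t >].
  have e0 : 0 < 4^-1 ^+ j :> R by rewrite exprn_gt0// invr_gt0.
  move/cvgrPdist_lt : (sf t I) => /(_ _ e0)[k _ /(_ _ (leqnn k))].
  rewrite /= sub0r normrN ger0_norm ?(nrm_ge0 SN)// => h; exists k; exact/asboolP.
pose K j t := ex_minn (exA j t).
have KA j t : A j (K j t) t by rewrite /K; case: ex_minnP => k /asboolP.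
have mK j k : measurable [set t | K j t = k].
  rewrite (_ : [set t | _] = A j k `\` \bigcup_(i in `I_k) A j i).
    by apply: measurableD => //; apply: bigcup_measurable.
  apply/seteqP; split => t /=.
    move=> <-; split => // -[i /= ik Ai]; move: ik; rewrite /K.
    by case: ex_minnP => k' _ /(_ i (asboolT Ai)); rewrite leqNgt => /negP.
  move=> [Ak nA]; rewrite /K; case: ex_minnP => k' /asboolP Ak' mink.
  apply/eqP; rewrite eqn_leq mink ?asboolT//= leqNgt; apply/negP => kk.
  by apply: nA; exists k'.
pose h j z := H (s (K j z.2)) z.
have mh j : measurable_fun (D `*` [set: Th]) (h j).
  move=> _ Y mY.
  rewrite (_ : _ `&` _ = \bigcup_k ((D `*` [set t | K j t = k]) `&`
      ((D `*` [set: Th]) `&` (H (s k) @^-1` Y)))).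
    apply: bigcup_measurable => k _; apply: measurableI.
      by apply: measurableX => //; exact: mK.
    exact: mH.
  apply/seteqP; split => [z [[Dz _] hz]|z [k _ [[Dz /= kz] [_ hz]]]].
    by exists (K j z.2) => //; split; split.
  by split => //; rewrite /h /= kz.
(* The upper limit is measurable without knowing where the sequence converges; [fine] makes it real
   valued. *)
pose F z := fine (limn_esup (fun j => (h j z)%:E)).
exists F; split.
  apply: measurableT_comp => //.
  by apply: measurable_fun_limn_esup => j; apply/measurable_EFinP.
move=> t.
pose g j := simple_fun (s (K j t)) t.
have Sg j : S (g j) by exact: (simple_fun_in t SN (hs _)).
pose u j x := o (g j) x - o (f t) x.
have hu j : sqint m D (u j) by exact: (sqintB mD (obs_sqint oC (Sg j)) (obs_sqint oC (Sf t I))).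
(* [K j t] guarantees a distance below [4^-1 ^+ j] at this very [t], hence the rate [16^-1] for the
   squares. *)
have ur j : sqi m D (u j) <= `|C| * 16^-1 ^+ j.
  have hS := subspB SN (Sg j) (Sf t I).
  rewrite (@sqi_ae _ _ _ _ _ mD (u j) (o (g j - f t))).
  - apply: le_trans (obs_bound oC hS) _.
    apply: (@le_trans _ _ (`|C| * n (g j - f t) ^+ 2)).
      by rewrite ler_wpM2r ?sqr_ge0// ler_norm.
    rewrite ler_wpM2l// (_ : 16^-1 = 4^-1 ^+ 2 :> R); last by field.
    rewrite -exprM mulnC exprM lerXn2r ?nnegrE ?exprn_ge0 ?(nrm_ge0 SN)//.
    by apply: ltW; exact: KA.
  - exact: (hu j).1.
  - exact: (obs_sqint oC hS).1.
  - by apply: filterS (obs_sub (Sg j) (Sf t I)) => x /[apply] ->.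
have r0 : 0 <= 16^-1 :> R by lra.
have r1 : 16^-1 < 1 :> R by lra.
have cvu := sqi_summable_cvg mD (normr_ge0 C) r0 r1 hu ur.
have hE : {ae m, forall x, D x -> forall j, h j (x, t) = o (g j) x}.
  have := ae_foralln (fun j => HE t (hs (K j t))).
  by apply: filterS => x hx Dx j; exact: hx.
move: cvu hE; apply: filterS2 => x /[swap] hE /[swap] Dx /(_ Dx) cvu.
have c : (fun j => h j (x, t)) @ \oo --> o (f t) x.
  rewrite (_ : (fun j => _) = fun j => u j x + o (f t) x); last first.
    by apply/funext => j; rewrite hE// subrK.
  by rewrite -[X in _ --> X]add0r; apply: cvgD => //; exact: cvg_cst.
have ce : (fun j => (h j (x, t))%:E) @ \oo --> (o (f t) x)%:E.
  by apply: cvg_EFin => //; exact: nearW.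
rewrite /F is_cvg_limn_esupE; last by apply/cvg_ex; exists (o (f t) x)%:E.
by have /cvg_lim -> := ce.
Qed.

End joint_representation.

Section quadratic_bound.
Context {R : realType} {V1 V2 : lmodType R}.
Variables (S1 : set V1) (N1 : V1 -> \bar R) (S2 : set V2) (N2 : V2 -> \bar R).
Hypotheses (SN1 : seminormed S1 N1) (SN2 : seminormed S2 N2).
Local Notation n1 := (nrm N1).
Local Notation n2 := (nrm N2).

(** Replacing [v] by [t *: v] and [w] by [t^-1 *: w] does not change [beta v w]; with
    [t ^+ 2 = n2 w / n1 v] the two squares balance and sum to [2 * n1 v * n2 w]. *)
Lemma bounded_bilinear_sq (beta : V1 -> V2 -> R) (K : R) : 0 <= K ->
  (forall w, S2 w -> linear_on S1 (beta ^~ w)) ->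
  (forall v, S1 v -> linear_on S2 (beta v)) ->
  (forall v w, S1 v -> S2 w -> `|beta v w| <= K * (n1 v ^+ 2 + n2 w ^+ 2)) ->
  bounded_bilinear S1 N1 S2 N2 beta (2 * K).
Proof.
move=> K0 bl br hb; split => // v w Sv Sw.
have scaled t : 0 < t -> `|beta v w| <= K * (t ^+ 2 * n1 v ^+ 2 + t^-1 ^+ 2 * n2 w ^+ 2).
  move=> t0; have h := hb _ _ (subspZ SN1 t Sv) (subspZ SN2 t^-1 Sw).
  have Stv := subspZ SN1 t Sv.
  rewrite (linear_onZ SN2 t^-1 (br _ Stv) Sw) (linear_onZ SN1 t (bl _ Sw) Sv) in h.
  rewrite mulrA mulVf ?gt_eqF// mul1r in h.
  apply: le_trans h _; rewrite (nrmZ SN1 t Sv) (nrmZ SN2 t^-1 Sw) !exprMn.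
  by rewrite !real_normK ?num_real.
have a0 := nrm_ge0 SN1 v; have b0 := nrm_ge0 SN2 w.
move: a0 b0 scaled; generalize (n1 v) (n2 w) `|beta v w| => a b x a0 b0 scaled.
(* The shift by [e] keeps the ratio meaningful when a norm vanishes; it tends to 0 at the end. *)
have small e : 0 < e -> x <= 2 * K * (a + e) * (b + e).
  move=> e0; have a1 : 0 < a + e by lra.
  have b1 : 0 < b + e by lra.
  pose t := Num.sqrt ((b + e) / (a + e)).
  have t0 : 0 < t by rewrite sqrtr_gt0 divr_gt0.
  have t2 : t ^+ 2 = (b + e) / (a + e) by rewrite sqr_sqrtr// divr_ge0// ltW.
  have t2' : t^-1 ^+ 2 = (a + e) / (b + e) by rewrite exprVn t2 invf_div.
  apply: le_trans (scaled t t0) _; rewrite t2 t2' [leRHS](_ : _ = K * (2 * ((a + e) * (b + e)))); last by ring.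
  rewrite ler_wpM2l//.
  have -> : 2 * ((a + e) * (b + e)) =
    (b + e) / (a + e) * (a + e) ^+ 2 + (a + e) / (b + e) * (b + e) ^+ 2.
    by field; rewrite !gt_eqF.
  by apply: lerD; apply: ler_wpM2l; rewrite ?divr_ge0 ?lerXn2r ?nnegrE//; lra.
have cv : (fun k : nat => 2 * K * (a + k.+1%:R^-1) * (b + k.+1%:R^-1)) @ \oo --> 2 * K * a * b.
  have h : (fun k : nat => k.+1%:R^-1) @ \oo --> (0 : R) := @cvg_harmonic R.
  rewrite -[in X in _ --> X](addr0 a) -[in X in _ --> X](addr0 b).
  by apply: cvgM; [apply: cvgMr|]; apply: cvgD => //; exact: cvg_cst.
rewrite -(cvg_lim _ cv)//; apply: limr_ge.
  by apply/cvg_ex; exists (2 * K * a * b).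
by apply: nearW => k; apply: small; rewrite invr_gt0.
Qed.

End quadratic_bound.

Lemma sqr_sum_sub (R : realType) (I : finType) (a b : I -> R) (e : R) : 0 < e ->
  \sum_i (a i + b i) ^+ 2 <= (1 + e) * \sum_i a i ^+ 2 + (1 + e^-1) * \sum_i b i ^+ 2.
Proof.
move=> e0; rewrite !mulr_sumr -big_split/=; apply: ler_sum => i _; exact: young_sqrD.
Qed.

Lemma sum_mul_le (R : realType) (I : finType) (a b : I -> R) :
  `|\sum_i a i * b i| <= 2^-1 * (\sum_i a i ^+ 2 + \sum_i b i ^+ 2).
Proof.
apply: le_trans (ler_norm_sum _ _ _) _.
rewrite -big_split/= mulr_sumr; apply: ler_sum => i _.
by rewrite ler_norml; have := sqr_ge0 (a i - b i); have := sqr_ge0 (a i + b i); nra.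
Qed.

Section random_fields.
Context {R : realType} {d : nat} {disp : measure_display} {Th : measurableType disp}.
Variables (P : probability Th R) (D : set 'rV[R]_d).
Hypothesis mD : measurable D.
Local Notation X := 'rV[R]_d.
Local Notation leb := (lebesgue_row d).
Local Notation M2 := (lebesgue_row d \x P)%E.
Local Notation A2 := (D `*` [set: Th]).
Local Notation mT := (@measurableT _ Th).

Let mA2 : measurable A2. Proof. exact: measurableX. Qed.

Section representative.
Context {V : lmodType R}.
Variables (S : set V) (N : V -> \bar R).
Hypothesis SN : seminormed S N.
Local Notation bL := (bochnerL2 P setT S N).
Local Notation bN := (bochner_norm P setT N).

(** Agreement is required for every outcome [t], so that it can be inserted into the inner integral
    of [ED] without a further null set. *)
Definition represents (o : V -> X -> R) (f : Th -> V) (F : X * Th -> R) : Prop :=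
  measurable_fun A2 F /\ forall t, {ae leb, forall x, D x -> F (x, t) = o (f t) x}.

Lemma represents_ex o C f : observable leb D S N o C -> bL f ->
  exists F, represents o f F.
Proof. by move=> oC [fm _]; exact: (joint_representation mD SN oC fm). Qed.

Lemma represents_lin o C a f g F G : observable leb D S N o C -> bL f -> bL g ->
  represents o f F -> represents o g G ->
  represents o (a *: f + g) (fun z => a * F z + G z).
Proof.
move=> oC [[Sf _] _] [[Sg _] _] [mF hF] [mG hG]; split.
  by apply: measurable_funD => //; exact: measurable_funM.
move=> t; move: (hF t) (hG t) (obs_linear oC a (Sf t I) (Sg t I)).
by apply: filterS3 => x h1 h2 h3 Dx; rewrite h1// h2// -h3.
Qed.

(** By Tonelli the product integral is the integral over outcomes of [sqi] of the observable, which
    [obs_bound] compares with the Bochner norm. *)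
Lemma represents_sqi o C f F : observable leb D S N o C -> bL f -> represents o f F ->
  sqint M2 A2 F /\ sqi M2 A2 F <= C * nrm bN f ^+ 2.
Proof.
move=> oC bf [mF hF]; have [[Sf _] _] := bf.
have mF2 : measurable_fun A2 (fun z => ((F z) ^+ 2)%:E).
  by apply/measurable_EFinP; exact: measurable_funX.
have F0 z : A2 z -> (0 <= ((F z) ^+ 2)%:E)%E by rewrite lee_fin sqr_ge0.
have [m1 E _ _] := tonelli_prod leb P mD mT mF2 F0.
have le : (\int[M2]_(z in A2) ((F z) ^+ 2)%:E <= (C * nrm bN f ^+ 2)%:E)%E.
  rewrite E.
  have C0 : (fun t => \int[leb]_(x in D) ((F (x, t)) ^+ 2)%:E)%E = fun t => (sqi leb D (o (f t)))%:E.
    apply/funext => t; have [mo oo] := obs_sqint oC (Sf t I).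
    rewrite -(sqiE mD (obs_sqint oC (Sf t I))).
    apply: ae_eq_integral => //.
    - by apply/measurable_EFinP; apply: measurable_funX; exact: (measurable_section2 (y := t) mD mT mF I).
    - by apply/measurable_EFinP; exact: measurable_funX.
    - by apply: filterS (hF t) => x h Dx; rewrite h.
  rewrite C0 EFinM -(nrm_bochner_sq SN bf).
  have mn := measurable_nrm_sq mT SN (bf.1).
  have n0 t : [set: Th] t -> (0 <= ((nrm N (f t)) ^+ 2)%:E)%E by rewrite lee_fin sqr_ge0.
  rewrite /bochner_sq -ge0_integralZl_EFin//; last exact: obs_const oC.
  apply: ge0_le_integral => //.
  - by move=> t _; rewrite lee_fin sqi_ge0.
  - by move: m1; rewrite C0.
  - exact: measurable_funeM.
  - by move=> t _; rewrite -EFinM lee_fin; exact: (obs_bound oC (Sf t I)).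
have hs : sqint M2 A2 F by split => //; exact: le_lt_trans le (ltry _).
by split => //; rewrite -lee_fin -sqiE.
Qed.

End representative.

Lemma ED_prod (G : Th -> X -> R) (Gt : X * Th -> R) :
  rintegrable M2 A2 Gt -> (forall t, measurable_fun D (G t)) ->
  (forall t, {ae leb, forall x, D x -> G t x = Gt (x, t)}) ->
  ED P D G = \int[M2]_(z in A2) Gt z.
Proof.
move=> iG mG GE; have [_ _ ->] := fubini_prod mD mT iG.
apply: eq_Rintegral => t _; apply: Rintegral_ae => //.
exact: (measurable_section2 (y := t) mD mT (rintegrable_measurable iG) I).
Qed.

Lemma ED_finite_prod (G : Th -> X -> R) (Gt : X * Th -> R) :
  ED_finite P D G -> measurable_fun A2 Gt -> (forall t, measurable_fun D (G t)) ->
  (forall t, {ae leb, forall x, D x -> G t x = Gt (x, t)}) ->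
  rintegrable M2 A2 Gt.
Proof.
move=> fG mGt mG GE; apply: (rintegrable_prod mD mT mGt); apply: le_lt_trans fG.
rewrite le_eqVlt; apply/orP; left; apply/eqP; apply: eq_integral => t _.
have mt := measurable_section2 (y := t) mD mT mGt I : measurable_fun D (fun x => Gt (x, t)).
apply: ae_eq_integral => //.
- by apply/measurable_EFinP; apply: measurableT_comp.
- by apply/measurable_EFinP; apply: measurableT_comp.
- by apply: filterS (GE t) => x h Dx; rewrite h.
Qed.

Section forms.
Context {V1 V2 : lmodType R}.
Variables (S1 : set V1) (N1 : V1 -> \bar R) (S2 : set V2) (N2 : V2 -> \bar R).
Hypotheses (SN1 : seminormed S1 N1) (SN2 : seminormed S2 N2).
Local Notation b1 := (bochnerL2 P setT S1 N1).
Local Notation b2 := (bochnerL2 P setT S2 N2).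
Local Notation nb1 := (nrm (bochner_norm P setT N1)).
Local Notation nb2 := (nrm (bochner_norm P setT N2)).
Variables (J : finType) (o1 : J -> V1 -> X -> R) (o2 : J -> V2 -> X -> R) (C : R).
Hypotheses (oC1 : forall i, observable leb D S1 N1 (o1 i) C).
Hypotheses (oC2 : forall i, observable leb D S2 N2 (o2 i) C).
Variable w : X * Th -> R.
Hypothesis mw : measurable_fun A2 w.

(** One shape for all the forms: the weight will be [2 mu], [lambda], [- alpha], [c0], [kappa] or 1,
    and the observables entries of the symmetric gradient, divergences, values, coordinates or
    partial derivatives. *)
Definition density (v : Th -> V1) (r : Th -> V2) (t : Th) (x : X) : R :=
  w (x, t) * \sum_i o1 i (v t) x * o2 i (r t) x.

Definition form (v : Th -> V1) (r : Th -> V2) : R := ED P D (density v r).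

Definition kernel (F G : J -> X * Th -> R) (z : X * Th) : R :=
  w z * \sum_i F i z * G i z.

Lemma measurable_density v r t : b1 v -> b2 r -> measurable_fun D (density v r t).
Proof.
move=> [[Sv _] _] [[Sr _] _]; apply: measurable_funM.
  exact: (measurable_section2 (y := t) mD mT mw I).
apply: measurable_sum => i; apply: measurable_funM.
  exact: (obs_sqint (oC1 i) (Sv t I)).1.
exact: (obs_sqint (oC2 i) (Sr t I)).1.
Qed.

Lemma measurable_kernel F G : (forall i, measurable_fun A2 (F i)) ->
  (forall i, measurable_fun A2 (G i)) -> measurable_fun A2 (kernel F G).
Proof.
move=> mF mG; apply: measurable_funM => //.
by apply: measurable_sum => i; exact: measurable_funM.
Qed.

Lemma density_kernel v r F G : (forall i, represents (o1 i) v (F i)) ->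
  (forall i, represents (o2 i) r (G i)) ->
  forall t, {ae leb, forall x, D x -> density v r t x = kernel F G (x, t)}.
Proof.
move=> hF hG t.
have h : {ae leb, forall x, D x -> forall i, F i (x, t) = o1 i (v t) x /\ G i (x, t) = o2 i (r t) x}.
  have : forall i, {ae leb, forall x, D x -> F i (x, t) = o1 i (v t) x /\ G i (x, t) = o2 i (r t) x}.
    move=> i; move: ((hF i).2 t) ((hG i).2 t); apply: filterS2 => x h1 h2 Dx.
    by split; [exact: h1|exact: h2].
  move/filter_forall; apply: filterS => x hx Dx i; exact: hx.
apply: filterS h => x h Dx; rewrite /density /kernel; congr (_ * _).
by apply: eq_bigr => i _; have [-> ->] := h Dx i.
Qed.

(** Finiteness stated for all joint representatives, so that Fubini applies to whichever one is at
    hand. *)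
Definition form_finite : Prop := forall v r F G, b1 v -> b2 r ->
  (forall i, represents (o1 i) v (F i)) -> (forall i, represents (o2 i) r (G i)) ->
  rintegrable M2 A2 (kernel F G).

Lemma ED_form_finite : (forall v r, b1 v -> b2 r -> ED_finite P D (density v r)) ->
  form_finite.
Proof.
move=> fin v r F G bv br hF hG; apply: (ED_finite_prod (fin v r bv br)).
- by apply: measurable_kernel => i; [exact: (hF i).1|exact: (hG i).1].
- by move=> t; exact: measurable_density.
- exact: density_kernel.
Qed.

Hypothesis fin : form_finite.

Lemma formE v r F G : b1 v -> b2 r ->
  (forall i, represents (o1 i) v (F i)) -> (forall i, represents (o2 i) r (G i)) ->
  form v r = \int[M2]_(z in A2) kernel F G z.
Proof.
move=> bv br hF hG; apply: ED_prod.
- exact: (fin bv br hF hG).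
- by move=> t; exact: measurable_density.
- exact: density_kernel.
Qed.

Lemma form_l r : b2 r -> linear_on b1 (form ^~ r).
Proof.
move=> br a f g bf bg.
have [F hF] := choice (fun i => represents_ex SN1 (oC1 i) bf).
have [G hG] := choice (fun i => represents_ex SN1 (oC1 i) bg).
have [H hH] := choice (fun i => represents_ex SN2 (oC2 i) br).
have hFG i := represents_lin a (oC1 i) bf bg (hF i) (hG i).
have bfg := seminormed_lin (seminormed_bochner P mT SN1) a bf bg.
rewrite (formE bfg br hFG hH) (formE bf br hF hH) (formE bg br hG hH).
apply: (Rintegral_lin mA2 (fin bf br hF hH) (fin bg br hG hH)) => z _.
rewrite /kernel mulrCA -mulrDr; congr (_ * _); rewrite mulr_sumr -big_split/=.
by apply: eq_bigr => i _; rewrite mulrDl mulrA.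
Qed.

Lemma form_r v : b1 v -> linear_on b2 (form v).
Proof.
move=> bv a f g bf bg.
have [F hF] := choice (fun i => represents_ex SN2 (oC2 i) bf).
have [G hG] := choice (fun i => represents_ex SN2 (oC2 i) bg).
have [H hH] := choice (fun i => represents_ex SN1 (oC1 i) bv).
have hFG i := represents_lin a (oC2 i) bf bg (hF i) (hG i).
have bfg := seminormed_lin (seminormed_bochner P mT SN2) a bf bg.
rewrite (formE bv bfg hH hFG) (formE bv bf hH hF) (formE bv bg hH hG).
apply: (Rintegral_lin mA2 (fin bv bf hH hF) (fin bv bg hH hG)) => z _.
rewrite /kernel mulrCA -mulrDr; congr (_ * _); rewrite mulr_sumr -big_split/=.
by apply: eq_bigr => i _; rewrite mulrDr mulrCA.
Qed.

End forms.
End random_fields.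

Section ae_comparison.
Context {R : realType} {disp : measure_display} {T : measurableType disp}.
Variables (mu : {measure set T -> \bar R}) (A : set T).
Hypothesis mA : measurable A.
Implicit Types f g : T -> R.

Lemma rintegrable_le_ae f g : measurable_fun A f -> rintegrable mu A g ->
  (forall x, A x -> 0 <= g x) -> {ae mu, forall x, A x -> `|f x| <= g x} ->
  rintegrable mu A f.
Proof.
move=> mf gi g0 fg; apply/integrableP; split; first exact/measurable_EFinP.
apply: le_lt_trans (rintegrable_ltoo mA gi).
apply: ae_ge0_le_integral => //.
- by apply/measurable_EFinP; exact: measurableT_comp.
- by apply/measurable_EFinP; exact: rintegrable_measurable gi.
Qed.

Lemma Rintegral_ae_ge0 f : rintegrable mu A f ->
  {ae mu, forall x, A x -> 0 <= f x} -> 0 <= \int[mu]_(x in A) f x.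
Proof.
move=> fi f0; have mf := rintegrable_measurable fi.
rewrite (@Rintegral_ae _ _ _ _ _ mA f (fun x => `|f x|))//.
- by apply: Rintegral_ge0 => x _.
- exact: measurableT_comp.
- by apply: filterS f0 => x /[apply] /ger0_norm.
Qed.

Lemma Rintegral_le_ae f g : rintegrable mu A f -> rintegrable mu A g ->
  {ae mu, forall x, A x -> f x <= g x} ->
  \int[mu]_(x in A) f x <= \int[mu]_(x in A) g x.
Proof.
move=> fi gi fg; rewrite -subr_ge0 -RintegralB//.
apply: Rintegral_ae_ge0; first exact: rintegrableB.
by apply: filterS fg => x /[apply]; rewrite subr_ge0.
Qed.

Lemma Rintegral_dominated (h : nat -> T -> R) f g : (forall k, measurable_fun A (h k)) ->
  measurable_fun A f -> (forall x, A x -> (fun k => h k x) @ \oo --> f x) ->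
  rintegrable mu A g -> (forall k x, A x -> `|h k x| <= g x) ->
  (fun k => \int[mu]_(x in A) h k x) @ \oo --> \int[mu]_(x in A) f x.
Proof.
move=> mh mf hf gi hg.
have hi k : rintegrable mu A (h k) by apply: (rintegrable_le mA _ _ gi) => // x; exact: hg.
have fi : rintegrable mu A f.
  apply: (rintegrable_le mA _ _ gi) => // x Ax.
  have c : (fun k => `|h k x|) @ \oo --> `|f x| by apply: cvg_norm; exact: hf.
  rewrite -(cvg_lim _ c)//; apply: limr_le.
    by apply/cvg_ex; exists `|f x|.
  by apply: nearW => k; exact: hg.
have := @dominated_cvg _ _ _ mu A mA (fun k x => (h k x)%:E) (fun x => (f x)%:E) (fun x => (g x)%:E).
move=> H; apply: fine_cvg; rewrite EFin_Rintegral//; apply: H.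
- by move=> k; exact/measurable_EFinP.
- by move=> x Ax; apply: cvg_EFin; [exact: nearW|exact: hf].
- by [].
- exact: gi.
- by move=> k x Ax; rewrite lee_fin; exact: hg.
Qed.

End ae_comparison.

(** * Continuity of forms with a bounded weight *)

Section form_bounds.
Context {R : realType} {d : nat} {disp : measure_display} {Th : measurableType disp}.
Variables (P : probability Th R) (D : set 'rV[R]_d).
Hypothesis mD : measurable D.
Local Notation X := 'rV[R]_d.
Local Notation leb := (lebesgue_row d).
Local Notation M2 := (lebesgue_row d \x P)%E.
Local Notation A2 := (D `*` [set: Th]).
Local Notation mT := (@measurableT _ Th).

Let mA2 : measurable A2. Proof. exact: measurableX. Qed.

Section bounded_weight.
Context {V1 V2 : lmodType R}.
Variables (S1 : set V1) (N1 : V1 -> \bar R) (S2 : set V2) (N2 : V2 -> \bar R).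
Hypotheses (SN1 : seminormed S1 N1) (SN2 : seminormed S2 N2).
Local Notation b1 := (bochnerL2 P setT S1 N1).
Local Notation b2 := (bochnerL2 P setT S2 N2).
Local Notation nb1 := (nrm (bochner_norm P setT N1)).
Local Notation nb2 := (nrm (bochner_norm P setT N2)).
Variables (J : finType) (o1 : J -> V1 -> X -> R) (o2 : J -> V2 -> X -> R) (C : R).
Hypotheses (oC1 : forall i, observable leb D S1 N1 (o1 i) C).
Hypotheses (oC2 : forall i, observable leb D S2 N2 (o2 i) C).
Variable w : X * Th -> R.
Hypothesis mw : measurable_fun A2 w.
Variable M : R.
Hypotheses (M0 : 0 <= M) (wM : {ae M2, forall z, A2 z -> `|w z| <= M}).

Let bound (F G : J -> X * Th -> R) z : R :=
  M * (2^-1 * (\sum_i F i z ^+ 2 + \sum_i G i z ^+ 2)).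

Let bound_int v r F G : b1 v -> b2 r ->
  (forall i, represents D (o1 i) v (F i)) -> (forall i, represents D (o2 i) r (G i)) ->
  rintegrable M2 A2 (bound F G) /\
  \int[M2]_(z in A2) bound F G z <= M * (2^-1 * (#|J|%:R * C)) * (nb1 v ^+ 2 + nb2 r ^+ 2).
Proof.
move=> bv br hF hG.
have iF i : i \in index_enum J -> rintegrable M2 A2 (fun z => F i z ^+ 2).
  by move=> _; exact: (sqint_rintegrable (represents_sqi mD SN1 (oC1 i) bv (hF i)).1).
have iG i : i \in index_enum J -> rintegrable M2 A2 (fun z => G i z ^+ 2).
  by move=> _; exact: (sqint_rintegrable (represents_sqi mD SN2 (oC2 i) br (hG i)).1).
have sF := rintegrable_sum mA2 iF; have sG := rintegrable_sum mA2 iG.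
have s := rintegrableD mA2 sF sG; have s2 := rintegrableZl mA2 2^-1 s.
have E (c : R) : \sum_(i : J) c = #|J|%:R * c by rewrite sumr_const mulr_natl.
split; first exact: rintegrableZl.
rewrite /bound RintegralZl// RintegralZl// RintegralD//.
rewrite -!mulrA ler_wpM2l// ler_wpM2l ?invr_ge0// (Rintegral_sum mA2 iF) (Rintegral_sum mA2 iG).
rewrite mulrA mulrDr; apply: lerD.
  apply: (@le_trans _ _ (\sum_(i : J) C * nb1 v ^+ 2)).
    by apply: ler_sum => i _; exact: (represents_sqi mD SN1 (oC1 i) bv (hF i)).2.
  by rewrite E mulrA.
apply: (@le_trans _ _ (\sum_(i : J) C * nb2 r ^+ 2)).
  by apply: ler_sum => i _; exact: (represents_sqi mD SN2 (oC2 i) br (hG i)).2.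
by rewrite E mulrA.
Qed.

Let bound_ge0 F G z : 0 <= bound F G z.
Proof.
rewrite /bound !mulr_ge0 ?invr_ge0// addr_ge0// sumr_ge0// => i _; exact: sqr_ge0.
Qed.

Let kernel_bound F G : {ae M2, forall z, A2 z -> `|kernel w F G z| <= bound F G z}.
Proof.
apply: filterS wM => z /[apply] h; rewrite normrM.
by apply: ler_pM => //; exact: sum_mul_le.
Qed.

Lemma bounded_form_finite : form_finite P D S1 N1 S2 N2 o1 o2 w.
Proof.
move=> v r F G bv br hF hG; have [bi _] := bound_int bv br hF hG.
apply: (rintegrable_le_ae mA2 _ bi) => //.
by apply: measurable_kernel => // i; [exact: (hF i).1|exact: (hG i).1].
Qed.

Lemma bounded_form_bilinear : exists K, bounded_bilinear b1 (bochner_norm P setT N1)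
  b2 (bochner_norm P setT N2) (form P D o1 o2 w) K.
Proof.
have fin := bounded_form_finite.
(* Without any index there is no observable from which to read [0 <= C]; the form is then
   identically 0. *)
have [J0|] := eqVneq #|J| 0%N; last first.
  move=> J1; have [i _] : exists i, i \in J by apply/card_gt0P; rewrite lt0n.
  have C0 := obs_const (oC1 i).
  eexists; apply: (bounded_bilinear_sq (seminormed_bochner P mT SN1) (seminormed_bochner P mT SN2)
    (K := M * (2^-1 * (#|J|%:R * C)))).
  - by rewrite !mulr_ge0.
  - by move=> r br; exact: (form_l mD SN1 SN2 oC1 oC2 mw fin).
  - by move=> r br; exact: (form_r mD SN1 SN2 oC1 oC2 mw fin).
  move=> v r bv br.
  have [F hF] := choice (fun i => represents_ex mD SN1 (oC1 i) bv).
  have [G hG] := choice (fun i => represents_ex mD SN2 (oC2 i) br).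
  have [bi bl] := bound_int bv br hF hG.
  have ki := fin v r F G bv br hF hG.
  rewrite (formE mD oC1 oC2 mw fin bv br hF hG).
  apply: le_trans (le_normr_Rintegral mA2 ki) (le_trans _ bl).
  by apply: Rintegral_le_ae => //; exact: rintegrable_norm.
exists 0; have z v r : form P D o1 o2 w v r = 0.
  apply: Rintegral_eq0 => t _; apply: Rintegral_eq0 => x _.
  by rewrite /density big_pred0 ?mulr0// => i; apply/negbTE; rewrite -(negbT (card0_eq J0 i)).
split=> [r br a f g _ _|r br a f g _ _|v r _ _]; rewrite !z ?mulr0 ?addr0//.
by rewrite normr0 !mul0r.
Qed.

End bounded_weight.
End form_bounds.

(** * Continuity of forms with a nonnegative, possibly unbounded weight *)

Section nonnegative_form.
Context {R : realType} {d : nat} {disp : measure_display} {Th : measurableType disp}.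
Variables (P : probability Th R) (D : set 'rV[R]_d).
Hypothesis mD : measurable D.
Local Notation X := 'rV[R]_d.
Local Notation leb := (lebesgue_row d).
Local Notation M2 := (lebesgue_row d \x P)%E.
Local Notation A2 := (D `*` [set: Th]).
Local Notation mT := (@measurableT _ Th).

Let mA2 : measurable A2. Proof. exact: measurableX. Qed.

Context {V : lmodType R}.
Variables (S : set V) (N : V -> \bar R).
Hypotheses (SN : seminormed S N).
Local Notation bL := (bochnerL2 P setT S N).
Local Notation bN := (bochner_norm P setT N).
Variables (J : finType) (o : J -> V -> X -> R) (C : R).
Hypotheses (oC : forall i, observable leb D S N (o i) C).
Variable w : X * Th -> R.
Hypothesis mw : measurable_fun A2 w.
Hypothesis w0 : {ae M2, forall z, A2 z -> 0 <= w z}.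
Hypothesis fin : form_finite P D S N S N o o w.
Local Notation form := (form P D o o).

Let bSN := seminormed_bochner P mT SN.

Lemma form_sym v r : form w v r = form w r v.
Proof.
apply: eq_Rintegral => t _; apply: eq_Rintegral => x _; congr (_ * _).
by apply: eq_bigr => i _; rewrite mulrC.
Qed.

Lemma form_ge0 v : bL v -> 0 <= form w v v.
Proof.
move=> bv; have [F hF] := choice (fun i => represents_ex mD SN (oC i) bv).
rewrite (formE mD oC oC mw fin bv bv hF hF).
apply: Rintegral_ae_ge0 => //; first exact: (fin bv bv hF hF).
apply: filterS w0 => z /[apply] wz; rewrite /kernel mulr_ge0// sumr_ge0// => i _.
by rewrite -expr2 sqr_ge0.
Qed.

Let l1 v := form_l mD SN SN oC oC mw fin (r := v).
Let l2 v := form_r mD SN SN oC oC mw fin (v := v).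

(** Both bounds come from nonnegativity, at [v + r] and at [v - r]. *)
Lemma form_polar v r : bL v -> bL r -> `|form w v r| <= 2^-1 * (form w v v + form w r r).
Proof.
move=> bv br; have bs := subspD bSN bv br; have bd := subspB bSN bv br.
have h1 := form_ge0 bs; have h2 := form_ge0 bd.
have a1 : form w (v + r) (v + r) = form w v (v + r) + form w r (v + r) :=
  linear_onD (l1 bs) bv br.
have a2 : form w v (v + r) = form w v v + form w v r := linear_onD (l2 bv) bv br.
have a3 : form w r (v + r) = form w r v + form w r r := linear_onD (l2 br) bv br.
have b1 : form w (v - r) (v - r) = form w v (v - r) - form w r (v - r) :=
  linear_onB (l1 bd) bv br.
have b2 : form w v (v - r) = form w v v - form w v r := linear_onB (l2 bv) bv br.
have b3 : form w r (v - r) = form w r v - form w r r := linear_onB (l2 br) bv br.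
rewrite a1 a2 a3 (form_sym r v) in h1; rewrite b1 b2 b3 (form_sym r v) in h2.
rewrite ler_norml; clear a1 a2 a3 b1 b2 b3; move: h1 h2.
generalize (form w v v) (form w v r) (form w r r) => x y z h1 h2.
by apply/andP; split; lra.
Qed.

(** Truncation to [[0, k]]; the lower cut makes the weight nonnegative everywhere instead of almost
    everywhere. *)
Let wk (k : nat) (z : X * Th) : R := Num.min (Num.max 0 (w z)) k%:R.

Let mwk k : measurable_fun A2 (wk k).
Proof.
apply: measurable_minr; last exact: measurable_cst.
by apply: measurable_maxr => //; exact: measurable_cst.
Qed.

Let wk_ge0 k z : 0 <= wk k z.
Proof. by rewrite /wk le_min le_max lexx/= ler0n. Qed.

Let wk_le k z : `|wk k z| <= k%:R.
Proof. by rewrite ger0_norm// /wk ge_min lexx orbT. Qed.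

Let wk_le_w k z : `|wk k z| <= `|w z|.
Proof. by rewrite ger0_norm// /wk ge_min ge_max normr_ge0 ler_norm. Qed.

Let wkfin k : form_finite P D S N S N o o (wk k).
Proof.
by apply: (bounded_form_finite mD SN SN oC oC (mwk k) (ler0n R k)); apply: aeW => z _.
Qed.

Let q k v := form (wk k) v v.

Let qE k v F : bL v -> (forall i, represents D (o i) v (F i)) ->
  q k v = \int[M2]_(z in A2) kernel (wk k) F F z.
Proof. by move=> bv hF; exact: (formE mD oC oC (mwk k) (@wkfin k) bv bv hF hF). Qed.

Let q_young k e v r : 0 < e -> bL v -> bL r ->
  q k (v + r) <= (1 + e) * q k v + (1 + e^-1) * q k r.
Proof.
move=> e0 bv br.
have [F hF] := choice (fun i => represents_ex mD SN (oC i) bv).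
have [G hG] := choice (fun i => represents_ex mD SN (oC i) br).
have hFG i := represents_lin 1 (oC i) bv br (hF i) (hG i).
have bs := seminormed_lin bSN 1 bv br.
have := qE k bs hFG; rewrite scale1r => ->.
rewrite (qE k bv hF) (qE k br hG).
have iF := wkfin k bv bv hF hF; have iG := wkfin k br br hG hG.
have iFG : rintegrable M2 A2 (kernel (wk k) (fun i z => 1 * F i z + G i z) (fun i z => 1 * F i z + G i z)).
  have := seminormed_lin bSN 1 bv br => bs'.
  exact: (wkfin k bs' bs' hFG hFG).
have i1 := rintegrableZl mA2 (1 + e) iF; have i2 := rintegrableZl mA2 (1 + e^-1) iG.
rewrite -RintegralZl// -[X in _ + X]RintegralZl// -RintegralD//.
apply: le_Rintegral => //; first exact: rintegrableD.
move=> z _; rewrite /kernel mulrCA [X in _ + X]mulrCA -mulrDr ler_wpM2l//.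
have := sqr_sum_sub (fun i => F i z) (fun i => G i z) e0.
by under eq_bigr => i _ do rewrite -[F i z]mul1r expr2;
  under [X in _ <= _ * X + _]eq_bigr => i _ do rewrite expr2;
  under [X in _ <= _ + _ * X]eq_bigr => i _ do rewrite expr2.
Qed.

Let q_ge0 k v : bL v -> 0 <= q k v.
Proof.
move=> bv; have [F hF] := choice (fun i => represents_ex mD SN (oC i) bv).
rewrite (qE k bv hF); apply: Rintegral_ge0 => z _.
by rewrite /kernel mulr_ge0// sumr_ge0// => i _; rewrite -expr2 sqr_ge0.
Qed.

Let qZ k a v : bL v -> q k (a *: v) = a ^+ 2 * q k v.
Proof.
move=> bv; have bav := subspZ bSN a bv.
have h1 := form_l mD SN SN oC oC (mwk k) (@wkfin k) bav.
have h2 := form_r mD SN SN oC oC (mwk k) (@wkfin k) bv.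
have a1 : form (wk k) (a *: v) (a *: v) = a * form (wk k) v (a *: v) := linear_onZ bSN a h1 bv.
have a2 : form (wk k) v (a *: v) = a * form (wk k) v v := linear_onZ bSN a h2 bv.
by rewrite /q a1 a2 mulrA -expr2.
Qed.

Let q_le k v : bL v -> q k v <= form w v v.
Proof.
move=> bv; have [F hF] := choice (fun i => represents_ex mD SN (oC i) bv).
rewrite (qE k bv hF) (formE mD oC oC mw fin bv bv hF hF).
apply: Rintegral_le_ae => //.
- exact: (wkfin k bv bv hF hF).
- exact: (fin bv bv hF hF).
apply: filterS w0 => z /[apply] wz; rewrite /kernel ler_wpM2r//.
  by rewrite sumr_ge0// => i _; rewrite -expr2 sqr_ge0.
by apply: le_trans (ler_norm _) (le_trans (wk_le_w k z) _); rewrite ger0_norm.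
Qed.

Let q_cvg v : bL v -> (fun k => q k v) @ \oo --> form w v v.
Proof.
move=> bv; have [F hF] := choice (fun i => represents_ex mD SN (oC i) bv).
have ki := fin bv bv hF hF.
rewrite (formE mD oC oC mw fin bv bv hF hF).
rewrite (_ : (fun k => _) = fun k => \int[M2]_(z in A2) kernel (wk k) F F z); last first.
  by apply/funext => k; exact: qE.
have mF i : measurable_fun A2 (F i) := (hF i).1.
have mker (u : X * Th -> R) : measurable_fun A2 u -> measurable_fun A2 (kernel u F F).
  by move=> mu; exact: measurable_kernel.
pose wp z := Num.max 0 (w z).
have mwp : measurable_fun A2 wp by apply: measurable_maxr => //; exact: measurable_cst.
rewrite (@Rintegral_ae _ _ _ _ _ mA2 (kernel w F F) (kernel wp F F)); [|exact: mker..|]; last first.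
  by apply: filterS w0 => z /[apply] wz; rewrite /kernel /wp max_r.
apply: (Rintegral_dominated mA2 (g := fun z => `|kernel w F F z|)).
- by move=> k; exact: mker.
- exact: mker.
- move=> z _; apply: cvgMl.
  have [M _ hM] : \forall k \near \oo, wp z <= k%:R.
    exists (Num.bound (wp z)) => // k /= hk.
    apply: le_trans (ltW (archi_boundP _)) _; first by rewrite /wp le_max lexx.
    by rewrite ler_nat.
  apply: cvg_near_cst; exists M => // k /= /hM h.
  by apply/eqP; rewrite /wk -/(wp z) min_l.
- exact: rintegrable_norm.
- by move=> k z _; rewrite /kernel !normrM ler_wpM2r.
Qed.

(** The square roots of the [q k] are seminorms, each continuous since its weight is bounded, and at
    each [v] they are bounded in [k] by the square root of [form w v v]. Uniform boundedness gives
    one constant; letting [k] grow bounds the diagonal of the form, and [form_polar] the rest. *)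
Lemma form_bounded_bilinear : seminorm_complete bL bN 4^-1 ->
  exists K, bounded_bilinear bL bN bL bN (form w) K.
Proof.
move=> cB.
have K_ k : exists K, bounded_bilinear bL bN bL bN (form (wk k)) K.
  apply: (bounded_form_bilinear mD SN SN oC oC (mwk k) (ler0n R k)).
  by apply: aeW => z _.
have [K hK] := choice K_.
pose p k v := Num.sqrt (q k v).
have [k v|k v r bv br|k a v bv|k v bv|v bv|M M0 hM] :=
  @uniform_boundedness _ _ _ _ bSN cB p (fun k => Num.sqrt `|K k|).
- exact: sqrtr_ge0.
- by apply: sqrt_young; [exact: q_ge0|exact: q_ge0|move=> e e0; exact: q_young].
- by rewrite /p qZ// sqrtrM ?sqr_ge0// sqrtr_sqr.
- have nE : nrm bN v = Num.sqrt (nrm bN v ^+ 2).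
    by rewrite sqrtr_sqr ger0_norm// (nrm_ge0 bSN).
  rewrite /p nE -sqrtrM//.
  rewrite ler_wsqrtr//; apply: le_trans (ler_norm _) _.
  apply: le_trans (bilinear_bound (hK k) bv bv) _.
  by rewrite -mulrA -expr2 ler_wpM2r ?sqr_ge0// ler_norm.
- exists (Num.sqrt (form w v v)) => k; rewrite ler_wsqrtr//; exact: q_le.
have le v : bL v -> form w v v <= M ^+ 2 * nrm bN v ^+ 2.
  move=> bv; have c := q_cvg bv; rewrite -(cvg_lim _ c)//; apply: limr_le.
    by apply/cvg_ex; exists (form w v v).
  apply: nearW => k; have := hM k v bv; rewrite /p => h.
  rewrite -[leLHS]sqr_sqrtr ?q_ge0// -exprMn lerXn2r ?nnegrE ?sqrtr_ge0//.
  by rewrite mulr_ge0// (nrm_ge0 bSN).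
eexists; apply: (bounded_bilinear_sq bSN bSN (K := 2^-1 * M ^+ 2)).
- by rewrite mulr_ge0 ?sqr_ge0.
- by move=> r br; exact: l1.
- by move=> v bv; exact: l2.
move=> v r bv br; apply: le_trans (form_polar bv br) _.
rewrite -mulrA ler_wpM2l ?invr_ge0// mulrDr.
by apply: lerD; exact: le.
Qed.

End nonnegative_form.

Section observables.
Context {R : realType} {disp : measure_display} {X : measurableType disp}.
Variables (m : {measure set X -> \bar R}) (D : set X).
Hypothesis mD : measurable D.
Context {V : lmodType R}.
Variables (S : set V) (N : V -> \bar R).
Hypothesis SN : seminormed S N.
Local Notation obs := (observable m D S N).

(** The constant is the one of [(x + y)^2 <= 2 x^2 + 2 y^2]. *)
Lemma observable_lin a b (o1 o2 : V -> X -> R) C1 C2 : obs o1 C1 -> obs o2 C2 ->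
  obs (fun v x => a * o1 v x + b * o2 v x) (2 * a ^+ 2 * C1 + 2 * b ^+ 2 * C2).
Proof.
move=> h1 h2; have C10 := obs_const h1; have C20 := obs_const h2.
have a0 := sqr_ge0 a; have b0 := sqr_ge0 b; split.
- by apply: addr_ge0; apply: mulr_ge0 => //; exact: mulr_ge0.
- move=> v Sv; apply: sqint_lin => //; first exact: (obs_sqint h1).
  by apply: sqintZ => //; exact: (obs_sqint h2).
- move=> c v w Sv Sw; move: (obs_linear h1 c Sv Sw) (obs_linear h2 c Sv Sw).
  by apply: filterS2 => x e1 e2 Dx; rewrite e1// e2//; ring.
- move=> v Sv; have s1 := obs_sqint h1 Sv; have s2 := obs_sqint h2 Sv.
  apply: (@le_trans _ _ (2 * a ^+ 2 * sqi m D (o1 v) + 2 * b ^+ 2 * sqi m D (o2 v))).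
    have i1 := rintegrableZl mD (2 * a ^+ 2) (sqint_rintegrable s1).
    have i2 := rintegrableZl mD (2 * b ^+ 2) (sqint_rintegrable s2).
    rewrite /sqi -RintegralZl; [|exact: mD|exact: sqint_rintegrable s1].
    rewrite -[X in _ <= _ + X]RintegralZl; [|exact: mD|exact: sqint_rintegrable s2].
    rewrite -RintegralD//; apply: le_Rintegral => //.
    + apply: sqint_rintegrable; apply: sqint_lin => //; exact: sqintZ.
    + exact: rintegrableD.
    + by move=> x _; have := sqr_ge0 (a * o1 v x - b * o2 v x); nra.
  rewrite [leRHS]mulrDl -(mulrA _ C1) -(mulrA _ C2); apply: lerD.
    exact: (ler_wpM2l (mulr_ge0 (ler0n _ 2) a0) (obs_bound h1 Sv)).
  exact: (ler_wpM2l (mulr_ge0 (ler0n _ 2) b0) (obs_bound h2 Sv)).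
Qed.

Lemma observable0 : obs (fun v x => 0) 0.
Proof.
split=> //.
- by move=> v _; exact: sqint0.
- by move=> a v w _ _; apply: aeW => x _; rewrite mulr0 addr0.
- by move=> v _; rewrite mul0r /sqi Rintegral_eq0// => x _; rewrite expr0n.
Qed.

Lemma observable_sum (I : Type) (r : seq I) (o : I -> V -> X -> R) (C : I -> R) :
  (forall i, obs (o i) (C i)) -> exists K, obs (fun v x => \sum_(i <- r) o i v x) K.
Proof.
move=> h; elim: r => [|i r [K IH]].
  exists 0; rewrite (_ : (fun v x => _) = fun v x => 0); first exact: observable0.
  by apply/funext => v; apply/funext => x; rewrite big_nil.
have := observable_lin 1 1 (h i) IH; set K' := (X in obs _ X) => h'.
exists K'; rewrite (_ : (fun v x => _) = (fun v x => 1 * o i v x + 1 * \sum_(j <- r) o j v x))//.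
by apply/funext => v; apply/funext => x; rewrite big_cons !mul1r.
Qed.

Lemma observable_le o C C' : C <= C' -> obs o C -> obs o C'.
Proof.
move=> CC' h; split; [exact: le_trans (obs_const h) CC'|exact: obs_sqint h|exact: obs_linear h|].
by move=> v Sv; apply: le_trans (obs_bound h Sv) _; rewrite ler_wpM2r// sqr_ge0.
Qed.

End observables.

Section sobolev_observables.
Context {R : realType} {d : nat}.
Variable D : set 'rV[R]_d.
Hypotheses (oD : open D) (bD : bounded_set D).
Local Notation leb := (lebesgue_row d).
Local Notation X := 'rV[R]_d.
Variable S : set (X -> R).
Hypotheses (S0 : S 0) (Slin : forall a q r, S q -> S r -> S (a *: q + r)).
Hypothesis SH : S `<=` H1 D.

Let mD : measurable D := open_row_measurable oD.

Lemma observable_H1 k : observable leb D S (H1norm D) (H1obs D k) 1.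
Proof.
split=> //.
- by move=> q /SH; exact: H1obs_sqint.
- by move=> a q r /SH qH /SH rH; exact: H1obs_lin.
- by move=> q Sq; rewrite mul1r; exact: (sqi_H1obs oD SH).
Qed.

Lemma observable_value : observable leb D S (H1norm D) (fun q x => q x) 1.
Proof.
have := observable_H1 ord0; congr observable.
by apply/funext => q; apply/funext => x; rewrite /H1obs unlift_none.
Qed.

Lemma observable_grad i : observable leb D S (H1norm D) (fun q x => weak_grad D q x ord0 i) 1.
Proof.
have := observable_H1 (lift ord0 i); congr observable.
by apply/funext => q; apply/funext => x; rewrite /H1obs liftK.
Qed.

Lemma observable_H1v p : observable leb D (fields S) (H1normv D) (H1vobs D p) 1.
Proof.
split=> //.
- by move=> v; exact: H1vobs_sqint.
- by move=> a v w; exact: H1vobs_lin.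
- by move=> v Sv; rewrite mul1r; exact: (sqi_H1vobs oD SH).
Qed.

Lemma observable_coord i : observable leb D (fields S) (H1normv D) (fun v x => v x ord0 i) 1.
Proof.
have := observable_H1v (i, ord0); congr observable.
by apply/funext => q; apply/funext => x; rewrite /H1vobs /H1obs unlift_none.
Qed.

Lemma observable_jac i j : observable leb D (fields S) (H1normv D) (fun v x => weak_jac D v x i j) 1.
Proof.
have := observable_H1v (i, lift ord0 j); congr observable.
by apply/funext => q; apply/funext => x; rewrite /H1vobs /H1obs/= liftK mxE.
Qed.

Lemma observable_symgrad p :
  observable leb D (fields S) (H1normv D) (fun v x => symgrad D v x p.1 p.2) 1.
Proof.
have := observable_lin mD 2^-1 2^-1 (observable_jac p.1 p.2) (observable_jac p.2 p.1).
rewrite (_ : _ + _ = 1 :> R); last by field.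
congr observable; apply/funext => q; apply/funext => x.
by rewrite -mulrDr [RHS]mxE [X in _ = _ * X]mxE [X in _ = _ * (_ + X)]mxE.
Qed.

Lemma observable_divergence : exists C,
  observable leb D (fields S) (H1normv D) (divergence D) C.
Proof.
exact: (observable_sum mD (index_enum 'I_d) (fun i => observable_jac i i)).
Qed.

Lemma observable_L2 : observable leb D (L2 D) (L2norm D) (fun q x => q x) 1.
Proof.
split=> //.
- by move=> a v w _ _; exact: aeW.
- by move=> v vL; rewrite mul1r nrm_L2.
Qed.

Lemma observable_L2v i : observable leb D (L2v D) (L2norm_mx D) (fun v x => v x ord0 i) 1.
Proof.
split=> //.
- by move=> v; exact.
- by move=> a v w _ _; apply: aeW => x _; rewrite row_lin_entry.
- move=> v vL; rewrite mul1r nrm_L2v// (bigD1 i)//= lerDl sumr_ge0// => j _.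
  exact: sqi_ge0.
Qed.

End sobolev_observables.

Section constant_fields.
Context {R : realType} {disp : measure_display} {Th : measurableType disp}.
Variable P : probability Th R.
Context {V : lmodType R}.
Variables (S : set V) (N : V -> \bar R).
Hypothesis SN : seminormed S N.

Lemma bochner_sq_cst v : S v -> bochner_sq P setT N (cst v) = (nrm N v ^+ 2)%:E.
Proof.
move=> Sv; rewrite /bochner_sq (eq_integral (cst (nrm N v ^+ 2)%:E))//.
rewrite integral_cst//= -[RHS]mule1; congr (_ * _)%E; exact: (@probability_setT _ _ _ P).
Qed.

Lemma bochnerL2_cst v : S v -> bochnerL2 P setT S N (cst v).
Proof.
move=> Sv; apply/(bochnerL2P _ _ SN); split; first exact: smeas_cst.
by rewrite bochner_sq_cst// ltry.
Qed.

Lemma nrm_bochner_cst v : S v -> nrm (bochner_norm P setT N) (cst v) = nrm N v.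
Proof.
move=> Sv; have SB := seminormed_bochner P measurableT SN.
have := nrm_bochner_sq SN (bochnerL2_cst Sv); rewrite bochner_sq_cst// => -[] /esym/eqP.
by rewrite eqrXn2 ?(nrm_ge0 SB) ?(nrm_ge0 SN)// => /eqP.
Qed.

End constant_fields.

(** * The energy inequality *)

Section nonmeasurable_bound.
Context {R : realType} {disp : measure_display} {T : measurableType disp}.
Variables (mu : {measure set T -> \bar R}) (A : set T).
Hypothesis mA : measurable A.

(** The integral of a nonnegative function is a supremum over simple functions below it, hence
    monotone for arbitrary functions. *)
Lemma ge0_le_integral_sup (f g : T -> \bar R) : (forall x, A x -> (0 <= f x)%E) ->
  (forall x, A x -> (f x <= g x)%E) ->
  (\int[mu]_(x in A) f x <= \int[mu]_(x in A) g x)%E.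
Proof.
move=> f0 fg; have g0 x : A x -> (0 <= g x)%E by move=> Ax; exact: le_trans (f0 x Ax) (fg x Ax).
rewrite !ge0_integralE//; apply: le_ereal_sup => _ [h hf <-].
exists h => // x; apply: le_trans (hf x) _.
by rewrite !patchE; case: ifPn => // /set_mem; exact: fg.
Qed.

(** Serves for the right-hand side of the estimate, where measurability in [t] of the norm of [G t]
    is not established. On the exceptional set [f] is replaced by 0, so that the comparison holds
    everywhere. *)
Lemma Rintegral_le_ae_sup (f : T -> R) (g : T -> \bar R) : rintegrable mu A f ->
  (forall x, A x -> (0 <= g x)%E) -> {ae mu, forall x, A x -> ((f x)%:E <= g x)%E} ->
  ((\int[mu]_(x in A) f x)%R%:E <= \int[mu]_(x in A) g x)%E.
Proof.
move=> fi g0 [Z [mZ Z0 hZ]].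
have mf := rintegrable_measurable fi.
pose h x := Num.max 0 (f x) * \1_(~` Z) x.
have hin x : Z x -> h x = 0 by move=> Zx; rewrite /h indicE memNset ?mulr0//; exact.
have hout x : ~ Z x -> h x = Num.max 0 (f x) by move=> Zx; rewrite /h indicE mem_set ?mulr1.
have mh : measurable_fun A h.
  apply: measurable_funM; first by apply: measurable_maxr => //; exact: measurable_cst.
  by apply: measurable_funTS; apply: measurable_indic; exact: measurableC.
have hg x : A x -> ((h x)%:E <= g x)%E.
  move=> Ax; have [Zx|nZx] := pselect (Z x); first by rewrite hin//; exact: g0.
  have fgx : ((f x)%:E <= g x)%E.
    by apply: contrapT => nfg; apply: nZx; apply: hZ => /= /(_ Ax).
  by rewrite hout// /Num.max; case: ifP => // _; exact: g0.
have h0 x : 0 <= h x by rewrite /h mulr_ge0// le_max lexx.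
have hi : rintegrable mu A h.
  apply: (rintegrable_le mA mh _ (rintegrable_norm fi)) => x _.
  rewrite ger0_norm//; have [Zx|nZx] := pselect (Z x); first by rewrite hin.
  by rewrite hout// ge_max normr_ge0 ler_norm.
apply: (@le_trans _ _ (\int[mu]_(x in A) (h x)%:E)%E); last first.
  by apply: ge0_le_integral_sup => // x _; rewrite lee_fin.
rewrite -EFin_Rintegral// lee_fin; apply: Rintegral_le_ae => //.
exists Z; split => // x /= nle; apply: contrapT => xZ; apply: nle => _.
by rewrite hout// le_max lexx orbT.
Qed.

End nonmeasurable_bound.

Section ae_test.
Context {R : realType} {disp : measure_display} {T : measurableType disp}.
Variables (mu : {measure set T -> \bar R}) (A : set T).
Hypothesis mA : measurable A.
Context {V : lmodType R}.
Variables (S : set V) (N : V -> \bar R).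
Hypothesis SN : seminormed S N.
Local Notation n := (nrm N).

(* Only countably many test vectors matter: the values of the simple
   approximations of [u]. *)
Lemma ae_test_curve (E : T -> V -> R) (u : T -> V) :
  (forall t, A t -> linear_on S (E t)) ->
  (forall t, A t -> exists K, forall v, S v -> `|E t v| <= K * n v) ->
  (forall v, S v -> {ae mu, forall t, A t -> E t v = 0}) ->
  strongly_measurable A S N u -> {ae mu, forall t, A t -> E t (u t) = 0}.
Proof.
move=> lE bE zE /(strongly_measurableP _ SN)[Su [s [hs su]]].
have vals k : {ae mu, forall t, A t -> forall v, v \in simple_values (s k) -> E t v = 0}.
  have : forall v, v \in simple_values (s k) -> S v.
    by move=> v; exact: (simple_values_in SN (hs k)).
  elim: (simple_values (s k)) => [|v r IH] Sr; first exact: aeW.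
  have Sv : S v by apply: Sr; rewrite mem_head.
  have {}IH := IH (fun x xr => Sr x (mem_behead (s := v :: r) xr)).
  move: (zE v Sv) IH; apply: filterS2 => t h1 h2 At x.
  by rewrite in_cons => /orP[/eqP ->|xr]; [exact: h1|exact: h2].
have := ae_foralln vals; apply: filterS => t ht At.
have [K hK] := bE t At.
have Sg k : S (simple_fun (s k) t) := simple_fun_in t SN (hs k).
have c := linear_on_cvg SN (lE t At) hK Sg (Su t At) (su t At).
apply: (cvg_unique _ c); first exact: norm_hausdorff.
rewrite (_ : (fun k => _) = fun=> 0); first exact: cvg_cst.
by apply/funext => k; apply: (ht k At); exact: simple_fun_values.
Qed.

Lemma bochnerL2_cst_on v : (mu A < +oo)%E -> S v -> bochnerL2 mu A S N (cst v).
Proof.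
move=> Aoo Sv; apply/(bochnerL2P _ _ SN); split; first exact: smeas_cst.
rewrite /bochner_sq (eq_integral (cst (n v ^+ 2)%:E))// integral_cst//.
by rewrite lte_mul_pinfty// lee_fin sqr_ge0.
Qed.

End ae_test.

Section time_before.
Context {R : realType} (T : R).
Local Notation mu := (@lebesgue_measure R).
Local Notation A := (`]0%R, T[%classic : set (measurableTypeR R)).

Lemma rintegrable_before (h : R -> R) (t : R) : rintegrable mu A h ->
  rintegrable mu A (fun s => if s < t then h s else 0).
Proof.
move=> hi; have mA := measurable_time_itv T.
apply: (rintegrable_le mA _ _ (rintegrable_norm hi)) => [|s _].
  have ms : measurable_fun A (fun s : measurableTypeR R => s < t).
    by apply: measurable_fun_ltr => //; exact: measurable_cst.
  apply: measurable_fun_if => //.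
  by apply: (measurable_funS mA) => [x []//|]; exact: rintegrable_measurable hi.
by case: ifP => // _; rewrite normr0.
Qed.

Lemma Rintegral_before (h : R -> R) (t : R) : A t ->
  \int[mu]_(s in A) (if s < t then h s else 0) = \int[mu]_(s in `]0, t[) h s.
Proof.
rewrite /= in_itv/= => /andP[t0 tT].
rewrite Rintegral_mkcond [RHS]Rintegral_mkcond; congr Rintegral.
apply/funext => s; rewrite !patchE; case: (ltP s t) => st.
  congr (if _ then _ else _); apply/idP/idP; rewrite !inE/= !in_itv/= => /andP[-> sT].
    by rewrite st.
  by rewrite (lt_trans st tT).
rewrite [X in _ = if X then _ else _]memNset; first by case: ifP.
by rewrite /= in_itv/= => /andP[_]; rewrite ltNge st.
Qed.

End time_before.

(** * The energy estimate for abstract bounded forms *)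

Section abstract_biot.
Context {R : realType} (T : R).
Hypothesis T0 : 0 < T.
Local Notation mu := (@lebesgue_measure R).
Local Notation A := (`]0%R, T[%classic : set (measurableTypeR R)).

Let mA : measurable A := measurable_time_itv T.
Let Aoo : (mu A < +oo)%E := time_itv_lty T.

Context {VU VP VF VG : lmodType R}.
Variables (SU : set VU) (NU : VU -> \bar R) (SP : set VP) (NP : VP -> \bar R).
Variables (SF : set VF) (NF : VF -> \bar R) (SG : set VG) (NG : VG -> \bar R).
Hypotheses (HU : seminormed SU NU) (HP : seminormed SP NP).
Hypotheses (HF : seminormed SF NF) (HG : seminormed SG NG).
Variables (a : VU -> VU -> R) (b : VU -> VP -> R) (c dd : VP -> VP -> R).
Variables (lf : VF -> VU -> R) (lg : VG -> VP -> R).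
Variables (Ka Kb Kc Kd Kf Kg : R).
Hypothesis ha : bounded_bilinear SU NU SU NU a Ka.
Hypothesis hb : bounded_bilinear SU NU SP NP b Kb.
Hypothesis hc : bounded_bilinear SP NP SP NP c Kc.
Hypothesis hd : bounded_bilinear SP NP SP NP dd Kd.
Hypothesis hlf : bounded_bilinear SF NF SU NU lf Kf.
Hypothesis hlg : bounded_bilinear SG NG SP NP lg Kg.
Variable r : R.
Hypotheses (r0 : 0 < r) (r1 : r < 1).
Hypotheses (cP : seminorm_complete SP NP r) (cG : seminorm_complete SG NG r).
Hypothesis dd_sym : forall v w, SP v -> SP w -> dd v w = dd w v.
Hypothesis dd_ge0 : forall v, SP v -> 0 <= dd v v.
Variables (u : R -> VU) (p : R -> VP) (f : R -> VF) (g : R -> VG) (phi0 : VG).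
Hypothesis hu : bochnerL2 mu A SU NU u.
Hypothesis hp : bochnerL2 mu A SP NP p.
Hypothesis hf : bochnerL2 mu A SF NF f.
Hypothesis hg : bochnerL2 mu A SG NG g.
Hypothesis hphi0 : SG phi0.
Hypothesis momentum : forall v, SU v -> forall psi, test_function A psi ->
  \int[mu]_(t in A) (a (u t) v * psi t) + \int[mu]_(t in A) (b v (p t) * psi t) =
  \int[mu]_(t in A) (lf (f t) v * psi t).
Hypothesis mass : forall q, SP q -> forall psi, test_function A psi ->
  \int[mu]_(t in A) ((b (u t) q - c (p t) q) * derive1 psi t) +
  \int[mu]_(t in A) (dd (p t) q * psi t) = \int[mu]_(t in A) (lg (g t) q * psi t).
Hypothesis initial : forall q, SP q ->
  continuous_rep T (fun t => c (p t) q - b (u t) q) 0 = lg phi0 q.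

Let G (t : R) : VG := bochner_integral mu `]0, t[ SG NG g + phi0.

Let Su t : A t -> SU (u t). Proof. by move: hu => [[+ _] _]; apply. Qed.
Let Sp t : A t -> SP (p t). Proof. by move: hp => [[+ _] _]; apply. Qed.
Let Sf t : A t -> SF (f t). Proof. by move: hf => [[+ _] _]; apply. Qed.
Let Sg t : A t -> SG (g t). Proof. by move: hg => [[+ _] _]; apply. Qed.

Let cstU v : SU v -> bochnerL2 mu A SU NU (cst v) := bochnerL2_cst_on mA HU Aoo.
Let cstP v : SP v -> bochnerL2 mu A SP NP (cst v) := bochnerL2_cst_on mA HP Aoo.

Let rint (V1 V2 : lmodType R) (S1 : set V1) N1 (S2 : set V2) N2
    (beta : V1 -> V2 -> R) K (x : R -> V1) (y : R -> V2) :
  seminormed S1 N1 -> seminormed S2 N2 -> bounded_bilinear S1 N1 S2 N2 beta K ->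
  bochnerL2 mu A S1 N1 x -> bochnerL2 mu A S2 N2 y ->
  rintegrable mu A (fun t => beta (x t) (y t)).
Proof. by move=> h1 h2 hB; exact: (rintegrable_bilinear mA h1 h2 hB). Qed.

(** For fixed [v] the fundamental lemma in time gives the equation at almost every [t];
    [ae_test_curve] then permits [v = u t]. *)
Lemma momentum_ae :
  {ae mu, forall t, A t -> a (u t) (u t) + b (u t) (p t) - lf (f t) (u t) = 0}.
Proof.
pose E t v := a (u t) v + b v (p t) - lf (f t) v.
apply: (@ae_test_curve R _ (measurableTypeR R) mu A VU SU NU HU E u _ _ _ hu.1) => [t At|t At|v Sv].
- move=> x v w Sv Sw; rewrite /E (bilinear_r ha (Su At) x Sv Sw).
  rewrite (bilinear_l hb (Sp At) x Sv Sw) (bilinear_r hlf (Sf At) x Sv Sw); ring.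
- exists (Ka * nrm NU (u t) + Kb * nrm NP (p t) + Kf * nrm NF (f t)) => v Sv.
  apply: le_trans (ler_normB _ _) _; apply: le_trans (lerD (ler_normD _ _) (lexx _)) _.
  rewrite !mulrDl; apply: lerD; first apply: lerD.
  + exact: (bilinear_bound ha (Su At) Sv).
  + by rewrite mulrAC; exact: (bilinear_bound hb Sv (Sp At)).
  + exact: (bilinear_bound hlf (Sf At) Sv).
have ia := rint HU HU ha hu (cstU Sv); have ib := rint HU HP hb (cstU Sv) hp.
have il := rint HF HU hlf hf (cstU Sv).
have iab := rintegrableD mA ia ib; have iE := rintegrableB mA iab il.
apply: (fundamental_lemma_itv iE) => psi tpsi.
have ja := rintegrable_test_mul T0 ia tpsi; have jb := rintegrable_test_mul T0 ib tpsi.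
have jl := rintegrable_test_mul T0 il tpsi.
have := momentum Sv tpsi; rewrite -RintegralD// => E1.
transitivity (\int[mu]_(t in A) (a (u t) v * psi t + b v (p t) * psi t) -
  \int[mu]_(t in A) (lf (f t) v * psi t)); last by rewrite E1 subrr.
rewrite -RintegralB//; last exact: rintegrableD.
by apply: eq_Rintegral => t _; rewrite /= mulrBl mulrDl.
Qed.

Let time_int q t := \int[mu]_(s in A) (if s < t then dd (p s) q else 0).

(** The equation says that [c (p t) q - b (u t) q] has weak derivative [lg (g t) q - dd (p t) q].
    The initial condition fixes the constant of integration, and moving the time integral of [g]
    inside [lg] produces [G]. *)
Lemma mass_ae_test q : SP q -> {ae mu, forall t, A t ->
  c (p t) q - b (u t) q + time_int q t - lg (G t) q = 0}.
Proof.
move=> Sq.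
have ic := rint HP HP hc hp (cstP Sq); have ib := rint HU HP hb hu (cstP Sq).
have id := rint HP HP hd hp (cstP Sq); have ig := rint HG HP hlg hg (cstP Sq).
have iw := rintegrableB mA ic ib; have igam := rintegrableB mA ig id.
have weak psi : test_function A psi ->
    \int[mu]_(t in A) ((c (p t) q - b (u t) q) * derive1 psi t) =
    - \int[mu]_(t in A) ((lg (g t) q - dd (p t) q) * psi t).
  move=> tpsi.
  have jd := rintegrable_test_mul T0 id tpsi; have jg := rintegrable_test_mul T0 ig tpsi.
  have jw := rintegrable_test_mul T0 iw (test_derive1 tpsi).
  have -> : \int[mu]_(t in A) ((lg (g t) q - dd (p t) q) * psi t) =
      \int[mu]_(t in A) (lg (g t) q * psi t) - \int[mu]_(t in A) (dd (p t) q * psi t).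
    by rewrite -RintegralB//; apply: eq_Rintegral => t _; rewrite mulrBl.
  rewrite -(mass Sq tpsi) addrK -mulN1r -RintegralZl//.
    by apply: eq_Rintegral => t _; rewrite mulN1r -mulNr opprB.
  have := rintegrableZl mA (-1) jw; congr rintegrable; apply/funext => t.
  by rewrite /= mulN1r -mulNr opprB.
have [C hC] := weak_derivative_ae T0 iw igam weak.
have CE : C = lg phi0 q by rewrite -(initial Sq); apply/esym; exact: continuous_rep_initial T0 igam hC.
move: hC; apply: filterS; first exact: (ae_filter_ringOfSetsType mu).
move=> t /[swap] At /(_ At) ->.
have -> : \int[mu]_(s in A) (if s < t then lg (g s) q - dd (p s) q else 0) =
    \int[mu]_(s in A) (if s < t then lg (g s) q else 0) - time_int q t.
  rewrite /time_int -RintegralB//; [|exact: rintegrable_before..].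
  by apply: eq_Rintegral => s _; case: ifP; rewrite ?subr0.
have [t0 tT] : 0 < t /\ t < T by move: At; rewrite /= in_itv/= => /andP.
rewrite (@Rintegral_before R T (fun s => lg (g s) q) t At).
have sub : `]0, t[%classic `<=` A.
  by move=> s; rewrite /= !in_itv/= => /andP[-> /lt_trans ->].
have mt := measurable_time_itv t; have too := time_itv_lty t.
have gm : strongly_measurable (`]0, t[%classic : set (measurableTypeR R)) SG NG g :=
  smeas_subset sub hg.1.
have gi : rintegrable mu `]0, t[ (nrm NG \o g).
  have /(bochnerL2P _ _ HG)[g1 g2] := hg.
  by apply: integrableS (L1_bochnerL2 mA HG Aoo g1 g2).
have HI := bochner_integral_exists mt HG too r0 r1 cG gm gi.
have bnd v : SG v -> `|lg v q| <= Kg * nrm NP q * nrm NG v.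
  by move=> Sv; rewrite mulrAC; exact: (bilinear_bound hlg Sv Sq).
have [_ ->] := bochner_integral_linear (l := fun v => lg v q) (C := Kg * nrm NP q) mt HG too gm gi HI
  (bilinear_l hlg Sq) bnd.
have := linear_onD (bilinear_l hlg Sq) HI.1 hphi0; rewrite CE => E.
have -> : lg (G t) q = lg (bochner_integral mu `]0, t[ SG NG g) q + lg phi0 q := E.
ring.
Qed.

Lemma source_primitive_in t : A t -> SG (G t).
Proof.
move=> At; have sub : `]0, t[%classic `<=` A.
  move=> s; move: At; rewrite /= !in_itv/= => /andP[_ tT] /andP[-> st].
  exact: lt_trans st tT.
have mt := measurable_time_itv t; have too := time_itv_lty t.
have gm : strongly_measurable (`]0, t[%classic : set (measurableTypeR R)) SG NG g :=
  smeas_subset sub hg.1.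
have gi : rintegrable mu `]0, t[ (nrm NG \o g).
  have /(bochnerL2P _ _ HG)[g1 g2] := hg.
  by apply: integrableS (L1_bochnerL2 mA HG Aoo g1 g2).
have HI := bochner_integral_exists mt HG too r0 r1 cG gm gi.
exact: (subspD HG HI.1 hphi0).
Qed.

Let id q : SP q -> rintegrable mu A (fun s => dd (p s) q).
Proof. by move=> Sq; exact: (rint HP HP hd hp (cstP Sq)). Qed.

(** Here the tested functional contains the memory term; it is continuous in [q] because the norm of
    [p] is integrable over the bounded time interval. *)
Lemma mass_ae : {ae mu, forall t, A t ->
  c (p t) (p t) - b (u t) (p t) + time_int (p t) t - lg (G t) (p t) = 0}.
Proof.
pose E t q := c (p t) q - b (u t) q + time_int q t - lg (G t) q.
have ni : rintegrable mu A (nrm NP \o p).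
  by have /(bochnerL2P _ _ HP)[p1 p2] := hp; exact: (L1_bochnerL2 mA HP Aoo p1 p2).
apply: (@ae_test_curve R _ (measurableTypeR R) mu A VP SP NP HP E p _ _ _ hp.1) => [t At|t At|q Sq].
- move=> x v w Sv Sw; rewrite /E (bilinear_r hc (Sp At) x Sv Sw).
  rewrite (bilinear_r hb (Su At) x Sv Sw) (bilinear_r hlg (source_primitive_in At) x Sv Sw).
  have -> : time_int (x *: v + w) t = x * time_int v t + time_int w t.
    apply: (Rintegral_lin mA (rintegrable_before t (id Sv)) (rintegrable_before t (id Sw))) => s As.
    by case: ifP => _; [exact: (bilinear_r hd (Sp As) x Sv Sw)|rewrite mulr0 addr0].
  ring.
- exists (Kc * nrm NP (p t) + Kb * nrm NU (u t) +
    (\int[mu]_(s in A) (Kd * nrm NP (p s))) + Kg * nrm NG (G t)) => q Sq.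
  apply: le_trans (ler_normB _ _) _; apply: le_trans (lerD (ler_normD _ _) (lexx _)) _.
  apply: le_trans (lerD (lerD (ler_normB _ _) (lexx _)) (lexx _)) _.
  rewrite !mulrDl; apply: lerD; first apply: lerD; first apply: lerD.
  + exact: (bilinear_bound hc (Sp At) Sq).
  + exact: (bilinear_bound hb (Su At) Sq).
  + have ib := rintegrable_before t (id Sq).
    apply: le_trans (le_normr_Rintegral mA ib) _.
    have ik := rintegrableZl mA Kd ni; have iq := rintegrableZr mA (nrm NP q) ik.
    rewrite -RintegralZr//; apply: le_Rintegral => //; first exact: rintegrable_norm.
    move=> s As; have h := bilinear_bound hd (Sp As) Sq.
    case: ifP => _; first exact: h.
    by rewrite normr0; exact: le_trans (normr_ge0 _) h.
  + exact: (bilinear_bound hlg (source_primitive_in At) Sq).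
exact: mass_ae_test.
Qed.

(** The sum of the two identities is [a + c + V = lf + lg] with [V] the memory term; hence
    [a + c + 2 V = 2 (lf + lg) - (a + c)]. As [V] has nonnegative integral, the integral of [a + c]
    is at most that of the right-hand side, which [B] bounds pointwise. *)
Lemma energy_bound (B : R -> \bar R) : (forall t, A t -> (0 <= B t)%E) ->
  (forall t, A t -> ((2 * (lf (f t) (u t) + lg (G t) (p t)) -
     (a (u t) (u t) + c (p t) (p t)))%:E <= B t)%E) ->
  (\int[mu]_(t in A) (a (u t) (u t) + c (p t) (p t))%:E <= \int[mu]_(t in A) B t)%E.
Proof.
move=> B0 hB.
have ia := rint HU HU ha hu hu; have ic := rint HP HP hc hp hp.
have iac := rintegrableD mA ia ic.
(* Totality fails only at [s = t], a Lebesgue-null set. *)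
have total t : A t -> {ae mu, forall s, A s -> (t < s) = ~~ (s < t)}.
  move=> At; exists [set t]; split; first exact: measurable_set1.
    by rewrite lebesgue_measure_set1.
  move=> s /= ns; apply: contrapT => /eqP st; apply: ns => As.
  by rewrite -leNgt lt_neqAle eq_sym st.
have [iV V0] := volterra_ge0 mA Aoo HP hd r0 r1 cP dd_sym dd_ge0 hp (@measurable_time_lt R T) total.
set V := fun t => \int[mu]_(s in A) (if s < t then dd (p s) (p t) else 0) in iV V0.
have iV2 := rintegrableZl mA 2 iV.
pose y t := (a (u t) (u t) + c (p t) (p t)) + 2 * V t.
have iy : rintegrable mu A y := rintegrableD mA iac iV2.
rewrite -EFin_Rintegral//.
apply: (@le_trans _ _ (\int[mu]_(t in A) y t)%:E).
  by rewrite lee_fin /y (RintegralD mA iac iV2) lerDl RintegralZl// mulr_ge0.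
apply: Rintegral_le_ae_sup => //.
move: momentum_ae mass_ae; apply: filterS2 => t h1 h2 At; have {}h1 := h1 At; have {}h2 := h2 At; have hBt := hB t At.
rewrite (_ : y t = 2 * (lf (f t) (u t) + lg (G t) (p t)) - (a (u t) (u t) + c (p t) (p t)))//.
have hV : time_int (p t) t = V t by [].
rewrite hV in h2; rewrite /y; clear hB hBt hV.
move: h1 h2; generalize (a (u t) (u t)) (b (u t) (p t)) (c (p t) (p t)) (V t)
  (lf (f t) (u t)) (lg (G t) (p t)) => x1 x2 x3 x4 x5 x6 h1 h2; lra.
Qed.

End abstract_biot.

(** * The forms of the Biot problem *)

Section bilinear_transport.
Context {R : realType} {V1 V2 : lmodType R}.
Variables (S1 : set V1) (N1 : V1 -> \bar R) (S2 : set V2) (N2 : V2 -> \bar R).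
Hypotheses (SN1 : seminormed S1 N1) (SN2 : seminormed S2 N2).

Lemma bounded_bilinear_eq (beta beta' : V1 -> V2 -> R) K :
  (forall v w, S1 v -> S2 w -> beta v w = beta' v w) ->
  bounded_bilinear S1 N1 S2 N2 beta' K -> bounded_bilinear S1 N1 S2 N2 beta K.
Proof.
move=> E h; split.
- move=> w Sw a v v' Sv Sv'; have Svv := seminormed_lin SN1 a Sv Sv'.
  by rewrite /= !E//; exact: (bilinear_l h Sw a Sv Sv').
- move=> v Sv a w w' Sw Sw'; have Sww := seminormed_lin SN2 a Sw Sw'.
  by rewrite /= !E//; exact: (bilinear_r h Sv a Sw Sw').
- by move=> v w Sv Sw; rewrite E//; exact: (bilinear_bound h).
Qed.

Lemma bounded_bilinear_add (beta beta' : V1 -> V2 -> R) K K' :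
  bounded_bilinear S1 N1 S2 N2 beta K -> bounded_bilinear S1 N1 S2 N2 beta' K' ->
  bounded_bilinear S1 N1 S2 N2 (fun v w => beta v w + beta' v w) (K + K').
Proof.
move=> h h'; split.
- move=> w Sw a v v' Sv Sv' /=.
  by rewrite (bilinear_l h Sw a Sv Sv') (bilinear_l h' Sw a Sv Sv'); ring.
- move=> v Sv a w w' Sw Sw' /=.
  by rewrite (bilinear_r h Sv a Sw Sw') (bilinear_r h' Sv a Sw Sw'); ring.
- move=> v w Sv Sw; apply: le_trans (ler_normD _ _) _; rewrite !mulrDl.
  by apply: lerD; [exact: (bilinear_bound h)|exact: (bilinear_bound h')].
Qed.

End bilinear_transport.

(** The deterministic data enter the forms as constant random fields, which keep their norm because
    [P] has mass 1. *)
Lemma bounded_bilinear_cst (R : realType) disp (Th : measurableType disp)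
    (P : probability Th R) (V1 V2 : lmodType R) (S1 : set V1) (N1 : V1 -> \bar R)
    (S2 : set V2) (N2 : V2 -> \bar R) (beta : (Th -> V1) -> V2 -> R) K :
  seminormed S1 N1 ->
  bounded_bilinear (bochnerL2 P setT S1 N1) (bochner_norm P setT N1) S2 N2 beta K ->
  bounded_bilinear S1 N1 S2 N2 (fun v => beta (cst v)) K.
Proof.
move=> SN1 h; have b1 v : S1 v -> _ := @bochnerL2_cst _ _ _ P _ _ _ SN1 v; split.
- move=> w Sw a v v' Sv Sv' /=.
  exact: (bilinear_l h Sw a (b1 v Sv) (b1 v' Sv')).
- by move=> v Sv; exact: (bilinear_r h (b1 v Sv)).
- move=> v w Sv Sw; have := bilinear_bound h (b1 v Sv) Sw.
  by rewrite (nrm_bochner_cst P SN1 Sv).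
Qed.

Section energy_comparison.
Context {R : realType} {d : nat} {disp : measure_display} {Th : measurableType disp}.
Variables (P : probability Th R) (D : set 'rV[R]_d).
Hypothesis mD : measurable D.
Local Notation X := 'rV[R]_d.
Local Notation leb := (lebesgue_row d).
Local Notation M2 := (lebesgue_row d \x P)%E.
Local Notation A2 := (D `*` [set: Th]).
Local Notation mT := (@measurableT _ Th).

Let mA2 : measurable A2. Proof. exact: measurableX. Qed.

Context {V : lmodType R}.
Variables (S : set V) (N : V -> \bar R).
Hypothesis SN : seminormed S N.
Local Notation bL := (bochnerL2 P setT S N).

Lemma rintegrable_sum_sqr (J : finType) (o : J -> V -> X -> R) (C : J -> R) v F :
  (forall j, observable leb D S N (o j) (C j)) -> bL v ->
  (forall j, represents D (o j) v (F j)) ->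
  rintegrable M2 A2 (fun z => \sum_j F j z ^+ 2).
Proof.
move=> oC bv hF; apply: (rintegrable_sum mA2) => j _.
exact: (sqint_rintegrable (represents_sqi mD SN (oC j) bv (hF j)).1).
Qed.

Lemma sum_sqr_fubini (J : finType) (o : J -> V -> X -> R) (C : J -> R) v F :
  (forall j, observable leb D S N (o j) (C j)) -> bL v ->
  (forall j, represents D (o j) v (F j)) ->
  rintegrable P setT (fun t => \sum_j sqi leb D (o j (v t))) /\
  \int[M2]_(z in A2) (\sum_j F j z ^+ 2) = \int[P]_t \sum_j sqi leb D (o j (v t)).
Proof.
move=> oC bv hF; have [[Sv _] _] := bv.
have [_ i1 E] := fubini_prod mD mT (rintegrable_sum_sqr oC bv hF).
have inner t : \int[leb]_(x in D) (\sum_j F j (x, t) ^+ 2) = \sum_j sqi leb D (o j (v t)).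
  have so j : sqint leb D (o j (v t)) := obs_sqint (oC j) (Sv t Logic.I).
  have h j : j \in index_enum J -> rintegrable leb D (fun x => o j (v t) x ^+ 2).
    by move=> _; exact: (sqint_rintegrable (so j)).
  rewrite -(Rintegral_sum mD h); apply: Rintegral_ae => //.
  - apply: measurable_sum => j; apply: measurable_funX.
    exact: (measurable_section2 (y := t) mD mT (hF j).1 Logic.I).
  - by apply: measurable_sum => j; apply: measurable_funX; exact: (so j).1.
  - have : forall j, {ae leb, forall x, D x -> F j (x, t) = o j (v t) x}.
      by move=> j; exact: (hF j).2.
    move/filter_forall; apply: filterS => x hx Dx.
    by apply: eq_bigr => j _; rewrite hx.
split; first by move: i1; congr rintegrable; apply/funext.
by rewrite E; apply: eq_Rintegral => t _; exact: inner.
Qed.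

(** Carries an inequality for deterministic fields, such as Korn's, over to random ones by
    integrating it over [Theta]. *)
Lemma sum_sqr_le (J J' : finType) (o : J -> V -> X -> R) (o' : J' -> V -> X -> R)
    (C : J -> R) (C' : J' -> R) K v F F' :
  (forall j, observable leb D S N (o j) (C j)) ->
  (forall j, observable leb D S N (o' j) (C' j)) ->
  (forall w, S w -> \sum_j sqi leb D (o j w) <= K * \sum_j sqi leb D (o' j w)) ->
  bL v -> (forall j, represents D (o j) v (F j)) ->
  (forall j, represents D (o' j) v (F' j)) ->
  \int[M2]_(z in A2) (\sum_j F j z ^+ 2) <= K * \int[M2]_(z in A2) (\sum_j F' j z ^+ 2).
Proof.
move=> oC oC' le bv hF hF'; have [[Sv _] _] := bv.
have [i1 ->] := sum_sqr_fubini oC bv hF; have [i2 ->] := sum_sqr_fubini oC' bv hF'.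
rewrite -RintegralZl//; apply: le_Rintegral => //; first exact: rintegrableZl.
by move=> t _; apply: le; exact: Sv.
Qed.

Lemma sum_sqr_cst (J : finType) (o : J -> V -> X -> R) (C : J -> R) v F :
  (forall j, observable leb D S N (o j) (C j)) -> S v ->
  (forall j, represents D (o j) (cst v) (F j)) ->
  \int[M2]_(z in A2) (\sum_j F j z ^+ 2) = \sum_j sqi leb D (o j v).
Proof.
move=> oC Sv hF; have [_ ->] := sum_sqr_fubini oC (bochnerL2_cst P SN Sv) hF.
transitivity (\int[P]_t cst (\sum_j sqi leb D (o j v)) t); first by [].
rewrite Rintegral_cst//= -[RHS]mulr1; congr (_ * _).
by transitivity (fine (1%E : \bar R)) => //; congr fine; exact: (@probability_setT _ _ _ P).
Qed.

End energy_comparison.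

Section pressure_space.
Context {R : realType} {d : nat}.
Variable D : set 'rV[R]_d.
Hypotheses (oD : open D) (bD : bounded_set D).
Variables (Gam : set 'rV[R]_d) (up : bool).
Local Notation S := (if up then H1 D `&` L2_0 D else H1_0 D Gam).

Lemma pressure_sub : S `<=` H1 D.
Proof. by case: up => q []. Qed.

Lemma pressure0 : S 0.
Proof. by case: up; [exact: mean_zero0|exact: H1_0_0]. Qed.

Lemma pressure_lin a q r : S q -> S r -> S (a *: q + r).
Proof. by case: up; [exact: mean_zero_lin|exact: H1_0_lin]. Qed.

Lemma pressure_complete r : 0 <= r -> r < 1 -> seminorm_complete S (H1norm D) r.
Proof.
move=> r0 r1; apply: H1_sub_complete => //; first exact: pressure_sub.
by case: up; [exact: mean_zero_closed|exact: H1_0_closed].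
Qed.

End pressure_space.

Section biot_forms.
Context {R : realType} {d : nat} {disp : measure_display} {Th : measurableType disp}.
Variables (P : probability Th R) (D : set 'rV[R]_d).
Hypotheses (oD : open D) (bD : bounded_set D).
Local Notation X := 'rV[R]_d.
Local Notation leb := (lebesgue_row d).
Local Notation M2 := (lebesgue_row d \x P)%E.
Local Notation A2 := (D `*` [set: Th]).
Local Notation mT := (@measurableT _ Th).

Let mD : measurable D := open_row_measurable oD.
Let mA2 : measurable A2. Proof. exact: measurableX. Qed.

Variables S1 S2 : set (X -> R).
Hypotheses (S10 : S1 0) (S1lin : forall a q r, S1 q -> S1 r -> S1 (a *: q + r)).
Hypotheses (S20 : S2 0) (S2lin : forall a q r, S2 q -> S2 r -> S2 (a *: q + r)).
Hypotheses (S1H : S1 `<=` H1 D) (S2H : S2 `<=` H1 D).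

Let SNU := seminormed_H1v oD bD S10 S1lin S1H.
Let SNP := seminormed_H1 oD bD S20 S2lin S2H.
Local Notation U := (bochnerL2 P setT (fields S1) (H1normv D)).
Local Notation NU := (bochner_norm P setT (H1normv D)).
Local Notation Pr := (bochnerL2 P setT S2 (H1norm D)).
Local Notation NP := (bochner_norm P setT (H1norm D)).

Definition sym_obs (p : 'I_d * 'I_d) (v : X -> X) (x : X) : R := symgrad D v x p.1 p.2.
Definition div_obs (i : 'I_1) (v : X -> X) (x : X) : R := divergence D v x.
Definition coord_obs (i : 'I_d) (v : X -> X) (x : X) : R := v x ord0 i.
Definition val_obs (i : 'I_1) (q : X -> R) (x : X) : R := q x.
Definition grad_obs (i : 'I_d) (q : X -> R) (x : X) : R := weak_grad D q x ord0 i.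

Let sym_ok p : observable leb D (fields S1) (H1normv D) (sym_obs p) 1.
Proof. exact: (observable_symgrad oD bD S1H). Qed.

Let coord_ok i : observable leb D (fields S1) (H1normv D) (coord_obs i) 1.
Proof. exact: (observable_coord oD bD S1H). Qed.

Let val_ok i : observable leb D S2 (H1norm D) (val_obs i) 1.
Proof. exact: (observable_value oD bD S2H). Qed.

Let grad_ok i : observable leb D S2 (H1norm D) (grad_obs i) 1.
Proof. exact: (observable_grad oD bD S2H). Qed.

Let div_ok : exists C, forall i, observable leb D (fields S1) (H1normv D) (div_obs i) C.
Proof. by have [C hC] := observable_divergence oD bD S1H; exists C. Qed.

Let Fcoord_ok i : observable leb D (L2v D) (L2norm_mx D) (coord_obs i) 1.
Proof. exact: (observable_L2v oD). Qed.

Let Gval_ok i : observable leb D (L2 D) (L2norm D) (val_obs i) 1.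
Proof. exact: (observable_L2 oD). Qed.

Let frob_sum (A B : 'M[R]_d) : frob_dot A B = \sum_p A p.1 p.2 * B p.1 p.2.
Proof. by rewrite /frob_dot pair_bigA. Qed.

Section elasticity.
Variables (mu lambda : X * Th -> R) (M : R).
Hypotheses (mmu : measurable_fun A2 mu) (mlambda : measurable_fun A2 lambda).
Hypothesis M0 : 0 <= M.
Hypothesis muM : {ae M2, forall z, A2 z -> `|2 * mu z| <= M}.
Hypothesis lambdaM : {ae M2, forall z, A2 z -> `|lambda z| <= M}.

Let w z := 2 * mu z.
Let mw : measurable_fun A2 w. Proof. exact: measurable_funM. Qed.

(** [a_form] integrates the sum of both densities at once; splitting it requires each of them to be
    integrable, which the bounds on the weights provide. *)
Lemma a_form_sum v r : U v -> U r -> a_form P D mu lambda v r =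
  form P D sym_obs sym_obs w v r + form P D div_obs div_obs lambda v r.
Proof.
move=> bv br; have [C div_C] := div_ok.
have [F hF] := choice (fun p => represents_ex mD SNU (sym_ok p) bv).
have [G hG] := choice (fun p => represents_ex mD SNU (sym_ok p) br).
have [F' hF'] := choice (fun p => represents_ex mD SNU (div_C p) bv).
have [G' hG'] := choice (fun p => represents_ex mD SNU (div_C p) br).
have f1 := bounded_form_finite mD SNU SNU sym_ok sym_ok mw M0 muM.
have f2 := bounded_form_finite mD SNU SNU div_C div_C mlambda M0 lambdaM.
rewrite (formE mD sym_ok sym_ok mw f1 bv br hF hG).
rewrite (formE mD div_C div_C mlambda f2 bv br hF' hG').
have i1 := f1 v r F G bv br hF hG; have i2 := f2 v r F' G' bv br hF' hG'.
rewrite -RintegralD//.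
have aE : a_density D mu lambda v r = fun t x => density sym_obs sym_obs w v r t x + density div_obs div_obs lambda v r t x.
  apply/funext => t; apply/funext => x.
  by rewrite /density big_ord1 /a_density frob_sum.
rewrite /a_form aE; apply: (ED_prod mD).
- exact: rintegrableD.
- move=> t; apply: measurable_funD.
    exact: (measurable_density mD sym_ok sym_ok mw t bv br).
  exact: (measurable_density mD div_C div_C mlambda t bv br).
- move=> t; move: (density_kernel w hF hG t) (density_kernel lambda hF' hG' t).
  by apply: filterS2 => x h1 h2 Dx; rewrite h1// h2.
Qed.

Lemma a_form_bilinear : exists K, bounded_bilinear U NU U NU (a_form P D mu lambda) K.
Proof.
have [C div_C] := div_ok; have SB := seminormed_bochner P mT SNU.
have [K1 h1] := bounded_form_bilinear mD SNU SNU sym_ok sym_ok mw M0 muM.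
have [K2 h2] := bounded_form_bilinear mD SNU SNU div_C div_C mlambda M0 lambdaM.
exists (K1 + K2); apply: (bounded_bilinear_eq SB SB a_form_sum).
exact: bounded_bilinear_add.
Qed.

(** The divergence term is nonnegative and is dropped; [mu_low <= mu] and Korn's inequality treat
    the other. Only the values of [v] are kept, since only they are paired with the force. *)
Lemma a_form_korn (mu_low C_K : R) v F : 0 < mu_low -> 0 < C_K ->
  {ae M2, forall z, A2 z -> mu_low <= mu z} -> {ae M2, forall z, A2 z -> 0 <= lambda z} ->
  (forall v, fields S1 v ->
    \sum_i sqi leb D (coord_obs i v) <= C_K * \sum_p sqi leb D (sym_obs p v)) ->
  U v -> (forall i, represents D (coord_obs i) v (F i)) ->
  2 * mu_low / C_K * \int[M2]_(z in A2) (\sum_i F i z ^+ 2) <= a_form P D mu lambda v v.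
Proof.
move=> mu0 CK0 hmu hlambda korn bv hF; have [C div_C] := div_ok.
have [G hG] := choice (fun p => represents_ex mD SNU (sym_ok p) bv).
have le := sum_sqr_le mD SNU coord_ok sym_ok korn bv hF hG.
have f1 := bounded_form_finite mD SNU SNU sym_ok sym_ok mw M0 muM.
have f2 := bounded_form_finite mD SNU SNU div_C div_C mlambda M0 lambdaM.
have k0 : 0 <= 2 * mu_low / C_K by rewrite divr_ge0 ?mulr_ge0// ltW.
rewrite (a_form_sum bv bv).
have := form_ge0 mD SNU div_C mlambda hlambda f2 bv; set dv := form _ _ _ _ _ _ _ => dv0.
apply: (@le_trans _ _ (form P D sym_obs sym_obs w v v)); last by rewrite lerDl.
apply: le_trans (ler_wpM2l k0 le) _.
rewrite mulrA divfK ?gt_eqF// (formE mD sym_ok sym_ok mw f1 bv bv hG hG).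
have iG := rintegrable_sum_sqr mD SNU sym_ok bv hG.
rewrite -RintegralZl//; apply: Rintegral_le_ae => //.
- exact: rintegrableZl.
- exact: (f1 v v G G bv bv hG hG).
apply: filterS hmu => z /[apply] hz; rewrite /kernel /w.
under [X in _ <= _ * X]eq_bigr do rewrite -expr2.
apply: ler_wpM2r; first by apply: sumr_ge0 => p _; exact: sqr_ge0.
by rewrite ler_wpM2l.
Qed.

End elasticity.

Lemma b_form_bilinear (alpha : X * Th -> R) M : measurable_fun A2 alpha -> 0 <= M ->
  {ae M2, forall z, A2 z -> `|alpha z| <= M} ->
  exists K, bounded_bilinear U NU Pr NP (b_form P D alpha) K.
Proof.
move=> malpha M0 alphaM; have [C div_C] := div_ok.
have mna : measurable_fun A2 (fun z => - alpha z) by exact: measurable_funN.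
have naM : {ae M2, forall z, A2 z -> `|- alpha z| <= M}.
  by apply: filterS alphaM => z /[apply]; rewrite normrN.
have C1 : C <= Num.max C 1 by rewrite le_max lexx.
have C2 : 1 <= Num.max C 1 by rewrite le_max lexx orbT.
have div_C' i := observable_le C1 (div_C i).
have val_C' i := observable_le C2 (val_ok i).
have [K hK] := bounded_form_bilinear mD SNU SNP div_C' val_C' mna M0 naM.
exists K; move: hK; congr bounded_bilinear; apply/funext => v; apply/funext => q.
congr ED; apply/funext => t; apply/funext => x.
by rewrite /density big_ord1 /b_density mulNr mulrA.
Qed.

Let c_formE c0 : c_form P D c0 = form P D val_obs val_obs c0.
Proof.
apply/funext => q; apply/funext => r; congr ED; apply/funext => t; apply/funext => x.
by rewrite /density big_ord1 /c_density mulrA.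
Qed.

Let d_formE kappa : d_form P D kappa = form P D grad_obs grad_obs kappa.
Proof.
apply/funext => q; apply/funext => r; congr ED; apply/funext => t; apply/funext => x.
rewrite /density /d_density frob_dot_row; congr (_ * _).
by apply: eq_bigr => i _; rewrite mulrC.
Qed.

Section storage_permeability.
Variable w : X * Th -> R.
Hypotheses (mw : measurable_fun A2 w) (w0 : {ae M2, forall z, A2 z -> 0 <= w z}).
Hypothesis cB : seminorm_complete Pr NP 4^-1.

Section storage.
Hypothesis fin : forall q r, Pr q -> Pr r -> ED_finite P D (c_density w q r).

Let c_fin : form_finite P D S2 (H1norm D) S2 (H1norm D) val_obs val_obs w.
Proof.
apply: (ED_form_finite mD val_ok val_ok mw) => q r bq br.
have := fin bq br; congr ED_finite; apply/funext => t; apply/funext => x.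
by rewrite /density big_ord1 /c_density mulrA.
Qed.

Lemma c_form_bilinear : exists K, bounded_bilinear Pr NP Pr NP (c_form P D w) K.
Proof. by rewrite c_formE; exact: (form_bounded_bilinear mD SNP val_ok mw w0 c_fin cB). Qed.

(** Pointwise, [2 G H <= w H^2 + k G^2] as soon as [1 <= k w]: the storage term absorbs the pressure
    when [k] bounds the inverse of the storage coefficient. *)
Lemma pairing_le_c_form (k : R) (G : X -> R) q : 0 < k ->
  {ae M2, forall z, A2 z -> 1 <= k * w z} -> L2 D G -> Pr q ->
  2 * ED P D (fun t x => G x * q t x) <= c_form P D w q q + k * sqi leb D G.
Proof.
move=> k0 hk GL bq.
have bG := bochnerL2_cst P (seminormed_L2 mD) GL.
have [F hF] := choice (fun i => represents_ex mD (seminormed_L2 mD) (Gval_ok i) bG).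
have [H hH] := choice (fun i => represents_ex mD SNP (val_ok i) bq).
have m1 : measurable_fun A2 (cst 1 : X * Th -> R) by exact: measurable_cst.
have f1 : form_finite P D (L2 D) (L2norm D) S2 (H1norm D) val_obs val_obs (cst 1).
  apply: (bounded_form_finite mD (seminormed_L2 mD) SNP Gval_ok val_ok m1 ler01).
  by apply: aeW => z _; rewrite normr1.
have i1 := f1 _ _ F H bG bq hF hH; have i2 := c_fin bq bq hH hH.
have iF := rintegrable_sum_sqr mD (seminormed_L2 mD) Gval_ok bG hF.
have -> : ED P D (fun t x => G x * q t x) = form P D val_obs val_obs (cst 1) (cst G) q.
  by congr ED; apply/funext => t; apply/funext => x; rewrite /density big_ord1 mul1r.
have GE := sum_sqr_cst P mD (seminormed_L2 mD) Gval_ok GL hF; rewrite big_ord1 in GE.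
have -> : sqi leb D G = \int[M2]_(z in A2) (\sum_j F j z ^+ 2) by rewrite GE.
rewrite c_formE (formE mD Gval_ok val_ok m1 f1 bG bq hF hH) (formE mD val_ok val_ok mw c_fin bq bq hH hH).
have ikF := rintegrableZl mA2 k iF.
rewrite -RintegralZl// -[X in _ + X]RintegralZl// -RintegralD//.
apply: Rintegral_le_ae => //; [exact: rintegrableZl|exact: rintegrableD|].
apply: filterS hk => z /[apply] hz; rewrite /kernel !big_ord1 mul1r.
have w1 : 0 <= w z by move: hz => /(lt_le_trans ltr01); rewrite pmulr_rgt0// => /ltW.
(* The pointwise inequality multiplied by [k], free of divisions: a square plus a multiple of
   [k * w z - 1]. *)
have h1 : k * (w z * (H ord0 z * H ord0 z) + k * F ord0 z ^+ 2) - k * (2 * (F ord0 z * H ord0 z)) =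
  (k * F ord0 z - H ord0 z) ^+ 2 + (k * w z - 1) * H ord0 z ^+ 2 by ring.
rewrite -subr_ge0 -(pmulr_rge0 _ k0) mulrBr h1 addr_ge0 ?sqr_ge0// mulr_ge0 ?sqr_ge0//.
by rewrite subr_ge0.
Qed.

End storage.

Section permeability.
Hypothesis fin : forall q r, Pr q -> Pr r -> ED_finite P D (d_density D w q r).

Let d_fin : form_finite P D S2 (H1norm D) S2 (H1norm D) grad_obs grad_obs w.
Proof.
apply: (ED_form_finite mD grad_ok grad_ok mw) => q r bq br.
have := fin bq br; congr ED_finite; apply/funext => t; apply/funext => x.
rewrite /density /d_density frob_dot_row; congr (_ * _).
by apply: eq_bigr => i _; rewrite mulrC.
Qed.

Lemma d_form_bilinear : exists K, bounded_bilinear Pr NP Pr NP (d_form P D w) K.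
Proof. by rewrite d_formE; exact: (form_bounded_bilinear mD SNP grad_ok mw w0 d_fin cB). Qed.

Lemma d_form_sym q r : d_form P D w q r = d_form P D w r q.
Proof. by rewrite d_formE form_sym. Qed.

Lemma d_form_ge0 q : Pr q -> 0 <= d_form P D w q q.
Proof. by rewrite d_formE; exact: (form_ge0 mD SNP grad_ok mw w0 d_fin). Qed.

End permeability.
End storage_permeability.

Let m1 : measurable_fun A2 (cst 1 : X * Th -> R). Proof. exact: measurable_cst. Qed.
Let h1 : {ae M2, forall z, A2 z -> `|(cst 1 : X * Th -> R) z| <= 1}.
Proof. by apply: aeW => z _; rewrite normr1. Qed.

Let force_formE F v : ED P D (fun t x => frob_dot (F x) (v t x)) =
  form P D coord_obs coord_obs (cst 1) (cst F) v.
Proof.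
by congr ED; apply/funext => t; apply/funext => x; rewrite /density mul1r frob_dot_row.
Qed.

Lemma force_bilinear : exists K, bounded_bilinear (L2v D) (L2norm_mx D) U NU
  (fun F v => ED P D (fun t x => frob_dot (F x) (v t x))) K.
Proof.
have SF := seminormed_L2v mD.
have [K hK] := bounded_form_bilinear mD SF SNU Fcoord_ok coord_ok m1 ler01 h1.
exists K; have := bounded_bilinear_cst SF hK; congr bounded_bilinear.
by apply/funext => F; apply/funext => v; rewrite force_formE.
Qed.

Lemma source_bilinear : exists K, bounded_bilinear (L2 D) (L2norm D) Pr NP
  (fun G q => ED P D (fun t x => G x * q t x)) K.
Proof.
have SG := seminormed_L2 mD.
have [K hK] := bounded_form_bilinear mD SG SNP Gval_ok val_ok m1 ler01 h1.
exists K; have := bounded_bilinear_cst SG hK; congr bounded_bilinear.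
apply/funext => G; apply/funext => q; congr ED; apply/funext => t; apply/funext => x.
by rewrite /density big_ord1 mul1r.
Qed.

(** The weight [k] is left free, to be matched with the coefficient in [a_form_korn]. *)
Lemma force_le (k : R) (F : X -> X) v H : 0 < k -> L2v D F -> U v ->
  (forall i, represents D (coord_obs i) v (H i)) ->
  2 * ED P D (fun t x => frob_dot (F x) (v t x)) <=
  k * \int[M2]_(z in A2) (\sum_i H i z ^+ 2) + k^-1 * nrm (L2norm_mx D) F ^+ 2.
Proof.
move=> k0 FL bv hH; have SF := seminormed_L2v mD.
have bF := bochnerL2_cst P SF FL.
have [G hG] := choice (fun i => represents_ex mD SF (Fcoord_ok i) bF).
have f1 := bounded_form_finite mD SF SNU Fcoord_ok coord_ok m1 ler01 h1.
have i1 := f1 _ _ G H bF bv hG hH.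
have iH := rintegrable_sum_sqr mD SNU coord_ok bv hH.
have iG := rintegrable_sum_sqr mD SF Fcoord_ok bF hG.
rewrite force_formE (nrm_L2v mD FL) -(sum_sqr_cst P mD SF Fcoord_ok FL hG).
rewrite (formE mD Fcoord_ok coord_ok m1 f1 bF bv hG hH).
have ikH := rintegrableZl mA2 k iH; have ikG := rintegrableZl mA2 k^-1 iG.
rewrite -RintegralZl// -RintegralZl// -[X in _ + X]RintegralZl// -RintegralD//.
apply: le_Rintegral => //; [exact: rintegrableZl|exact: rintegrableD|].
move=> z _; rewrite /kernel mul1r !mulr_sumr -big_split/=; apply: ler_sum => i _.
have E : k * (k * H i z ^+ 2 + k^-1 * G i z ^+ 2) - k * (2 * (G i z * H i z)) =
  (k * H i z - G i z) ^+ 2 by field; rewrite gt_eqF.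
by rewrite -subr_ge0 -(pmulr_rge0 _ k0) mulrBr E sqr_ge0.
Qed.

End biot_forms.

(** Retains only the zeroth-order part of the H1 norm, in the coordinates used by [a_form_korn]. *)
Lemma korn_sum (R : realType) d (D : set 'rV[R]_d) (S : set ('rV[R]_d -> R)) C_K v :
  open D -> bounded_set D -> S 0 -> (forall a q r, S q -> S r -> S (a *: q + r)) ->
  S `<=` H1 D -> fields S v ->
  ((H1normv D v) ^+ 2 <= C_K%:E * (L2norm_mx D (symgrad D v)) ^+ 2)%E ->
  \sum_i sqi (lebesgue_row d) D (coord_obs i v) <=
  C_K * \sum_p sqi (lebesgue_row d) D (sym_obs D p v).
Proof.
move=> oD bD S0 Slin SH Sv korn; have mD := open_row_measurable oD.
have SN := seminormed_H1v oD bD S0 Slin SH.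
apply: (@le_trans _ _ (nrm (H1normv D) v ^+ 2)).
  rewrite (nrm_H1v oD SH Sv).
  rewrite -(pair_bigA _ (fun i k => sqi (lebesgue_row d) D (H1vobs D (i, k) v)))/=.
  apply: ler_sum => i _; rewrite big_ord_recl [X in X + _](_ : _ = sqi (lebesgue_row d) D (coord_obs i v)).
    by rewrite lerDl sumr_ge0// => k _; exact: sqi_ge0.
  by congr sqi; apply/funext => x; rewrite /H1vobs /H1obs unlift_none.
set s := \sum_p _; have s0 : 0 <= s by apply: sumr_ge0 => p _; exact: sqi_ge0.
have E : (L2norm_mx D (symgrad D v) = (Num.sqrt s)%:E)%E.
  transitivity (energy (lebesgue_row d) D (sym_obs D) v `^ 2^-1)%E.
    congr (_ `^ _)%E; apply: eq_integral => x _; congr EFin.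
    by rewrite /frob_dot pair_bigA; apply: eq_bigr => p _; rewrite expr2.
  rewrite (energyE (S := fields S) mD)//; first by rewrite poweR_EFin powR12_sqrt.
  by move=> p w Sw; exact: (obs_sqint (observable_symgrad oD bD SH p) Sw).
by move: korn; rewrite E (nrmE SN Sv) -!EFin_expe -EFinM lee_fin sqr_sqrtr.
Qed.

(** * The Biot problem as an instance of the abstract estimate *)

Unset Implicit Arguments.

Theorem proposition5 (R : realType) (d : nat) (hd : d = 2%N \/ d = 3%N)
  (D : set 'rV[R]_d) (hD : polyhedral_domain D)
  (Gam_D Gam_d : set 'rV[R]_d)
  (hGam_D : Gam_D `<=` bd D) (hGam_D_pos : (0 < hausdorff d.-1 Gam_D)%E)
  (hGam_d : Gam_d `<=` bd D)
  (disp : measure_display) (Theta : measurableType disp)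
  (P : probability Theta R) (tF : R) (htF : 0 < tF)
  (mu lambda alpha c0 kappa : 'rV[R]_d * Theta -> R)
  (mu_meas : measurable_fun (D `*` setT) mu)
  (lambda_meas : measurable_fun (D `*` setT) lambda)
  (alpha_meas : measurable_fun (D `*` setT) alpha)
  (c0_meas : measurable_fun (D `*` setT) c0)
  (kappa_meas : measurable_fun (D `*` setT) kappa)
  (mu_gt0 : aeDT P D (fun z => 0 < mu z))
  (lambda_gt0 : aeDT P D (fun z => 0 < lambda z))
  (kappa_gt0 : aeDT P D (fun z => 0 < kappa z))
  (c0_ge0 : aeDT P D (fun z => 0 <= c0 z))
  (a_finite : forall v w, U_space P D Gam_D v -> U_space P D Gam_D w ->
    ED_finite P D (a_density D mu lambda v w))
  (b_finite : forall v q, U_space P D Gam_D v -> P_space P D Gam_D Gam_d c0 q ->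
    ED_finite P D (b_density D alpha v q))
  (c_finite : forall q r, P_space P D Gam_D Gam_d c0 q ->
    P_space P D Gam_D Gam_d c0 r -> ED_finite P D (c_density c0 q r))
  (d_finite : forall q r, P_space P D Gam_D Gam_d c0 q ->
    P_space P D Gam_D Gam_d c0 r -> ED_finite P D (d_density D kappa q r))
  (phi alpha_low : R) (hphi : 0 < phi)
  (alpha_lowE : alpha_low = 3 * phi / (2 + phi))
  (alpha_bounds : aeDT P D (fun z => alpha_low < alpha z <= 1))
  (* extended-real inverse, with 0^-1 = +oo *)
  (gassmann : aeDT P D (fun z =>
    ((c0 z)%:E^-1 <= (bulk_modulus mu lambda z / alpha z)%:E)%E))
  (f : R -> 'rV[R]_d -> 'rV[R]_d) (g : R -> 'rV[R]_d -> R)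
  (phi0 : 'rV[R]_d -> R)
  (hf : bochnerL2 lebesgue_measure `]0, tF[ (L2v D) (L2norm_mx D) f)
  (hg : bochnerL2 lebesgue_measure `]0, tF[ (L2 D) (L2norm D) g)
  (hphi0 : L2 D phi0)
  (data_compat : pressure_up_to_constant P D Gam_D Gam_d c0 ->
    \int[lebesgue_row d]_(x in D) phi0 x = 0 /\
    forall t : R, 0 < t < tF -> \int[lebesgue_row d]_(x in D) g t x = 0)
  (C_K : R) (C_K_gt0 : 0 < C_K)
  (korn : forall v, H1_0v D Gam_D v ->
    ((H1normv D v) ^+ 2 <= C_K%:E * (L2norm_mx D (symgrad D v)) ^+ 2)%E)
  (mu_Linfty : Linfty P D mu)
  (mu_low : R) (mu_low_gt0 : 0 < mu_low)
  (mu_bound : aeDT P D (fun z => mu_low <= mu z))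
  (K_Linfty : Linfty P D (bulk_modulus mu lambda))
  (K_up : R)
  (K_bound : aeDT P D (fun z => 0 < bulk_modulus mu lambda z <= K_up))
  (u : R -> Theta -> 'rV[R]_d -> 'rV[R]_d) (p : R -> Theta -> 'rV[R]_d -> R)
  (hu : bochnerL2 lebesgue_measure `]0, tF[ (U_space P D Gam_D)
          (bochner_norm P setT (H1normv D)) u)
  (hp : bochnerL2 lebesgue_measure `]0, tF[ (P_space P D Gam_D Gam_d c0)
          (bochner_norm P setT (H1norm D)) p)
  (eq_momentum : forall v, U_space P D Gam_D v ->
    forall psi : R -> R, test_function `]0, tF[ psi ->
    \int[lebesgue_measure]_(t in `]0, tF[)
      (a_form P D mu lambda (u t) v * psi t) +
    \int[lebesgue_measure]_(t in `]0, tF[) (b_form P D alpha v (p t) * psi t) =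
    \int[lebesgue_measure]_(t in `]0, tF[)
      (ED P D (fun th x => frob_dot (f t x) (v th x)) * psi t))
  (eq_mass : forall q, P_space P D Gam_D Gam_d c0 q ->
    forall psi : R -> R, test_function `]0, tF[ psi ->
    \int[lebesgue_measure]_(t in `]0, tF[)
      ((b_form P D alpha (u t) q - c_form P D c0 (p t) q) * derive1 psi t) +
    \int[lebesgue_measure]_(t in `]0, tF[) (d_form P D kappa (p t) q * psi t) =
    \int[lebesgue_measure]_(t in `]0, tF[)
      (ED P D (fun th x => g t x * q th x) * psi t))
  (initial : forall q, P_space P D Gam_D Gam_d c0 q ->
    continuous_rep tF
      (fun t => c_form P D c0 (p t) q - b_form P D alpha (u t) q) 0 =
    ED P D (fun th x => phi0 x * q th x)) :
  let G := fun t : R =>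
    bochner_integral lebesgue_measure `]0, t[ (L2 D) (L2norm D) g + phi0 in
  (\int[lebesgue_measure]_(t in `]0%R, tF[)
      (a_form P D mu lambda (u t) (u t) + c_form P D c0 (p t) (p t))%:E <=
   \int[lebesgue_measure]_(t in `]0%R, tF[)
      ((C_K / (2 * mu_low))%:E * (L2norm_mx D (f t)) ^+ 2 +
       (K_up / alpha_low)%:E * (L2norm D (G t)) ^+ 2))%E.
Proof.
cbv zeta; set G := (fun t : R => _ + phi0).
have [oD bD _ _ _] := hD; have mD := open_row_measurable oD.
have mT := @measurableT _ Theta.
pose M2 := (lebesgue_row d \x P)%E; pose A2 := D `*` [set: Theta].
have aeA (Q : 'rV[R]_d * Theta -> Prop) : aeDT P D Q -> {ae M2, forall z, A2 z -> Q z}.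
  by rewrite /aeDT; apply: filterS => z h [Dz _]; exact: h.
pose S1 := H1_0 D Gam_D.
have S10 : S1 0 := H1_0_0 oD bD Gam_D.
have S1lin a q r : S1 q -> S1 r -> S1 (a *: q + r) := @H1_0_lin _ _ _ oD bD Gam_D a q r.
have S1H : S1 `<=` H1 D by exact: H1_0_sub.
pose up := `[< pressure_up_to_constant P D Gam_D Gam_d c0 >].
pose S2 := if up then H1 D `&` L2_0 D else H1_0 D Gam_d.
have S20 : S2 0 := pressure0 oD bD Gam_d up.
have S2lin a q r : S2 q -> S2 r -> S2 (a *: q + r) := @pressure_lin _ _ _ oD bD Gam_d up a q r.
have S2H : S2 `<=` H1 D by exact: pressure_sub.
have SNU := seminormed_H1v oD bD S10 S1lin S1H.
have SNP := seminormed_H1 oD bD S20 S2lin S2H.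
have SBU := seminormed_bochner P mT SNU; have SBP := seminormed_bochner P mT SNP.
have SF := seminormed_L2v mD; have SG := seminormed_L2 mD.
have r40 : 0 < 4^-1 :> R by lra.
have r41 : 4^-1 < 1 :> R by lra.
have cS2 : seminorm_complete S2 (H1norm D) 2^-1.
  by apply: pressure_complete => //; lra.
have cB := bochner_complete (mu := P) mT SNP cS2.
have cG := L2_complete mD (ltW r40) r41.
have alow0 : 0 < alpha_low by rewrite alpha_lowE divr_gt0// ?mulr_gt0//; lra.
have [Mm hMm] := mu_Linfty.2; have [MK hMK] := K_Linfty.2.
have d1 : 1 <= d%:R :> R by case: hd => ->; rewrite ler1n.
(* One bound for both elastic weights: [lambda] equals the bulk modulus minus [2 mu / d], and [d] is
   at least 1. *)
pose M := 2 * `|Mm| + `|MK|.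
have M0 : 0 <= M by rewrite /M addr_ge0// mulr_ge0.
have muM : {ae M2, forall z, A2 z -> `|2 * mu z| <= M}.
  apply: filterS (aeA _ hMm) => z /[apply] h.
  rewrite normrM (ger0_norm (ler0n _ 2)) /M.
  have := ler_norm Mm; have := normr_ge0 MK; lra.
have lambdaM : {ae M2, forall z, A2 z -> `|lambda z| <= M}.
  move: (aeA _ hMm) (aeA _ hMK); apply: filterS2 => z h1 h2 Az.
  have {}h1 := h1 Az; have {}h2 := h2 Az.
  have d0 : 0 < d%:R :> R by exact: lt_le_trans d1.
  have -> : lambda z = bulk_modulus mu lambda z - 2 * (mu z / d%:R).
    by rewrite /bulk_modulus; field; rewrite gt_eqF.
  have n2 : `|2 * (mu z / d%:R)| = 2 * (`|mu z| * `|d%:R^-1|).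
    by rewrite !normrM (ger0_norm (ler0n _ 2)).
  apply: le_trans (ler_normB _ _) _; rewrite n2.
  have : `|mu z| * `|d%:R^-1| <= `|mu z|.
    by rewrite ler_piMr// ger0_norm ?invr_ge0 ?ler0n// invf_le1.
  have := ler_norm Mm; have := ler_norm MK; rewrite /M; lra.
have alphaM : {ae M2, forall z, A2 z -> `|alpha z| <= 1}.
  apply: filterS (aeA _ alpha_bounds) => z /[apply] /andP[h1 h2].
  by rewrite ger0_norm//; apply: ltW; exact: lt_trans h1.
have [Ka ha] := a_form_bilinear oD bD S10 S1lin S1H mu_meas lambda_meas M0 muM lambdaM.
have [Kb hb] := b_form_bilinear oD bD S10 S1lin S20 S2lin S1H S2H alpha_meas ler01 alphaM.
have kappa0 : {ae M2, forall z, A2 z -> 0 <= kappa z}.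
  by apply: filterS (aeA _ kappa_gt0) => z /[apply] /ltW.
have [Kc hc] := c_form_bilinear oD bD S20 S2lin S2H c0_meas (aeA _ c0_ge0) cB c_finite.
have [Kd hdd] := d_form_bilinear oD bD S20 S2lin S2H kappa_meas kappa0 cB d_finite.
have [Kf hlf] := force_bilinear P oD bD S10 S1lin S1H.
have [Kg hlg] := source_bilinear P oD bD S20 S2lin S2H.
have dsym v w : P_space P D Gam_D Gam_d c0 v -> P_space P D Gam_D Gam_d c0 w ->
    d_form P D kappa v w = d_form P D kappa w v.
  by move=> _ _; exact: d_form_sym.
have dge0 v : P_space P D Gam_D Gam_d c0 v -> 0 <= d_form P D kappa v v.
  exact: (d_form_ge0 oD bD S20 S2lin S2H kappa_meas kappa0 d_finite).
have GL t : `]0, tF[%classic t -> L2 D (G t) :=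
  @source_primitive_in R tF _ _ _ SG _ r40 r41 cG _ _ hg hphi0 t.
(* The weight must be positive although the sign of [K_up] is not given; the last clause restores
   the constant of the statement in either case. *)
have [k [k0 hk kE]] : exists k, [/\ 0 < k,
    {ae M2, forall z, A2 z -> 1 <= k * c0 z} &
    forall q, L2 D q -> k * sqi (lebesgue_row d) D q =
      K_up / alpha_low * sqi (lebesgue_row d) D q].
  have [K0|K0] := ltP 0 K_up.
    exists (K_up / alpha_low); split => //; first exact: divr_gt0.
    have a1 : {ae M2, forall z, A2 z -> alpha_low < alpha z <= 1 /\ 0 <= c0 z}.
      by move: (aeA _ alpha_bounds) (aeA _ c0_ge0); apply: filterS2 => z h1 h2 Az;
        split; [exact: h1|exact: h2].
    move: a1 (aeA _ gassmann) (aeA _ K_bound); apply: filterS3 => z h1 h3 h4 Az.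
    have [/andP[{}h1 _] h2] := h1 Az; have {}h3 := h3 Az; have {h4}/andP[h4 h5] := h4 Az.
    have c1 : 0 < c0 z.
      (* [c0 z = 0] would make its extended inverse infinite, against a finite bound. *)
      rewrite lt_neqAle h2 andbT eq_sym; apply/eqP => cz.
      by move: h3; rewrite inver cz eqxx leNgt ltry.
    move: h3; rewrite inver gt_eqF// lee_fin => h3.
    rewrite -ler_pdivrMr// div1r; apply: le_trans h3 _.
    rewrite ler_pM//; [exact: ltW|rewrite invr_ge0 ltW//; exact: lt_trans h1|].
    by rewrite lef_pV2 ?posrE//; [exact: ltW|exact: lt_trans h1].
  (* If [K_up <= 0], the bounds on the bulk modulus are contradictory, so [D] times [Theta] is null.
     As [P] has mass 1, every squared norm on [D] is 0 and the weight 1 will do. *)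
  have none : {ae M2, forall z, A2 z -> False}.
    by apply: filterS (aeA _ K_bound) => z /[apply] /andP[/lt_le_trans h /h]; rewrite ltNge K0.
  exists 1; split => //; first by apply: filterS none => z /[apply].
  move=> q qL; suff -> : sqi (lebesgue_row d) D q = 0 by rewrite !mulr0.
  have bq := bochnerL2_cst P SG qL.
  have obs (i : 'I_1) : observable (lebesgue_row d) D (L2 D) (L2norm D) (val_obs i) 1 := observable_L2 oD.
  have [F hF] := choice (fun i => represents_ex mD SG (obs i) bq).
  have := sum_sqr_cst P mD SG obs qL hF; rewrite big_ord1 => <-.
  transitivity (\int[M2]_(z in A2) (0 : R)); last by rewrite Rintegral_eq0.
  apply: Rintegral_ae; [exact: measurableX| |exact: measurable_cst|].
    by apply: measurable_sum => i; apply: measurable_funX; exact: (hF i).1.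
  by apply: filterS none => z /[apply].
have BE t : `]0, tF[%classic t -> ((C_K / (2 * mu_low))%:E * (L2norm_mx D (f t)) ^+ 2 +
       (K_up / alpha_low)%:E * (L2norm D (G t)) ^+ 2 =
     (C_K / (2 * mu_low) * nrm (L2norm_mx D) (f t) ^+ 2 +
      k * sqi (lebesgue_row d) D (G t))%:E)%E.
  move=> At; have ft := hf.1.1 t At; have Gt := GL t At.
  by rewrite (nrmE SF ft) (nrmE SG Gt) -!EFin_expe -!EFinM -EFinD (nrm_L2 mD Gt) kE.
have Ck0 : 0 < C_K / (2 * mu_low) by rewrite divr_gt0// mulr_gt0.
apply: (energy_bound htF SBU SBP SF SG ha hb hc hdd hlf hlg r40 r41 cB cG dsym dge0
  hu hp hf hg hphi0 eq_momentum eq_mass initial) => t At.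
  rewrite BE// lee_fin addr_ge0// mulr_ge0 ?sqr_ge0 ?sqi_ge0//; exact: ltW.
rewrite BE// lee_fin.
have ut := hu.1.1 t At; have pt := hp.1.1 t At; have ft := hf.1.1 t At.
have [F hF] := choice (fun i => represents_ex mD SNU (observable_coord oD bD S1H i) ut).
have lambda0 : {ae M2, forall z, A2 z -> 0 <= lambda z}.
  by apply: filterS (aeA _ lambda_gt0) => z /[apply] /ltW.
have kornS v : fields S1 v -> \sum_i sqi (lebesgue_row d) D (coord_obs i v) <=
    C_K * \sum_p sqi (lebesgue_row d) D (sym_obs D p v).
  move=> Sv; have := korn_sum oD bD S10 S1lin S1H Sv (korn _ Sv); by [].
have e1 := a_form_korn oD bD S10 S1lin S1H mu_meas lambda_meas M0 muM lambdaM
  mu_low_gt0 C_K_gt0 (aeA _ mu_bound) lambda0 kornS ut hF.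
have kk0 : 0 < 2 * mu_low / C_K by rewrite divr_gt0// mulr_gt0.
have e2 := force_le oD bD S10 S1lin S1H kk0 ft ut hF.
have e3 := pairing_le_c_form oD bD S20 S2lin S2H c0_meas c_finite k0 hk (GL t At) pt.
(* The inverse of the Korn coefficient is the constant [C_K / (2 * mu_low)] of the statement. *)
rewrite invf_div in e2.
move: e1 e2 e3; rewrite mulrDr.
set x1 := a_form _ _ _ _ _ _; set x2 := c_form _ _ _ _ _; set x3 := 2 * ED _ _ _.
set x4 := 2 * ED _ _ _; set x5 := _ * nrm _ _ ^+ 2; set x6 := k * _; set x7 := _ * \int[_]_(_ in _) _.
clear; lra.
Qed.
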